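(* The alignable V-nets of the first kind comprise a positive and a negative two-parameter family $(\eta^{t,k},\Omega_k)$, where $t\in\mathbb{R}$ is the isometric deformation parameter and $k\in\mathbb{R}^+$ is the alignability parameter. Put $\lambda=\exp(t)$. Up to a box reparametrization (and a constant scaling of the V-net), these V-nets are characterized by the following fundamental forms. In the positive-alignable case $$I_V^+=\csc^4\!\left(\tfrac{\omega_k}{2}\right)\left(\mathrm{d}u^2+2\cos(\omega_k)\,\mathrm{d}u\,\mathrm{d}v+\mathrm{d}v^2\right),\qquad II_V^+=2\cot\!\left(\tfrac{\omega_k}{2}\right)\left(\lambda\,\mathrm{d}u^2+\tfrac1\lambda\,\mathrm{d}v^2\right),$$ and in the negative-alignable case $$I_V^-=\sec^4\!\left(\tfrac{\omega_k}{2}\right)\left(\mathrm{d}u^2-2\cos(\omega_k)\,\mathrm{d}u\,\mathrm{d}v+\mathrm{d}v^2\right),\qquad II_V^-=2\tan\!\left(\tfrac{\omega_k}{2}\right)\left(\lambda\,\mathrm{d}u^2-\tfrac1\lambda\,\mathrm{d}v^2\right),$$ where $$\omega_k(u,v)=\arccos\left(2k^2\,\mathrm{sn}^2(u+v\mid k)-1\right).$$ The corresponding Gaussian and mean curvatures are $$\mathrm{K}^+=\sin^4\!\left(\tfrac{\omega_k}{2}\right),\quad \mathrm{K}^-=-\cos^4\!\left(\tfrac{\omega_k}{2}\right),\quad \mathrm{H}^+=\tfrac14\left(\lambda+\tfrac1\lambda\right)\tan\!\left(\tfrac{\omega_k}{2}\right),\quad \mathrm{H}^-=\tfrac14\left(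\lambda-\tfrac1\lambda\right)\cot\!\left(\tfrac{\omega_k}{2}\right).$$
   Context: Everything is smooth and local; nets are considered up to isometries of $\mathbb{R}^3$ (hence $II$ up to an overall sign). A net is an immersion $\eta:\Omega\to\mathbb{R}^3$, $\Omega\subset\mathbb{R}^2$. A V-net is a non-developable net that is conjugate ($\eta_{uv}\in\mathrm{span}\{\eta_u,\eta_v\}$) and whose coordinate lines are geodesics. A box reparametrization is $(u,v)\mapsto(f(u),g(v))$. A K-surface is a surface of constant Gaussian curvature $-1$. Its K-frame $(E_1,E_3)$ consists of unit vector fields along the asymptotic directions (they commute), with dual coframe $(\theta^1,\theta^3)$. $\eta$ is a rotation field of $\psi$ if $\mathrm{d}\xi=\eta\times\mathrm{d}\psi$ for some $\xi:\Omega\to\mathbb{R}^3$. Each V-net $\eta$ is a rotation field of a unique K-surface $\psi$ (its reciprocal-parallel K-surface) whose asymptotic lines correspond to the V-net lines, and $\mathrm{d}\psi^{-1}\circ\mathrm{d}\eta=b\,E_1\otimes\theta^3+c\,E_3\otimes\theta^1$ with nowhere vanishing $b,c$. With $\bar\theta^1=c\theta^1$, $\bar\theta^3=b\theta^3$, the V-net is positive-alignable if $\mathrm{d}\bar\theta^1+\mathrm{d}\bar\theta^3=0$ and negative-alignable if $\mathrm{d}\bar\theta^1-\mathrm{d}\bar\theta^3=0$ (the former condition with $E_1$ replaced by $-E_1$); this expresses that for all quadrilateral loops $ABCD$ of net lines $l_{AB}+l_{BC}=l_{AD}+l_{DC}$ in signed lengths. It is of the first kind if its reciprocal-parallel K-surface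 is helicoidal, i.e. (locally) invariant under a screw motion group of $\mathbb{R}^3$ (rotations included). $\mathrm{sn}(\cdot\mid k)$ is the Jacobi elliptic sine with modulus $k>0$, $\mathcal{K}(k)$ is the complete elliptic integral of the first kind with modulus $k$, $k'=1/k$. The domains are, with $x=u+v$ and $m\in\mathbb{Z}$: for $k\in(0,1)$, $\Omega_k=\{2m\mathcal{K}(k)<x<2(m+1)\mathcal{K}(k)\}$; for $k=1$, $\Omega_k=\{x>0\}$ or $\{x<0\}$; for $k>1$, $\Omega_k=\{2m\,k'\mathcal{K}(k')<x<(2m+1)\,k'\mathcal{K}(k')\}$.
   Formalization: The signs of the K-frame are fixed so that the asymptotic angle varies in the same sense along E_1 and E_3; otherwise replacing E_1 by -E_1 makes a negative-family net positive-alignable. Without this choice, alignable first-kind nets are shown to lie in one of the two families. *)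

(* Defs.v *)
From Stdlib Require Import Reals ZArith ClassicalEpsilon.
From Coquelicot Require Import Coquelicot.
Open Scope R_scope.

Definition R3 : Type := (R * R * R)%type.

Definition c1 (p : R3) : R := fst (fst p).
Definition c2 (p : R3) : R := snd (fst p).
Definition c3 (p : R3) : R := snd p.

Definition add3 (p q : R3) : R3 := (c1 p + c1 q, c2 p + c2 q, c3 p + c3 q).
Definition scal3 (a : R) (p : R3) : R3 := (a * c1 p, a * c2 p, a * c3 p).
Definition sub3 (p q : R3) : R3 := add3 p (scal3 (-1) q).
Definition dot (p q : R3) : R := c1 p * c1 q + c2 p * c2 q + c3 p * c3 q.
Definition norm3 (p : R3) : R := sqrt (dot p p).
Definition cross (p q : R3) : R3 :=
  (c2 p * c3 q - c3 p * c2 q,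
   c3 p * c1 q - c1 p * c3 q,
   c1 p * c2 q - c2 p * c1 q).

Definition isometry (A : R3 -> R3) : Prop :=
  forall p q, norm3 (sub3 (A p) (A q)) = norm3 (sub3 p q).

Definition dom : Type := R -> R -> Prop.

Definition open_dom (D : dom) : Prop := forall u v, D u v -> locally_2d D u v.

Definition convex_dom (D : dom) : Prop :=
  forall u v u' v' s, D u v -> D u' v' -> 0 <= s <= 1 ->
    D ((1 - s) * u + s * u') ((1 - s) * v + s * v').

Definition sub_dom (D D' : dom) : Prop := forall u v, D u v -> D' u v.

Definition pu (f : R -> R -> R) (u v : R) : R := Derive (fun z => f z v) u.
Definition pv (f : R -> R -> R) (u v : R) : R := Derive (fun z => f u z) v.

Definition du (x : R -> R -> R3) (u v : R) : R3 :=
  (pu (fun a b => c1 (x a b)) u v,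
   pu (fun a b => c2 (x a b)) u v,
   pu (fun a b => c3 (x a b)) u v).
Definition dv (x : R -> R -> R3) (u v : R) : R3 :=
  (pv (fun a b => c1 (x a b)) u v,
   pv (fun a b => c2 (x a b)) u v,
   pv (fun a b => c3 (x a b)) u v).

(* All iterated partial derivatives exist and are continuous on [D]
   (meant for open [D]). *)
Definition smooth (D : dom) (f : R -> R -> R) : Prop :=
  forall n u v, D u v -> ex_diff_n f n u v.

Definition smooth3 (D : dom) (x : R -> R -> R3) : Prop :=
  smooth D (fun u v => c1 (x u v)) /\
  smooth D (fun u v => c2 (x u v)) /\
  smooth D (fun u v => c3 (x u v)).

(* Vector fields and 1-forms, by their components in the bases
   (d/du, d/dv) and (du, dv). *)
Definition field2 : Type := R -> R -> R * R.

Definition smooth2 (D : dom) (X : field2) : Prop :=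
  smooth D (fun u v => fst (X u v)) /\ smooth D (fun u v => snd (X u v)).

Definition pair2 (theta : field2) (u v : R) (X : R * R) : R :=
  fst (theta u v) * fst X + snd (theta u v) * snd X.

Definition scale_form (f : R -> R -> R) (theta : field2) : field2 :=
  fun u v => (f u v * fst (theta u v), f u v * snd (theta u v)).

(* The coefficient of du /\ dv in the exterior derivative of a 1-form. *)
Definition ext_d (theta : field2) (u v : R) : R :=
  pu (fun a b => snd (theta a b)) u v - pv (fun a b => fst (theta a b)) u v.

Definition dir (X : field2) (f : R -> R -> R) (u v : R) : R :=
  fst (X u v) * pu f u v + snd (X u v) * pv f u v.

Definition push (x : R -> R -> R3) (u v : R) (X : R * R) : R3 :=
  add3 (scal3 (fst X) (du x u v)) (scal3 (snd X) (dv x u v)).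

Definition is_net (D : dom) (eta : R -> R -> R3) : Prop :=
  open_dom D /\ smooth3 D eta /\
  forall u v, D u v -> cross (du eta u v) (dv eta u v) <> (0, 0, 0).

(* A triple (E, F, G) stands for E du^2 + 2 F du dv + G dv^2. *)
Definition qform : Type := (R * R * R)%type.

Definition unit_normal (eta : R -> R -> R3) (u v : R) : R3 :=
  let n := cross (du eta u v) (dv eta u v) in scal3 (/ norm3 n) n.

Definition first_form (eta : R -> R -> R3) (u v : R) : qform :=
  (dot (du eta u v) (du eta u v),
   dot (du eta u v) (dv eta u v),
   dot (dv eta u v) (dv eta u v)).

Definition second_form (eta : R -> R -> R3) (u v : R) : qform :=
  let n := unit_normal eta u v in
  (dot (du (du eta) u v) n, dot (dv (du eta) u v) n, dot (dv (dv eta) u v) n).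

Definition qeval (q : qform) (X Y : R * R) : R :=
  let '(E, F, G) := q in
  E * (fst X * fst Y) + F * (fst X * snd Y + snd X * fst Y) + G * (snd X * snd Y).

Definition gauss_curvature (eta : R -> R -> R3) (u v : R) : R :=
  let '(E, F, G) := first_form eta u v in
  let '(L, M, N) := second_form eta u v in
  (L * N - M ^ 2) / (E * G - F ^ 2).

Definition mean_curvature (eta : R -> R -> R3) (u v : R) : R :=
  let '(E, F, G) := first_form eta u v in
  let '(L, M, N) := second_form eta u v in
  (L * G - 2 * (M * F) + N * E) / (2 * (E * G - F ^ 2)).

(* [eps] = 1 or -1 selects the unit normal [eps * unit_normal eta]: since nets
   are considered up to all isometries, the second form carries a free
   overall sign. *)
Definition has_forms (eps : R) (D : dom) (eta : R -> R -> R3)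
    (I II : R -> R -> qform) : Prop :=
  forall u v, D u v ->
    first_form eta u v = I u v /\ scal3 eps (second_form eta u v) = II u v.

Definition is_sign (eps : R) : Prop := eps = 1 \/ eps = -1.

Definition in_span (x a b : R3) : Prop :=
  exists s t, x = add3 (scal3 s a) (scal3 t b).

Definition conjugate (D : dom) (eta : R -> R -> R3) : Prop :=
  forall u v, D u v -> in_span (dv (du eta) u v) (du eta u v) (dv eta u v).

(* The acceleration of a geodesic, in any parametrization, has no tangential
   component transversal to the velocity. *)
Definition geodesic_lines (D : dom) (eta : R -> R -> R3) : Prop :=
  forall u v, D u v ->
    in_span (du (du eta) u v) (du eta u v) (unit_normal eta u v) /\
    in_span (dv (dv eta) u v) (dv eta u v) (unit_normal eta u v).

Definition non_developable (D : dom) (eta : R -> R -> R3) : Prop :=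
  forall u v, D u v -> gauss_curvature eta u v <> 0.

Definition V_net (D : dom) (eta : R -> R -> R3) : Prop :=
  is_net D eta /\ non_developable D eta /\ conjugate D eta /\ geodesic_lines D eta.

Definition K_surface (D : dom) (psi : R -> R -> R3) : Prop :=
  is_net D psi /\ forall u v, D u v -> gauss_curvature psi u v = -1.

Definition asymptotic (D : dom) (psi : R -> R -> R3) (X : field2) : Prop :=
  forall u v, D u v -> qeval (second_form psi u v) (X u v) (X u v) = 0.

Definition unit_field (D : dom) (psi : R -> R -> R3) (X : field2) : Prop :=
  forall u v, D u v -> norm3 (push psi u v (X u v)) = 1.

Definition det2 (X Y : R * R) : R := fst X * snd Y - snd X * fst Y.

Definition K_frame (D : dom) (psi : R -> R -> R3) (E1 E3 : field2) : Prop :=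
  smooth2 D E1 /\ smooth2 D E3 /\
  unit_field D psi E1 /\ unit_field D psi E3 /\
  asymptotic D psi E1 /\ asymptotic D psi E3 /\
  forall u v, D u v -> det2 (E1 u v) (E3 u v) <> 0.

(* The coframe (theta1, theta3) dual to (E1, E3). *)
Definition theta1 (E1 E3 : field2) : field2 := fun u v =>
  let d := det2 (E1 u v) (E3 u v) in (snd (E3 u v) / d, - fst (E3 u v) / d).
Definition theta3 (E1 E3 : field2) : field2 := fun u v =>
  let d := det2 (E1 u v) (E3 u v) in (- snd (E1 u v) / d, fst (E1 u v) / d).

Definition rotation_field (D : dom) (eta psi : R -> R -> R3) : Prop :=
  exists xi : R -> R -> R3, smooth3 D xi /\
    forall u v, D u v ->
      du xi u v = cross (eta u v) (du psi u v) /\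
      dv xi u v = cross (eta u v) (dv psi u v).

Record K_data : Type := mkK {
  Kpsi : R -> R -> R3;
  KE1 : field2;
  KE3 : field2;
  Kb : R -> R -> R;
  Kc : R -> R -> R
}.

(* [Kpsi F] is the reciprocal-parallel K-surface of [eta], with a K-frame whose
   E1 is tangent to the u-lines and whose E3 is tangent to the v-lines, and
     dpsi^{-1} o deta = b E1 (x) theta3 + c E3 (x) theta1. *)
Definition reciprocal_parallel (D : dom) (eta : R -> R -> R3) (F : K_data) : Prop :=
  K_surface D (Kpsi F) /\
  rotation_field D eta (Kpsi F) /\
  K_frame D (Kpsi F) (KE1 F) (KE3 F) /\
  smooth D (Kb F) /\ smooth D (Kc F) /\
  forall u v, D u v ->
    snd (KE1 F u v) = 0 /\ fst (KE3 F u v) = 0 /\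
    Kb F u v <> 0 /\ Kc F u v <> 0 /\
    forall X : R * R,
      push eta u v X =
      add3
        (scal3 (Kb F u v * pair2 (theta3 (KE1 F) (KE3 F)) u v X)
               (push (Kpsi F) u v (KE1 F u v)))
        (scal3 (Kc F u v * pair2 (theta1 (KE1 F) (KE3 F)) u v X)
               (push (Kpsi F) u v (KE3 F u v))).

Definition theta1_bar (F : K_data) : field2 :=
  scale_form (Kc F) (theta1 (KE1 F) (KE3 F)).
Definition theta3_bar (F : K_data) : field2 :=
  scale_form (Kb F) (theta3 (KE1 F) (KE3 F)).

Definition positive_alignable (D : dom) (F : K_data) : Prop :=
  forall u v, D u v -> ext_d (theta1_bar F) u v + ext_d (theta3_bar F) u v = 0.

Definition negative_alignable (D : dom) (F : K_data) : Prop :=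
  forall u v, D u v -> ext_d (theta1_bar F) u v - ext_d (theta3_bar F) u v = 0.

Definition frame_angle (F : K_data) (u v : R) : R :=
  acos (dot (push (Kpsi F) u v (KE1 F u v)) (push (Kpsi F) u v (KE3 F u v))).

(* E1 and E3 are unique up to signs only. Replacing E1 alone by -E1 changes b, c
   into -b, -c, exchanges the two alignability conditions and turns the frame
   angle omega into PI - omega. On a helicoidal K-surface omega is a function of
   a linear combination of the arc lengths along the asymptotic lines; the
   convention below, which can always be met by such a replacement, makes the two
   coefficients have the same sign, so that after a box reparametrization omega is
   a function of u + v. This is the convention for which "positive" and "negative"
   are properties of the net. *)
Definition coherent_frame (D : dom) (F : K_data) : Prop :=
  forall u v, D u v ->
    0 <= dir (KE1 F) (frame_angle F) u v * dir (KE3 F) (frame_angle F) u v.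

(* Rotation by the angle [s] about the axis through [o] with unit direction [w]
   (Rodrigues' formula), followed by the translation by [h * s] along it. *)
Definition screw (o w : R3) (h s : R) (x : R3) : R3 :=
  let y := sub3 x o in
  add3 (add3 o (add3 (scal3 (cos s) y)
                     (add3 (scal3 (sin s) (cross w y))
                           (scal3 ((1 - cos s) * dot w y) w))))
       (scal3 (h * s) w).

(* Local invariance: arbitrarily small pieces of the surface around a point
   contain the images, under all small screw motions, of still smaller pieces. *)
Definition helicoidal (D : dom) (psi : R -> R -> R3) : Prop :=
  exists (o w : R3) (h : R), dot w w = 1 /\
    forall u0 v0, D u0 v0 -> forall delta : posreal,
      exists (delta' eps : posreal), forall s u v,
        Rabs s < eps -> Rabs (u - u0) < delta' -> Rabs (v - v0) < delta' ->
        exists u' v', D u' v' /\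
          Rabs (u' - u0) < delta /\ Rabs (v' - v0) < delta /\
          screw o w h s (psi u v) = psi u' v'.

Definition ell_integrand (k theta : R) : R := / sqrt (1 - k ^ 2 * sin theta ^ 2).

Definition ellK (k : R) : R := RInt (ell_integrand k) 0 (PI / 2).

(* For 0 < k <= 1, the amplitude inverts the elliptic integral of the first kind;
   for k = 1 the integral only exists for |phi| < PI/2. *)
Definition amplitude (k x : R) : R :=
  epsilon (inhabits 0) (fun phi => is_RInt (ell_integrand k) 0 phi x).

(* For k > 1, by the reciprocal modulus transformation
   sn(x | k) = k' sn(k x | k'), k' = 1/k. *)
Definition jacobi_sn (x k : R) : R :=
  if Rle_dec k 1 then sin (amplitude k x)
  else / k * sin (amplitude (/ k) (k * x)).

Definition omega (k u v : R) : R := acos (2 * k ^ 2 * jacobi_sn (u + v) k ^ 2 - 1).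

(* [Om] is one of the domains Omega_k; in particular k > 0. *)
Definition is_Omega (k : R) (Om : dom) : Prop :=
  (0 < k < 1 /\ exists m : Z, forall u v,
      Om u v <-> 2 * IZR m * ellK k < u + v < 2 * (IZR m + 1) * ellK k) \/
  (k = 1 /\ ((forall u v, Om u v <-> 0 < u + v) \/
             (forall u v, Om u v <-> u + v < 0))) \/
  (1 < k /\ exists m : Z, forall u v,
      Om u v <-> 2 * IZR m * (/ k * ellK (/ k)) < u + v
                 < (2 * IZR m + 1) * (/ k * ellK (/ k))).

Definition csc (x : R) : R := / sin x.
Definition sec (x : R) : R := / cos x.
Definition cot (x : R) : R := cos x / sin x.

Definition I_pos (k u v : R) : qform :=
  let w := omega k u v in
  scal3 (csc (w / 2) ^ 4) (1, cos w, 1).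
Definition II_pos (t k u v : R) : qform :=
  let w := omega k u v in let lam := exp t in
  scal3 (2 * cot (w / 2)) (lam, 0, / lam).
Definition I_neg (k u v : R) : qform :=
  let w := omega k u v in
  scal3 (sec (w / 2) ^ 4) (1, - cos w, 1).
Definition II_neg (t k u v : R) : qform :=
  let w := omega k u v in let lam := exp t in
  scal3 (2 * tan (w / 2)) (lam, 0, - / lam).

Definition K_pos (k u v : R) : R := sin (omega k u v / 2) ^ 4.
Definition K_neg (k u v : R) : R := - cos (omega k u v / 2) ^ 4.
Definition H_pos (t k u v : R) : R :=
  / 4 * (exp t + / exp t) * tan (omega k u v / 2).
Definition H_neg (t k u v : R) : R :=
  / 4 * (exp t - / exp t) * cot (omega k u v / 2).

(* f is a diffeomorphism of the interval (x0 - delta, x0 + delta) onto its image. *)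
Definition local_diffeo (f : R -> R) (x0 delta : R) : Prop :=
  forall x, Rabs (x - x0) < delta ->
    (forall n, ex_derive_n f n x) /\ Derive f x <> 0.

(* Near (u0, v0), [eta] is, up to a box reparametrization and a constant scaling,
   a piece of a net on some Omega_k with the fundamental forms I and +-II. *)
Definition locally_in_family (I : R -> R -> R -> qform) (II : R -> R -> R -> R -> qform)
    (eta : R -> R -> R3) (u0 v0 : R) : Prop :=
  exists (t k : R) (Om : dom) (eps : R) (eta0 : R -> R -> R3)
         (f g : R -> R) (s : R) (delta : posreal),
    is_Omega k Om /\ is_net Om eta0 /\
    is_sign eps /\ has_forms eps Om eta0 (I k) (II t k) /\
    0 < s /\ local_diffeo f u0 delta /\ local_diffeo g v0 delta /\
    forall u v, Rabs (u - u0) < delta -> Rabs (v - v0) < delta ->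
      Om (f u) (g v) /\ eta u v = scal3 s (eta0 (f u) (g v)).

Definition congruent (D : dom) (eta eta' : R -> R -> R3) : Prop :=
  exists A, isometry A /\ forall u v, D u v -> eta' u v = A (eta u v).

(* Main.v *)
From Stdlib Require Import Reals ZArith Lra Lia ClassicalEpsilon.
From Coquelicot Require Import Coquelicot.
Require Import Defs.
Open Scope R_scope.

(* Everything is read off the orthonormal frame e = (E1, n x E1, n) of the
   reciprocal-parallel K-surface psi, on which psi_u = lam E1 and psi_v = E3 / lam
   with E3 = cos w E1 + sin w (n x E1). When w depends on x = u + v only, the
   Gauss equation becomes the pendulum w'' = sin w, with first integral
   w'^2 = 4 k^2 - 4 cos^2 (w / 2); this k is the modulus of the Jacobi function in
   omega_k. A V-net over psi has eta_u = a E3 and eta_v = b E1, and its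
   integrability together with alignability forces a and b to be the same multiple
   of 1 / sin^2 (w / 2) (positive case), or opposite multiples of 1 / cos^2 (w / 2)
   (negative case).

   Frame equations with an x-dependent w have the explicit solution in which psi is
   swept out by a screw motion, as psi_u - psi_v = W x psi + const for the constant
   vector W = lam E1 + E3 / lam - w' n. Conversely, the forms determine the body
   angular velocities of e, hence e up to a rotation and eta up to an isometry.

   If psi is helicoidal, its screw field is tangent to psi and, by Maurer-Cartan,
   has constant nonzero components al E1 + be E3. Thus w is constant along the
   field, and rescaling u and v makes it a function of u + v; when al * be > 0 this
   needs E1 replaced by - E1. The energy of the pendulum gives k, and integrating
   the pendulum places the net on the domain Omega_k. *)

(** * Smooth functions of two variables *)

(** The parameter lam is Lie's transformation of K-surfaces: stretching the arc lengths of the two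
    families of asymptotic lines by lam and 1 / lam keeps the angle w, hence the first form of the
    V-net, and changes only the second. W is the angular velocity of e along d/du - d/dv, the
    direction in which w does not change. Two facts carry every reconstruction: a triad is
    determined by its body angular velocities up to a rotation, and closed forms are exact. Both are
    proved along straight segments, so nets are compared on convex domains and a given net is
    studied on a small box. Two places need more than comparing derivatives. Local invariance yields
    image points (u', v') without any regularity in the screw parameter, so tangency of the screw
    field is a first-order estimate. And where w' = 0, integrability does not compare a with b;
    since w'' = sin w is nonzero there, one more derivative does. For k > 1 the model has w' < 0
    throughout Omega_k, so the coordinates of a given net are first oriented to have w' <= 0 at the
    base point; the energy then decides which kind of domain occurs. *)

Lemma is_derive_eq (f : R -> R) (x l l' : R) :
  is_derive f x l -> l = l' -> is_derive f x l'.
Proof. now intros H <-. Qed.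

Lemma is_derive_Rplus (f g : R -> R) (x a b : R) :
  is_derive f x a -> is_derive g x b -> is_derive (fun z => f z + g z) x (a + b).
Proof. intros. apply (is_derive_plus (V:=R_NormedModule)); assumption. Qed.

Lemma is_derive_Rmult (f g : R -> R) (x a b : R) :
  is_derive f x a -> is_derive g x b ->
  is_derive (fun z => f z * g z) x (a * g x + f x * b).
Proof.
  intros. apply (is_derive_mult (K:=R_AbsRing) f g); [assumption..|].
  intros; apply Rmult_comm.
Qed.

Lemma is_derive_Rcomp (h f : R -> R) (x a b : R) :
  is_derive h (f x) a -> is_derive f x b -> is_derive (fun z => h (f z)) x (a * b).
Proof.
  intros. rewrite Rmult_comm.
  apply (is_derive_comp (V:=R_NormedModule) h); assumption.
Qed.

Lemma is_derive_Rconst (a x : R) : is_derive (fun _ => a) x 0.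
Proof. apply (is_derive_const a). Qed.

Lemma open_dom_locally_u (D : dom) (u v : R) :
  open_dom D -> D u v -> locally u (fun z => D z v).
Proof.
  intros HD H. destruct (HD u v H) as [d Hd]. exists d. intros y Hy.
  apply Hd; [exact Hy|]. rewrite Rminus_diag, Rabs_R0. apply cond_pos.
Qed.

Lemma open_dom_locally_v (D : dom) (u v : R) :
  open_dom D -> D u v -> locally v (fun z => D u z).
Proof.
  intros HD H. destruct (HD u v H) as [d Hd]. exists d. intros y Hy.
  apply Hd; [|exact Hy]. rewrite Rminus_diag, Rabs_R0. apply cond_pos.
Qed.

(** Explicit formulas for the partial derivatives, carried as data: the rules below assemble them by
    unification and [partials_eq] simplifies the result, so no [Derive] is ever computed. *)
Definition partials (D : dom) (f fu fv : R -> R -> R) : Prop :=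
  forall u v, D u v ->
    is_derive (fun z => f z v) u (fu u v) /\ is_derive (fun z => f u z) v (fv u v).

Lemma partials_pu (D : dom) f fu fv u v :
  partials D f fu fv -> D u v -> pu f u v = fu u v.
Proof. intros H Huv. apply is_derive_unique, H, Huv. Qed.

Lemma partials_pv (D : dom) f fu fv u v :
  partials D f fu fv -> D u v -> pv f u v = fv u v.
Proof. intros H Huv. apply is_derive_unique, H, Huv. Qed.

Lemma partials_ext (D : dom) f g fu fv gu gv :
  open_dom D -> (forall u v, D u v -> f u v = g u v) ->
  (forall u v, D u v -> fu u v = gu u v) -> (forall u v, D u v -> fv u v = gv u v) ->
  partials D f fu fv -> partials D g gu gv.
Proof.
  intros HD He Hu Hv H u v Huv. destruct (H u v Huv) as [H1 H2].
  rewrite <- Hu, <- Hv by assumption. split.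
  - eapply is_derive_ext_loc, H1. generalize (open_dom_locally_u D u v HD Huv).
    apply filter_imp. intros z Hz. apply He, Hz.
  - eapply is_derive_ext_loc, H2. generalize (open_dom_locally_v D u v HD Huv).
    apply filter_imp. intros z Hz. apply He, Hz.
Qed.

Lemma partials_const D a : partials D (fun _ _ => a) (fun _ _ => 0) (fun _ _ => 0).
Proof. intros u v _. split; apply is_derive_Rconst. Qed.

Lemma partials_plus D f fu fv g gu gv :
  partials D f fu fv -> partials D g gu gv ->
  partials D (fun u v => f u v + g u v) (fun u v => fu u v + gu u v)
    (fun u v => fv u v + gv u v).
Proof.
  intros H K u v Huv. destruct (H u v Huv), (K u v Huv).
  split; apply is_derive_Rplus; assumption.
Qed.

Lemma partials_mult D f fu fv g gu gv :
  partials D f fu fv -> partials D g gu gv ->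
  partials D (fun u v => f u v * g u v) (fun u v => fu u v * g u v + f u v * gu u v)
    (fun u v => fv u v * g u v + f u v * gv u v).
Proof.
  intros H K u v Huv. destruct (H u v Huv), (K u v Huv).
  split; [apply (is_derive_Rmult (fun z => f z v) (fun z => g z v))
    |apply (is_derive_Rmult (fun z => f u z) (fun z => g u z))];
  assumption.
Qed.

Lemma partials_comp D (I : R -> Prop) (h dh : R -> R) f fu fv :
  (forall x, I x -> is_derive h x (dh x)) -> (forall u v, D u v -> I (f u v)) ->
  partials D f fu fv ->
  partials D (fun u v => h (f u v)) (fun u v => dh (f u v) * fu u v)
    (fun u v => dh (f u v) * fv u v).
Proof.
  intros Hh Hf H u v Huv. destruct (H u v Huv). specialize (Hh _ (Hf u v Huv)).
  split; [apply (is_derive_Rcomp h (fun z => f z v))|apply (is_derive_Rcomp h (fun z => f u z))];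
  assumption.
Qed.

Lemma locally_2d_locally_pair (P : R -> R -> Prop) (u v : R) :
  locally_2d P u v -> locally (u, v) (fun z => P (fst z) (snd z)).
Proof.
  intros [d Hd]. exists d. intros [a b] [Ha Hb]. apply Hd; assumption.
Qed.

(** Continuity of one of the two partial derivatives is enough: the u-derivative controls increments
    in u near the point, while the v-derivative is needed only at the point itself. *)
Lemma differentiable_of_partials (D : dom) f fu fv u v :
  open_dom D -> partials D f fu fv -> D u v -> continuity_2d_pt fu u v ->
  differentiable_pt_lim f u v (fu u v) (fv u v).
Proof.
  intros HD H Huv Hc.
  apply filterdiff_differentiable_pt_lim.
  eapply filterdiff_ext_lin; [apply (is_derive_filterdiff f u v fu (fv u v))|].
  - generalize (locally_2d_locally_pair _ _ _ (HD u v Huv)).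
    apply filter_imp. intros z Hz. apply H, Hz.
  - apply H, Huv.
  - apply continuity_2d_pt_filterlim, Hc.
  - intros [a b]. reflexivity.
Qed.

Lemma continuity_of_partials (D : dom) f fu fv :
  open_dom D -> partials D f fu fv -> (forall u v, D u v -> continuity_2d_pt fu u v) ->
  forall u v, D u v -> continuity_2d_pt f u v.
Proof.
  intros HD H Hc u v Huv. apply differentiable_continuity_pt.
  exists (fu u v), (fv u v). apply (differentiable_of_partials D); auto.
Qed.

(** Smoothness to a fixed order, the form in which closure properties are proved by induction on the
    order. *)
Definition smoothn (n : nat) (D : dom) (f : R -> R -> R) : Prop :=
  forall u v, D u v -> ex_diff_n f n u v.

Lemma smoothn_continuity n D f u v : smoothn n D f -> D u v -> continuity_2d_pt f u v.
Proof. intros H Huv. specialize (H u v Huv). destruct n; apply H. Qed.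

Lemma smoothn_le n m D f : (m <= n)%nat -> smoothn n D f -> smoothn m D f.
Proof. intros Hm H u v Huv. apply (ex_diff_n_m n m Hm), H, Huv. Qed.

Lemma smoothn_ext n D f g :
  open_dom D -> (forall u v, D u v -> f u v = g u v) -> smoothn n D f -> smoothn n D g.
Proof.
  intros HD He H u v Huv. apply (ex_diff_n_ext_loc f); [|apply H, Huv].
  destruct (HD u v Huv) as [d Hd]. exists d. intros. apply He, Hd; assumption.
Qed.

Lemma smoothn_S n D f fu fv :
  open_dom D -> partials D f fu fv -> smoothn n D fu -> smoothn n D fv ->
  smoothn (S n) D f.
Proof.
  intros HD H Hu Hv u v Huv. simpl. split; [|split; [|split; [|split]]].
  - apply (continuity_of_partials D f fu fv HD H); [|exact Huv].
    intros; eapply smoothn_continuity; eassumption.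
  - exists (fu u v). apply H, Huv.
  - exists (fv u v). apply H, Huv.
  - apply (smoothn_ext n D fu); [exact HD| |exact Hu|exact Huv].
    intros a b Hab. symmetry. apply (partials_pu _ _ _ _ _ _ H Hab).
  - apply (smoothn_ext n D fv); [exact HD| |exact Hv|exact Huv].
    intros a b Hab. symmetry. apply (partials_pv _ _ _ _ _ _ H Hab).
Qed.

Lemma smoothn_partials n D f : smoothn (S n) D f ->
  partials D f (pu f) (pv f) /\ smoothn n D (pu f) /\ smoothn n D (pv f).
Proof.
  intros H. split; [|split].
  - intros u v Huv. split; apply Derive_correct; apply (H u v Huv).
  - intros u v Huv. apply (H u v Huv).
  - intros u v Huv. apply (H u v Huv).
Qed.

Lemma smooth_partials D f : smooth D f -> partials D f (pu f) (pv f).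
Proof. intros H. apply (smoothn_partials 0). intros u v Huv. apply (H 1%nat), Huv. Qed.

Lemma smooth_pu D f : smooth D f -> smooth D (pu f).
Proof.
  intros H n. apply (smoothn_partials n). intros u v Huv. apply (H (S n)), Huv.
Qed.

Lemma smooth_pv D f : smooth D f -> smooth D (pv f).
Proof.
  intros H n. apply (smoothn_partials n). intros u v Huv. apply (H (S n)), Huv.
Qed.

Lemma smooth_continuity D f u v : smooth D f -> D u v -> continuity_2d_pt f u v.
Proof. intros H. apply (smoothn_continuity 0). exact (H 0%nat). Qed.

Lemma smooth_ext D f g :
  open_dom D -> (forall u v, D u v -> f u v = g u v) -> smooth D f -> smooth D g.
Proof. intros HD He H n. apply (smoothn_ext n D f); auto. exact (H n). Qed.

Lemma smooth_sub D D' f : sub_dom D' D -> smooth D f -> smooth D' f.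
Proof. intros K H n u v Huv. apply H, K, Huv. Qed.

Lemma smooth_of_partials D f fu fv :
  open_dom D -> partials D f fu fv -> smooth D fu -> smooth D fv -> smooth D f.
Proof.
  intros HD H Hu Hv n. apply (smoothn_le (S n)); [lia|].
  apply (smoothn_S n D f fu fv HD H (Hu n) (Hv n)).
Qed.

Lemma smoothn_const n D a : open_dom D -> smoothn n D (fun _ _ => a).
Proof.
  intros HD. revert a. induction n as [|n IH]; intros a.
  - intros u v _. split; [apply continuity_2d_pt_const|exact I].
  - eapply smoothn_S; [exact HD|apply partials_const|apply IH|apply IH].
Qed.

Lemma smoothn_plus n D f g : open_dom D ->
  smoothn n D f -> smoothn n D g -> smoothn n D (fun u v => f u v + g u v).
Proof.
  intros HD. revert f g. induction n as [|n IH]; intros f g Hf Hg.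
  - intros u v Huv. split; [|exact I]. apply continuity_2d_pt_plus; [apply Hf|apply Hg]; auto.
  - apply smoothn_partials in Hf. apply smoothn_partials in Hg.
    eapply smoothn_S; [exact HD|apply partials_plus; [apply Hf|apply Hg]|apply IH|apply IH];
    tauto.
Qed.

Lemma smoothn_mult n D f g : open_dom D ->
  smoothn n D f -> smoothn n D g -> smoothn n D (fun u v => f u v * g u v).
Proof.
  intros HD. revert f g. induction n as [|n IH]; intros f g Hf Hg.
  - intros u v Huv. split; [|exact I]. apply continuity_2d_pt_mult; [apply Hf|apply Hg]; auto.
  - pose proof (smoothn_le (S n) n D f ltac:(lia) Hf).
    pose proof (smoothn_le (S n) n D g ltac:(lia) Hg).
    apply smoothn_partials in Hf. apply smoothn_partials in Hg.
    eapply smoothn_S; [exact HD|apply partials_mult; [apply Hf|apply Hg]| |];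
    apply smoothn_plus; auto; apply IH; tauto.
Qed.

Lemma smooth_const D a : open_dom D -> smooth D (fun _ _ => a).
Proof. intros HD n. now apply smoothn_const. Qed.

Lemma smooth_plus D f g : open_dom D ->
  smooth D f -> smooth D g -> smooth D (fun u v => f u v + g u v).
Proof. intros HD Hf Hg n. apply smoothn_plus; [exact HD|exact (Hf n)|exact (Hg n)]. Qed.

Lemma smooth_mult D f g : open_dom D ->
  smooth D f -> smooth D g -> smooth D (fun u v => f u v * g u v).
Proof. intros HD Hf Hg n. apply smoothn_mult; [exact HD|exact (Hf n)|exact (Hg n)]. Qed.

Lemma smooth_opp D f : open_dom D -> smooth D f -> smooth D (fun u v => - f u v).
Proof.
  intros HD Hf. apply (smooth_ext D (fun u v => -1 * f u v)); [exact HD|intros; ring|].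
  apply smooth_mult; [|apply smooth_const|]; assumption.
Qed.

Lemma smooth_minus D f g : open_dom D ->
  smooth D f -> smooth D g -> smooth D (fun u v => f u v - g u v).
Proof. intros HD Hf Hg. apply smooth_plus; [| |apply smooth_opp]; assumption. Qed.

(** The derivatives of 1 / f are those of f times - (1 / f) (1 / f), so order n for 1 / f itself
    gives order n + 1. *)
Lemma smooth_inv D f : open_dom D -> smooth D f -> (forall u v, D u v -> f u v <> 0) ->
  smooth D (fun u v => / f u v).
Proof.
  intros HD Hf H0.
  assert (Hp : partials D (fun u v => / f u v)
    (fun u v => - (/ f u v * / f u v) * pu f u v)
    (fun u v => - (/ f u v * / f u v) * pv f u v)).
  { apply (partials_comp D (fun x => x <> 0) Rinv (fun x => - (/ x * / x)));
      [|exact H0|apply smooth_partials, Hf].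
    intros x Hx. eapply is_derive_eq; [apply (is_derive_inv (fun z => z) x 1)|].
    - apply (is_derive_id x).
    - exact Hx.
    - field. exact Hx. }
  intros n. change (smoothn n D (fun u v => / f u v)). induction n as [|n IH].
  - intros u v Huv. split; [|exact I]. apply continuity_2d_pt_inv; [|auto].
    eapply smooth_continuity; eassumption.
  - assert (K : smoothn n D (fun u v => - (/ f u v * / f u v))).
    { apply (smoothn_ext n D (fun u v => -1 * (/ f u v * / f u v))); [exact HD|intros; ring|].
      repeat apply smoothn_mult; auto. now apply smoothn_const. }
    eapply smoothn_S; [exact HD|exact Hp| |]; apply smoothn_mult; auto;
    [exact (smooth_pu D f Hf n)|exact (smooth_pv D f Hf n)].
Qed.

Lemma smooth_div D f g : open_dom D -> smooth D f -> smooth D g ->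
  (forall u v, D u v -> g u v <> 0) -> smooth D (fun u v => f u v / g u v).
Proof. intros. apply smooth_mult; [| |apply smooth_inv]; assumption. Qed.

(** The derivative is written with [/ (2 * f) * sqrt f] instead of [/ sqrt f]: it is then a product
    of [sqrt f] and functions already known to be smooth, and the induction on the order closes. *)
Lemma smooth_sqrt D f : open_dom D -> smooth D f -> (forall u v, D u v -> 0 < f u v) ->
  smooth D (fun u v => sqrt (f u v)).
Proof.
  intros HD Hf H0.
  assert (Hp : partials D (fun u v => sqrt (f u v))
    (fun u v => / (2 * f u v) * sqrt (f u v) * pu f u v)
    (fun u v => / (2 * f u v) * sqrt (f u v) * pv f u v)).
  { apply (partials_comp D (fun x => 0 < x) sqrt (fun x => / (2 * x) * sqrt x));
      [|exact H0|apply smooth_partials, Hf].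
    intros x Hx. eapply is_derive_eq; [apply (is_derive_sqrt (fun z => z) x 1)|].
    - apply (is_derive_id x).
    - exact Hx.
    - pose proof (sqrt_lt_R0 x Hx). rewrite <- (sqrt_sqrt x) at 2 by lra. field. lra. }
  assert (K : smooth D (fun u v => / (2 * f u v))).
  { apply smooth_inv; [exact HD| |].
    - apply smooth_mult; auto. now apply smooth_const.
    - intros u v Huv. specialize (H0 u v Huv). lra. }
  intros n. change (smoothn n D (fun u v => sqrt (f u v))). induction n as [|n IH].
  - intros u v Huv. split; [|exact I].
    apply (continuity_1d_2d_pt_comp sqrt); [apply continuity_pt_sqrt; apply Rlt_le; auto|].
    eapply smooth_continuity; eassumption.
  - eapply smoothn_S; [exact HD|exact Hp| |]; (apply smoothn_mult; [exact HD| |]);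
    [apply smoothn_mult; [exact HD|exact (K n)|exact IH]|exact (smooth_pu D f Hf n)
    |apply smoothn_mult; [exact HD|exact (K n)|exact IH]|exact (smooth_pv D f Hf n)].
Qed.

Lemma is_derive_Rsin x : is_derive sin x (cos x).
Proof. apply is_derive_Reals, derivable_pt_lim_sin. Qed.

Lemma is_derive_Rcos x : is_derive cos x (- sin x).
Proof. apply is_derive_Reals, derivable_pt_lim_cos. Qed.

Lemma smooth_sin_cos D f : open_dom D -> smooth D f ->
  smooth D (fun u v => sin (f u v)) /\ smooth D (fun u v => cos (f u v)).
Proof.
  intros HD Hf.
  assert (H : forall n, smoothn n D (fun u v => sin (f u v)) /\
    smoothn n D (fun u v => cos (f u v))).
  { induction n as [|n [IH1 IH2]].
    - pose proof (smooth_continuity D f) as Hc.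
      split; intros u v Huv; (split; [|exact I]).
      + apply (continuity_1d_2d_pt_comp sin); [apply continuity_sin|now apply Hc].
      + apply (continuity_1d_2d_pt_comp cos); [apply continuity_cos|now apply Hc].
    - pose proof (smooth_partials D f Hf) as Hp.
      pose proof (smooth_pu D f Hf n) as Hu. pose proof (smooth_pv D f Hf n) as Hv.
      split.
      + eapply smoothn_S; [exact HD|apply (partials_comp D (fun _ => True) sin cos);
          [intros x _; apply is_derive_Rsin|auto|exact Hp]| |]; now apply smoothn_mult.
      + assert (K : smoothn n D (fun u v => - sin (f u v))).
        { apply (smoothn_ext n D (fun u v => -1 * sin (f u v))); [exact HD|intros; ring|].
          apply smoothn_mult; auto. now apply smoothn_const. }
        eapply smoothn_S; [exact HD|apply (partials_comp D (fun _ => True) cos (fun x => - sin x));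
          [intros x _; apply is_derive_Rcos|auto|exact Hp]| |]; now apply smoothn_mult. }
  split; intros n; apply (H n).
Qed.

Lemma smooth_comm D f u v : open_dom D -> smooth D f -> D u v ->
  pu (pv f) u v = pv (pu f) u v.
Proof.
  intros HD Hf Huv. symmetry. symmetry. apply (Schwarz f u v).
  - destruct (HD u v Huv) as [d Hd]. exists d. intros a b Ha Hb. specialize (Hd a b Ha Hb).
    pose proof (smooth_partials _ _ Hf a b Hd) as [H1 H2].
    pose proof (smooth_partials _ _ (smooth_pu _ _ Hf) a b Hd) as [H3 H4].
    pose proof (smooth_partials _ _ (smooth_pv _ _ Hf) a b Hd) as [H5 H6].
    split; [|split; [|split]]; eexists; eassumption.
  - apply (smooth_continuity D (pu (pv f))); [|exact Huv]. apply smooth_pu, smooth_pv, Hf.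
  - apply (smooth_continuity D (pv (pu f))); [|exact Huv]. apply smooth_pv, smooth_pu, Hf.
Qed.

Lemma partials_comm D f fu fv fuu fuv fvu fvv : open_dom D -> smooth D f ->
  partials D f fu fv -> partials D fu fuu fuv -> partials D fv fvu fvv ->
  forall u v, D u v -> fuv u v = fvu u v.
Proof.
  intros HD Hs Hf Hu Hv u v Huv.
  transitivity (pv (pu f) u v); [|rewrite <- (smooth_comm D f u v HD Hs Huv)].
  - symmetry. apply (partials_pv D (pu f) fuu); [|exact Huv].
    apply (partials_ext D fu (pu f) fuu fuv); auto.
    intros a b Hab. symmetry. apply (partials_pu _ _ _ _ _ _ Hf Hab).
  - apply (partials_pu D (pv f) fvu fvv); [|exact Huv].
    apply (partials_ext D fv (pv f) fvu fvv); auto.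
    intros a b Hab. symmetry. apply (partials_pv _ _ _ _ _ _ Hf Hab).
Qed.

Lemma locally_2d_comp (P : R -> R -> Prop) (a b : R -> R -> R) (x y : R) :
  locally_2d P (a x y) (b x y) -> continuity_2d_pt a x y -> continuity_2d_pt b x y ->
  locally_2d (fun u v => P (a u v) (b u v)) x y.
Proof.
  intros [d Hd] Ha Hb.
  generalize (locally_2d_and _ _ _ _ (Ha d) (Hb d)). apply locally_2d_impl.
  apply locally_2d_forall. intros u v [H1 H2]. apply Hd; assumption.
Qed.

Lemma continuity_2d_comp (f a b : R -> R -> R) (x y : R) :
  continuity_2d_pt f (a x y) (b x y) -> continuity_2d_pt a x y -> continuity_2d_pt b x y ->
  continuity_2d_pt (fun u v => f (a u v) (b u v)) x y.
Proof.
  intros Hf Ha Hb eps. apply (locally_2d_comp _ a b x y (Hf eps) Ha Hb).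
Qed.

Lemma is_derive_line (D : dom) f fu fv (a b : R -> R) (t a' b' : R) :
  open_dom D -> partials D f fu fv -> (forall u v, D u v -> continuity_2d_pt fu u v) ->
  D (a t) (b t) -> is_derive a t a' -> is_derive b t b' ->
  is_derive (fun s => f (a s) (b s)) t (fu (a t) (b t) * a' + fv (a t) (b t) * b').
Proof.
  intros HD H Hc Ht Ha Hb. apply is_derive_Reals.
  apply derivable_pt_lim_comp_2d; [|apply is_derive_Reals, Ha|apply is_derive_Reals, Hb].
  apply (differentiable_of_partials D); auto.
Qed.

Lemma is_derive_affine (a b t : R) : is_derive (fun s => (1 - s) * a + s * b) t (b - a).
Proof. auto_derive; [exact I|ring]. Qed.

Lemma constant_of_zero_partials (D : dom) f :
  open_dom D -> convex_dom D -> partials D f (fun _ _ => 0) (fun _ _ => 0) ->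
  forall u v u' v', D u v -> D u' v' -> f u v = f u' v'.
Proof.
  intros HD Hc H u v u' v' H1 H2.
  pose (a := fun s => (1 - s) * u + s * u'). pose (b := fun s => (1 - s) * v + s * v').
  replace (f u v) with (f (a 0) (b 0)) by (unfold a, b; f_equal; ring).
  replace (f u' v') with (f (a 1) (b 1)) by (unfold a, b; f_equal; ring).
  apply (eq_is_derive (V:=R_NormedModule) (fun s => f (a s) (b s))); [|lra].
  intros t Ht. eapply is_derive_eq.
  - apply (is_derive_line D f _ _ a b t (u' - u) (v' - v) HD H);
      [intros; apply continuity_2d_pt_const|apply Hc; assumption|apply is_derive_affine..].
  - change zero with 0. ring.
Qed.

(** * The Poincaré lemma on convex domains *)

Lemma continuity_2d_affine (a x t : R) :
  continuity_2d_pt (fun z s => (1 - s) * a + s * z) x t.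
Proof.
  apply continuity_2d_pt_plus; apply continuity_2d_pt_mult;
  repeat first [apply continuity_2d_pt_minus|apply continuity_2d_pt_const
    |apply continuity_2d_pt_id1|apply continuity_2d_pt_id2].
Qed.

Lemma continuity_2d_affine2 (a b x t : R) :
  continuity_2d_pt (fun _ s => (1 - s) * a + s * b) x t.
Proof.
  apply continuity_2d_pt_plus; apply continuity_2d_pt_mult;
  repeat first [apply continuity_2d_pt_minus|apply continuity_2d_pt_const
    |apply continuity_2d_pt_id1|apply continuity_2d_pt_id2].
Qed.

Lemma continuous_of_2d (f : R -> R -> R) (x t : R) :
  continuity_2d_pt f x t -> continuous (fun s => f x s) t.
Proof.
  intros H. apply continuity_pt_filterlim. intros e He.
  destruct (H (mkposreal e He)) as [d Hd]. exists d. split; [apply cond_pos|].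
  intros s [_ Hs]. apply Hd; [|exact Hs]. rewrite Rminus_diag, Rabs_R0. apply cond_pos.
Qed.

(** The potential is the line integral of P du + Q dv over the segment from (u0, v0). After
    differentiation under the integral sign, closedness ([Pv] is also the u-derivative of Q) turns
    the integrand into the s-derivative of s P along the segment. *)
Lemma poincare_u (D : dom) (P Q Pu Pv Qv : R -> R -> R) (u0 v0 : R) :
  open_dom D -> convex_dom D -> D u0 v0 ->
  partials D P Pu Pv -> partials D Q Pv Qv ->
  (forall u v, D u v -> continuity_2d_pt Pu u v) ->
  (forall u v, D u v -> continuity_2d_pt Pv u v) ->
  forall u v, D u v ->
  is_derive (fun z => RInt (fun s =>
      P ((1 - s) * u0 + s * z) ((1 - s) * v0 + s * v) * (z - u0)
      + Q ((1 - s) * u0 + s * z) ((1 - s) * v0 + s * v) * (v - v0)) 0 1) u (P u v).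
Proof.
  intros HD Hc H0 HP HQ HPu HPv u v Huv.
  pose proof (continuity_of_partials D P Pu Pv HD HP HPu) as CP.
  pose proof (continuity_of_partials D Q Pv Qv HD HQ HPv) as CQ.
  pose (a := fun z s => (1 - s) * u0 + s * z). pose (b := fun s => (1 - s) * v0 + s * v).
  pose (F := fun z s => P (a z s) (b s) * (z - u0) + Q (a z s) (b s) * (v - v0)).
  pose (dF := fun z s => (Pu (a z s) (b s) * s * (z - u0) + P (a z s) (b s))
                         + (Pv (a z s) (b s) * s * (v - v0))).
  change (is_derive (fun z => RInt (F z) 0 1) u (P u v)).
  assert (HF : forall z s, D (a z s) (b s) -> is_derive (fun z => F z s) z (dF z s)).
  { intros z s Hzs. unfold F, dF. apply is_derive_Rplus.
    - eapply is_derive_eq; [apply (is_derive_Rmult (fun z => P (a z s) (b s)) (fun z => z - u0))|].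
      + apply (is_derive_Rcomp (fun x => P x (b s)) (fun z => a z s)).
        * exact (proj1 (HP _ _ Hzs)).
        * unfold a. auto_derive; [exact I|reflexivity].
      + auto_derive; [exact I|reflexivity].
      + ring.
    - eapply is_derive_eq; [apply (is_derive_Rmult (fun z => Q (a z s) (b s)) (fun _ => v - v0))|].
      + apply (is_derive_Rcomp (fun x => Q x (b s)) (fun z => a z s)).
        * exact (proj1 (HQ _ _ Hzs)).
        * unfold a. auto_derive; [exact I|reflexivity].
      + apply is_derive_Rconst.
      + ring. }
  assert (HC : forall f, (forall u v, D u v -> continuity_2d_pt f u v) ->
     forall z s, D (a z s) (b s) -> continuity_2d_pt (fun z s => f (a z s) (b s)) z s).
  { intros f Hf z s Hzs. apply (continuity_2d_comp f a (fun _ s => b s)).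
    - apply Hf, Hzs.
    - apply continuity_2d_affine.
    - apply continuity_2d_affine2. }
  assert (HdF : forall z s, D (a z s) (b s) -> continuity_2d_pt dF z s).
  { intros z s Hzs. unfold dF.
    repeat first [apply continuity_2d_pt_plus|apply continuity_2d_pt_mult
      |apply continuity_2d_pt_minus|apply continuity_2d_pt_const
      |apply continuity_2d_pt_id1|apply continuity_2d_pt_id2|apply HC; assumption]. }
  assert (HFc : forall z s, D (a z s) (b s) -> continuity_2d_pt F z s).
  { intros z s Hzs. unfold F.
    repeat first [apply continuity_2d_pt_plus|apply continuity_2d_pt_mult
      |apply continuity_2d_pt_minus|apply continuity_2d_pt_const
      |apply continuity_2d_pt_id1|apply continuity_2d_pt_id2|apply HC; assumption]. }
  assert (Hin : forall z s, D z v -> 0 <= s <= 1 -> D (a z s) (b s)).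
  { intros z s Hz Hs. apply Hc; assumption. }
  assert (Hmm : Rmin 0 1 = 0 /\ Rmax 0 1 = 1)
    by (unfold Rmin, Rmax; destruct (Rle_dec 0 1); lra).
  destruct Hmm as [Hmin Hmax].
  eapply is_derive_eq; [apply is_derive_RInt_param|].
  - generalize (open_dom_locally_u D u v HD Huv). apply filter_imp.
    intros z Hz t. rewrite Hmin, Hmax. intros Ht. exists (dF z t). apply HF. auto.
  - intros t. rewrite Hmin, Hmax. intros Ht.
    apply (continuity_2d_pt_ext_loc dF); [|apply HdF; auto].
    pose proof (locally_2d_comp D a (fun _ s => b s) u t (HD _ _ (Hin u t Huv Ht))
      (continuity_2d_affine u0 u t) (continuity_2d_affine2 v0 v u t)) as Hl.
    revert Hl. apply locally_2d_impl, locally_2d_forall. intros z s Hzs.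
    symmetry. apply is_derive_unique, HF, Hzs.
  - generalize (open_dom_locally_u D u v HD Huv). apply filter_imp.
    intros z Hz. apply (ex_RInt_continuous (V:=R_CompleteNormedModule)).
    intros s. rewrite Hmin, Hmax. intros Hs. apply (continuous_of_2d F). apply HFc; auto.
  - transitivity (RInt (dF u) 0 1).
    { apply RInt_ext. intros s. rewrite Hmin, Hmax. intros Hs.
      apply is_derive_unique, HF, Hin; [exact Huv|lra]. }
    apply is_RInt_unique.
    replace (P u v) with (minus (1 * P (a u 1) (b 1)) (0 * P (a u 0) (b 0))).
    2:{ unfold minus, plus, opp; simpl. unfold a, b.
        replace ((1 - 1) * u0 + 1 * u) with u by ring.
        replace ((1 - 1) * v0 + 1 * v) with v by ring. ring. }
    apply (is_RInt_derive (V:=R_CompleteNormedModule) (fun s => s * P (a u s) (b s))).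
    + intros s. rewrite Hmin, Hmax. intros Hs.
      eapply is_derive_eq; [apply (is_derive_Rmult (fun s => s) (fun s => P (a u s) (b s)))|].
      * apply (is_derive_id s).
      * apply (is_derive_line D P Pu Pv (a u) b s (u - u0) (v - v0)); auto;
        apply is_derive_affine.
      * unfold dF. change one with 1. ring.
    + intros s. rewrite Hmin, Hmax. intros Hs. apply (continuous_of_2d dF). apply HdF; auto.
Qed.

Lemma continuity_2d_swap (f : R -> R -> R) (u v : R) :
  continuity_2d_pt f u v -> continuity_2d_pt (fun a b => f b a) v u.
Proof. intros H e. destruct (H e) as [d Hd]. exists d. intros. now apply Hd. Qed.

Lemma poincare (D : dom) (P Q : R -> R -> R) :
  open_dom D -> convex_dom D -> smooth D P -> smooth D Q ->
  (forall u v, D u v -> pv P u v = pu Q u v) ->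
  exists f, smooth D f /\ partials D f P Q.
Proof.
  intros HD Hc HP HQ He.
  destruct (Classical_Prop.classic (exists u0 v0, D u0 v0)) as [(u0 & v0 & H0)|Hn].
  2:{ exists (fun _ _ => 0). split; [now apply smooth_const|].
      intros u v Huv. destruct Hn. exists u, v. exact Huv. }
  exists (fun u v => RInt (fun s =>
      P ((1 - s) * u0 + s * u) ((1 - s) * v0 + s * v) * (u - u0)
      + Q ((1 - s) * u0 + s * u) ((1 - s) * v0 + s * v) * (v - v0)) 0 1).
  match goal with |- _ /\ partials _ ?f _ _ => assert (H : partials D f P Q) end.
  2:{ split; [|exact H]. apply (smooth_of_partials D _ P Q); assumption. }
  intros u v Huv. split.
  - apply (poincare_u D P Q (pu P) (pv P) (pv Q)); auto.
    + apply smooth_partials, HP.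
    + apply (partials_ext D Q Q (pu Q) (pv Q)); auto.
      * intros a b Hab. symmetry. now apply He.
      * apply smooth_partials, HQ.
    + intros a b Hab. apply (smooth_continuity D (pu P)); [now apply smooth_pu|exact Hab].
    + intros a b Hab. apply (smooth_continuity D (pv P)); [now apply smooth_pv|exact Hab].
  (* The v-derivative is the u-derivative of the same integral over the transposed domain, with P
     and Q exchanged. *)
  - pose (D' := fun a b => D b a : Prop).
    pose proof (poincare_u D' (fun a b => Q b a) (fun a b => P b a) (fun a b => pv Q b a)
      (fun a b => pu Q b a) (fun a b => pu P b a) v0 u0) as K.
    eapply is_derive_ext; [|apply K].
    + intros z. simpl. apply RInt_ext. intros s _.
      match goal with |- ?x = ?y => change (@eq R x y) end. ring.
    + intros a b Hab. destruct (HD b a Hab) as [d Hd]. exists d. intros. now apply Hd.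
    + intros a b a' b' s H1 H2 Hs. apply Hc; assumption.
    + exact H0.
    + intros a b Hab. split; apply (smooth_partials D Q HQ b a Hab).
    + intros a b Hab. unfold D' in Hab. rewrite <- He by exact Hab.
      split; apply (smooth_partials D P HP b a Hab).
    + intros a b Hab. apply continuity_2d_swap, (smooth_continuity D); [now apply smooth_pv|exact Hab].
    + intros a b Hab. apply continuity_2d_swap, (smooth_continuity D); [now apply smooth_pu|exact Hab].
    + exact Huv.
Qed.

(** * Differential calculus of maps to space *)

Lemma R3_ext (p q : R3) : c1 p = c1 q -> c2 p = c2 q -> c3 p = c3 q -> p = q.
Proof.
  destruct p as [[? ?] ?], q as [[? ?] ?]; unfold c1, c2, c3; simpl; congruence.
Qed.

Ltac vec_simpl := unfold sub3, add3, scal3, dot, cross, c1, c2, c3; cbn [fst snd].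
Ltac vec_ring := apply R3_ext; vec_simpl; ring.

Definition zero3 : R3 := (0, 0, 0).

Definition vpartials (D : dom) (X Xu Xv : R -> R -> R3) : Prop :=
  partials D (fun u v => c1 (X u v)) (fun u v => c1 (Xu u v)) (fun u v => c1 (Xv u v)) /\
  partials D (fun u v => c2 (X u v)) (fun u v => c2 (Xu u v)) (fun u v => c2 (Xv u v)) /\
  partials D (fun u v => c3 (X u v)) (fun u v => c3 (Xu u v)) (fun u v => c3 (Xv u v)).

Lemma vpartials_du D X Xu Xv u v : vpartials D X Xu Xv -> D u v -> du X u v = Xu u v.
Proof.
  intros (H1 & H2 & H3) H. apply R3_ext;
  [exact (partials_pu _ _ _ _ _ _ H1 H)|exact (partials_pu _ _ _ _ _ _ H2 H)
  |exact (partials_pu _ _ _ _ _ _ H3 H)].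
Qed.

Lemma vpartials_dv D X Xu Xv u v : vpartials D X Xu Xv -> D u v -> dv X u v = Xv u v.
Proof.
  intros (H1 & H2 & H3) H. apply R3_ext;
  [exact (partials_pv _ _ _ _ _ _ H1 H)|exact (partials_pv _ _ _ _ _ _ H2 H)
  |exact (partials_pv _ _ _ _ _ _ H3 H)].
Qed.

Lemma partials_eq (D : dom) f fu fv gu gv : partials D f fu fv ->
  (forall u v, D u v -> fu u v = gu u v) -> (forall u v, D u v -> fv u v = gv u v) ->
  partials D f gu gv.
Proof.
  intros H Hu Hv u v Huv. rewrite <- Hu, <- Hv by exact Huv. apply H, Huv.
Qed.

Lemma vpartials_eq (D : dom) X Xu Xv Yu Yv : vpartials D X Xu Xv ->
  (forall u v, D u v -> Xu u v = Yu u v) -> (forall u v, D u v -> Xv u v = Yv u v) ->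
  vpartials D X Yu Yv.
Proof.
  intros (H1 & H2 & H3) Hu Hv.
  split; [|split]; (eapply partials_eq; [eassumption|..]); intros u v Huv; simpl;
  rewrite ?Hu, ?Hv by exact Huv; reflexivity.
Qed.

Lemma vpartials_ext (D : dom) X Y Xu Xv Yu Yv : open_dom D -> vpartials D X Xu Xv ->
  (forall u v, D u v -> X u v = Y u v) ->
  (forall u v, D u v -> Xu u v = Yu u v) -> (forall u v, D u v -> Xv u v = Yv u v) ->
  vpartials D Y Yu Yv.
Proof.
  intros HD (H1 & H2 & H3) He Hu Hv.
  split; [|split];
  [apply (partials_ext D _ _ _ _ _ _ HD) with (4 := H1)
  |apply (partials_ext D _ _ _ _ _ _ HD) with (4 := H2)
  |apply (partials_ext D _ _ _ _ _ _ HD) with (4 := H3)];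
  intros u v Huv; simpl; rewrite ?He, ?Hu, ?Hv by exact Huv; reflexivity.
Qed.

Lemma vpartials_const D p : vpartials D (fun _ _ => p) (fun _ _ => zero3) (fun _ _ => zero3).
Proof. split; [|split]; apply partials_const. Qed.

Lemma vpartials_add D X Xu Xv Y Yu Yv : vpartials D X Xu Xv -> vpartials D Y Yu Yv ->
  vpartials D (fun u v => add3 (X u v) (Y u v)) (fun u v => add3 (Xu u v) (Yu u v))
    (fun u v => add3 (Xv u v) (Yv u v)).
Proof.
  intros (H1 & H2 & H3) (K1 & K2 & K3). split; [|split]; apply partials_plus; assumption.
Qed.

Lemma vpartials_scal D f fu fv Y Yu Yv : partials D f fu fv -> vpartials D Y Yu Yv ->
  vpartials D (fun u v => scal3 (f u v) (Y u v))
    (fun u v => add3 (scal3 (fu u v) (Y u v)) (scal3 (f u v) (Yu u v)))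
    (fun u v => add3 (scal3 (fv u v) (Y u v)) (scal3 (f u v) (Yv u v))).
Proof.
  intros H (K1 & K2 & K3). split; [|split]; apply partials_mult; assumption.
Qed.

Lemma vpartials_cscal D a Y Yu Yv : vpartials D Y Yu Yv ->
  vpartials D (fun u v => scal3 a (Y u v))
    (fun u v => scal3 a (Yu u v)) (fun u v => scal3 a (Yv u v)).
Proof.
  intros H. eapply vpartials_eq; [apply vpartials_scal; [apply partials_const|exact H]|..];
  intros; vec_ring.
Qed.

Lemma partials_minus D f fu fv g gu gv :
  partials D f fu fv -> partials D g gu gv ->
  partials D (fun u v => f u v - g u v) (fun u v => fu u v - gu u v)
    (fun u v => fv u v - gv u v).
Proof.
  intros H K u v Huv. destruct (H u v Huv), (K u v Huv).
  split; apply (is_derive_minus (V:=R_NormedModule)); assumption.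
Qed.

Lemma vpartials_cross D X Xu Xv Y Yu Yv : vpartials D X Xu Xv -> vpartials D Y Yu Yv ->
  vpartials D (fun u v => cross (X u v) (Y u v))
    (fun u v => add3 (cross (Xu u v) (Y u v)) (cross (X u v) (Yu u v)))
    (fun u v => add3 (cross (Xv u v) (Y u v)) (cross (X u v) (Yv u v))).
Proof.
  intros (H1 & H2 & H3) (K1 & K2 & K3).
  split; [|split]; (eapply partials_eq; [apply partials_minus; apply partials_mult; eassumption|..]);
  intros; vec_simpl; ring.
Qed.

Lemma partials_dot D X Xu Xv Y Yu Yv : vpartials D X Xu Xv -> vpartials D Y Yu Yv ->
  partials D (fun u v => dot (X u v) (Y u v))
    (fun u v => dot (Xu u v) (Y u v) + dot (X u v) (Yu u v))
    (fun u v => dot (Xv u v) (Y u v) + dot (X u v) (Yv u v)).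
Proof.
  intros (H1 & H2 & H3) (K1 & K2 & K3).
  eapply partials_eq; [unfold dot; apply partials_plus; [apply partials_plus|];
    apply partials_mult; eassumption|..]; intros; vec_simpl; ring.
Qed.

Lemma smooth3_vpartials D X : smooth3 D X -> vpartials D X (du X) (dv X).
Proof. intros (H1 & H2 & H3). split; [|split]; apply smooth_partials; assumption. Qed.

Lemma smooth3_du D X : smooth3 D X -> smooth3 D (du X).
Proof. intros (H1 & H2 & H3). split; [|split]; apply (smooth_pu D); assumption. Qed.

Lemma smooth3_dv D X : smooth3 D X -> smooth3 D (dv X).
Proof. intros (H1 & H2 & H3). split; [|split]; apply (smooth_pv D); assumption. Qed.

Lemma smooth3_ext D X Y : open_dom D -> (forall u v, D u v -> X u v = Y u v) ->
  smooth3 D X -> smooth3 D Y.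
Proof.
  intros HD He (H1 & H2 & H3). split; [|split];
  [apply (smooth_ext D _ _ HD) with (2 := H1)|apply (smooth_ext D _ _ HD) with (2 := H2)
  |apply (smooth_ext D _ _ HD) with (2 := H3)]; intros u v Huv; simpl;
  rewrite He by exact Huv; reflexivity.
Qed.

Lemma smooth3_sub D D' X : sub_dom D' D -> smooth3 D X -> smooth3 D' X.
Proof. intros H (H1 & H2 & H3). split; [|split]; eapply smooth_sub; eassumption. Qed.

Lemma smooth3_const D p : open_dom D -> smooth3 D (fun _ _ => p).
Proof. intros HD. split; [|split]; now apply smooth_const. Qed.

Lemma smooth3_add D X Y : open_dom D -> smooth3 D X -> smooth3 D Y ->
  smooth3 D (fun u v => add3 (X u v) (Y u v)).
Proof.
  intros HD (H1 & H2 & H3) (K1 & K2 & K3). split; [|split]; apply smooth_plus; assumption.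
Qed.

Lemma smooth3_scal D f X : open_dom D -> smooth D f -> smooth3 D X ->
  smooth3 D (fun u v => scal3 (f u v) (X u v)).
Proof.
  intros HD H (K1 & K2 & K3). split; [|split]; apply smooth_mult; assumption.
Qed.

Lemma smooth3_cscal D a X : open_dom D -> smooth3 D X ->
  smooth3 D (fun u v => scal3 a (X u v)).
Proof. intros HD H. apply (smooth3_scal D (fun _ _ => a)); auto. now apply smooth_const. Qed.

Lemma smooth3_cross D X Y : open_dom D -> smooth3 D X -> smooth3 D Y ->
  smooth3 D (fun u v => cross (X u v) (Y u v)).
Proof.
  intros HD (H1 & H2 & H3) (K1 & K2 & K3).
  split; [|split]; apply smooth_minus; auto; apply smooth_mult; assumption.
Qed.

Lemma smooth_dot D X Y : open_dom D -> smooth3 D X -> smooth3 D Y ->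
  smooth D (fun u v => dot (X u v) (Y u v)).
Proof.
  intros HD (H1 & H2 & H3) (K1 & K2 & K3).
  repeat apply smooth_plus; auto; apply smooth_mult; assumption.
Qed.

Lemma vpartials_comm D X Xu Xv Xuu Xuv Xvu Xvv : open_dom D -> smooth3 D X ->
  vpartials D X Xu Xv -> vpartials D Xu Xuu Xuv -> vpartials D Xv Xvu Xvv ->
  forall u v, D u v -> Xuv u v = Xvu u v.
Proof.
  intros HD (S1 & S2 & S3) (H1 & H2 & H3) (K1 & K2 & K3) (L1 & L2 & L3) u v Huv.
  apply R3_ext; [exact (partials_comm D _ _ _ _ _ _ _ HD S1 H1 K1 L1 u v Huv)
    |exact (partials_comm D _ _ _ _ _ _ _ HD S2 H2 K2 L2 u v Huv)
    |exact (partials_comm D _ _ _ _ _ _ _ HD S3 H3 K3 L3 u v Huv)].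
Qed.

Lemma vpoincare (D : dom) (P Q Pu Pv Qu Qv : R -> R -> R3) :
  open_dom D -> convex_dom D -> smooth3 D P -> smooth3 D Q ->
  vpartials D P Pu Pv -> vpartials D Q Qu Qv ->
  (forall u v, D u v -> Pv u v = Qu u v) ->
  exists X, smooth3 D X /\ vpartials D X P Q.
Proof.
  intros HD Hc (P1 & P2 & P3) (Q1 & Q2 & Q3) (A1 & A2 & A3) (B1 & B2 & B3) He.
  destruct (poincare D (fun u v => c1 (P u v)) (fun u v => c1 (Q u v)) HD Hc P1 Q1)
    as (f1 & S1 & H1).
  { intros u v Huv. rewrite (partials_pv _ _ _ _ _ _ A1 Huv), (partials_pu _ _ _ _ _ _ B1 Huv).
    now rewrite He. }
  destruct (poincare D (fun u v => c2 (P u v)) (fun u v => c2 (Q u v)) HD Hc P2 Q2)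
    as (f2 & S2 & H2).
  { intros u v Huv. rewrite (partials_pv _ _ _ _ _ _ A2 Huv), (partials_pu _ _ _ _ _ _ B2 Huv).
    now rewrite He. }
  destruct (poincare D (fun u v => c3 (P u v)) (fun u v => c3 (Q u v)) HD Hc P3 Q3)
    as (f3 & S3 & H3).
  { intros u v Huv. rewrite (partials_pv _ _ _ _ _ _ A3 Huv), (partials_pu _ _ _ _ _ _ B3 Huv).
    now rewrite He. }
  exists (fun u v => (f1 u v, f2 u v, f3 u v)).
  split; (split; [|split]); assumption.
Qed.

Lemma vconstant_of_zero_partials (D : dom) X : open_dom D -> convex_dom D ->
  vpartials D X (fun _ _ => zero3) (fun _ _ => zero3) ->
  forall u v u' v', D u v -> D u' v' -> X u v = X u' v'.
Proof.
  intros HD Hc (H1 & H2 & H3) u v u' v' Huv Huv'.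
  apply R3_ext; [exact (constant_of_zero_partials D _ HD Hc H1 u v u' v' Huv Huv')
   |exact (constant_of_zero_partials D _ HD Hc H2 u v u' v' Huv Huv')
   |exact (constant_of_zero_partials D _ HD Hc H3 u v u' v' Huv Huv')].
Qed.

(** * Moving orthonormal frames *)

Definition triad : Type := (R3 * R3 * R3)%type.

(** From body coordinates to space; [cof] goes back. For an orthonormal triad both are rotations, so
    dot and cross products of vectors given in the frame are computed in coordinates. *)
Definition fr (e : triad) (q : R3) : R3 :=
  add3 (add3 (scal3 (c1 q) (fst (fst e))) (scal3 (c2 q) (snd (fst e)))) (scal3 (c3 q) (snd e)).

Definition cof (e : triad) (p : R3) : R3 :=
  (dot (fst (fst e)) p, dot (snd (fst e)) p, dot (snd e) p).

Definition onf (e : triad) : Prop :=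
  let '(e1, e2, e3) := e in
  dot e1 e1 = 1 /\ dot e2 e2 = 1 /\ dot e1 e2 = 0 /\ e3 = cross e1 e2.

Lemma onf_gram e1 e2 e3 : onf (e1, e2, e3) ->
  (dot e1 e1 = 1 /\ dot e2 e2 = 1 /\ dot e3 e3 = 1) /\
  (dot e1 e2 = 0 /\ dot e1 e3 = 0 /\ dot e2 e3 = 0) /\
  (cross e1 e2 = e3 /\ cross e2 e3 = e1 /\ cross e3 e1 = e2).
Proof.
  intros (H1 & H2 & H3 & ->).
  assert (L : forall a b, dot (cross a b) (cross a b) = dot a a * dot b b - dot a b * dot a b)
    by (intros; vec_simpl; ring).
  assert (T : forall a b, cross a (cross b a) = add3 (scal3 (dot a a) b) (scal3 (- dot a b) a))
    by (intros; vec_ring).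
  assert (T' : forall a b, cross (cross b a) b = add3 (scal3 (dot b b) a) (scal3 (- dot b a) b))
    by (intros; vec_ring).
  repeat split; auto.
  - rewrite L, H1, H2, H3. ring.
  - vec_simpl; ring.
  - vec_simpl; ring.
  - rewrite T, H2. replace (dot e2 e1) with 0 by (rewrite <- H3; vec_simpl; ring). vec_ring.
  - rewrite T', H1, H3. vec_ring.
Qed.

Lemma dot_comm p q : dot p q = dot q p.
Proof. vec_simpl; ring. Qed.

Lemma fr_dot e p q : onf e -> dot (fr e p) (fr e q) = dot p q.
Proof.
  destruct e as [[e1 e2] e3]. intros H. apply onf_gram in H.
  destruct H as ((H1 & H2 & H3) & (H4 & H5 & H6) & _).
  transitivity (c1 p * c1 q * dot e1 e1 + c2 p * c2 q * dot e2 e2 + c3 p * c3 q * dot e3 e3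
    + (c1 p * c2 q + c2 p * c1 q) * dot e1 e2 + (c1 p * c3 q + c3 p * c1 q) * dot e1 e3
    + (c2 p * c3 q + c3 p * c2 q) * dot e2 e3).
  - unfold fr. vec_simpl. ring.
  - rewrite H1, H2, H3, H4, H5, H6. unfold dot. ring.
Qed.

Lemma fr_cross e p q : onf e -> cross (fr e p) (fr e q) = fr e (cross p q).
Proof.
  destruct e as [[e1 e2] e3]. intros H. apply onf_gram in H.
  destruct H as (_ & _ & (H1 & H2 & H3)).
  transitivity (add3 (add3 (scal3 (c2 p * c3 q - c3 p * c2 q) (cross e2 e3))
     (scal3 (c3 p * c1 q - c1 p * c3 q) (cross e3 e1)))
     (scal3 (c1 p * c2 q - c2 p * c1 q) (cross e1 e2))).
  - unfold fr. vec_ring.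
  - rewrite H1, H2, H3. unfold fr. vec_ring.
Qed.

Lemma fr_add e p q : add3 (fr e p) (fr e q) = fr e (add3 p q).
Proof. unfold fr. vec_ring. Qed.

Lemma fr_scal e a q : scal3 a (fr e q) = fr e (scal3 a q).
Proof. unfold fr. vec_ring. Qed.

Lemma fr_zero e : fr e zero3 = zero3.
Proof. unfold fr, zero3. vec_ring. Qed.

Lemma cof_fr e q : onf e -> cof e (fr e q) = q.
Proof.
  destruct e as [[e1 e2] e3]. intros H. apply onf_gram in H.
  destruct H as ((H1 & H2 & H3) & (H4 & H5 & H6) & _).
  assert (L : forall a, dot a (fr (e1, e2, e3) q) = c1 q * dot e1 a + c2 q * dot e2 a + c3 q * dot e3 a)
    by (intros; unfold fr; vec_simpl; ring).
  unfold cof. simpl. rewrite !L, (dot_comm e2 e1), (dot_comm e3 e1), (dot_comm e3 e2).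
  rewrite H1, H2, H3, H4, H5, H6. apply R3_ext; unfold c1, c2, c3; simpl; ring.
Qed.

Lemma cof_dot e p q : onf e -> dot (fr e q) p = dot q (cof e p).
Proof. intros _. unfold fr, cof. vec_simpl. ring. Qed.

(* Completeness of an orthonormal triad is the expansion of
   [det (e1, e2, e3) * p] along its columns. *)
Lemma fr_cof e p : onf e -> fr e (cof e p) = p.
Proof.
  destruct e as [[e1 e2] e3]. intros H. apply onf_gram in H.
  destruct H as ((H1 & _) & _ & (K1 & K2 & K3)).
  transitivity (scal3 (dot e1 (cross e2 e3)) p).
  - transitivity (add3 (add3 (scal3 (dot e1 p) (cross e2 e3)) (scal3 (dot e2 p) (cross e3 e1)))
      (scal3 (dot e3 p) (cross e1 e2))).
    + rewrite K1, K2, K3. reflexivity.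
    + vec_ring.
  - rewrite K2, H1. vec_ring.
Qed.

(** [ku] and [kv] are the Darboux vectors of the triad in body coordinates, hence their place inside
    [fr]. Quantifying over constant coordinates [q] gives the derivatives of the three legs at
    once. *)
Definition moving (D : dom) (e : R -> R -> triad) (ku kv : R -> R -> R3) : Prop :=
  (forall u v, D u v -> onf (e u v)) /\
  forall q, vpartials D (fun u v => fr (e u v) q)
    (fun u v => fr (e u v) (cross (ku u v) q)) (fun u v => fr (e u v) (cross (kv u v) q)).

Lemma fr_basis e q : fr e q = add3 (add3 (scal3 (c1 q) (fr e (1, 0, 0)))
  (scal3 (c2 q) (fr e (0, 1, 0)))) (scal3 (c3 q) (fr e (0, 0, 1))).
Proof. unfold fr. vec_ring. Qed.

(** Differentiation in a rotating frame: the rate of change of the coordinates plus the angular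
    velocity crossed with them. *)
Lemma moving_vpartials D e ku kv x xu xv : open_dom D ->
  moving D e ku kv -> vpartials D x xu xv ->
  vpartials D (fun u v => fr (e u v) (x u v))
    (fun u v => fr (e u v) (add3 (xu u v) (cross (ku u v) (x u v))))
    (fun u v => fr (e u v) (add3 (xv u v) (cross (kv u v) (x u v)))).
Proof.
  intros HD [_ H] (H1 & H2 & H3).
  eapply vpartials_ext; [exact HD
   |apply vpartials_add; [apply vpartials_add|];
    apply vpartials_scal; [exact H1|exact (H (1,0,0))|exact H2|exact (H (0,1,0))
      |exact H3|exact (H (0,0,1))]|..].
  - intros u v _. simpl. symmetry. apply fr_basis.
  - intros u v _. unfold fr. vec_ring.
  - intros u v _. unfold fr. vec_ring.
Qed.

(** A vector fixed in space, seen from the triad, turns with the opposite angular velocity. *)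
Lemma moving_cof D e ku kv p : open_dom D -> moving D e ku kv ->
  vpartials D (fun u v => cof (e u v) p)
    (fun u v => scal3 (-1) (cross (ku u v) (cof (e u v) p)))
    (fun u v => scal3 (-1) (cross (kv u v) (cof (e u v) p))).
Proof.
  intros HD [Ho H].
  assert (K : forall q, partials D (fun u v => dot (fr (e u v) q) p)
    (fun u v => dot (cross (ku u v) q) (cof (e u v) p))
    (fun u v => dot (cross (kv u v) q) (cof (e u v) p))).
  { intros q. eapply partials_eq; [apply partials_dot; [apply H|apply vpartials_const]|..];
    intros u v Huv; cbv beta; rewrite (cof_dot (e u v) p (cross _ q)) by auto; unfold zero3;
    vec_simpl; ring. }
  split; [|split];
  [apply (partials_ext D _ _ _ _ _ _ HD) with (4 := K (1, 0, 0))
  |apply (partials_ext D _ _ _ _ _ _ HD) with (4 := K (0, 1, 0))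
  |apply (partials_ext D _ _ _ _ _ _ HD) with (4 := K (0, 0, 1))];
  intros u v _; unfold fr, cof; vec_simpl; ring.
Qed.

Lemma cof_basis e p : add3 (add3 (scal3 (c1 p) (cof e (1, 0, 0)))
  (scal3 (c2 p) (cof e (0, 1, 0)))) (scal3 (c3 p) (cof e (0, 0, 1))) = cof e p.
Proof.
  destruct e as [[[[a b] c] [[a' b'] c']] [[a'' b''] c'']], p as [[x y] z].
  unfold cof. vec_ring.
Qed.

(* Two moving triads with the same angular velocities in body coordinates differ
   by a constant rotation: the vector [fr e' (cof e p)] has zero derivatives. *)
Lemma moving_unique D e e' ku kv : open_dom D -> convex_dom D ->
  moving D e ku kv -> moving D e' ku kv -> (exists u v, D u v) ->
  exists r, onf r /\ forall u v q, D u v -> fr (e' u v) q = fr r (fr (e u v) q).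
Proof.
  intros HD Hc He He' (u0 & v0 & H0).
  pose (T := fun u v p => fr (e' u v) (cof (e u v) p)).
  assert (HT : forall p u v u' v', D u v -> D u' v' -> T u v p = T u' v' p).
  { intros p. apply (vconstant_of_zero_partials D); [exact HD|exact Hc|].
    eapply vpartials_eq;
    [apply (moving_vpartials D e' ku kv); [exact HD|exact He'|apply (moving_cof D e ku kv p HD He)]|..];
    intros u v _; cbv beta; rewrite <- (fr_zero (e' u v)); f_equal; unfold zero3; vec_ring. }
  pose (o := e u0 v0). pose (o' := e' u0 v0).
  assert (Ho : onf o) by now apply He. assert (Ho' : onf o') by now apply He'.
  exists (T u0 v0 (1, 0, 0), T u0 v0 (0, 1, 0), T u0 v0 (0, 0, 1)).
  assert (HL : forall p, fr (T u0 v0 (1, 0, 0), T u0 v0 (0, 1, 0), T u0 v0 (0, 0, 1)) p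
    = T u0 v0 p).
  { intros p. unfold T. unfold fr at 1. simpl. rewrite !fr_scal, !fr_add. f_equal.
    apply cof_basis. }
  split.
  - assert (HTd : forall p q, dot (T u0 v0 p) (T u0 v0 q) = dot p q).
    { intros p q. unfold T. rewrite fr_dot by exact Ho'.
      rewrite <- (fr_dot o) by exact Ho. unfold o. rewrite !fr_cof by exact Ho. reflexivity. }
    assert (HTc : forall p q, cross (T u0 v0 p) (T u0 v0 q) = T u0 v0 (cross p q)).
    { intros p q. unfold T. rewrite fr_cross by exact Ho'. f_equal.
      rewrite <- (cof_fr (e u0 v0) (cross _ _)) by exact Ho.
      rewrite <- fr_cross by exact Ho. rewrite !fr_cof by exact Ho. reflexivity. }
    unfold onf. rewrite !HTd, HTc. split; [|split; [|split]]; try (vec_simpl; ring).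
    f_equal. vec_ring.
  - intros u v q H. rewrite HL, (HT _ _ _ u v H0 H). unfold T.
    rewrite cof_fr by (apply He; exact H). reflexivity.
Qed.

Lemma smooth3_fr D (e : R -> R -> triad) x : open_dom D ->
  (forall q, smooth3 D (fun u v => fr (e u v) q)) -> smooth3 D x ->
  smooth3 D (fun u v => fr (e u v) (x u v)).
Proof.
  intros HD He (H1 & H2 & H3).
  apply (smooth3_ext D (fun u v => add3 (add3
     (scal3 (c1 (x u v)) (fr (e u v) (1, 0, 0)))
     (scal3 (c2 (x u v)) (fr (e u v) (0, 1, 0)))) (scal3 (c3 (x u v)) (fr (e u v) (0, 0, 1)))));
  [exact HD|intros; symmetry; apply fr_basis|].
  repeat apply smooth3_add; try exact HD; apply smooth3_scal; auto.
Qed.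

Lemma partials_of_const D f fu fv a : open_dom D -> partials D f fu fv ->
  (forall u v, D u v -> f u v = a) -> forall u v, D u v -> fu u v = 0 /\ fv u v = 0.
Proof.
  intros HD H He u v Huv.
  assert (K : partials D (fun _ _ => a) fu fv)
    by (apply (partials_ext D f _ fu fv fu fv); auto).
  split.
  - rewrite <- (partials_pu _ _ _ _ u v K Huv). apply (Derive_const a).
  - rewrite <- (partials_pv _ _ _ _ u v K Huv). apply (Derive_const a).
Qed.

Lemma partials_unique D f g fu fv gu gv : open_dom D -> partials D f fu fv ->
  partials D g gu gv -> (forall u v, D u v -> f u v = g u v) ->
  forall u v, D u v -> fu u v = gu u v /\ fv u v = gv u v.
Proof.
  intros HD H K He u v Huv.
  assert (L : partials D g fu fv) by (apply (partials_ext D f _ fu fv fu fv); auto).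
  split.
  - now rewrite <- (partials_pu _ _ _ _ u v K Huv), <- (partials_pu _ _ _ _ u v L Huv).
  - now rewrite <- (partials_pv _ _ _ _ u v K Huv), <- (partials_pv _ _ _ _ u v L Huv).
Qed.

Lemma onf_coords e V a b c : onf e -> dot V (fst (fst e)) = a -> dot V (snd (fst e)) = b ->
  dot V (snd e) = c -> V = fr e (a, b, c).
Proof.
  intros H <- <- <-. rewrite <- (fr_cof e V) at 1 by exact H.
  unfold cof. now rewrite !(dot_comm V).
Qed.

Definition pair_triad (E1 n : R3) : triad := (E1, cross n E1, n).

Lemma pair_triad_onf E1 E3 n C S : dot E1 E1 = 1 -> dot E3 E3 = 1 -> dot E1 E3 = C ->
  cross E1 E3 = scal3 S n -> 0 < S -> S ^ 2 + C ^ 2 = 1 ->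
  onf (pair_triad E1 n) /\ E3 = fr (pair_triad E1 n) (C, S, 0).
Proof.
  intros H1 H3 H13 Hx HS HSC.
  assert (Hn1 : dot n E1 = 0).
  { apply (Rmult_eq_reg_l S); [|lra]. rewrite Rmult_0_r.
    transitivity (dot (scal3 S n) E1); [vec_simpl; ring|]. rewrite <- Hx. vec_simpl; ring. }
  assert (Hn3 : dot n E3 = 0).
  { apply (Rmult_eq_reg_l S); [|lra]. rewrite Rmult_0_r.
    transitivity (dot (scal3 S n) E3); [vec_simpl; ring|]. rewrite <- Hx. vec_simpl; ring. }
  assert (Hnn : dot n n = 1).
  { apply (Rmult_eq_reg_l (S ^ 2)); [|apply pow_nonzero; lra].
    transitivity (dot (scal3 S n) (scal3 S n)); [vec_simpl; ring|]. rewrite <- Hx.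
    transitivity (dot E1 E1 * dot E3 E3 - dot E1 E3 ^ 2); [vec_simpl; ring|].
    rewrite H1, H3, H13. lra. }
  assert (Ho : onf (pair_triad E1 n)).
  { unfold pair_triad, onf. split; [exact H1|split; [|split]].
    - transitivity (dot n n * dot E1 E1 - dot n E1 ^ 2); [vec_simpl; ring|].
      rewrite H1, Hnn, Hn1. ring.
    - vec_simpl; ring.
    - transitivity (add3 (scal3 (dot E1 E1) n) (scal3 (- dot n E1) E1)); [|vec_ring].
      rewrite H1, Hn1. vec_ring. }
  split; [exact Ho|].
  apply onf_coords; [exact Ho|simpl; rewrite dot_comm; exact H13| |simpl; rewrite dot_comm; exact Hn3].
  simpl. apply (Rmult_eq_reg_l S); [|lra].
  transitivity (dot E3 (cross (scal3 S n) E1)); [vec_simpl; ring|]. rewrite <- Hx.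
  transitivity (dot E1 E1 * dot E3 E3 - dot E1 E3 ^ 2); [vec_simpl; ring|].
  rewrite H1, H3, H13. lra.
Qed.

(** Here x, y and z are the components of E1' on n x E1, of E1' on n, and of (n x E1)' on n. They
    are read off E3 instead of n x E1, by S (n x E1) = E3 - C E1. *)
Lemma pair_triad_derivative e x y z C S E1 E3 n E1' E3' n' :
  e = pair_triad E1 n -> onf e -> E3 = fr e (C, S, 0) -> 0 < S ->
  dot E1' E1 = 0 -> dot n' n = 0 ->
  dot n' E1 + dot n E1' = 0 -> dot n' E3 + dot n E3' = 0 ->
  dot E1' E3 = x * S -> dot E1' n = y -> dot E3' n = z * S + C * y ->
  forall q, add3 (add3 (scal3 (c1 q) E1')
      (scal3 (c2 q) (add3 (cross n' E1) (cross n E1')))) (scal3 (c3 q) n')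
    = fr e (cross (z, - y, x) q).
Proof.
  intros He Ho HE3 HS H11 Hnn Hn1 Hn3 Hx Hy Hz q.
  assert (F1 : E1 = fr e (1, 0, 0)) by (rewrite He; unfold fr, pair_triad; vec_ring).
  assert (Fn : n = fr e (0, 0, 1)) by (rewrite He; unfold fr, pair_triad; vec_ring).
  assert (F2 : forall V, S * dot V (snd (fst e)) = dot V E3 - C * dot V E1).
  { intros V. rewrite HE3. rewrite F1 at 1.
    replace (snd (fst e)) with (fr e (0, 1, 0)) by (rewrite He; unfold fr, pair_triad; vec_ring).
    unfold fr. vec_simpl. ring. }
  assert (G1 : E1' = fr e (0, x, y)).
  { apply onf_coords; [exact Ho| | |].
    - rewrite He. exact H11.
    - apply (Rmult_eq_reg_l S); [|lra]. rewrite F2, Hx, H11. ring.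
    - rewrite He. exact Hy. }
  assert (Gn : n' = fr e (- y, - z, 0)).
  { apply onf_coords; [exact Ho| | |].
    - rewrite He. simpl. rewrite (dot_comm n E1') in Hn1. lra.
    - apply (Rmult_eq_reg_l S); [|lra]. rewrite F2.
      rewrite (dot_comm n E1') in Hn1. rewrite (dot_comm n E3') in Hn3.
      replace (dot n' E3) with (- dot E3' n) by lra.
      replace (dot n' E1) with (- dot E1' n) by lra. rewrite Hy, Hz. ring.
    - rewrite He. exact Hnn. }
  rewrite G1, Gn, Fn, F1, !fr_cross, !fr_add, !fr_scal, !fr_add by exact Ho.
  f_equal. vec_ring.
Qed.

(** Three products of derivatives in each direction determine the angular velocity; all other
    components follow by differentiating the constant products E1 . E1, n . n, n . E1 and n . E3. *)
Lemma moving_of_pair D E1 E1u E1v E3 E3u E3v n nu nv C S xu yu zu xv yv zv :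
  open_dom D ->
  vpartials D E1 E1u E1v -> vpartials D E3 E3u E3v -> vpartials D n nu nv ->
  (forall u v, D u v -> dot (E1 u v) (E1 u v) = 1 /\ dot (E3 u v) (E3 u v) = 1 /\
    dot (E1 u v) (E3 u v) = C u v /\ cross (E1 u v) (E3 u v) = scal3 (S u v) (n u v) /\
    0 < S u v /\ S u v ^ 2 + C u v ^ 2 = 1) ->
  (forall u v, D u v -> dot (E1u u v) (E3 u v) = xu u v * S u v /\
    dot (E1u u v) (n u v) = yu u v /\
    dot (E3u u v) (n u v) = zu u v * S u v + C u v * yu u v) ->
  (forall u v, D u v -> dot (E1v u v) (E3 u v) = xv u v * S u v /\
    dot (E1v u v) (n u v) = yv u v /\
    dot (E3v u v) (n u v) = zv u v * S u v + C u v * yv u v) ->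
  moving D (fun u v => pair_triad (E1 u v) (n u v))
    (fun u v => (zu u v, - yu u v, xu u v)) (fun u v => (zv u v, - yv u v, xv u v)) /\
  forall u v, D u v -> E3 u v = fr (pair_triad (E1 u v) (n u v)) (C u v, S u v, 0).
Proof.
  intros HD H1 H3 Hn Hp Hu Hv.
  assert (Ho : forall u v, D u v -> onf (pair_triad (E1 u v) (n u v)) /\
     E3 u v = fr (pair_triad (E1 u v) (n u v)) (C u v, S u v, 0)).
  { intros u v Huv. destruct (Hp u v Huv) as (P1 & P2 & P3 & P4 & P5 & P6).
    apply (pair_triad_onf _ _ _ _ _ P1 P2 P3 P4 P5 P6). }
  assert (Hd : forall u v, D u v -> dot (n u v) (n u v) = 1 /\
    dot (n u v) (E1 u v) = 0 /\ dot (n u v) (E3 u v) = 0).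
  { intros u v Huv. destruct (Ho u v Huv) as [Hon HE3].
    assert (F1 : E1 u v = fr (pair_triad (E1 u v) (n u v)) (1, 0, 0))
      by (unfold fr, pair_triad; vec_ring).
    assert (Fn : n u v = fr (pair_triad (E1 u v) (n u v)) (0, 0, 1))
      by (unfold fr, pair_triad; vec_ring).
    set (e0 := pair_triad (E1 u v) (n u v)) in *.
    rewrite HE3.
    replace (dot (n u v) (n u v)) with (dot (fr e0 (0, 0, 1)) (fr e0 (0, 0, 1)))
      by (now rewrite <- Fn).
    replace (dot (n u v) (E1 u v)) with (dot (fr e0 (0, 0, 1)) (fr e0 (1, 0, 0)))
      by (now rewrite <- Fn, <- F1).
    replace (dot (n u v) (fr e0 (C u v, S u v, 0)))
      with (dot (fr e0 (0, 0, 1)) (fr e0 (C u v, S u v, 0))) by (now rewrite <- Fn).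
    rewrite !fr_dot by exact Hon. vec_simpl. repeat split; ring. }
  assert (L1 := partials_dot D _ _ _ _ _ _ H1 H1).
  assert (Ln := partials_dot D _ _ _ _ _ _ Hn Hn).
  assert (Ln1 := partials_dot D _ _ _ _ _ _ Hn H1).
  assert (Ln3 := partials_dot D _ _ _ _ _ _ Hn H3).
  pose proof (partials_of_const D _ _ _ 1 HD L1 (fun u v h => proj1 (Hp u v h))) as M1.
  pose proof (partials_of_const D _ _ _ 1 HD Ln (fun u v h => proj1 (Hd u v h))) as Mn.
  pose proof (partials_of_const D _ _ _ 0 HD Ln1 (fun u v h => proj1 (proj2 (Hd u v h)))) as Mn1.
  pose proof (partials_of_const D _ _ _ 0 HD Ln3 (fun u v h => proj2 (proj2 (Hd u v h)))) as Mn3.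
  split; [split|]; [intros u v Huv; now apply Ho| |intros u v Huv; now apply Ho].
  intros q.
  eapply vpartials_eq.
  - unfold fr, pair_triad. cbn [fst snd].
    apply vpartials_add; [apply vpartials_add|]; apply vpartials_cscal;
    [exact H1|apply vpartials_cross; [exact Hn|exact H1]|exact Hn].
  - intros u v Huv. destruct (Ho u v Huv) as [Hon HE3].
    destruct (Hu u v Huv) as (U1 & U2 & U3). destruct (Hp u v Huv) as (_ & _ & _ & _ & P5 & _).
    apply (pair_triad_derivative _ (xu u v) (yu u v) (zu u v) (C u v) (S u v) _ (E3 u v) _ _ (E3u u v) _
      eq_refl); auto.
    + destruct (M1 u v Huv) as [M _]. rewrite (dot_comm (E1 u v)) in M. lra.
    + destruct (Mn u v Huv) as [M _]. rewrite (dot_comm (n u v)) in M. lra.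
    + now apply Mn1.
    + now apply Mn3.
  - intros u v Huv. destruct (Ho u v Huv) as [Hon HE3].
    destruct (Hv u v Huv) as (U1 & U2 & U3). destruct (Hp u v Huv) as (_ & _ & _ & _ & P5 & _).
    apply (pair_triad_derivative _ (xv u v) (yv u v) (zv u v) (C u v) (S u v) _ (E3 u v) _ _ (E3v u v) _
      eq_refl); auto.
    + destruct (M1 u v Huv) as [_ M]. rewrite (dot_comm (E1 u v)) in M. lra.
    + destruct (Mn u v Huv) as [_ M]. rewrite (dot_comm (n u v)) in M. lra.
    + now apply Mn1.
    + now apply Mn3.
Qed.

(** * V-nets over a K-surface frame *)

(* [C], [S] are cosine and sine of a function [omega (u + v)] with [omega' = p]
   and [omega'' = sin omega]. *)
Definition pendulum (D : dom) (C S p : R -> R -> R) : Prop :=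
  (smooth D C /\ smooth D S /\ smooth D p) /\
  partials D C (fun u v => - (S u v * p u v)) (fun u v => - (S u v * p u v)) /\
  partials D S (fun u v => C u v * p u v) (fun u v => C u v * p u v) /\
  partials D p S S /\
  forall u v, D u v -> 0 < S u v /\ S u v ^ 2 + C u v ^ 2 = 1.

(* The orthonormal frame (E1, n x E1, n) of a K-surface with unit asymptotic fields
   E1 = psi_u / lam and E3 = lam * psi_v = C E1 + S (n x E1). *)
Definition K_moving (D : dom) (lam : R) (C S p : R -> R -> R) (e : R -> R -> triad) : Prop :=
  moving D e (fun u v => (lam, 0, - p u v))
    (fun u v => (- C u v / lam, - S u v / lam, 0)).

Lemma vpartials_of D (x y z xu yu zu xv yv zv : R -> R -> R) :
  partials D x xu xv -> partials D y yu yv -> partials D z zu zv ->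
  vpartials D (fun u v => (x u v, y u v, z u v)) (fun u v => (xu u v, yu u v, zu u v))
    (fun u v => (xv u v, yv u v, zv u v)).
Proof. intros. split; [|split]; assumption. Qed.

Lemma smooth3_of D (x y z : R -> R -> R) : smooth D x -> smooth D y -> smooth D z ->
  smooth3 D (fun u v => (x u v, y u v, z u v)).
Proof. intros. split; [|split]; assumption. Qed.

Definition E3_body (C S : R -> R -> R) (a : R -> R -> R) : R -> R -> R3 :=
  fun u v => (a u v * C u v, a u v * S u v, 0).
Definition E1_body (b : R -> R -> R) : R -> R -> R3 := fun u v => (b u v, 0, 0).

Lemma vpartials_E3_body D lam C S p e a au av : open_dom D -> lam <> 0 ->
  pendulum D C S p -> K_moving D lam C S p e -> partials D a au av ->
  vpartials D (fun u v => fr (e u v) (E3_body C S a u v))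
    (fun u v => fr (e u v) (au u v * C u v, au u v * S u v, lam * (a u v * S u v)))
    (fun u v => fr (e u v) (av u v * C u v - a u v * S u v * p u v,
                            av u v * S u v + a u v * C u v * p u v, 0)).
Proof.
  intros HD Hl (_ & HC & HS & _) He Ha.
  eapply vpartials_eq.
  - eapply (moving_vpartials D e _ _ (E3_body C S a)); [exact HD|exact He|]. apply vpartials_of;
    [apply partials_mult; [exact Ha|exact HC]|apply partials_mult; [exact Ha|exact HS]|
     apply partials_const].
  - intros u v _. unfold E3_body. cbv beta. f_equal. vec_ring.
  - intros u v _. unfold E3_body. cbv beta. f_equal. apply R3_ext; vec_simpl; field; exact Hl.
Qed.

Lemma vpartials_E1_body D lam C S p e b bu bv : open_dom D -> lam <> 0 ->
  K_moving D lam C S p e -> partials D b bu bv ->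
  vpartials D (fun u v => fr (e u v) (E1_body b u v))
    (fun u v => fr (e u v) (bu u v, - (b u v * p u v), 0))
    (fun u v => fr (e u v) (bv u v, 0, b u v * S u v / lam)).
Proof.
  intros HD Hl He Hb.
  eapply vpartials_eq.
  - eapply (moving_vpartials D e _ _ (E1_body b)); [exact HD|exact He|]. apply vpartials_of;
    [exact Hb|apply partials_const|apply partials_const].
  - intros u v _. unfold E1_body. cbv beta. f_equal. vec_ring.
  - intros u v _. unfold E1_body. cbv beta. f_equal. apply R3_ext; vec_simpl; field; exact Hl.
Qed.

(** The u-lines of eta run along E3 and its v-lines along E1: this is the relation d eta = b E1 (x)
    theta3 + c E3 (x) theta1, with the lengths of psi_u and psi_v absorbed into the coefficients. *)
Definition adapted (D : dom) (C S a b : R -> R -> R) (e : R -> R -> triad)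
  (eta : R -> R -> R3) : Prop :=
  vpartials D eta (fun u v => fr (e u v) (E3_body C S a u v))
    (fun u v => fr (e u v) (E1_body b u v)).

Lemma fr_ext_zero e q : onf e -> fr e q = zero3 -> q = zero3.
Proof.
  intros H E. rewrite <- (cof_fr e q H), E. unfold cof, zero3. vec_ring.
Qed.

Lemma unit_normal_eq eta u v (n : R3) r : 0 < r -> dot n n = 1 ->
  cross (du eta u v) (dv eta u v) = scal3 r n -> unit_normal eta u v = n.
Proof.
  intros Hr Hn H. unfold unit_normal. rewrite H.
  replace (norm3 (scal3 r n)) with r.
  - apply R3_ext; vec_simpl; field; lra.
  - unfold norm3.
    replace (dot (scal3 r n) (scal3 r n)) with (r ^ 2); [symmetry; apply sqrt_pow2; lra|].
    transitivity (r ^ 2 * dot n n); [rewrite Hn; ring|vec_simpl; ring].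
Qed.

(** * Fundamental forms and curvatures of an adapted net *)

Section Adapted.
Variables (D : dom) (lam : R) (C S p a b au av bu bv : R -> R -> R).
Variables (e : R -> R -> triad) (eta : R -> R -> R3) (nu : R).
Hypothesis HD : open_dom D.
Hypothesis Hlam : lam <> 0.
Hypothesis Hpend : pendulum D C S p.
Hypothesis He : K_moving D lam C S p e.
Hypothesis Ha : partials D a au av.
Hypothesis Hb : partials D b bu bv.
Hypothesis Hnu : is_sign nu.
Hypothesis Hab : forall u v, D u v -> 0 < - nu * (a u v * b u v).
Hypothesis Heta : adapted D C S a b e eta.

Let Hons u v (h : D u v) : onf (e u v) := proj1 He u v h.
Let HS0 u v (h : D u v) : 0 < S u v /\ S u v ^ 2 + C u v ^ 2 = 1 :=
  proj2 (proj2 (proj2 (proj2 Hpend))) u v h.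

Lemma adapted_du u v : D u v -> du eta u v = fr (e u v) (E3_body C S a u v).
Proof. apply (vpartials_du D eta _ _ u v Heta). Qed.

Lemma adapted_dv u v : D u v -> dv eta u v = fr (e u v) (E1_body b u v).
Proof. apply (vpartials_dv D eta _ _ u v Heta). Qed.

Lemma adapted_duu u v : D u v -> du (du eta) u v =
  fr (e u v) (au u v * C u v, au u v * S u v, lam * (a u v * S u v)).
Proof.
  apply (vpartials_du D (du eta) _ _ u v
   (vpartials_ext D _ _ _ _ _ _ HD (vpartials_E3_body D lam C S p e a au av HD Hlam Hpend He Ha)
     (fun u v h => eq_sym (adapted_du u v h)) (fun _ _ _ => eq_refl) (fun _ _ _ => eq_refl))).
Qed.

Lemma adapted_duv u v : D u v -> dv (du eta) u v =
  fr (e u v) (av u v * C u v - a u v * S u v * p u v,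
              av u v * S u v + a u v * C u v * p u v, 0).
Proof.
  apply (vpartials_dv D (du eta) _ _ u v
   (vpartials_ext D _ _ _ _ _ _ HD (vpartials_E3_body D lam C S p e a au av HD Hlam Hpend He Ha)
     (fun u v h => eq_sym (adapted_du u v h)) (fun _ _ _ => eq_refl) (fun _ _ _ => eq_refl))).
Qed.

Lemma adapted_dvv u v : D u v -> dv (dv eta) u v =
  fr (e u v) (bv u v, 0, b u v * S u v / lam).
Proof.
  apply (vpartials_dv D (dv eta) _ _ u v
   (vpartials_ext D _ _ _ _ _ _ HD (vpartials_E1_body D lam C S p e b bu bv HD Hlam He Hb)
     (fun u v h => eq_sym (adapted_dv u v h)) (fun _ _ _ => eq_refl) (fun _ _ _ => eq_refl))).
Qed.

Lemma sign_sqr : nu * nu = 1.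
Proof. destruct Hnu as [-> | ->]; ring. Qed.

(** Since E3 x E1 = - S n, the unit normal of eta is [nu] times n, where the sign [nu] is opposite
    to that of a b. *)
Lemma adapted_cross u v : D u v -> cross (du eta u v) (dv eta u v) =
  scal3 (- nu * (a u v * b u v) * S u v) (fr (e u v) (0, 0, nu)).
Proof.
  intros h. rewrite adapted_du, adapted_dv, fr_cross, fr_scal by auto. f_equal.
  pose proof sign_sqr as Hs. unfold E3_body, E1_body. apply R3_ext; vec_simpl; try ring.
  transitivity (- (nu * nu) * (a u v * b u v * S u v)); [rewrite Hs; ring|ring].
Qed.

Lemma adapted_normal u v : D u v -> unit_normal eta u v = fr (e u v) (0, 0, nu).
Proof.
  intros h. apply (unit_normal_eq eta u v _ (- nu * (a u v * b u v) * S u v)).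
  - apply Rmult_lt_0_compat; [now apply Hab|now apply HS0].
  - rewrite fr_dot by auto. rewrite <- sign_sqr. vec_simpl. ring.
  - now apply adapted_cross.
Qed.

Lemma adapted_first_form u v : D u v ->
  first_form eta u v = (a u v ^ 2, a u v * b u v * C u v, b u v ^ 2).
Proof.
  intros h. unfold first_form. rewrite adapted_du, adapted_dv, !fr_dot by auto.
  unfold E3_body, E1_body. apply R3_ext; vec_simpl; try ring.
  transitivity (a u v ^ 2 * (S u v ^ 2 + C u v ^ 2)); [ring|].
  rewrite (proj2 (HS0 u v h)). ring.
Qed.

Lemma adapted_second_form u v : D u v ->
  second_form eta u v = (nu * (lam * (a u v * S u v)), 0, nu * (b u v * S u v / lam)).
Proof.
  intros h. unfold second_form. rewrite adapted_normal, adapted_duu, adapted_duv, adapted_dvv by auto.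
  rewrite !fr_dot by auto. apply R3_ext; vec_simpl; ring.
Qed.

Lemma adapted_ab u v : D u v -> a u v <> 0 /\ b u v <> 0.
Proof. intros h. pose proof (Hab u v h). split; intros E; rewrite E in *; lra. Qed.

Lemma adapted_gauss u v : D u v -> gauss_curvature eta u v = / (a u v * b u v).
Proof.
  intros h. unfold gauss_curvature. rewrite adapted_first_form, adapted_second_form by auto.
  destruct (adapted_ab u v h). destruct (HS0 u v h) as [Hs He1].
  replace (a u v ^ 2 * b u v ^ 2 - (a u v * b u v * C u v) ^ 2)
    with (a u v ^ 2 * b u v ^ 2 * (S u v ^ 2)).
  2:{ replace (S u v ^ 2) with (1 - C u v ^ 2) by lra. ring. }
  transitivity ((nu * nu) / (a u v * b u v)); [|rewrite sign_sqr; field; auto].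
  field. repeat split; auto; lra.
Qed.

Lemma adapted_mean u v : D u v -> mean_curvature eta u v =
  nu * (lam / a u v + / (lam * b u v)) / (2 * S u v).
Proof.
  intros h. unfold mean_curvature. rewrite adapted_first_form, adapted_second_form by auto.
  destruct (adapted_ab u v h). destruct (HS0 u v h) as [Hs He1].
  replace (a u v ^ 2 * b u v ^ 2 - (a u v * b u v * C u v) ^ 2)
    with (a u v ^ 2 * b u v ^ 2 * (S u v ^ 2)).
  2:{ replace (S u v ^ 2) with (1 - C u v ^ 2) by lra. ring. }
  field. repeat split; auto; lra.
Qed.

Lemma adapted_net : smooth3 D eta -> is_net D eta.
Proof.
  intros Hs. split; [exact HD|split; [exact Hs|]]. intros u v h E.
  rewrite adapted_cross, fr_scal in E by auto. apply fr_ext_zero in E; [|auto].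
  apply (f_equal c3) in E. unfold zero3, scal3, c3 in E. cbn [fst snd] in E. pose proof (Hab u v h). destruct (HS0 u v h).
  assert (nu <> 0) by (destruct Hnu; lra).
  assert (0 < - nu * (a u v * b u v) * S u v) by now apply Rmult_lt_0_compat.
  apply Rmult_integral in E. lra.
Qed.

(** All conditions are visible in body coordinates: eta_uv has no n-component, the tangential part
    of eta_uu lies along E3, and that of eta_vv along E1. *)
Lemma adapted_V_net : smooth3 D eta -> V_net D eta.
Proof.
  intros Hs. split; [now apply adapted_net|split; [|split]].
  - intros u v h. rewrite adapted_gauss by exact h. destruct (adapted_ab u v h).
    apply Rinv_neq_0_compat. now apply Rmult_integral_contrapositive.
  - intros u v h. destruct (adapted_ab u v h). destruct (HS0 u v h).
    rewrite adapted_duv, adapted_du, adapted_dv by exact h.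
    exists ((av u v * S u v + a u v * C u v * p u v) / (a u v * S u v)),
     ((av u v * C u v - a u v * S u v * p u v
       - (av u v * S u v + a u v * C u v * p u v) / S u v * C u v) / b u v).
    rewrite !fr_scal, fr_add. f_equal. unfold E3_body, E1_body.
    apply R3_ext; vec_simpl; field; repeat split; auto; lra.
  - intros u v h. destruct (adapted_ab u v h).
    rewrite adapted_duu, adapted_dvv, adapted_du, adapted_dv, adapted_normal by exact h.
    pose proof sign_sqr as Hq.
    split.
    + exists (au u v / a u v), (nu * (lam * (a u v * S u v))). rewrite !fr_scal, fr_add. f_equal.
      unfold E3_body. apply R3_ext; vec_simpl; try (field; auto).
      transitivity ((nu * nu) * (lam * (a u v * S u v))); [rewrite Hq; ring|ring].
    + exists (bv u v / b u v), (nu * (b u v * S u v / lam)). rewrite !fr_scal, fr_add. f_equal.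
      unfold E1_body. apply R3_ext; vec_simpl; try (field; auto).
      transitivity ((nu * nu) * (b u v * S u v / lam)); [rewrite Hq; ring|field; auto].
Qed.
End Adapted.

Lemma partials_inv D f fu fv : partials D f fu fv -> (forall u v, D u v -> f u v <> 0) ->
  partials D (fun u v => / f u v) (fun u v => - fu u v / f u v ^ 2)
    (fun u v => - fv u v / f u v ^ 2).
Proof.
  intros H H0 u v Huv. destruct (H u v Huv) as [H1 H2].
  split; [apply (is_derive_inv (fun z => f z v))|apply (is_derive_inv (fun z => f u z))]; auto.
Qed.

Lemma dot_scal_l a p q : dot (scal3 a p) q = a * dot p q.
Proof. vec_simpl; ring. Qed.
Lemma dot_scal_r a p q : dot p (scal3 a q) = a * dot p q.
Proof. vec_simpl; ring. Qed.
Lemma dot_add_l p p' q : dot (add3 p p') q = dot p q + dot p' q.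
Proof. vec_simpl; ring. Qed.

(** The frame is made from the net itself, with E1 = eta_v / b, E3 = eta_u / a and n along E1 x E3.
    Derivatives of the first form give the tangential components of the derivatives of E1, the
    second form gives the normal ones, and the two equations relating a_v and b_u to p convert the
    former into the angular velocities of [K_moving]. *)
Lemma frame_of_forms D lam C S p a au av b bu bv eta nu :
  lam <> 0 -> pendulum D C S p -> smooth D a -> smooth D b ->
  partials D a au av -> partials D b bu bv -> is_sign nu ->
  (forall u v, D u v -> 0 < - nu * (a u v * b u v)) ->
  (forall u v, D u v -> av u v * S u v + a u v * p u v * C u v + b u v * p u v = 0 /\
                        bu u v * S u v + b u v * p u v * C u v + a u v * p u v = 0) ->
  is_net D eta ->
  (forall u v, D u v ->
     first_form eta u v = (a u v ^ 2, a u v * b u v * C u v, b u v ^ 2) /\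
     second_form eta u v = (nu * (lam * (a u v * S u v)), 0, nu * (b u v * S u v / lam))) ->
  exists e, K_moving D lam C S p e /\ adapted D C S a b e eta /\
    forall q, smooth3 D (fun u v => fr (e u v) q).
Proof.
  intros Hlam Hpend Sa Sb Ha Hb Hnu Hab Hcl (HD & Heta & _) Hf.
  assert (H0 : forall u v, D u v -> a u v <> 0 /\ b u v <> 0).
  { intros u v h. pose proof (Hab u v h). split; intros E; rewrite E in *; lra. }
  assert (HS0 := proj2 (proj2 (proj2 (proj2 Hpend)))).
  pose (E1 := fun u v => scal3 (/ b u v) (dv eta u v)).
  pose (E3 := fun u v => scal3 (/ a u v) (du eta u v)).
  pose (n := fun u v => scal3 (/ S u v) (cross (E1 u v) (E3 u v))).
  assert (SE1 : smooth3 D E1).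
  { apply smooth3_scal; [exact HD| |now apply smooth3_dv].
    apply smooth_inv; auto. intros; now apply H0. }
  assert (SE3 : smooth3 D E3).
  { apply smooth3_scal; [exact HD| |now apply smooth3_du].
    apply smooth_inv; auto. intros; now apply H0. }
  assert (Sn : smooth3 D n).
  { apply smooth3_scal; [exact HD| |now apply smooth3_cross].
    apply smooth_inv; auto; [apply Hpend|]. intros u v h. destruct (HS0 u v h); lra. }
  pose proof (smooth3_vpartials _ _ (smooth3_du _ _ Heta)) as Hu.
  pose proof (smooth3_vpartials _ _ (smooth3_dv _ _ Heta)) as Hv.
  assert (Hcomm : forall u v, D u v -> dv (du eta) u v = du (dv eta) u v).
  { apply (vpartials_comm D eta (du eta) (dv eta) _ _ _ _ HD Heta
     (smooth3_vpartials _ _ Heta) Hu Hv). }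
  assert (PE1 := vpartials_scal D _ _ _ _ _ _ (partials_inv D b bu bv Hb (fun u v h => proj2 (H0 u v h))) Hv).
  assert (PE3 := vpartials_scal D _ _ _ _ _ _ (partials_inv D a au av Ha (fun u v h => proj1 (H0 u v h))) Hu).
  assert (F1 : forall u v, D u v -> dot (du eta u v) (du eta u v) = a u v * a u v).
  { intros u v h. destruct (Hf u v h) as [K _]. apply (f_equal c1) in K.
    cbn in K. rewrite K. ring. }
  assert (F2 : forall u v, D u v -> dot (du eta u v) (dv eta u v) = a u v * b u v * C u v).
  { intros u v h. destruct (Hf u v h) as [K _]. apply (f_equal c2) in K. exact K. }
  assert (F3 : forall u v, D u v -> dot (dv eta u v) (dv eta u v) = b u v * b u v).
  { intros u v h. destruct (Hf u v h) as [K _]. apply (f_equal c3) in K.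
    cbn in K. rewrite K. ring. }
  assert (Dn : forall u v, D u v -> dot (du eta u v) (n u v) = 0 /\ dot (dv eta u v) (n u v) = 0).
  { intros u v h. unfold n, E1, E3. split; vec_simpl; ring. }
  assert (P13 : forall u v, D u v -> dot (E1 u v) (E1 u v) = 1 /\ dot (E3 u v) (E3 u v) = 1 /\
     dot (E1 u v) (E3 u v) = C u v /\ cross (E1 u v) (E3 u v) = scal3 (S u v) (n u v) /\
     0 < S u v /\ S u v ^ 2 + C u v ^ 2 = 1).
  { intros u v h. destruct (H0 u v h), (HS0 u v h). unfold E1, E3.
    rewrite !dot_scal_l, !dot_scal_r, F1, F3, (dot_comm (dv eta u v)), F2 by exact h.
    repeat split; try (field; auto); try assumption.
    apply R3_ext; unfold n, E1, E3; vec_simpl; field; repeat split; auto; lra. }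
  assert (N : forall u v, D u v -> unit_normal eta u v = scal3 nu (n u v)).
  { intros u v h. destruct (H0 u v h), (HS0 u v h). destruct (P13 u v h) as (Q1 & Q2 & Q3 & Q4 & _).
    assert (Hn2 : nu * nu = 1) by (destruct Hnu as [-> | ->]; ring).
    apply (unit_normal_eq eta u v _ (- nu * (a u v * b u v) * S u v)).
    - apply Rmult_lt_0_compat; auto.
    - apply (Rmult_eq_reg_l (S u v ^ 2)); [|apply pow_nonzero; lra].
      rewrite dot_scal_l, dot_scal_r.
      transitivity (nu * nu * dot (scal3 (S u v) (n u v)) (scal3 (S u v) (n u v)));
        [rewrite dot_scal_l, dot_scal_r; ring|]. rewrite <- Q4.
      transitivity (nu * nu * (dot (E1 u v) (E1 u v) * dot (E3 u v) (E3 u v)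
        - dot (E1 u v) (E3 u v) ^ 2)); [vec_simpl; ring|].
      rewrite Q1, Q2, Q3, Hn2. lra.
    - transitivity (scal3 (- (nu * nu) * (a u v * b u v)) (scal3 (S u v) (n u v))); [|vec_ring].
      rewrite <- Q4, Hn2. unfold E1, E3. apply R3_ext; vec_simpl; field; auto. }
  assert (G : forall u v, D u v -> dot (du (du eta) u v) (n u v) = lam * (a u v * S u v) /\
     dot (dv (du eta) u v) (n u v) = 0 /\ dot (dv (dv eta) u v) (n u v) = b u v * S u v / lam).
  { intros u v h. destruct (Hf u v h) as [_ K]. unfold second_form in K. rewrite N in K by exact h.
    rewrite !dot_scal_r in K. assert (nu <> 0) by (destruct Hnu; lra).
    pose proof (f_equal c1 K) as K1. pose proof (f_equal c2 K) as K2. pose proof (f_equal c3 K) as K3.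
    unfold c1, c2, c3 in K1, K2, K3. cbn [fst snd] in K1, K2, K3.
    repeat split; apply (Rmult_eq_reg_l nu); auto. rewrite K2. ring. }
  assert (D1 := partials_unique D _ _ _ _ _ _ HD (partials_dot D _ _ _ _ _ _ Hu Hu)
    (partials_mult D _ _ _ _ _ _ Ha Ha) F1).
  assert (D2 := partials_unique D _ _ _ _ _ _ HD (partials_dot D _ _ _ _ _ _ Hu Hv)
    (partials_mult D _ _ _ _ _ _ (partials_mult D _ _ _ _ _ _ Ha Hb) (proj1 (proj2 Hpend))) F2).
  assert (D3 := partials_unique D _ _ _ _ _ _ HD (partials_dot D _ _ _ _ _ _ Hv Hv)
    (partials_mult D _ _ _ _ _ _ Hb Hb) F3).
  destruct (moving_of_pair D E1 _ _ E3 _ _ n (du n) (dv n) C S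
    (fun u v => - p u v) (fun _ _ => 0) (fun _ _ => lam)
    (fun _ _ => 0) (fun u v => S u v / lam) (fun u v => - C u v / lam)
    HD PE1 PE3 (smooth3_vpartials _ _ Sn) P13) as [M ME].
  - intros u v h. destruct (H0 u v h), (HS0 u v h). destruct (Dn u v h) as [N1 N2].
    destruct (G u v h) as (G1 & G2 & G3). destruct (Hcl u v h) as [C1 C2].
    destruct (D1 u v h) as [_ D1v]. destruct (D3 u v h) as [D3u _].
    rewrite !dot_add_l, !dot_scal_l, N1, N2, <- Hcomm, G1, G2 by exact h.
    unfold E3. rewrite !dot_scal_r.
    rewrite (dot_comm (dv eta u v)), F2 by exact h.
    rewrite (dot_comm (du eta u v)) in D1v.
    replace (dot (dv (du eta) u v) (du eta u v)) with (av u v * a u v) by lra.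
    repeat split; try (field; auto).
    apply (Rmult_eq_reg_l (b u v * S u v)); [|apply Rmult_integral_contrapositive; split; [auto|lra]].
    transitivity (av u v * S u v - bu u v * S u v * C u v); [field; auto|].
    replace (av u v * S u v) with (- (a u v * p u v * C u v + b u v * p u v)) by lra.
    replace (bu u v * S u v) with (- (b u v * p u v * C u v + a u v * p u v)) by lra.
    transitivity (- (b u v * p u v) * (1 - C u v ^ 2)); [ring|].
    replace (1 - C u v ^ 2) with (S u v ^ 2) by lra. ring.
  - intros u v h. destruct (H0 u v h), (HS0 u v h). destruct (Dn u v h) as [N1 N2].
    destruct (G u v h) as (G1 & G2 & G3). destruct (Hcl u v h) as [C1 C2].
    destruct (D2 u v h) as [_ D2v]. destruct (D3 u v h) as [D3u _].
    rewrite !dot_add_l, !dot_scal_l, N1, N2, G2, G3 by exact h.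
    unfold E3. rewrite !dot_scal_r.
    rewrite (dot_comm (dv eta u v)), F2 by exact h.
    rewrite (dot_comm (dv eta u v)), <- Hcomm in D3u by exact h.
    rewrite (dot_comm (du eta u v)) in D2v.
    (* eta_vv . eta_u = (eta_u . eta_v)_v - eta_v . eta_uv, and the last product is b b_u. *)
    replace (dot (dv (dv eta) u v) (du eta u v)) with
      ((av u v * b u v + a u v * bv u v) * C u v + a u v * b u v * - (S u v * p u v) - bu u v * b u v) by lra.
    repeat split; try (field; auto).
    apply (Rmult_eq_reg_l (a u v * b u v * S u v)).
    2:{ repeat (apply Rmult_integral_contrapositive; split); auto; lra. }
    transitivity (b u v * ((av u v * S u v) * C u v - bu u v * S u v - a u v * p u v * S u v ^ 2)); [field; auto|].
    replace (av u v * S u v) with (- (a u v * p u v * C u v + b u v * p u v)) by lra.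
    replace (bu u v * S u v) with (- (b u v * p u v * C u v + a u v * p u v)) by lra.
    replace (S u v ^ 2) with (1 - C u v ^ 2) by lra. ring.
  - exists (fun u v => pair_triad (E1 u v) (n u v)). split; [|split].
    + destruct M as [M1 M2]. split; [exact M1|]. intros q.
      eapply vpartials_eq; [apply (M2 q)|..]; intros u v h; cbv beta; f_equal; f_equal;
      apply R3_ext; vec_simpl; try reflexivity; try (field; auto).
    + eapply vpartials_eq; [apply (smooth3_vpartials _ _ Heta)|..]; intros u v h.
      * destruct (H0 u v h).
        transitivity (scal3 (a u v) (E3 u v)); [unfold E3; apply R3_ext; vec_simpl; field; auto|].
        rewrite ME, fr_scal by exact h. f_equal. unfold E3_body. vec_ring.
      * destruct (H0 u v h).
        transitivity (scal3 (b u v) (E1 u v)); [unfold E1; apply R3_ext; vec_simpl; field; auto|].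
        unfold fr, pair_triad, E1_body. vec_ring.
    + intros q. unfold fr, pair_triad. cbn [fst snd].
      repeat apply smooth3_add; try exact HD; apply smooth3_cscal; auto; now apply smooth3_cross.
Qed.

(** * Screw motions *)

Lemma is_derive_acos x : -1 < x < 1 -> is_derive acos x (- / sqrt (1 - x ^ 2)).
Proof.
  intros H. apply is_derive_Reals. unfold Rdiv.
  replace (- / sqrt (1 - x ^ 2)) with (-1 / sqrt (1 - Rsqr x)).
  - rewrite <- (derive_pt_acos x H). apply derive_pt_eq_1 with (derivable_pt_acos x H).
    reflexivity.
  - unfold Rsqr. replace (x * x) with (x ^ 2) by ring. unfold Rdiv. ring.
Qed.

Lemma partials_acos D C S p : pendulum D C S p ->
  partials D (fun u v => acos (C u v)) p p.
Proof.
  intros (_ & HC & _ & _ & H).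
  assert (Hin : forall u v, D u v -> -1 < C u v < 1).
  { intros u v h. destruct (H u v h). assert (0 < S u v ^ 2) by now apply pow_lt. nra. }
  eapply partials_eq; [apply (partials_comp D (fun x => -1 < x < 1) acos _ C _ _
    is_derive_acos Hin HC)|..]; intros u v h; cbv beta;
  destruct (H u v h) as [Hs He]; replace (1 - C u v ^ 2) with (S u v ^ 2) by lra;
  rewrite sqrt_pow2 by lra; field; lra.
Qed.

Lemma dot_self_zero d : dot d d = 0 -> d = zero3.
Proof.
  intros H. destruct d as [[x y] z]. unfold dot, c1, c2, c3 in H. cbn [fst snd] in H.
  assert (x = 0 /\ y = 0 /\ z = 0) as (-> & -> & ->) by (repeat split; nra).
  reflexivity.
Qed.

Lemma sub3_zero p q : sub3 p q = zero3 -> p = q.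
Proof.
  destruct p as [[x y] z], q as [[x' y'] z']. unfold sub3, add3, scal3, zero3, c1, c2, c3.
  cbn [fst snd]. intros H. injection H. intros. f_equal; [f_equal|]; lra.
Qed.

Lemma dot_self_pos d : d <> zero3 -> 0 < dot d d.
Proof.
  intros H. assert (0 <= dot d d) by (unfold dot; nra).
  destruct (Req_dec (dot d d) 0) as [E|E]; [|lra]. now apply dot_self_zero in E.
Qed.

Definition is_vderive (x : R -> R3) (t : R) (d : R3) : Prop :=
  is_derive (fun s => c1 (x s)) t (c1 d) /\ is_derive (fun s => c2 (x s)) t (c2 d) /\
  is_derive (fun s => c3 (x s)) t (c3 d).

(** A screw motion moves a point with the velocity of its own screw field at the point reached; for
    a unit vector w this rests on w x (w x y) = (w . y) w - y. *)
Lemma screw_derive o w h x a t : dot w w = 1 ->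
  is_vderive (fun t => screw o w h (t * a) x) t
    (scal3 a (add3 (cross w (sub3 (screw o w h (t * a) x) o)) (scal3 h w))).
Proof.
  intros Hw. set (d := scal3 a _).
  assert (Hd : d = scal3 a (add3
     (add3 (scal3 (- sin (t * a)) (sub3 x o)) (add3 (scal3 (cos (t * a)) (cross w (sub3 x o)))
       (scal3 (sin (t * a) * dot w (sub3 x o)) w))) (scal3 h w))).
  { unfold d. f_equal. f_equal. unfold screw. cbv zeta. generalize (sub3 x o). intros y.
    transitivity (add3 (scal3 (- sin (t * a) * dot w w) y)
      (add3 (scal3 (cos (t * a)) (cross w y)) (scal3 (sin (t * a) * dot w y) w))); [vec_ring|].
    rewrite Hw. vec_ring. }
  rewrite Hd. clear d Hd. unfold screw. cbv zeta. generalize (sub3 x o). intros y.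
  generalize (dot w y) (cross w y). intros r z.
  split; [|split]; vec_simpl; auto_derive; auto; ring.
Qed.

(* Two orbits of the same screw motion field: their difference [d] satisfies
   [d' = w x d], so its norm is constant. *)
Lemma screw_orbit (g : R -> R3) o w h a : dot w w = 1 ->
  (forall t, 0 <= t <= 1 ->
     is_vderive g t (scal3 a (add3 (cross w (sub3 (g t) o)) (scal3 h w)))) ->
  screw o w h a (g 0) = g 1.
Proof.
  intros Hw Hg.
  pose (d := fun t => sub3 (screw o w h (t * a) (g 0)) (g t)).
  assert (Hd : dot (d 0) (d 0) = dot (d 1) (d 1)).
  { apply (eq_is_derive (V:=R_NormedModule) (fun t => dot (d t) (d t))); [|lra].
    intros t Ht. destruct (Hg t Ht) as (G1 & G2 & G3).
    destruct (screw_derive o w h (g 0) a t Hw) as (F1 & F2 & F3).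
    assert (Hm : forall (f f' : R -> R) (l l' : R), is_derive f t l -> is_derive f' t l' ->
      is_derive (fun t => (f t + -1 * f' t) * (f t + -1 * f' t)) t
        (2 * (f t + -1 * f' t) * (l - l'))).
    { intros f f' l l' H H'. eapply is_derive_eq.
      - apply (is_derive_Rmult (fun t => f t + -1 * f' t) (fun t => f t + -1 * f' t));
        (apply is_derive_Rplus; [exact H|]);
        apply (is_derive_Rmult (fun _ => -1) f'); [apply is_derive_Rconst|exact H'
        |apply is_derive_Rconst|exact H'].
      - ring. }
    eapply is_derive_eq.
    - unfold dot. apply is_derive_Rplus; [apply is_derive_Rplus|].
      + exact (Hm _ _ _ _ F1 G1).
      + exact (Hm _ _ _ _ F2 G2).
      + exact (Hm _ _ _ _ F3 G3).
    - change zero with 0. cbv beta. generalize (screw o w h (t * a) (g 0)) (g t). intros p q.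
      vec_simpl. ring. }
  assert (H0 : d 0 = zero3).
  { unfold d. rewrite Rmult_0_l. unfold screw. rewrite cos_0, sin_0, Rmult_0_r.
    unfold zero3. vec_ring. }
  rewrite H0 in Hd. unfold zero3 in Hd at 1 2.
  replace (dot (0, 0, 0) (0, 0, 0)) with 0 in Hd by (vec_simpl; ring).
  symmetry in Hd. apply dot_self_zero in Hd. unfold d in Hd. rewrite Rmult_1_l in Hd.
  now apply sub3_zero.
Qed.

Lemma vpartials_line (D : dom) X Xu Xv (a b : R -> R) (t a' b' : R) :
  open_dom D -> vpartials D X Xu Xv -> smooth3 D Xu -> D (a t) (b t) ->
  is_derive a t a' -> is_derive b t b' ->
  is_vderive (fun s => X (a s) (b s)) t
    (add3 (scal3 a' (Xu (a t) (b t))) (scal3 b' (Xv (a t) (b t)))).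
Proof.
  intros HD (H1 & H2 & H3) (K1 & K2 & K3) Ht Ha Hb.
  split; [|split].
  - eapply is_derive_eq; [exact (is_derive_line D _ _ _ a b t a' b' HD H1
      (fun x y h => smooth_continuity D _ x y K1 h) Ht Ha Hb)|]. vec_simpl. ring.
  - eapply is_derive_eq; [exact (is_derive_line D _ _ _ a b t a' b' HD H2
      (fun x y h => smooth_continuity D _ x y K2 h) Ht Ha Hb)|]. vec_simpl. ring.
  - eapply is_derive_eq; [exact (is_derive_line D _ _ _ a b t a' b' HD H3
      (fun x y h => smooth_continuity D _ x y K3 h) Ht Ha Hb)|]. vec_simpl. ring.
Qed.

(* [psi_u - psi_v = w x psi + tau] makes the surface invariant under the screw
   motion with rotation vector [w]. *)
Lemma helicoidal_of_field D psi pu' pv' w tau : open_dom D -> vpartials D psi pu' pv' ->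
  smooth3 D pu' -> w <> zero3 ->
  (forall u v, D u v -> sub3 (pu' u v) (pv' u v) = add3 (cross w (psi u v)) tau) ->
  helicoidal D psi.
Proof.
  intros HD Hp Sp Hw Hf. pose proof (dot_self_pos w Hw) as Hq.
  pose (W := norm3 w). assert (HW : 0 < W) by now apply sqrt_lt_R0.
  assert (HWW : W * W = dot w w) by (apply sqrt_sqrt; lra).
  (* The field w x X + tau is W times the screw field of the unit vector w / W with axis through (w
     x tau) / W^2 and pitch (w . tau) / W^2. A screw parameter s thus corresponds to the
     displacement s / W in u and - s / W in v. *)
  exists (scal3 (/ (W * W)) (cross w tau)), (scal3 (/ W) w), (dot w tau / (W * W)).
  assert (Hw1 : dot (scal3 (/ W) w) (scal3 (/ W) w) = 1).
  { transitivity (dot w w / (W * W)); [vec_simpl; field; lra|]. rewrite <- HWW. field. lra. }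
  split; [exact Hw1|]. intros u0 v0 H0 delta.
  destruct (HD u0 v0 H0) as [d Hd].
  (* Half of the room is for the starting point and half for the motion. *)
  assert (Hr : 0 < Rmin d delta / 2).
  { assert (0 < Rmin d delta) by (apply Rmin_glb_lt; apply cond_pos). lra. }
  pose (r := mkposreal _ Hr).
  assert (He : 0 < W * r) by (apply Rmult_lt_0_compat; [exact HW|apply cond_pos]).
  exists r, (mkposreal _ He). intros s u v Hs Hu Hv. simpl in Hs, Hu, Hv.
  assert (Hsr : Rabs (s / W) < Rmin d delta / 2).
  { unfold Rdiv at 1. rewrite Rabs_mult, Rabs_inv, (Rabs_right W) by lra.
    apply (Rmult_lt_reg_l W); [exact HW|]. unfold r in Hs. simpl in Hs.
    replace (W * (Rabs s * / W)) with (Rabs s) by (field; lra). exact Hs. }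
  assert (Hbox : forall t, 0 <= t <= 1 ->
    Rabs (u + t * (s / W) - u0) < Rmin d delta /\ Rabs (v + t * (- (s / W)) - v0) < Rmin d delta).
  { intros t Ht. assert (Rabs (t * (s / W)) < Rmin d delta / 2).
    { rewrite Rabs_mult, (Rabs_right t) by lra.
      apply Rle_lt_trans with (1 * Rabs (s / W)); [|lra].
      apply Rmult_le_compat_r; [apply Rabs_pos|lra]. }
    split.
    - replace (u + t * (s / W) - u0) with ((u - u0) + t * (s / W)) by ring.
      eapply Rle_lt_trans; [apply Rabs_triang|]. lra.
    - replace (v + t * - (s / W) - v0) with ((v - v0) + - (t * (s / W))) by ring.
      eapply Rle_lt_trans; [apply Rabs_triang|]. rewrite Rabs_Ropp. lra. }
  pose proof (Rmin_l d delta). pose proof (Rmin_r d delta).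
  assert (HDt : forall t, 0 <= t <= 1 -> D (u + t * (s / W)) (v + t * (- (s / W)))).
  { intros t Ht. destruct (Hbox t Ht). apply Hd; lra. }
  exists (u + 1 * (s / W)), (v + 1 * (- (s / W))).
  split; [apply HDt; lra|]. destruct (Hbox 1) as [B1 B2]; [lra|].
  split; [lra|]. split; [lra|].
  pose proof (screw_orbit (fun t => psi (u + t * (s / W)) (v + t * (- (s / W))))
    (scal3 (/ (W * W)) (cross w tau)) (scal3 (/ W) w) (dot w tau / (W * W)) s Hw1) as K.
  cbv beta in K. rewrite <- K.
  - f_equal. f_equal; ring.
  - intros t Ht. pose proof (HDt t Ht) as Hin.
    pose proof (vpartials_line D psi pu' pv' (fun t => u + t * (s / W)) (fun t => v + t * (- (s / W)))
      t (s / W) (- (s / W)) HD Hp Sp Hin) as L.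
    match goal with |- is_vderive _ _ ?x => match type of L with _ -> _ -> is_vderive _ _ ?y =>
      replace x with y end end.
    + apply L; auto_derive; auto; ring.
    + cbv beta. pose proof (Hf _ _ Hin) as E. revert E.
      generalize (pu' (u + t * (s / W)) (v + t * (- (s / W)))) (pv' (u + t * (s / W)) (v + t * (- (s / W))))
        (psi (u + t * (s / W)) (v + t * (- (s / W)))). intros x y z E.
      transitivity (scal3 (s / W) (sub3 x y)); [vec_ring|]. rewrite E.
      transitivity (scal3 (s / W) (add3 (add3 (cross w z)
        (scal3 (dot w w / (W * W)) tau)) zero3)).
      * rewrite <- HWW. unfold zero3. apply R3_ext; vec_simpl; field; lra.
      * unfold zero3. apply R3_ext; vec_simpl; field; lra.
Qed.

(** The triple is the difference of the two body angular velocities in [K_moving], that is, the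
    angular velocity along d/du - d/dv. Its second coordinate S / lam keeps it away from zero. *)
Lemma K_moving_axis D lam C S p e : open_dom D -> convex_dom D -> 0 < lam -> pendulum D C S p ->
  K_moving D lam C S p e -> (exists u v, D u v) ->
  exists w, w <> zero3 /\
    forall u v, D u v -> fr (e u v) (lam + C u v / lam, S u v / lam, - p u v) = w.
Proof.
  intros HD Hc Hl Hpend He (u0 & v0 & H0).
  exists (fr (e u0 v0) (lam + C u0 v0 / lam, S u0 v0 / lam, - p u0 v0)). split.
  - intros E. apply fr_ext_zero in E; [|now apply He].
    apply (f_equal c2) in E. unfold c2, zero3 in E. cbn [fst snd] in E.
    destruct (proj2 (proj2 (proj2 (proj2 Hpend))) u0 v0 H0).
    assert (0 < S u0 v0 / lam) by now apply Rdiv_lt_0_compat. lra.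
  - intros u v h.
    apply (vconstant_of_zero_partials D (fun u v => fr (e u v) (lam + C u v / lam, S u v / lam, - p u v))); auto.
    destruct Hpend as (_ & PC & PS & Pp & _).
    eapply vpartials_eq; [eapply (moving_vpartials D e _ _ (fun u v => (lam + C u v / lam, S u v / lam, - p u v)) _ _ HD He);
      apply vpartials_of;
      [apply partials_plus; [apply partials_const|apply partials_mult; [exact PC|apply partials_const]]
      |apply partials_mult; [exact PS|apply partials_const]|]|..].
    + eapply partials_eq with (fu := fun u v => -1 * S u v) (fv := fun u v => -1 * S u v).
      * eapply partials_ext; [exact HD| | | |apply (partials_mult D (fun _ _ => -1) _ _ _ _ _ (partials_const D (-1)) Pp)];
        intros; cbv beta; ring.
      * reflexivity.
      * reflexivity.
    + intros a b _. cbv beta. rewrite <- (fr_zero (e a b)). f_equal. unfold zero3.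
      apply R3_ext; vec_simpl; field; lra.
    + intros a b _. cbv beta. rewrite <- (fr_zero (e a b)). f_equal. unfold zero3.
      apply R3_ext; vec_simpl; field; lra.
Qed.

Lemma helicoidal_empty D psi : (forall u v, ~ D u v) -> helicoidal D psi.
Proof.
  intros H. exists zero3, (1, 0, 0), 0. split; [vec_simpl; ring|].
  intros u v h. destruct (H u v h).
Qed.

(** * The reciprocal-parallel K-surface of an adapted net *)

Section Reciprocal.
Variables (D : dom) (lam : R) (C S p : R -> R -> R) (e : R -> R -> triad).
Hypothesis HD : open_dom D.
Hypothesis Hconv : convex_dom D.
Hypothesis Hlam : 0 < lam.
Hypothesis Hpend : pendulum D C S p.
Hypothesis He : K_moving D lam C S p e.
Hypothesis Hes : forall q, smooth3 D (fun u v => fr (e u v) q).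

Let Hlam0 : lam <> 0. Proof. lra. Qed.
Let P u v := fr (e u v) (E1_body (fun _ _ => lam) u v).
Let Q u v := fr (e u v) (E3_body C S (fun _ _ => / lam) u v).

Let HP := vpartials_E1_body D lam C S p e _ _ _ HD Hlam0 He (partials_const D lam).
Let HQ := vpartials_E3_body D lam C S p e _ _ _ HD Hlam0 Hpend He (partials_const D (/ lam)).

Let SP : smooth3 D P.
Proof. apply smooth3_fr; auto. apply smooth3_of; now apply smooth_const. Qed.

Let SQ : smooth3 D Q.
Proof.
  destruct (proj1 Hpend) as (SC & SS & _).
  apply smooth3_fr; auto. apply smooth3_of; try apply smooth_mult; auto; now apply smooth_const.
Qed.

(** The form lam E1 du + (E3 / lam) dv is closed because both mixed derivatives equal S n. *)
Lemma K_surface_exists : exists psi, smooth3 D psi /\ vpartials D psi P Q.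
Proof.
  eapply (vpoincare D P Q); [exact HD|exact Hconv|exact SP|exact SQ|exact HP|exact HQ|].
  intros u v _. cbv beta. f_equal. apply R3_ext; vec_simpl; field; lra.
Qed.

Variable psi : R -> R -> R3.
Hypothesis Spsi : smooth3 D psi.
Hypothesis Hpsi : vpartials D psi P Q.

Let Hons u v (h : D u v) : onf (e u v) := proj1 He u v h.
Let HS0 u v (h : D u v) : 0 < S u v /\ S u v ^ 2 + C u v ^ 2 = 1 :=
  proj2 (proj2 (proj2 (proj2 Hpend))) u v h.

Let psi_du u v : D u v -> du psi u v = P u v.
Proof. apply (vpartials_du D psi _ _ u v Hpsi). Qed.

Let psi_dv u v : D u v -> dv psi u v = Q u v.
Proof. apply (vpartials_dv D psi _ _ u v Hpsi). Qed.

Let psi_duu u v : D u v -> du (du psi) u v = fr (e u v) (0, - (lam * p u v), 0).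
Proof.
  apply (vpartials_du D (du psi) _ _ u v (vpartials_ext D _ _ _ _ _ _ HD HP
     (fun u v h => eq_sym (psi_du u v h)) (fun _ _ _ => eq_refl) (fun _ _ _ => eq_refl))).
Qed.

Let psi_duv u v : D u v -> dv (du psi) u v = fr (e u v) (0, 0, lam * S u v / lam).
Proof.
  apply (vpartials_dv D (du psi) _ _ u v (vpartials_ext D _ _ _ _ _ _ HD HP
     (fun u v h => eq_sym (psi_du u v h)) (fun _ _ _ => eq_refl) (fun _ _ _ => eq_refl))).
Qed.

Let psi_dvv u v : D u v -> dv (dv psi) u v =
  fr (e u v) (0 * C u v - / lam * S u v * p u v, 0 * S u v + / lam * C u v * p u v, 0).
Proof.
  apply (vpartials_dv D (dv psi) _ _ u v (vpartials_ext D _ _ _ _ _ _ HD HQ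
     (fun u v h => eq_sym (psi_dv u v h)) (fun _ _ _ => eq_refl) (fun _ _ _ => eq_refl))).
Qed.

Let psi_cross u v : D u v ->
  cross (du psi u v) (dv psi u v) = scal3 (S u v) (fr (e u v) (0, 0, 1)).
Proof.
  intros h. rewrite psi_du, psi_dv by exact h. unfold P, Q.
  rewrite fr_cross, fr_scal by auto. f_equal.
  unfold E1_body, E3_body. apply R3_ext; vec_simpl; field; lra.
Qed.

Let psi_normal u v : D u v -> unit_normal psi u v = fr (e u v) (0, 0, 1).
Proof.
  intros h. apply (unit_normal_eq psi u v _ (S u v)); [now apply HS0| |now apply psi_cross].
  rewrite fr_dot by auto. vec_simpl; ring.
Qed.

Let psi_second u v : D u v -> second_form psi u v = (0, S u v, 0).
Proof.
  intros h. unfold second_form. rewrite psi_duu, psi_duv, psi_dvv, psi_normal by exact h.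
  rewrite !fr_dot by auto. apply R3_ext; vec_simpl; field; lra.
Qed.

Let psi_K_surface : K_surface D psi.
Proof.
  split; [split; [exact HD|split; [exact Spsi|]]|].
  - intros u v h E. rewrite psi_cross, fr_scal in E by exact h.
    apply fr_ext_zero in E; [|auto]. apply (f_equal c3) in E.
    unfold zero3, scal3, c3 in E. cbn [fst snd] in E. destruct (HS0 u v h). lra.
  - intros u v h. unfold gauss_curvature. rewrite psi_second by exact h.
    unfold first_form. rewrite psi_du, psi_dv by exact h. unfold P, Q.
    rewrite !fr_dot by auto. unfold E1_body, E3_body. vec_simpl. destruct (HS0 u v h) as [Hs E].
    replace (S u v) with (S u v * 1) in E by ring.
    replace ((lam * lam + 0 * 0 + 0 * 0) * (/ lam * C u v * (/ lam * C u v)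
       + / lam * S u v * (/ lam * S u v) + 0 * 0)
       - (lam * (/ lam * C u v) + 0 * (/ lam * S u v) + 0 * 0) ^ 2) with (S u v ^ 2)
      by (field; lra).
    field. lra.
Qed.

Let push1 u v : D u v -> push psi u v (/ lam, 0) = fr (e u v) (1, 0, 0).
Proof.
  intros h. unfold push. rewrite psi_du, psi_dv by exact h. unfold P, Q.
  rewrite !fr_scal, fr_add. f_equal. unfold E1_body, E3_body. apply R3_ext; vec_simpl; field; lra.
Qed.

Let push3 u v : D u v -> push psi u v (0, lam) = fr (e u v) (C u v, S u v, 0).
Proof.
  intros h. unfold push. rewrite psi_du, psi_dv by exact h. unfold P, Q.
  rewrite !fr_scal, fr_add. f_equal. unfold E1_body, E3_body. apply R3_ext; vec_simpl; field; lra.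
Qed.

Let psi_frame : K_frame D psi (fun _ _ => (/ lam, 0)) (fun _ _ => (0, lam)).
Proof.
  split; [split; now apply smooth_const|]. split; [split; now apply smooth_const|].
  split; [|split; [|split; [|split]]].
  - intros u v h. rewrite push1 by exact h. unfold norm3. rewrite fr_dot by auto.
    transitivity (sqrt 1); [f_equal; vec_simpl; ring|apply sqrt_1].
  - intros u v h. rewrite push3 by exact h. unfold norm3. rewrite fr_dot by auto.
    transitivity (sqrt 1); [f_equal; vec_simpl; destruct (HS0 u v h); lra|apply sqrt_1].
  - intros u v h. rewrite psi_second by exact h. unfold qeval. cbn [fst snd]. ring.
  - intros u v h. rewrite psi_second by exact h. unfold qeval. cbn [fst snd]. ring.
  - intros u v h. unfold det2. cbn [fst snd]. rewrite Rmult_0_l, Rminus_0_r.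
    rewrite Rinv_l; lra.
Qed.

(** Along d/du - d/dv the body coordinates of psi_u and psi_v are constant and the frame turns with
    angular velocity w. Exchanging derivatives, psi_u - psi_v and w x psi have the same partial
    derivatives, so they differ by a constant. *)
Let psi_helicoidal : helicoidal D psi.
Proof.
  destruct (Classical_Prop.classic (exists u v, D u v)) as [Hex|Hn].
  2:{ apply helicoidal_empty. intros u v h. apply Hn. now exists u, v. }
  destruct (K_moving_axis D lam C S p e HD Hconv Hlam Hpend He Hex) as (w & Hw & Hwe).
  destruct Hex as (u0 & v0 & H0).
  pose (T := fun u v => add3 (add3 (P u v) (scal3 (-1) (Q u v)))
    (scal3 (-1) (cross w (psi u v)))).
  assert (HT : vpartials D T (fun _ _ => zero3) (fun _ _ => zero3)).
  { eapply vpartials_eq.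
    - apply vpartials_add; [apply vpartials_add; [exact HP|apply vpartials_cscal, HQ]|
       apply vpartials_cscal, vpartials_cross; [apply vpartials_const|exact Hpsi]].
    - intros u v h. cbv beta. rewrite <- (Hwe u v h). unfold P, Q.
      rewrite fr_cross by auto. rewrite <- (fr_zero (e u v)) at 1.
      transitivity (fr (e u v) zero3); [|apply fr_zero].
      replace (cross (fr (e u v) zero3) (psi u v)) with (fr (e u v) zero3)
        by (rewrite fr_zero; unfold zero3; vec_ring).
      rewrite ?fr_scal, ?fr_add, ?fr_scal, ?fr_add. f_equal.
      unfold E1_body, E3_body, zero3. apply R3_ext; vec_simpl; field; lra.
    - intros u v h. cbv beta. rewrite <- (Hwe u v h). unfold P, Q.
      rewrite fr_cross by auto. rewrite <- (fr_zero (e u v)) at 1.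
      transitivity (fr (e u v) zero3); [|apply fr_zero].
      replace (cross (fr (e u v) zero3) (psi u v)) with (fr (e u v) zero3)
        by (rewrite fr_zero; unfold zero3; vec_ring).
      rewrite ?fr_scal, ?fr_add, ?fr_scal, ?fr_add. f_equal.
      unfold E1_body, E3_body, zero3. apply R3_ext; vec_simpl; field; lra. }
  apply (helicoidal_of_field D psi P Q w (T u0 v0) HD Hpsi SP Hw).
  intros u v h.
  rewrite (vconstant_of_zero_partials D T HD Hconv HT u0 v0 u v H0 h). unfold T.
  vec_ring.
Qed.

Variables (a b au av bu bv : R -> R -> R) (eta : R -> R -> R3).
Hypothesis Sa : smooth D a.
Hypothesis Sb : smooth D b.
Hypothesis Ha : partials D a au av.
Hypothesis Hb : partials D b bu bv.
Hypothesis Hab : forall u v, D u v -> a u v <> 0 /\ b u v <> 0.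
Hypothesis Seta : smooth3 D eta.
Hypothesis Heta : adapted D C S a b e eta.

(** The form eta x d psi is closed because eta_u is parallel to psi_v and eta_v is parallel to
    psi_u. *)
Let psi_rotation : rotation_field D eta psi.
Proof.
  destruct (vpoincare D (fun u v => cross (eta u v) (P u v)) (fun u v => cross (eta u v) (Q u v))
    _ _ _ _ HD Hconv (smooth3_cross D _ _ HD Seta SP) (smooth3_cross D _ _ HD Seta SQ)
    (vpartials_cross D _ _ _ _ _ _ Heta HP) (vpartials_cross D _ _ _ _ _ _ Heta HQ))
    as (xi & Sxi & Hxi).
  - intros u v h. cbv beta. unfold P, Q. rewrite !fr_cross by auto.
    f_equal; [f_equal; unfold E1_body, E3_body; vec_ring|].
    f_equal. f_equal. apply R3_ext; vec_simpl; field; lra.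
  - exists xi. split; [exact Sxi|]. intros u v h.
    rewrite (vpartials_du D _ _ _ _ _ Hxi h), (vpartials_dv D _ _ _ _ _ Hxi h).
    now rewrite psi_du, psi_dv.
Qed.

Lemma reciprocal_of_adapted : exists F, reciprocal_parallel D eta F /\
  helicoidal D (Kpsi F) /\ coherent_frame D F /\
  forall u v, D u v -> ext_d (theta1_bar F) u v = - av u v /\ ext_d (theta3_bar F) u v = bu u v.
Proof.
  (* Here theta1 = lam du and theta3 = dv / lam, so these values of b and c make the barred forms
     equal to a du and b dv, with a and b the coefficients of the adapted net. *)
  pose (F := mkK psi (fun _ _ => (/ lam, 0)) (fun _ _ => (0, lam))
    (fun u v => lam * b u v) (fun u v => / lam * a u v)).
  exists F.
  assert (Hdet : det2 (/ lam, 0) (0, lam) = 1)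
    by (unfold det2; cbn [fst snd]; rewrite Rinv_l by lra; ring).
  split; [|split; [exact psi_helicoidal|split]].
  - split; [exact psi_K_surface|split; [exact psi_rotation|split; [exact psi_frame|]]].
    split; [apply (smooth_mult D (fun _ _ => lam)); auto; now apply smooth_const|].
    split; [apply (smooth_mult D (fun _ _ => / lam)); auto; now apply smooth_const|].
    intros u v h. destruct (Hab u v h). cbn [Kb Kc KE1 KE3 Kpsi F fst snd].
    split; [reflexivity|]. split; [reflexivity|].
    split; [apply Rmult_integral_contrapositive; split; [lra|assumption]|].
    split; [apply Rmult_integral_contrapositive; split; [apply Rinv_neq_0_compat; lra|assumption]|].
    intros X. rewrite push1, push3 by exact h.
    unfold push. rewrite (vpartials_du D _ _ _ _ _ Heta h), (vpartials_dv D _ _ _ _ _ Heta h).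
    unfold pair2, theta1, theta3. cbv zeta. rewrite Hdet. cbn [fst snd].
    rewrite !fr_scal, !fr_add. f_equal. unfold E1_body, E3_body.
    apply R3_ext; vec_simpl; field; lra.
  - assert (PA : partials D (frame_angle F) p p).
    { apply (partials_ext D (fun u v => acos (C u v)) _ p p); auto; [|apply (partials_acos D C S p Hpend)].
      intros u v h. unfold frame_angle. cbn [KE1 KE3 Kpsi F]. rewrite push1, push3 by exact h.
      rewrite fr_dot by auto. f_equal. vec_simpl. ring. }
    intros u v h. unfold dir. cbn [KE1 KE3 F fst snd].
    rewrite (partials_pu D _ _ _ _ _ PA h), (partials_pv D _ _ _ _ _ PA h).
    replace ((/ lam * p u v + 0 * p u v) * (0 * p u v + lam * p u v)) with (p u v ^ 2)
      by (field; lra). apply pow2_ge_0.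
  - intros u v h. unfold ext_d, theta1_bar, theta3_bar, scale_form, theta1, theta3.
    cbn [Kb Kc KE1 KE3 F]. cbv zeta. rewrite Hdet. cbn [fst snd].
    split.
    + match goal with |- pu ?f u v - pv ?g u v = _ =>
        assert (Hf : partials D f (fun _ _ => 0) (fun _ _ => 0));
        [|assert (Hg : partials D g au av)] end.
      * apply (partials_ext D (fun _ _ => 0) _ (fun _ _ => 0) (fun _ _ => 0)); auto;
        [intros; field; lra|apply partials_const].
      * apply (partials_ext D a _ au av); auto. intros; field; lra.
      * rewrite (partials_pu _ _ _ _ _ _ Hf h), (partials_pv _ _ _ _ _ _ Hg h). ring.
    + match goal with |- pu ?f u v - pv ?g u v = _ =>
        assert (Hf : partials D f bu bv);
        [|assert (Hg : partials D g (fun _ _ => 0) (fun _ _ => 0))] end.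
      * apply (partials_ext D b _ bu bv); auto. intros; field; lra.
      * apply (partials_ext D (fun _ _ => 0) _ (fun _ _ => 0) (fun _ _ => 0)); auto;
        [intros; field; lra|apply partials_const].
      * rewrite (partials_pu _ _ _ _ _ _ Hf h), (partials_pv _ _ _ _ _ _ Hg h). ring.
Qed.
End Reciprocal.

Lemma is_derive_Rid x : is_derive (fun z : R => z) x 1.
Proof. apply (is_derive_id x). Qed.

(** [amplitude] is defined by choice, so a formula for it requires that the upper limit of the
    integral be unique. *)
Lemma amplitude_unique k phi x : is_RInt (ell_integrand k) 0 phi x ->
  (forall phi', is_RInt (ell_integrand k) 0 phi' x -> phi' = phi) -> amplitude k x = phi.
Proof.
  intros H Hu. apply Hu. unfold amplitude.
  apply (epsilon_spec (inhabits 0) (fun phi => is_RInt (ell_integrand k) 0 phi x)).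
  now exists phi.
Qed.

(** * The amplitude for k = 1 *)

Lemma cos_sq_sin x : cos x ^ 2 = 1 - sin x ^ 2.
Proof. pose proof (sin2_cos2 x) as H. unfold Rsqr in H. lra. Qed.

Lemma ell_integrand_1 th : - PI / 2 < th < PI / 2 ->
  ell_integrand 1 th = / cos th /\ 0 < cos th.
Proof.
  intros H. assert (Hc : 0 < cos th) by (apply cos_gt_0; lra). split; [|exact Hc].
  unfold ell_integrand. f_equal.
  replace (1 - 1 ^ 2 * sin th ^ 2) with (cos th ^ 2) by (rewrite cos_sq_sin; ring).
  apply sqrt_pow2. lra.
Qed.

(** For modulus 1 the integrand is 1 / cos, and its primitive arcsinh (tan) is the inverse
    Gudermannian function. *)
Lemma is_derive_arcsinh_tan th : - PI / 2 < th < PI / 2 ->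
  is_derive (fun z => arcsinh (tan z)) th (/ cos th).
Proof.
  intros H. destruct (ell_integrand_1 th H) as [_ Hc].
  eapply is_derive_eq; [apply (is_derive_Rcomp arcsinh tan)|].
  - apply is_derive_Reals, derivable_pt_lim_arcsinh.
  - apply is_derive_tan. lra.
  - replace (tan th ^ 2 + 1) with ((/ cos th) ^ 2).
    + rewrite sqrt_pow2; [field; lra|]. apply Rlt_le, Rinv_0_lt_compat, Hc.
    + unfold tan. pose proof (cos_sq_sin th). 
      replace ((sin th / cos th) ^ 2 + 1) with ((sin th ^ 2 + cos th ^ 2) / cos th ^ 2)
        by (field; lra).
      replace (sin th ^ 2 + cos th ^ 2) with 1 by lra. field. lra.
Qed.

Lemma ell_1_RInt phi : - PI / 2 < phi < PI / 2 ->
  is_RInt (ell_integrand 1) 0 phi (arcsinh (tan phi)).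
Proof.
  intros H. pose proof PI_RGT_0 as Hpi.
  assert (Hin : forall x, Rmin 0 phi <= x <= Rmax 0 phi -> - PI / 2 < x < PI / 2).
  { intros x. unfold Rmin, Rmax. destruct (Rle_dec 0 phi); lra. }
  apply (is_RInt_ext (fun th => / cos th)).
  { intros x Hx. symmetry. apply ell_integrand_1, Hin. lra. }
  replace (arcsinh (tan phi)) with (minus (arcsinh (tan phi)) (arcsinh (tan 0))).
  2:{ rewrite tan_0, arcsinh_0. unfold minus, plus, opp. simpl. ring. }
  apply (is_RInt_derive (V:=R_CompleteNormedModule) (fun z => arcsinh (tan z))).
  - intros x Hx. apply is_derive_arcsinh_tan, Hin, Hx.
  - intros x Hx. destruct (ell_integrand_1 x (Hin x Hx)) as [_ Hc].
    apply (ex_derive_continuous (V:=R_NormedModule) (fun th => / cos th)).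
    auto_derive. lra.
Qed.

(** The integrand is a total function, so the divergence at PI / 2 has to be proved: an integral M
    up to PI / 2 would bound the integrals over smaller intervals, but one of them has the value |M|
    + 1. *)
Lemma ell_1_no_RInt phi x : PI / 2 <= phi -> ~ is_RInt (ell_integrand 1) 0 phi x.
Proof.
  intros Hp H. pose proof PI_RGT_0 as Hpi.
  assert (E : ex_RInt (ell_integrand 1) 0 (PI / 2)).
  { apply (ex_RInt_Chasles_1 (V:=R_CompleteNormedModule)) with phi; [lra|]. now exists x. }
  set (M := RInt (ell_integrand 1) 0 (PI / 2)) in *.
  pose (y := Rabs M + 1). pose (a := atan (sinh y)).
  assert (Hy : 0 < y) by (unfold y; pose proof (Rabs_pos M); lra).
  assert (Hs : 0 < sinh y) by (rewrite <- sinh_0; now apply sinh_lt).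
  assert (Ha : 0 < a < PI / 2).
  { unfold a. pose proof (atan_bound (sinh y)). split; [|lra].
    rewrite <- atan_0. now apply atan_increasing. }
  assert (E1 : is_RInt (ell_integrand 1) 0 a y).
  { replace y with (arcsinh (tan a)); [apply ell_1_RInt; lra|].
    unfold a. rewrite tan_atan. apply arcsinh_sinh. }
  assert (E2 : ex_RInt (ell_integrand 1) a (PI / 2)).
  { apply (ex_RInt_Chasles_2 (V:=R_CompleteNormedModule)) with 0; [lra|exact E]. }
  pose proof (RInt_Chasles (ell_integrand 1) 0 a (PI / 2) (ex_intro _ y E1) E2) as K.
  rewrite (is_RInt_unique _ _ _ _ E1) in K. fold M in K. unfold plus in K. simpl in K.
  assert (0 <= RInt (ell_integrand 1) a (PI / 2)).
  { apply RInt_ge_0; [lra|exact E2|]. intros z Hz.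
    destruct (ell_integrand_1 z) as [-> Hc]; [lra|]. apply Rlt_le, Rinv_0_lt_compat, Hc. }
  pose proof (Rle_abs M). unfold y in K. lra.
Qed.

Lemma ell_integrand_even k th : ell_integrand k (- th) = ell_integrand k th.
Proof. unfold ell_integrand. rewrite sin_neg. f_equal. f_equal. ring. Qed.

Lemma ell_RInt_opp k phi x :
  is_RInt (ell_integrand k) 0 phi x -> is_RInt (ell_integrand k) 0 (- phi) (- x).
Proof.
  intros H.
  assert (K : is_RInt (fun y => opp (ell_integrand k (- y))) 0 (- phi) x).
  { apply (is_RInt_comp_opp (V:=R_NormedModule) (ell_integrand k)).
    rewrite Ropp_0, Ropp_involutive. exact H. }
  apply (is_RInt_opp (V:=R_NormedModule)) in K.
  eapply is_RInt_ext; [|exact K]. intros z _. simpl. rewrite ell_integrand_even.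
  unfold opp; simpl. ring.
Qed.

Lemma ell_1_RInt_inv phi x : is_RInt (ell_integrand 1) 0 phi x ->
  - PI / 2 < phi < PI / 2 /\ x = arcsinh (tan phi).
Proof.
  intros H.
  assert (Hp : - PI / 2 < phi < PI / 2).
  { split.
    - destruct (Rlt_dec (- PI / 2) phi) as [h|h]; [exact h|].
      exfalso. apply (ell_1_no_RInt (- phi) (- x)); [lra|]. now apply ell_RInt_opp.
    - destruct (Rlt_dec phi (PI / 2)) as [h|h]; [exact h|].
      exfalso. apply (ell_1_no_RInt phi x); [lra|exact H]. }
  split; [exact Hp|].
  rewrite <- (is_RInt_unique _ _ _ _ H). apply is_RInt_unique, ell_1_RInt, Hp.
Qed.

Lemma amplitude_1 x : amplitude 1 x = atan (sinh x).
Proof.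
  pose proof (atan_bound (sinh x)) as Hb.
  apply amplitude_unique.
  - replace x with (arcsinh (tan (atan (sinh x)))) at 2; [apply ell_1_RInt; lra|].
    rewrite tan_atan. apply arcsinh_sinh.
  - intros phi H. destruct (ell_1_RInt_inv phi x H) as [Hp ->].
    rewrite sinh_arcsinh. symmetry. apply atan_tan. lra.
Qed.

(** * The amplitude for 0 < k < 1 *)

(** The incomplete elliptic integral of the first kind. [ell_D] is the reciprocal of its integrand,
    which becomes the Jacobi function dn when evaluated at the amplitude. *)
Definition ell_F (k phi : R) : R := RInt (ell_integrand k) 0 phi.
Definition ell_D (k phi : R) : R := sqrt (1 - k ^ 2 * sin phi ^ 2).

Lemma ell_radicand k phi : 0 < k < 1 -> 0 < 1 - k ^ 2 * sin phi ^ 2.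
Proof.
  intros H. pose proof (cos_sq_sin phi) as E. pose proof (pow2_ge_0 (cos phi)).
  pose proof (pow2_ge_0 (sin phi)). assert (k ^ 2 < 1) by nra. nra.
Qed.

Lemma ell_D_pos k phi : 0 < k < 1 -> 0 < ell_D k phi <= 1.
Proof.
  intros H. pose proof (ell_radicand k phi H). split; [now apply sqrt_lt_R0|].
  unfold ell_D. rewrite <- sqrt_1 at 2. apply sqrt_le_1_alt.
  assert (0 <= k ^ 2 * sin phi ^ 2) by (apply Rmult_le_pos; apply pow2_ge_0). lra.
Qed.

Lemma ell_D_sqr k phi : 0 < k < 1 -> ell_D k phi ^ 2 = 1 - k ^ 2 * sin phi ^ 2.
Proof.
  intros H. pose proof (ell_radicand k phi H). unfold ell_D.
  replace (sqrt _ ^ 2) with (sqrt (1 - k ^ 2 * sin phi ^ 2) * sqrt (1 - k ^ 2 * sin phi ^ 2)) by ring.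
  apply sqrt_sqrt. lra.
Qed.

Lemma is_derive_ell_D k phi : 0 < k < 1 ->
  is_derive (ell_D k) phi (- (k ^ 2 * sin phi * cos phi) / ell_D k phi).
Proof.
  intros H. pose proof (ell_radicand k phi H). pose proof (ell_D_pos k phi H).
  unfold ell_D in *.
  eapply is_derive_eq; [apply (is_derive_sqrt (fun x => 1 - k ^ 2 * sin x ^ 2) phi
    (- (k ^ 2 * (2 * sin phi * cos phi))))|]; [auto_derive; [exact I|ring]|lra|field; lra].
Qed.

Lemma ell_integrand_continuous k phi : 0 < k < 1 -> continuous (ell_integrand k) phi.
Proof.
  intros H. apply (ex_derive_continuous (V:=R_NormedModule) (ell_integrand k)).
  pose proof (ell_D_pos k phi H). eexists.
  apply (is_derive_inv (ell_D k)); [now apply is_derive_ell_D|lra].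
Qed.

Lemma ell_ex_RInt k a b : 0 < k < 1 -> ex_RInt (ell_integrand k) a b.
Proof.
  intros H. apply (ex_RInt_continuous (V:=R_CompleteNormedModule)).
  intros. now apply ell_integrand_continuous.
Qed.

Lemma is_derive_ell_F k phi : 0 < k < 1 -> is_derive (ell_F k) phi (/ ell_D k phi).
Proof.
  intros H. apply (is_derive_RInt (V:=R_NormedModule) (ell_integrand k) (ell_F k) 0).
  - apply filter_forall. intros x. exact (RInt_correct (V:=R_CompleteNormedModule) _ _ _ (ell_ex_RInt k _ _ H)).
  - now apply ell_integrand_continuous.
Qed.

Lemma ell_F_continuity k : 0 < k < 1 -> continuity (ell_F k).
Proof.
  intros H x. apply continuity_pt_filterlim, (ex_derive_continuous (V:=R_NormedModule) (ell_F k)).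
  eexists. now apply is_derive_ell_F.
Qed.

Lemma ell_F_MVT k a b : 0 < k < 1 ->
  exists c, Rmin a b <= c <= Rmax a b /\ ell_F k b - ell_F k a = (b - a) / ell_D k c.
Proof.
  intros H. destruct (MVT_gen (ell_F k) a b (fun c => / ell_D k c)) as (c & Hc & E).
  - intros. now apply is_derive_ell_F.
  - intros. now apply ell_F_continuity.
  - exists c. split; [exact Hc|]. rewrite E. unfold Rdiv. ring.
Qed.

(** The integrand is at least 1. This serves twice: for injectivity, and as a Lipschitz bound for
    the inverse. *)
Lemma ell_F_expand k a b : 0 < k < 1 -> Rabs (b - a) <= Rabs (ell_F k b - ell_F k a).
Proof.
  intros H. destruct (ell_F_MVT k a b H) as (c & _ & ->). pose proof (ell_D_pos k c H).
  unfold Rdiv. rewrite Rabs_mult. rewrite (Rabs_right (/ _)).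
  2:{ apply Rle_ge, Rlt_le, Rinv_0_lt_compat. lra. }
  rewrite <- (Rmult_1_r (Rabs (b - a))) at 1. apply Rmult_le_compat_l; [apply Rabs_pos|].
  rewrite <- Rinv_1 at 1. apply Rinv_le_contravar; lra.
Qed.

Lemma ell_F_lt k a b : 0 < k < 1 -> a < b -> ell_F k a < ell_F k b.
Proof.
  intros H Hab. destruct (ell_F_MVT k a b H) as (c & _ & E). pose proof (ell_D_pos k c H).
  assert (0 < (b - a) / ell_D k c) by (apply Rdiv_lt_0_compat; lra). lra.
Qed.

Lemma amplitude_ell_F k phi : 0 < k < 1 -> amplitude k (ell_F k phi) = phi.
Proof.
  intros H. apply amplitude_unique.
  - exact (RInt_correct (V:=R_CompleteNormedModule) _ _ _ (ell_ex_RInt k _ _ H)).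
  - intros phi' Hp. apply (is_RInt_unique (V:=R_CompleteNormedModule)) in Hp.
    fold (ell_F k phi') in Hp.
    pose proof (ell_F_expand k phi phi' H) as K. rewrite Hp, Rminus_diag, Rabs_R0 in K.
    destruct (Req_dec (phi' - phi) 0); [lra|]. pose proof (Rabs_pos_lt (phi' - phi)). lra.
Qed.

Lemma ell_F_0 k : ell_F k 0 = 0.
Proof. apply (RInt_point (V:=R_CompleteNormedModule)). Qed.

Lemma ell_F_onto k a b x : 0 < k < 1 -> a <= b -> ell_F k a <= x <= ell_F k b ->
  exists phi, a <= phi <= b /\ ell_F k phi = x.
Proof.
  intros H Hab Hx. destruct (IVT_gen (ell_F k) a b x (ell_F_continuity k H)) as (phi & H1 & H2).
  - rewrite Rmin_left, Rmax_right; lra.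
  - exists phi. rewrite Rmin_left, Rmax_right in H1 by lra. auto.
Qed.

(** By the mean value theorem the difference quotient of the inverse equals [ell_D] at an
    intermediate angle, and by [ell_F_expand] that angle is within |h| of phi. *)
Lemma is_derive_amplitude k phi : 0 < k < 1 ->
  is_derive (amplitude k) (ell_F k phi) (ell_D k phi).
Proof.
  intros H. apply is_derive_Reals. intros eps Heps.
  assert (Hc : continuity_pt (ell_D k) phi).
  { apply continuity_pt_filterlim, (ex_derive_continuous (V:=R_NormedModule) (ell_D k)).
    eexists. now apply is_derive_ell_D. }
  destruct (Hc eps Heps) as (d & Hd & Hcont).
  (* The bound d serves the continuity of [ell_D]; the bound 1 keeps F (phi) + h between F (phi - 1)
     and F (phi + 1), where the intermediate value theorem applies. *)
  assert (Hm : 0 < Rmin d 1) by (apply Rmin_glb_lt; lra).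
  exists (mkposreal _ Hm). intros h Hh0 Hh. simpl in Hh.
  assert (Rabs h < d) by (eapply Rlt_le_trans; [exact Hh|apply Rmin_l]).
  assert (Rabs h < 1) by (eapply Rlt_le_trans; [exact Hh|apply Rmin_r]).
  assert (exists phi', ell_F k phi' = ell_F k phi + h) as (phi' & E).
  { pose proof (ell_F_expand k phi (phi + 1) H) as K1.
    pose proof (ell_F_expand k (phi - 1) phi H) as K2.
    pose proof (ell_F_lt k phi (phi + 1) H). pose proof (ell_F_lt k (phi - 1) phi H).
    replace (phi + 1 - phi) with 1 in K1 by ring. replace (phi - (phi - 1)) with 1 in K2 by ring.
    rewrite Rabs_R1, Rabs_right in K1 by lra. rewrite Rabs_R1, Rabs_right in K2 by lra.
    apply Rabs_def2 in H1.
    destruct (ell_F_onto k (phi - 1) (phi + 1) (ell_F k phi + h) H) as (phi' & _ & E); try lra.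
    now exists phi'. }
  rewrite <- E, !amplitude_ell_F by exact H.
  destruct (ell_F_MVT k phi phi' H) as (c & Hcb & Em). rewrite E in Em.
  pose proof (ell_D_pos k c H) as HDc.
  assert (Eh : (phi' - phi) / h = ell_D k c).
  { replace (ell_F k phi + h - ell_F k phi) with h in Em by ring.
    assert (phi' - phi = h * ell_D k c) as -> by (rewrite Em; field; lra). field. exact Hh0. }
  rewrite Eh.
  destruct (Req_dec c phi) as [->|Hne]; [rewrite Rminus_diag, Rabs_R0; exact Heps|].
  apply Hcont. split; [split; [exact I|congruence]|].
  simpl. unfold Rdist. apply Rle_lt_trans with (Rabs (phi' - phi)).
  - unfold Rmin, Rmax in Hcb. destruct (Rle_dec phi phi').
    + rewrite !Rabs_right; lra.
    + rewrite !Rabs_left1; lra.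
  - eapply Rle_lt_trans; [apply (ell_F_expand k phi phi' H)|]. rewrite E.
    replace (ell_F k phi + h - ell_F k phi) with h by ring. assumption.
Qed.

Lemma constant_of_derive_0 (f : R -> R) : (forall x, is_derive f x 0) -> forall x y, f x = f y.
Proof.
  intros H x y. destruct (Rtotal_order x y) as [h|[->|h]]; [|reflexivity|symmetry];
  apply (eq_is_derive (V:=R_NormedModule) f); auto; intros; apply H.
Qed.

Lemma ell_D_ext k a b : sin a ^ 2 = sin b ^ 2 -> ell_D k a = ell_D k b.
Proof. intros E. unfold ell_D. now rewrite E. Qed.

(** As sin^2 is symmetric about PI / 2, the sum F (PI - x) + F (x) is constant; compare x = 0 with x
    = PI / 2. *)
Lemma ell_F_PI k : 0 < k < 1 -> ell_F k PI = 2 * ellK k.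
Proof.
  intros H.
  pose proof (constant_of_derive_0 (fun x => ell_F k (PI - x) + ell_F k x)) as K.
  assert (E : forall x, is_derive (fun x => ell_F k (PI - x) + ell_F k x) x 0).
  { intros x. eapply is_derive_eq.
    - apply is_derive_Rplus; [|now apply is_derive_ell_F].
      apply (is_derive_Rcomp (ell_F k) (fun x => PI - x)); [now apply is_derive_ell_F|].
      auto_derive; [exact I|reflexivity].
    - rewrite (ell_D_ext k (PI - x) x) by (rewrite sin_PI_x; reflexivity). ring. }
  specialize (K E 0 (PI / 2)). cbv beta in K. rewrite Rminus_0_r, ell_F_0 in K.
  replace (PI - PI / 2) with (PI / 2) in K by field. unfold ellK. fold (ell_F k (PI / 2)). lra.
Qed.

Lemma ell_F_shift k phi : 0 < k < 1 -> ell_F k (phi + PI) = ell_F k phi + 2 * ellK k.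
Proof.
  intros H.
  pose proof (constant_of_derive_0 (fun x => ell_F k (x + PI) - ell_F k x)) as K.
  assert (E : forall x, is_derive (fun x => ell_F k (x + PI) - ell_F k x) x 0).
  { intros x. eapply is_derive_eq.
    - apply (is_derive_minus (V:=R_NormedModule)); [|now apply is_derive_ell_F].
      apply (is_derive_Rcomp (ell_F k) (fun x => x + PI)); [now apply is_derive_ell_F|].
      auto_derive; [exact I|reflexivity].
    - rewrite (ell_D_ext k (x + PI) x) by (rewrite neg_sin; ring).
      unfold minus, plus, opp; simpl. ring. }
  specialize (K E phi 0). cbv beta in K. rewrite Rplus_0_l, ell_F_0, ell_F_PI in K by exact H. lra.
Qed.

Lemma ell_F_multiple k phi m : 0 < k < 1 ->
  ell_F k (phi + IZR m * PI) = ell_F k phi + 2 * IZR m * ellK k.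
Proof.
  intros H. revert phi.
  assert (N : forall n phi, ell_F k (phi + INR n * PI) = ell_F k phi + 2 * INR n * ellK k).
  { induction n as [|n IH]; intros phi.
    - simpl. rewrite !Rmult_0_l, !Rplus_0_r. ring_simplify. f_equal.
    - rewrite S_INR. replace (phi + (INR n + 1) * PI) with ((phi + INR n * PI) + PI) by ring.
      rewrite ell_F_shift, IH by exact H. ring. }
  intros phi. destruct (Z.le_gt_cases 0 m) as [h|h].
  - rewrite <- (Z2Nat.id m h), <- INR_IZR_INZ. apply N.
  - pose proof (N (Z.to_nat (- m)) (phi + IZR m * PI)) as K.
    rewrite INR_IZR_INZ, Z2Nat.id, opp_IZR in K by lia.
    replace (phi + IZR m * PI + - IZR m * PI) with phi in K by ring. lra.
Qed.

(** * Half-angle functions of omega_k in terms of Jacobi functions *)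

Lemma sin_multiple_sqr phi m : sin (phi + IZR m * PI) ^ 2 = sin phi ^ 2.
Proof.
  assert (S0 : sin (IZR m * PI) = 0) by (apply sin_eq_0_1; now exists m).
  pose proof (cos_sq_sin (IZR m * PI)) as C0. rewrite S0 in C0.
  rewrite sin_plus, S0.
  replace ((sin phi * cos (IZR m * PI) + cos phi * 0) ^ 2)
    with (sin phi ^ 2 * cos (IZR m * PI) ^ 2) by ring.
  rewrite C0. ring.
Qed.

(* [s], [c] are sine and cosine of half the angle [omega_k], and [p] is its derivative. *)
Definition half_angle_data (I : R -> Prop) (k : R) (s c p : R -> R) : Prop :=
  forall x, I x ->
    is_derive s x (c x * p x / 2) /\ is_derive c x (- (s x * p x) / 2) /\
    is_derive p x (2 * s x * c x) /\
    0 < s x /\ 0 < c x /\ s x ^ 2 + c x ^ 2 = 1 /\ p x ^ 2 = 4 * k ^ 2 - 4 * c x ^ 2.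

(** Only the square of sn enters omega_k, so each case is free to choose the signs that make [s] and
    [c] positive. *)
Definition omega_param (k : R) (I : R -> Prop) (s c p : R -> R) : Prop :=
  half_angle_data I k s c p /\
  forall u v, I (u + v) -> k ^ 2 * jacobi_sn (u + v) k ^ 2 = c (u + v) ^ 2.

Lemma ell_F_between k a b x : 0 < k < 1 -> a < b -> ell_F k a < x < ell_F k b ->
  exists phi, a < phi < b /\ ell_F k phi = x.
Proof.
  intros H Hab Hx. destruct (ell_F_onto k a b x H) as (phi & Hp & E); [lra|lra|].
  exists phi. split; [|exact E]. split.
  - destruct (Req_dec a phi) as [->|]; lra.
  - destruct (Req_dec b phi) as [->|]; lra.
Qed.

Lemma jacobi_sn_le k x : k <= 1 -> jacobi_sn x k = sin (amplitude k x).
Proof. intros H. unfold jacobi_sn. destruct (Rle_dec k 1); [reflexivity|lra]. Qed.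

Lemma jacobi_sn_gt k x : 1 < k -> jacobi_sn x k = / k * sin (amplitude (/ k) (k * x)).
Proof. intros H. unfold jacobi_sn. destruct (Rle_dec k 1); [lra|reflexivity]. Qed.

(** On this interval the amplitude minus m PI runs through (0, PI), and s, c, p are dn, k sn and - 2
    k cn formed with the shifted amplitude. The derivative p changes sign in the middle of the
    interval. *)
Lemma omega_param_lt k m : 0 < k < 1 -> exists s c p,
  omega_param k (fun x => 2 * IZR m * ellK k < x < 2 * (IZR m + 1) * ellK k) s c p.
Proof.
  intros H. pose (f := fun x => amplitude k x - IZR m * PI).
  assert (Hf : forall x, 2 * IZR m * ellK k < x < 2 * (IZR m + 1) * ellK k ->
    0 < f x < PI /\ is_derive f x (ell_D k (f x)) /\ sin (amplitude k x) ^ 2 = sin (f x) ^ 2).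
  { intros x Hx. pose proof PI_RGT_0.
    destruct (ell_F_between k (0 + IZR m * PI) (PI + IZR m * PI) x H) as (phi & Hp & <-); [lra| |].
    { rewrite !ell_F_multiple, ell_F_0, ell_F_PI by exact H. lra. }
    assert (Es : sin phi ^ 2 = sin (f (ell_F k phi)) ^ 2).
    { unfold f. rewrite amplitude_ell_F by exact H.
      rewrite <- (sin_multiple_sqr (phi - IZR m * PI) m). f_equal. f_equal. ring. }
    split; [unfold f; rewrite amplitude_ell_F by exact H; lra|]. split.
    - rewrite (ell_D_ext k (f (ell_F k phi)) phi) by now symmetry.
      unfold f. rewrite <- (Rplus_0_r (ell_D k phi)).
      apply (is_derive_Rplus (amplitude k)); [now apply is_derive_amplitude|apply is_derive_Rconst].
    - rewrite amplitude_ell_F by exact H. exact Es. }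
  exists (fun x => ell_D k (f x)), (fun x => k * sin (f x)), (fun x => - 2 * k * cos (f x)).
  split.
  - intros x Hx. destruct (Hf x Hx) as (Hp & Hd & _).
    pose proof (ell_D_pos k (f x) H). pose proof (ell_D_sqr k (f x) H).
    pose proof (sin_gt_0 (f x)). pose proof (cos_sq_sin (f x)) as Hcs.
    split; [|split; [|split; [|split; [|split; [|split]]]]].
    + eapply is_derive_eq; [apply (is_derive_Rcomp (ell_D k) f); [now apply is_derive_ell_D|exact Hd]|].
      field. lra.
    + eapply is_derive_eq; [apply (is_derive_Rmult (fun _ => k) (fun x => sin (f x)));
        [apply is_derive_Rconst|apply (is_derive_Rcomp sin f); [apply is_derive_Rsin|exact Hd]]|].
      field.
    + eapply is_derive_eq; [apply (is_derive_Rmult (fun _ => -2 * k) (fun x => cos (f x)));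
        [apply is_derive_Rconst|apply (is_derive_Rcomp cos f); [apply is_derive_Rcos|exact Hd]]|].
      ring.
    + lra.
    + apply Rmult_lt_0_compat; lra.
    + rewrite H1. ring.
    + replace ((- 2 * k * cos (f x)) ^ 2) with (4 * k ^ 2 * cos (f x) ^ 2) by ring. rewrite Hcs. ring.
  - intros u v Hx. rewrite jacobi_sn_le by lra. rewrite (proj2 (proj2 (Hf _ Hx))). ring.
Qed.

Lemma is_derive_Rsinh x : is_derive sinh x (cosh x).
Proof. apply is_derive_Reals, derivable_pt_lim_sinh. Qed.
Lemma is_derive_Rcosh x : is_derive cosh x (sinh x).
Proof. apply is_derive_Reals, derivable_pt_lim_cosh. Qed.

Lemma cosh_pos x : 0 < cosh x.
Proof. unfold cosh. pose proof (exp_pos x). pose proof (exp_pos (- x)). lra. Qed.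

Lemma cosh_sq x : cosh x ^ 2 = 1 + sinh x ^ 2.
Proof.
  unfold cosh, sinh. assert (exp x * exp (- x) = 1) by (rewrite <- exp_plus, Rplus_opp_r; apply exp_0).
  field_simplify. replace (4 + (exp x ^ 2 - 2 * exp x * exp (- x) + exp (- x) ^ 2)) with
   (4 * (exp x * exp (-x)) + (exp x ^ 2 - 2 * exp x * exp (- x) + exp (- x) ^ 2)) by (rewrite H; ring).
  f_equal. ring_simplify. nra.
Qed.

Lemma jacobi_sn_1 x : jacobi_sn x 1 = sinh x / cosh x.
Proof.
  rewrite jacobi_sn_le, amplitude_1, sin_atan by lra.
  replace (1 + (sinh x)²) with (cosh x ^ 2) by (rewrite cosh_sq; unfold Rsqr; ring).
  rewrite sqrt_pow2 by (apply Rlt_le, cosh_pos). reflexivity.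
Qed.

(** For modulus 1, sn is tanh while cn and dn are both 1 / cosh; [sg] is the sign of x on the
    half-line and makes c positive. *)
Lemma omega_param_1 (I : R -> Prop) sg : sg ^ 2 = 1 -> (forall x, I x -> 0 < sg * sinh x) ->
  omega_param 1 I (fun x => / cosh x) (fun x => sg * sinh x / cosh x) (fun x => - 2 * sg / cosh x).
Proof.
  intros Hsg HI. split.
  - intros x Hx. specialize (HI x Hx). pose proof (cosh_pos x) as Hc. pose proof (cosh_sq x) as Hs.
    assert (Di : is_derive (fun x => / cosh x) x (- sinh x / cosh x ^ 2)).
    { apply (is_derive_inv cosh); [apply is_derive_Rcosh|lra]. }
    split; [|split; [|split; [|split; [|split; [|split]]]]].
    + eapply is_derive_eq; [exact Di|].
      replace (- sinh x) with (- (sg ^ 2 * sinh x)) by (rewrite Hsg; ring). field. lra.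
    + eapply is_derive_eq; [apply (is_derive_Rmult (fun x => sg * sinh x) (fun x => / cosh x));
       [apply (is_derive_Rmult (fun _ => sg) sinh); [apply is_derive_Rconst|apply is_derive_Rsinh]|exact Di]|].
      apply (Rmult_eq_reg_l (cosh x ^ 2)); [|apply pow_nonzero; lra].
      transitivity (sg * (cosh x ^ 2 - sinh x ^ 2)); [field; lra|]. replace (cosh x ^ 2 - sinh x ^ 2) with 1 by lra. field. lra.
    + eapply is_derive_eq; [apply (is_derive_Rmult (fun _ => -2 * sg) (fun x => / cosh x));
       [apply is_derive_Rconst|exact Di]|]. field. lra.
    + now apply Rinv_0_lt_compat.
    + now apply Rdiv_lt_0_compat.
    + apply (Rmult_eq_reg_l (cosh x ^ 2)); [|apply pow_nonzero; lra].
      transitivity (1 + sg ^ 2 * sinh x ^ 2); [field; lra|]. rewrite Hsg, Hs. ring.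
    + apply (Rmult_eq_reg_l (cosh x ^ 2)); [|apply pow_nonzero; lra].
      transitivity (4 * sg ^ 2); [field; lra|].
      transitivity (4 * (cosh x ^ 2 - sg ^ 2 * sinh x ^ 2)); [|field; lra].
      rewrite Hsg, Hs. ring.
  - intros u v _. rewrite jacobi_sn_1.
    replace ((sg * sinh (u + v) / cosh (u + v)) ^ 2) with (sg ^ 2 * (sinh (u + v) / cosh (u + v)) ^ 2)
      by (field; pose proof (cosh_pos (u + v)); lra). rewrite Hsg. ring.
Qed.

(** With the reciprocal modulus h and the argument k x, the functions s, c, p are cn, sn and - 2 k
    dn of the shifted amplitude. Positivity of cn confines the latter to (0, PI / 2), which is why
    the domains end at odd multiples of the quarter period. *)
Lemma omega_param_gt k m : 1 < k -> exists s c p,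
  omega_param k (fun x => 2 * IZR m * (/ k * ellK (/ k)) < x < (2 * IZR m + 1) * (/ k * ellK (/ k))) s c p.
Proof.
  intros Hk. set (h := / k).
  assert (H : 0 < h < 1).
  { unfold h. split; [apply Rinv_0_lt_compat; lra|]. rewrite <- Rinv_1.
    apply Rinv_lt_contravar; lra. }
  assert (Hkh : k * h = 1) by (unfold h; field; lra).
  pose (f := fun x => amplitude h (k * x) - IZR m * PI).
  assert (Hf : forall x, 2 * IZR m * (h * ellK h) < x < (2 * IZR m + 1) * (h * ellK h) ->
    0 < f x < PI / 2 /\ is_derive f x (k * ell_D h (f x)) /\
    sin (amplitude h (k * x)) ^ 2 = sin (f x) ^ 2).
  { intros x Hx. pose proof PI_RGT_0.
    destruct (ell_F_between h (0 + IZR m * PI) (PI / 2 + IZR m * PI) (k * x) H) as (phi & Hp & E); [lra| |].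
    { rewrite !ell_F_multiple, ell_F_0 by exact H.
      replace (ell_F h (PI / 2)) with (ellK h) by reflexivity.
      destruct Hx as [H1 H2]. apply (Rmult_lt_compat_l k) in H1; [|lra].
      apply (Rmult_lt_compat_l k) in H2; [|lra].
      replace (k * (2 * IZR m * (h * ellK h))) with (2 * IZR m * ellK h * (k * h)) in H1 by ring.
      replace (k * ((2 * IZR m + 1) * (h * ellK h))) with ((2 * IZR m + 1) * ellK h * (k * h)) in H2 by ring.
      rewrite Hkh in H1, H2. lra. }
    assert (Ef : f x = phi - IZR m * PI) by (unfold f; now rewrite <- E, amplitude_ell_F).
    assert (Es : sin phi ^ 2 = sin (f x) ^ 2).
    { rewrite Ef, <- (sin_multiple_sqr (phi - IZR m * PI) m). f_equal. f_equal. ring. }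
    split; [rewrite Ef; lra|]. split.
    - rewrite (ell_D_ext h (f x) phi) by now symmetry.
      unfold f. eapply is_derive_eq; [apply (is_derive_Rplus (fun x => amplitude h (k * x)));
       [|apply is_derive_Rconst]|].
      + apply (is_derive_Rcomp (amplitude h) (fun x => k * x)).
        * rewrite <- E. now apply is_derive_amplitude.
        * auto_derive; [exact I|reflexivity].
      + ring.
    - rewrite <- E, amplitude_ell_F by exact H. exact Es. }
  exists (fun x => cos (f x)), (fun x => sin (f x)), (fun x => - 2 * k * ell_D h (f x)).
  split.
  - intros x Hx. destruct (Hf x Hx) as (Hp & Hd & _).
    pose proof (ell_D_pos h (f x) H). pose proof (ell_D_sqr h (f x) H) as HD2.
    pose proof (sin_gt_0 (f x)). pose proof (cos_gt_0 (f x)). pose proof (cos_sq_sin (f x)) as Hcs.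
    pose proof PI_RGT_0.
    split; [|split; [|split; [|split; [|split; [|split]]]]].
    + eapply is_derive_eq; [apply (is_derive_Rcomp cos f); [apply is_derive_Rcos|exact Hd]|].
      field.
    + eapply is_derive_eq; [apply (is_derive_Rcomp sin f); [apply is_derive_Rsin|exact Hd]|].
      field.
    + eapply is_derive_eq; [apply (is_derive_Rmult (fun _ => -2 * k) (fun x => ell_D h (f x)));
        [apply is_derive_Rconst|apply (is_derive_Rcomp (ell_D h) f); [now apply is_derive_ell_D|exact Hd]]|].
      transitivity (2 * (k * h) ^ 2 * sin (f x) * cos (f x)); [field; lra|]. rewrite Hkh. ring.
    + apply cos_gt_0; lra.
    + apply sin_gt_0; lra.
    + rewrite Hcs. ring.
    + replace ((- 2 * k * ell_D h (f x)) ^ 2) with (4 * k ^ 2 * ell_D h (f x) ^ 2) by ring.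
      rewrite HD2. transitivity (4 * k ^ 2 - 4 * (k * h) ^ 2 * sin (f x) ^ 2); [ring|].
      rewrite Hkh. ring.
  - intros u v Hx. rewrite jacobi_sn_gt by exact Hk. fold h.
    rewrite Rpow_mult_distr, (proj2 (proj2 (Hf _ Hx))), <- Rmult_assoc, <- Rpow_mult_distr, Hkh. ring.
Qed.

Lemma sinh_pos x : 0 < x -> 0 < sinh x.
Proof. intros H. rewrite <- sinh_0. now apply sinh_lt. Qed.

Lemma sinh_opp x : sinh (- x) = - sinh x.
Proof. unfold sinh. rewrite Ropp_involutive. field. Qed.

Lemma convex_comb_gt a x y t : a < x -> a < y -> 0 <= t <= 1 -> a < (1 - t) * x + t * y.
Proof.
  intros Hx Hy Ht. destruct (Rle_dec x y) as [h|h].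
  - assert (0 <= t * (y - x)) by (apply Rmult_le_pos; lra). lra.
  - assert (0 <= (1 - t) * (x - y)) by (apply Rmult_le_pos; lra). lra.
Qed.

Lemma convex_comb_lt b x y t : x < b -> y < b -> 0 <= t <= 1 -> (1 - t) * x + t * y < b.
Proof.
  intros Hx Hy Ht. pose proof (convex_comb_gt (- b) (- x) (- y) t). lra.
Qed.

(** Removes the distinction between k < 1, k = 1 and k > 1 from the construction of the families and
    from the study of nets with the given forms. *)
Lemma is_Omega_param k Om : is_Omega k Om -> 0 < k /\ exists (I : R -> Prop) s c p,
  (forall u v, Om u v <-> I (u + v)) /\ (forall x, I x -> locally x I) /\
  (forall x y t, I x -> I y -> 0 <= t <= 1 -> I ((1 - t) * x + t * y)) /\
  omega_param k I s c p.
Proof.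
  assert (Hopen : forall a b x, a < x < b -> locally x (fun x => a < x < b)).
  { intros a b x Hx. apply (open_and (fun x => a < x) (fun x => x < b));
    [apply open_gt|apply open_lt|exact Hx]. }
  assert (Hconv : forall a b x y t, a < x < b -> a < y < b -> 0 <= t <= 1 ->
     a < (1 - t) * x + t * y < b).
  { intros. split; [now apply convex_comb_gt|now apply convex_comb_lt]. }
  intros [[H [m Hm]]|[[-> [Hm|Hm]]|[H [m Hm]]]].
  - split; [lra|]. destruct (omega_param_lt k m H) as (s & c & p & Hp).
    exists (fun x => 2 * IZR m * ellK k < x < 2 * (IZR m + 1) * ellK k), s, c, p.
    split; [exact Hm|]. split; [intros; now apply Hopen|]. split; [intros; now apply Hconv|exact Hp].
  - split; [lra|]. exists (fun x => 0 < x). do 3 eexists.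
    split; [exact Hm|]. split; [intros x Hx; apply open_gt, Hx|]. split; [intros; now apply convex_comb_gt|].
    apply (omega_param_1 _ 1); [ring|]. intros x Hx. rewrite Rmult_1_l. now apply sinh_pos.
  - split; [lra|]. exists (fun x => x < 0). do 3 eexists.
    split; [exact Hm|]. split; [intros x Hx; apply open_lt, Hx|]. split; [intros; now apply convex_comb_lt|].
    apply (omega_param_1 _ (-1)); [ring|]. intros x Hx.
    pose proof (sinh_pos (- x)) as K. rewrite sinh_opp in K. lra.
  - split; [lra|]. destruct (omega_param_gt k m H) as (s & c & p & Hp).
    exists (fun x => 2 * IZR m * (/ k * ellK (/ k)) < x < (2 * IZR m + 1) * (/ k * ellK (/ k))), s, c, p.
    split; [exact Hm|]. split; [intros; now apply Hopen|]. split; [intros; now apply Hconv|exact Hp].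
Qed.

(** * The two families *)

Lemma partials_sum D (I : R -> Prop) (f df : R -> R) :
  (forall x, I x -> is_derive f x (df x)) -> (forall u v, D u v -> I (u + v)) ->
  partials D (fun u v => f (u + v)) (fun u v => df (u + v)) (fun u v => df (u + v)).
Proof.
  intros Hf HI u v h. specialize (Hf _ (HI u v h)). split.
  - eapply is_derive_eq; [apply (is_derive_Rcomp f (fun z => z + v)); [exact Hf|]|].
    + auto_derive; [exact Logic.I|reflexivity].
    + ring.
  - eapply is_derive_eq; [apply (is_derive_Rcomp f (fun z => u + z)); [exact Hf|]|].
    + auto_derive; [exact Logic.I|reflexivity].
    + ring.
Qed.

Lemma half_angle_partials D I k s c p : half_angle_data I k s c p ->
  (forall u v, D u v -> I (u + v)) ->
  partials D (fun u v => s (u + v)) (fun u v => c (u + v) * p (u + v) / 2)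
    (fun u v => c (u + v) * p (u + v) / 2) /\
  partials D (fun u v => c (u + v)) (fun u v => - (s (u + v) * p (u + v)) / 2)
    (fun u v => - (s (u + v) * p (u + v)) / 2) /\
  partials D (fun u v => p (u + v)) (fun u v => 2 * s (u + v) * c (u + v))
    (fun u v => 2 * s (u + v) * c (u + v)).
Proof.
  intros H HI. split; [|split].
  - apply (partials_sum D I s (fun x => c x * p x / 2)); auto. intros x Hx. apply (H x Hx).
  - apply (partials_sum D I c (fun x => - (s x * p x) / 2)); auto. intros x Hx. apply (H x Hx).
  - apply (partials_sum D I p (fun x => 2 * s x * c x)); auto. intros x Hx. apply (H x Hx).
Qed.

Lemma continuity_2d_sum (f : R -> R) u v l : is_derive f (u + v) l ->
  continuity_2d_pt (fun u v => f (u + v)) u v.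
Proof.
  intros H. apply (continuity_1d_2d_pt_comp f (fun u v => u + v)).
  - apply continuity_pt_filterlim, (ex_derive_continuous (V:=R_NormedModule) f). now exists l.
  - apply continuity_2d_pt_plus; [apply continuity_2d_pt_id1|apply continuity_2d_pt_id2].
Qed.

(** The three functions solve a polynomial system of differential equations, so order n for all of
    them together gives order n + 1 for each. *)
Lemma half_angle_smooth D I k s c p : open_dom D -> half_angle_data I k s c p ->
  (forall u v, D u v -> I (u + v)) ->
  smooth D (fun u v => s (u + v)) /\ smooth D (fun u v => c (u + v)) /\
  smooth D (fun u v => p (u + v)).
Proof.
  intros HD H HI. destruct (half_angle_partials D I k s c p H HI) as (Ps & Pc & Pp).
  assert (K : forall n, smoothn n D (fun u v => s (u + v)) /\
    smoothn n D (fun u v => c (u + v)) /\ smoothn n D (fun u v => p (u + v))).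
  { induction n as [|n (K1 & K2 & K3)].
    - repeat split; try (destruct (H _ (HI _ _ H0)) as (D1 & D2 & D3 & _);
        eapply continuity_2d_sum; eassumption).
    - assert (C0 : forall a, smoothn n D (fun _ _ => a)) by (intros; now apply smoothn_const).
      split; [|split]; (eapply smoothn_S; [exact HD|eassumption|..]).
      + apply (smoothn_mult n D (fun u v => c (u + v) * p (u + v)) (fun _ _ => / 2)); auto.
        now apply smoothn_mult.
      + apply (smoothn_mult n D (fun u v => c (u + v) * p (u + v)) (fun _ _ => / 2)); auto.
        now apply smoothn_mult.
      + apply (smoothn_ext n D (fun u v => (- / 2) * (s (u + v) * p (u + v)))); [exact HD|intros; field|].
        apply smoothn_mult; auto. now apply smoothn_mult.
      + apply (smoothn_ext n D (fun u v => (- / 2) * (s (u + v) * p (u + v)))); [exact HD|intros; field|].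
        apply smoothn_mult; auto. now apply smoothn_mult.
      + apply smoothn_mult; auto. now apply smoothn_mult.
      + apply smoothn_mult; auto. now apply smoothn_mult. }
  split; [|split]; intros n; apply (K n).
Qed.

Definition Cos_of (c : R -> R) : R -> R -> R := fun u v => 2 * c (u + v) ^ 2 - 1.
Definition Sin_of (s c : R -> R) : R -> R -> R := fun u v => 2 * s (u + v) * c (u + v).
Definition sum_of (p : R -> R) : R -> R -> R := fun u v => p (u + v).

Lemma pendulum_of_param D I k s c p : open_dom D -> half_angle_data I k s c p ->
  (forall u v, D u v -> I (u + v)) -> pendulum D (Cos_of c) (Sin_of s c) (sum_of p).
Proof.
  intros HD H HI. destruct (half_angle_partials D I k s c p H HI) as (Ps & Pc & Pp).
  destruct (half_angle_smooth D I k s c p HD H HI) as (Ss & Sc & Sp).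
  unfold Cos_of, Sin_of, sum_of.
  split; [split; [|split]|split; [|split; [|split]]].
  - apply smooth_minus; [exact HD| |now apply smooth_const].
    apply smooth_mult; [exact HD|now apply smooth_const|].
    apply (smooth_ext D (fun u v => c (u + v) * c (u + v))); [exact HD|intros; ring|].
    now apply smooth_mult.
  - repeat apply smooth_mult; auto. now apply smooth_const.
  - exact Sp.
  - eapply (partials_ext D (fun u v => 2 * (c (u + v) * c (u + v)) + -1)); [exact HD| | | |
      apply partials_plus; [apply partials_mult; [apply partials_const|
        apply partials_mult; [exact Pc|exact Pc]]|apply partials_const]];
    intros; cbv beta; field.
  - assert (Hsc : forall u v, D u v -> s (u + v) ^ 2 + c (u + v) ^ 2 = 1)
      by (intros u v h; apply (H _ (HI u v h))).
    eapply partials_eq; [apply partials_mult; [apply partials_mult; [apply partials_const|exact Ps]|exact Pc]|..];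
    intros u v h; cbv beta; specialize (Hsc u v h);
    transitivity ((c (u + v) ^ 2 - s (u + v) ^ 2) * p (u + v)); try field;
    replace (s (u + v) ^ 2) with (1 - c (u + v) ^ 2) by lra; ring.
  - exact Pp.
  - intros u v h. destruct (H _ (HI u v h)) as (_ & _ & _ & H1 & H2 & H3 & _). split.
    + apply Rmult_lt_0_compat; lra.
    + replace ((2 * s (u + v) * c (u + v)) ^ 2) with (4 * (s (u + v) ^ 2) * c (u + v) ^ 2) by ring.
      replace (s (u + v) ^ 2) with (1 - c (u + v) ^ 2) by lra. ring.
Qed.

(** The arc cosine lies in [0, PI], so sine and cosine of its half are nonnegative, and the squares
    prescribed by the half-angle formulas have s and c as their nonnegative roots. *)
Lemma omega_half I k s c p u v : omega_param k I s c p -> I (u + v) ->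
  cos (omega k u v) = 2 * c (u + v) ^ 2 - 1 /\
  sin (omega k u v / 2) = s (u + v) /\ cos (omega k u v / 2) = c (u + v).
Proof.
  intros [H Hsn] h. destruct (H _ h) as (_ & _ & _ & H1 & H2 & H3 & _).
  assert (E : omega k u v = acos (2 * c (u + v) ^ 2 - 1)).
  { unfold omega. f_equal. rewrite <- (Hsn u v h). ring. }
  rewrite E. set (x := 2 * c (u + v) ^ 2 - 1).
  assert (Hx : -1 <= x <= 1) by (unfold x; nra).
  pose proof (acos_bound x) as Hb. pose proof PI_RGT_0.
  assert (Ec : cos (acos x) = x) by (apply cos_acos; lra).
  split; [exact Ec|].
  set (w := acos x) in *.
  assert (Hc0 : 0 <= cos (w / 2)) by (apply cos_ge_0; lra).
  assert (Hs0 : 0 <= sin (w / 2)) by (apply sin_ge_0; lra).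
  replace w with (2 * (w / 2)) in Ec by field. rewrite cos_2a_cos in Ec.
  pose proof (cos_sq_sin (w / 2)) as Hcs. unfold x in Ec.
  split.
  - apply Rsqr_inj; [exact Hs0|lra|]. unfold Rsqr. nra.
  - apply Rsqr_inj; [exact Hc0|lra|]. unfold Rsqr. nra.
Qed.

(* The coefficients in eta_u = a E3, eta_v = b E1, for functions of u + v; the
   two equations are the integrability condition. *)
Definition net_coeffs (D : dom) (C S p a b da db : R -> R -> R) (nu : R) : Prop :=
  smooth D a /\ smooth D b /\ partials D a da da /\ partials D b db db /\ is_sign nu /\
  forall u v, D u v -> 0 < - nu * (a u v * b u v) /\
    da u v * S u v + a u v * p u v * C u v + b u v * p u v = 0 /\
    db u v * S u v + b u v * p u v * C u v + a u v * p u v = 0.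

(** With a = b both integrability equations become a' S = - a p (1 + C), that is a' = - a p cot (w /
    2), whose solutions are the multiples of 1 / sin^2 (w / 2). Here a b > 0, hence [nu] = -1. *)
Lemma net_coeffs_pos D I k s c p eps : open_dom D -> half_angle_data I k s c p ->
  (forall u v, D u v -> I (u + v)) -> is_sign eps ->
  net_coeffs D (Cos_of c) (Sin_of s c) (sum_of p)
    (fun u v => - eps / s (u + v) ^ 2) (fun u v => - eps / s (u + v) ^ 2)
    (fun u v => eps * (c (u + v) * p (u + v)) / s (u + v) ^ 3)
    (fun u v => eps * (c (u + v) * p (u + v)) / s (u + v) ^ 3) (-1).
Proof.
  intros HD H HI Heps. destruct (half_angle_partials D I k s c p H HI) as (Ps & Pc & Pp).
  destruct (half_angle_smooth D I k s c p HD H HI) as (Ss & Sc & Sp).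
  assert (Hs0 : forall u v, D u v -> s (u + v) <> 0).
  { intros u v h. destruct (H _ (HI u v h)) as (_ & _ & _ & H1 & _). lra. }
  assert (Sa : smooth D (fun u v => - eps / s (u + v) ^ 2)).
  { apply (smooth_ext D (fun u v => - eps * (/ s (u + v) * / s (u + v)))); [exact HD|intros; field; auto|].
    assert (smooth D (fun u v => / s (u + v))) by (apply smooth_inv; auto).
    repeat apply smooth_mult; auto. now apply smooth_const. }
  assert (Pa : partials D (fun u v => - eps / s (u + v) ^ 2)
    (fun u v => eps * (c (u + v) * p (u + v)) / s (u + v) ^ 3)
    (fun u v => eps * (c (u + v) * p (u + v)) / s (u + v) ^ 3)).
  { pose proof (partials_inv D _ _ _ Ps Hs0) as Pi.
    eapply (partials_ext D (fun u v => - eps * (/ s (u + v) * / s (u + v)))); [exact HD| | | |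
      apply partials_mult; [apply partials_const|apply partials_mult; [exact Pi|exact Pi]]];
    intros u v h; specialize (Hs0 u v h); cbv beta; field; auto. }
  split; [exact Sa|split; [exact Sa|split; [exact Pa|split; [exact Pa|split; [now right|]]]]].
  intros u v h. destruct (H _ (HI u v h)) as (_ & _ & _ & H1 & H2 & H3 & _).
  split.
  - replace (- -1 * (- eps / s (u + v) ^ 2 * (- eps / s (u + v) ^ 2)))
      with (eps ^ 2 * (/ s (u + v) ^ 2) ^ 2) by (field; lra).
    replace (eps ^ 2) with 1 by (destruct Heps as [-> | ->]; ring).
    apply Rmult_lt_0_compat; [lra|]. apply pow_lt, Rinv_0_lt_compat, pow_lt, H1.
  - unfold Cos_of, Sin_of, sum_of. split; field; lra.
Qed.

(** With b = - a the equations become a' S = a p (1 - C), that is a' = a p tan (w / 2), whose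
    solutions are the multiples of 1 / cos^2 (w / 2). Here a b < 0, hence [nu] = 1. *)
Lemma net_coeffs_neg D I k s c p eps : open_dom D -> half_angle_data I k s c p ->
  (forall u v, D u v -> I (u + v)) -> is_sign eps ->
  net_coeffs D (Cos_of c) (Sin_of s c) (sum_of p)
    (fun u v => eps / c (u + v) ^ 2) (fun u v => - eps / c (u + v) ^ 2)
    (fun u v => eps * (s (u + v) * p (u + v)) / c (u + v) ^ 3)
    (fun u v => - (eps * (s (u + v) * p (u + v)) / c (u + v) ^ 3)) 1.
Proof.
  intros HD H HI Heps. destruct (half_angle_partials D I k s c p H HI) as (Ps & Pc & Pp).
  destruct (half_angle_smooth D I k s c p HD H HI) as (Ss & Sc & Sp).
  assert (Hs0 : forall u v, D u v -> c (u + v) <> 0).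
  { intros u v h. destruct (H _ (HI u v h)) as (_ & _ & _ & _ & H1 & _). lra. }
  assert (Sa : forall r, smooth D (fun u v => r / c (u + v) ^ 2)).
  { intros r. apply (smooth_ext D (fun u v => r * (/ c (u + v) * / c (u + v)))); [exact HD|intros; field; auto|].
    assert (smooth D (fun u v => / c (u + v))) by (apply smooth_inv; auto).
    repeat apply smooth_mult; auto. now apply smooth_const. }
  assert (Pa : forall r, partials D (fun u v => r / c (u + v) ^ 2)
    (fun u v => r * (s (u + v) * p (u + v)) / c (u + v) ^ 3)
    (fun u v => r * (s (u + v) * p (u + v)) / c (u + v) ^ 3)).
  { intros r. pose proof (partials_inv D _ _ _ Pc Hs0) as Pi.
    eapply (partials_ext D (fun u v => r * (/ c (u + v) * / c (u + v)))); [exact HD| | | |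
      apply partials_mult; [apply partials_const|apply partials_mult; [exact Pi|exact Pi]]];
    intros u v h; specialize (Hs0 u v h); cbv beta; field; auto. }
  split; [apply Sa|split; [apply Sa|split; [apply Pa|split; [|split; [now left|]]]]].
  { eapply partials_eq; [apply Pa|..]; intros u v h; specialize (Hs0 u v h); cbv beta; field; auto. }
  intros u v h. destruct (H _ (HI u v h)) as (_ & _ & _ & H1 & H2 & H3 & _).
  split.
  - replace (- (1) * (eps / c (u + v) ^ 2 * (- eps / c (u + v) ^ 2)))
      with (eps ^ 2 * (/ c (u + v) ^ 2) ^ 2) by (field; lra).
    replace (eps ^ 2) with 1 by (destruct Heps as [-> | ->]; ring).
    apply Rmult_lt_0_compat; [lra|]. apply pow_lt, Rinv_0_lt_compat, pow_lt, H2.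
  - unfold Cos_of, Sin_of, sum_of. split.
    + transitivity (2 * eps * p (u + v) / c (u + v) ^ 2 * (s (u + v) ^ 2 + c (u + v) ^ 2 - 1));
        [field; lra|rewrite H3; ring].
    + transitivity (- 2 * eps * p (u + v) / c (u + v) ^ 2 * (s (u + v) ^ 2 + c (u + v) ^ 2 - 1));
        [field; lra|rewrite H3; ring].
Qed.

(** The factor - eps in a is chosen so that the product of eps, [nu] = -1 and a is positive, like
    the coefficient of [II_pos]. For the negative family, where [nu] = 1, it becomes eps. *)
Lemma forms_pos I k s c p t eps u v : omega_param k I s c p -> I (u + v) -> is_sign eps ->
  let a := - eps / s (u + v) ^ 2 in
  I_pos k u v = (a ^ 2, a * a * Cos_of c u v, a ^ 2) /\
  II_pos t k u v = scal3 eps (-1 * (exp t * (a * Sin_of s c u v)), 0,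
                              -1 * (a * Sin_of s c u v / exp t)).
Proof.
  intros H h Heps a. destruct (omega_half I k s c p u v H h) as (E1 & E2 & E3).
  destruct (proj1 H _ h) as (_ & _ & _ & H1 & H2 & _).
  assert (He2 : eps * eps = 1) by (destruct Heps as [-> | ->]; ring).
  pose proof (exp_pos t).
  unfold I_pos, II_pos, csc, cot. cbv zeta. rewrite E1, E2, E3. unfold a, Cos_of, Sin_of.
  split; apply R3_ext; vec_simpl.
  - transitivity ((eps * eps) / s (u + v) ^ 4); [rewrite He2; field; lra|field; lra].
  - transitivity ((eps * eps) / s (u + v) ^ 4 * (2 * c (u + v) ^ 2 - 1)); [rewrite He2; field; lra|field; lra].
  - transitivity ((eps * eps) / s (u + v) ^ 4); [rewrite He2; field; lra|field; lra].
  - transitivity ((eps * eps) * 2 * c (u + v) / s (u + v) * exp t); [rewrite He2; field; lra|field; lra].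
  - ring.
  - transitivity ((eps * eps) * 2 * c (u + v) / s (u + v) / exp t); [rewrite He2; field; lra|field; lra].
Qed.

Lemma forms_neg I k s c p t eps u v : omega_param k I s c p -> I (u + v) -> is_sign eps ->
  let a := eps / c (u + v) ^ 2 in let b := - eps / c (u + v) ^ 2 in
  I_neg k u v = (a ^ 2, a * b * Cos_of c u v, b ^ 2) /\
  II_neg t k u v = scal3 eps (1 * (exp t * (a * Sin_of s c u v)), 0,
                              1 * (b * Sin_of s c u v / exp t)).
Proof.
  intros H h Heps a b. destruct (omega_half I k s c p u v H h) as (E1 & E2 & E3).
  destruct (proj1 H _ h) as (_ & _ & _ & H1 & H2 & _).
  assert (He2 : eps * eps = 1) by (destruct Heps as [-> | ->]; ring).
  pose proof (exp_pos t).
  unfold I_neg, II_neg, sec, tan. cbv zeta. rewrite E1, E2, E3. unfold a, b, Cos_of, Sin_of.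
  split; apply R3_ext; vec_simpl.
  - transitivity ((eps * eps) / c (u + v) ^ 4); [rewrite He2; field; lra|field; lra].
  - transitivity (- (eps * eps) / c (u + v) ^ 4 * (2 * c (u + v) ^ 2 - 1)); [rewrite He2; field; lra|field; lra].
  - transitivity ((eps * eps) / c (u + v) ^ 4); [rewrite He2; field; lra|field; lra].
  - transitivity ((eps * eps) * 2 * s (u + v) / c (u + v) * exp t); [rewrite He2; field; lra|field; lra].
  - ring.
  - transitivity (- (eps * eps) * 2 * s (u + v) / c (u + v) / exp t); [rewrite He2; field; lra|field; lra].
Qed.

Lemma fr_linear r p q a : fr r (add3 p (scal3 a q)) = add3 (fr r p) (scal3 a (fr r q)).
Proof. unfold fr. vec_ring. Qed.

Lemma rigid_isometry r t0 d : onf r -> is_sign d ->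
  isometry (fun p => add3 t0 (scal3 d (fr r p))).
Proof.
  intros Hr Hd p q. unfold norm3. f_equal.
  assert (Hd2 : d * d = 1) by (destruct Hd as [-> | ->]; ring).
  transitivity (d * d * dot (fr r (sub3 p q)) (fr r (sub3 p q))).
  - unfold sub3 at 3 4. rewrite fr_linear. vec_simpl. ring.
  - rewrite fr_dot, Hd2 by exact Hr. ring.
Qed.

(** Equal angular velocities make e' a rotated copy of e, by the rotation r; then eta' and d times
    the rotated eta have equal derivatives. The factor d will be a sign or a constant scaling. *)
Lemma rigid_of_moving D e e' ku kv x y eta eta' d : open_dom D -> convex_dom D ->
  (exists u v, D u v) -> moving D e ku kv -> moving D e' ku kv ->
  vpartials D eta (fun u v => fr (e u v) (x u v)) (fun u v => fr (e u v) (y u v)) ->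
  vpartials D eta' (fun u v => fr (e' u v) (scal3 d (x u v)))
    (fun u v => fr (e' u v) (scal3 d (y u v))) ->
  exists r t0, onf r /\ forall u v, D u v -> eta' u v = add3 t0 (scal3 d (fr r (eta u v))).
Proof.
  intros HD Hc Hex He He' H H'.
  destruct (moving_unique D e e' ku kv HD Hc He He' Hex) as (r & Hr & Hre).
  destruct Hex as (u0 & v0 & H0).
  assert (Hfr : vpartials D (fun u v => fr r (eta u v))
    (fun u v => fr r (fr (e u v) (x u v))) (fun u v => fr r (fr (e u v) (y u v)))).
  { destruct H as (H1 & H2 & H3).
    eapply vpartials_eq; [apply vpartials_add; [apply vpartials_add|];
      (apply vpartials_scal; [|apply vpartials_const]); [exact H1|exact H2|exact H3]|..];
    intros u v _; cbv beta; [generalize (fr (e u v) (x u v))|generalize (fr (e u v) (y u v))];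
    intros z; unfold fr, zero3; vec_ring. }
  pose (T := fun u v => add3 (eta' u v) (scal3 (-1) (scal3 d (fr r (eta u v))))).
  assert (HT : vpartials D T (fun _ _ => zero3) (fun _ _ => zero3)).
  { eapply vpartials_eq; [apply vpartials_add; [exact H'|apply vpartials_cscal, vpartials_cscal, Hfr]|..];
    intros u v h; cbv beta; rewrite <- Hre, <- fr_scal by exact h; unfold zero3; vec_ring. }
  exists r, (T u0 v0). split; [exact Hr|]. intros u v h.
  rewrite (vconstant_of_zero_partials D T HD Hc HT u0 v0 u v H0 h). unfold T. vec_ring.
Qed.

Lemma net_of_forms D lam C S p a b da db nu eta : convex_dom D -> 0 < lam ->
  pendulum D C S p -> net_coeffs D C S p a b da db nu -> is_net D eta ->
  (forall u v, D u v ->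
     first_form eta u v = (a u v ^ 2, a u v * b u v * C u v, b u v ^ 2) /\
     second_form eta u v = (nu * (lam * (a u v * S u v)), 0, nu * (b u v * S u v / lam))) ->
  V_net D eta /\
  (exists F, reciprocal_parallel D eta F /\ helicoidal D (Kpsi F) /\ coherent_frame D F /\
    forall u v, D u v -> ext_d (theta1_bar F) u v = - da u v /\ ext_d (theta3_bar F) u v = db u v) /\
  (forall u v, D u v -> gauss_curvature eta u v = / (a u v * b u v) /\
    mean_curvature eta u v = nu * (lam / a u v + / (lam * b u v)) / (2 * S u v)).
Proof.
  intros Hc Hlam Hp (Sa & Sb & Ha & Hb & Hnu & Hk) Hn Hf.
  assert (Hl0 : lam <> 0) by lra.
  destruct (frame_of_forms D lam C S p a da da b db db eta nu Hl0 Hp Sa Sb Ha Hb Hnu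
    (fun u v h => proj1 (Hk u v h)) (fun u v h => proj2 (Hk u v h)) Hn Hf) as (e & He & Hae & Se).
  pose proof (fun u v h => proj1 (Hk u v h)) as Hab.
  destruct Hn as (HD & Seta & _).
  split; [exact (adapted_V_net D lam C S p a b da da db db e eta nu HD Hl0 Hp He Ha Hb Hnu Hab Hae Seta)|].
  split.
  - destruct (K_surface_exists D lam C S p e HD Hc Hlam Hp He Se) as (psi & Spsi & Hpsi).
    apply (reciprocal_of_adapted D lam C S p e HD Hc Hlam Hp He Se psi Spsi Hpsi
      a b da da db db eta Sa Sb Ha Hb
      (fun u v h => adapted_ab D a b nu Hab u v h) Seta Hae).
  - intros u v h. split.
    + exact (adapted_gauss D lam C S p a b da da db db e eta nu HD Hl0 Hp He Ha Hb Hnu Hab Hae u v h).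
    + exact (adapted_mean D lam C S p a b da da db db e eta nu HD Hl0 Hp He Ha Hb Hnu Hab Hae u v h).
Qed.

(** The value d = -1 occurs when the two second forms have opposite signs; the congruence then is a
    rotation followed by a point reflection and a translation. *)
Lemma net_unique D lam C S p a b da db nu a' b' da' db' nu' eta eta' d :
  convex_dom D -> 0 < lam -> pendulum D C S p -> is_sign d ->
  net_coeffs D C S p a b da db nu -> net_coeffs D C S p a' b' da' db' nu' ->
  (forall u v, a' u v = d * a u v) -> (forall u v, b' u v = d * b u v) ->
  is_net D eta -> is_net D eta' ->
  (forall u v, D u v ->
     first_form eta u v = (a u v ^ 2, a u v * b u v * C u v, b u v ^ 2) /\
     second_form eta u v = (nu * (lam * (a u v * S u v)), 0, nu * (b u v * S u v / lam))) ->
  (forall u v, D u v ->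
     first_form eta' u v = (a' u v ^ 2, a' u v * b' u v * C u v, b' u v ^ 2) /\
     second_form eta' u v = (nu' * (lam * (a' u v * S u v)), 0, nu' * (b' u v * S u v / lam))) ->
  congruent D eta eta'.
Proof.
  intros Hc Hlam Hp Hd (Sa & Sb & Ha & Hb & Hnu & Hk) (Sa' & Sb' & Ha' & Hb' & Hnu' & Hk')
    Ea Eb Hn Hn' Hf Hf'.
  assert (Hl0 : lam <> 0) by lra.
  destruct (frame_of_forms D lam C S p a da da b db db eta nu Hl0 Hp Sa Sb Ha Hb Hnu
    (fun u v h => proj1 (Hk u v h)) (fun u v h => proj2 (Hk u v h)) Hn Hf) as (e & He & Hae & _).
  destruct (frame_of_forms D lam C S p a' da' da' b' db' db' eta' nu' Hl0 Hp Sa' Sb' Ha' Hb' Hnu'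
    (fun u v h => proj1 (Hk' u v h)) (fun u v h => proj2 (Hk' u v h)) Hn' Hf') as (e' & He' & Hae' & _).
  destruct (Classical_Prop.classic (exists u v, D u v)) as [Hex|Hno].
  - destruct (rigid_of_moving D e e' _ _ (E3_body C S a) (E1_body b) eta eta' d
      (proj1 Hn) Hc Hex He He' Hae) as (r & t0 & Hr & Hre).
    { eapply vpartials_eq; [exact Hae'|..]; intros u v _; cbv beta; f_equal;
      unfold E3_body, E1_body; rewrite ?Ea, ?Eb; vec_ring. }
    exists (fun p => add3 t0 (scal3 d (fr r p))). split; [now apply rigid_isometry|exact Hre].
  - exists (fun p => p). split; [intros x y; reflexivity|].
    intros u v h. destruct Hno. now exists u, v.
Qed.

Lemma forms_of_has_forms eps D eta I II J JJ : is_sign eps -> has_forms eps D eta I II ->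
  (forall u v, D u v -> I u v = J u v /\ II u v = scal3 eps (JJ u v)) ->
  forall u v, D u v -> first_form eta u v = J u v /\ second_form eta u v = JJ u v.
Proof.
  intros Heps H HJ u v h. destruct (H u v h) as [H1 H2], (HJ u v h) as [J1 J2].
  split; [congruence|]. rewrite J2 in H2.
  assert (E2 : eps * eps = 1) by (destruct Heps as [-> | ->]; ring).
  assert (L : forall x, x = scal3 eps (scal3 eps x)).
  { intros x. transitivity (scal3 (eps * eps) x); [rewrite E2; vec_ring|vec_ring]. }
  rewrite (L (second_form eta u v)), H2. symmetry. apply L.
Qed.

Lemma characterization (t k : R) (Om D : dom) (eta : R -> R -> R3) (eps : R) :
  is_Omega k Om -> sub_dom D Om -> convex_dom D -> is_net D eta -> is_sign eps ->
     (has_forms eps D eta (I_pos k) (II_pos t k) ->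
        V_net D eta /\
        (exists F, reciprocal_parallel D eta F /\ helicoidal D (Kpsi F) /\
                   coherent_frame D F /\ positive_alignable D F) /\
        (forall u v, D u v ->
           gauss_curvature eta u v = K_pos k u v /\
           eps * mean_curvature eta u v = H_pos t k u v) /\
        (forall eta' eps', is_net D eta' -> is_sign eps' ->
           has_forms eps' D eta' (I_pos k) (II_pos t k) -> congruent D eta eta')) /\
     (has_forms eps D eta (I_neg k) (II_neg t k) ->
        V_net D eta /\
        (exists F, reciprocal_parallel D eta F /\ helicoidal D (Kpsi F) /\
                   coherent_frame D F /\ negative_alignable D F) /\
        (forall u v, D u v ->
           gauss_curvature eta u v = K_neg k u v /\
           eps * mean_curvature eta u v = H_neg t k u v) /\
        (forall eta' eps', is_net D eta' -> is_sign eps' ->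
           has_forms eps' D eta' (I_neg k) (II_neg t k) -> congruent D eta eta')).
Proof.
  intros HOm Hsub Hc Hn Heps. pose proof (exp_pos t) as Ht.
  destruct (is_Omega_param k Om HOm) as (_ & I & s & c & p & HI & _ & _ & Hpar).
  assert (HDI : forall u v, D u v -> I (u + v)) by (intros u v h; apply HI, Hsub, h).
  pose proof (proj1 Hpar) as Hh. pose proof (proj1 Hn) as HD.
  pose proof (pendulum_of_param D I k s c p HD Hh HDI) as Hpend.
  assert (He2 : eps * eps = 1) by (destruct Heps as [-> | ->]; ring).
  assert (Hsgn : forall eps', is_sign eps' -> is_sign (eps * eps')).
  { intros eps' H'. destruct Heps as [-> | ->], H' as [-> | ->]; [left|right|right|left]; ring. }
  split; intros Hf.
  - assert (HF : forall eps' eta', is_sign eps' -> has_forms eps' D eta' (I_pos k) (II_pos t k) ->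
      forall u v, D u v ->
        first_form eta' u v = ((- eps' / s (u + v) ^ 2) ^ 2,
          - eps' / s (u + v) ^ 2 * (- eps' / s (u + v) ^ 2) * Cos_of c u v, (- eps' / s (u + v) ^ 2) ^ 2) /\
        second_form eta' u v = (-1 * (exp t * (- eps' / s (u + v) ^ 2 * Sin_of s c u v)), 0,
          -1 * (- eps' / s (u + v) ^ 2 * Sin_of s c u v / exp t))).
    { intros eps' eta' He' Hf'. eapply forms_of_has_forms; [exact He'|exact Hf'|].
      intros u v h. exact (forms_pos I k s c p t eps' u v Hpar (HDI u v h) He'). }
    pose proof (net_coeffs_pos D I k s c p eps HD Hh HDI Heps) as Hco.
    destruct (net_of_forms D (exp t) _ _ _ _ _ _ _ _ eta Hc Ht Hpend Hco Hn (HF eps eta Heps Hf))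
      as (HV & (F & F1 & F2 & F3 & F4) & HKH).
    split; [exact HV|]. split; [|split].
    + exists F. do 3 (split; [assumption|]). intros u v h.
      destruct (F4 u v h) as [-> ->]. ring.
    + intros u v h. destruct (HKH u v h) as [-> ->].
      destruct (omega_half I k s c p u v Hpar (HDI u v h)) as (_ & E2 & E3).
      destruct (Hh _ (HDI u v h)) as (_ & _ & _ & H1 & H2 & _).
      unfold K_pos, H_pos, tan, Sin_of. rewrite E2, E3. split.
      * transitivity (s (u + v) ^ 4 / (eps * eps)); [|rewrite He2; field].
        field. repeat split; try lra; destruct Heps; lra.
      * transitivity (/ 4 * (exp t + / exp t) * (s (u + v) / c (u + v)) * (eps / eps));
        field; repeat split; try lra; destruct Heps; lra.
    + intros eta' eps' Hn' Heps' Hf'.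
      eapply (net_unique D (exp t) _ _ _ _ _ _ _ _ _ _ _ _ _ eta eta' (eps * eps') Hc Ht Hpend
        (Hsgn eps' Heps') Hco (net_coeffs_pos D I k s c p eps' HD Hh HDI Heps')); auto;
      intros u v; transitivity (- (eps * eps) * eps' / s (u + v) ^ 2);
      [rewrite He2; unfold Rdiv; ring|unfold Rdiv; ring|rewrite He2; unfold Rdiv; ring|unfold Rdiv; ring].
  - assert (HF : forall eps' eta', is_sign eps' -> has_forms eps' D eta' (I_neg k) (II_neg t k) ->
      forall u v, D u v ->
        first_form eta' u v = ((eps' / c (u + v) ^ 2) ^ 2,
          eps' / c (u + v) ^ 2 * (- eps' / c (u + v) ^ 2) * Cos_of c u v, (- eps' / c (u + v) ^ 2) ^ 2) /\
        second_form eta' u v = (1 * (exp t * (eps' / c (u + v) ^ 2 * Sin_of s c u v)), 0,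
          1 * (- eps' / c (u + v) ^ 2 * Sin_of s c u v / exp t))).
    { intros eps' eta' He' Hf'. eapply forms_of_has_forms; [exact He'|exact Hf'|].
      intros u v h. exact (forms_neg I k s c p t eps' u v Hpar (HDI u v h) He'). }
    pose proof (net_coeffs_neg D I k s c p eps HD Hh HDI Heps) as Hco.
    destruct (net_of_forms D (exp t) _ _ _ _ _ _ _ _ eta Hc Ht Hpend Hco Hn (HF eps eta Heps Hf))
      as (HV & (F & F1 & F2 & F3 & F4) & HKH).
    split; [exact HV|]. split; [|split].
    + exists F. do 3 (split; [assumption|]). intros u v h.
      destruct (F4 u v h) as [-> ->]. ring.
    + intros u v h. destruct (HKH u v h) as [-> ->].
      destruct (omega_half I k s c p u v Hpar (HDI u v h)) as (_ & E2 & E3).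
      destruct (Hh _ (HDI u v h)) as (_ & _ & _ & H1 & H2 & _).
      unfold K_neg, H_neg, cot, Sin_of. rewrite E2, E3. split.
      * transitivity (- c (u + v) ^ 4 / (eps * eps)); [|rewrite He2; field].
        field. repeat split; try lra; destruct Heps; lra.
      * transitivity (/ 4 * (exp t - / exp t) * (c (u + v) / s (u + v)) * (eps / eps));
        field; repeat split; try lra; destruct Heps; lra.
    + intros eta' eps' Hn' Heps' Hf'.
      eapply (net_unique D (exp t) _ _ _ _ _ _ _ _ _ _ _ _ _ eta eta' (eps * eps') Hc Ht Hpend
        (Hsgn eps' Heps') Hco (net_coeffs_neg D I k s c p eps' HD Hh HDI Heps')); auto.
      * intros u v. transitivity ((eps * eps) * eps' / c (u + v) ^ 2);
        [rewrite He2; unfold Rdiv; ring|unfold Rdiv; ring].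
      * intros u v. transitivity (- (eps * eps) * eps' / c (u + v) ^ 2);
        [rewrite He2; unfold Rdiv; ring|unfold Rdiv; ring].
Qed.

(** * An explicit frame of the helicoidal K-surface *)

Lemma moving_rotation D Phi fu fv : partials D Phi fu fv ->
  moving D (fun u v => ((cos (Phi u v), sin (Phi u v), 0), (- sin (Phi u v), cos (Phi u v), 0),
                        (0, 0, 1)))
    (fun u v => (0, 0, fu u v)) (fun u v => (0, 0, fv u v)).
Proof.
  intros H. split.
  - intros u v _. pose proof (sin2_cos2 (Phi u v)) as E. unfold Rsqr in E. unfold onf.
    repeat split; try (vec_simpl; lra).
    apply R3_ext; vec_simpl; lra.
  - intros q.
    assert (Pc := partials_comp D (fun _ => True) cos (fun x => - sin x) Phi _ _
      (fun x _ => is_derive_Rcos x) (fun _ _ _ => I) H).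
    assert (Ps := partials_comp D (fun _ => True) sin cos Phi _ _
      (fun x _ => is_derive_Rsin x) (fun _ _ _ => I) H).
    assert (Pns := partials_comp D (fun _ => True) (fun x => - x) (fun _ => -1)
      (fun u v => sin (Phi u v)) _ _
      (fun x _ => is_derive_eq _ _ _ _ (is_derive_opp (V:=R_NormedModule) (fun x => x) x 1 (is_derive_Rid x)) eq_refl)
      (fun _ _ _ => I) Ps).
    eapply vpartials_eq; [unfold fr; cbn [fst snd]; apply vpartials_add; [apply vpartials_add|];
      apply vpartials_cscal; apply vpartials_of;
      first [exact Pc|exact Ps|exact Pns|apply partials_const]|..];
    intros u v _; unfold fr; vec_ring.
Qed.

Lemma smooth3_pair_triad D X N r : open_dom D -> smooth3 D X -> smooth3 D N ->
  smooth3 D (fun u v => fr (pair_triad (X u v) (N u v)) r).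
Proof.
  intros HD HX HN. unfold fr, pair_triad. cbn [fst snd].
  repeat apply smooth3_add; auto; apply smooth3_cscal; auto. now apply smooth3_cross.
Qed.

Section Helicoidal_frame.
Variables (D : dom) (C S p : R -> R -> R) (lam mu k : R).
Hypothesis HD : open_dom D.
Hypothesis Hconv : convex_dom D.
Hypothesis Hpend : pendulum D C S p.
Hypothesis Hlam : 0 < lam.
Hypothesis Hmu : lam * mu = 1.
Hypothesis Hk : 0 < k.
Hypothesis HC : forall u v, D u v -> -1 < C u v.
Hypothesis Hp2 : forall u v, D u v -> p u v ^ 2 = 4 * k ^ 2 - 2 - 2 * C u v.

(** [W] is the length of the axis vector lam E1 + mu E3 - p n, constant by the energy relation, and
    [tau] is the length of its tangential part lam E1 + mu E3. *)
Let T u v := lam ^ 2 + mu ^ 2 + 2 * C u v.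
Let tau u v := sqrt (T u v).
Let W := sqrt (lam ^ 2 + mu ^ 2 + 4 * k ^ 2 - 2).

Let W_sqr : W * W = lam ^ 2 + mu ^ 2 + 4 * k ^ 2 - 2.
Proof.
  apply sqrt_sqrt. assert (0 <= (lam - mu) ^ 2) by apply pow2_ge_0.
  assert (0 < k ^ 2) by now apply pow_lt. nra.
Qed.

Let W_pos : 0 < W.
Proof.
  apply sqrt_lt_R0. assert (0 <= (lam - mu) ^ 2) by apply pow2_ge_0.
  assert (0 < k ^ 2) by now apply pow_lt. nra.
Qed.

Let T_pos u v : D u v -> 0 < T u v.
Proof.
  intros h. assert (0 <= (lam - mu) ^ 2) by apply pow2_ge_0. specialize (HC u v h).
  unfold T. nra.
Qed.

Let tau_pos u v : D u v -> 0 < tau u v.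
Proof. intros h. apply sqrt_lt_R0, T_pos, h. Qed.

Let tau_sqr u v : D u v -> tau u v * tau u v = lam * lam + mu * mu + 2 * C u v.
Proof. intros h. unfold tau. rewrite sqrt_sqrt by (apply Rlt_le, T_pos, h). unfold T. ring. Qed.

Let WW u v : D u v -> W * W = lam * lam + mu * mu + 2 * C u v + p u v * p u v.
Proof. intros h. rewrite W_sqr. specialize (Hp2 u v h). simpl in Hp2. lra. Qed.

Let SS u v : D u v -> S u v * S u v = 1 - C u v * C u v.
Proof.
  intros h. destruct (proj2 (proj2 (proj2 (proj2 Hpend))) u v h) as [_ E]. simpl in E. lra.
Qed.

Let itau_partials : partials D (fun u v => / tau u v)
  (fun u v => S u v * p u v / tau u v ^ 3) (fun u v => S u v * p u v / tau u v ^ 3).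
Proof.
  assert (PT : partials D T (fun u v => - 2 * (S u v * p u v)) (fun u v => - 2 * (S u v * p u v))).
  { eapply partials_eq; [apply partials_plus; [apply partials_const|
      apply partials_mult; [apply partials_const|exact (proj1 (proj2 Hpend))]]|..];
    intros; cbv beta; ring. }
  assert (Pt := partials_comp D (fun x => 0 < x) sqrt (fun x => / (2 * sqrt x)) T _ _
    (fun x Hx => is_derive_eq _ _ _ _ (is_derive_sqrt (fun z => z) x 1 (is_derive_Rid x) Hx)
       ltac:(unfold Rdiv; ring)) T_pos PT).
  eapply partials_eq; [apply (partials_inv D tau _ _ Pt);
    intros u v h; pose proof (tau_pos u v h); lra|..];
  intros u v h; cbv beta; fold (tau u v); pose proof (tau_pos u v h); field; lra.
Qed.

Let tau_partials : partials D tau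
  (fun u v => - (S u v * p u v) / tau u v) (fun u v => - (S u v * p u v) / tau u v).
Proof.
  eapply (partials_ext D (fun u v => T u v * / tau u v)); [exact HD| | | |
    apply partials_mult; [|exact itau_partials]].
  4:{ eapply partials_eq; [apply partials_plus; [apply partials_const|
      apply partials_mult; [apply partials_const|exact (proj1 (proj2 Hpend))]]|..];
    intros; cbv beta; reflexivity. }
  all: intros u v h; pose proof (tau_pos u v h); cbv beta;
    replace (T u v) with (tau u v * tau u v) by (apply sqrt_sqrt, Rlt_le, T_pos, h); field; lra.
Qed.

(** [A1] and [A3] are the products of E1 and E3 with the axis vector; divided by W they are axial
    coordinates. The radial direction is chosen along the projection of n perpendicular to the axis,
    so [xn] has no angular coordinate. *)
Let A1 u v := lam + mu * C u v.
Let A3 u v := lam * C u v + mu.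
(* E1, E3 and the normal in cylindrical coordinates (radial, angular, axial). *)
Let x1 u v := (A1 u v * p u v * / tau u v * / W, mu * S u v * / tau u v, A1 u v * / W).
Let x3 u v := (A3 u v * p u v * / tau u v * / W, - lam * S u v * / tau u v, A3 u v * / W).
Let xn u v := (tau u v * / W, 0, - / W * p u v).

Let d1 u v := ((- mu * (S u v * p u v) * p u v + A1 u v * S u v) * / tau u v * / W
    + A1 u v * p u v * (S u v * p u v / tau u v ^ 3) * / W,
  mu * (C u v * p u v) * / tau u v + mu * S u v * (S u v * p u v / tau u v ^ 3),
  - mu * (S u v * p u v) * / W).
Let d3 u v := ((- lam * (S u v * p u v) * p u v + A3 u v * S u v) * / tau u v * / W
    + A3 u v * p u v * (S u v * p u v / tau u v ^ 3) * / W,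
  - lam * (C u v * p u v) * / tau u v + - lam * S u v * (S u v * p u v / tau u v ^ 3),
  - lam * (S u v * p u v) * / W).
Let dn u v := (- (S u v * p u v) / tau u v * / W, 0, - / W * S u v).

Let x1_partials : vpartials D x1 d1 d1.
Proof.
  destruct Hpend as (_ & PC & PS & Pp & _).
  assert (PA : partials D A1 (fun u v => - mu * (S u v * p u v)) (fun u v => - mu * (S u v * p u v))).
  { eapply partials_eq; [apply partials_plus; [apply partials_const|apply partials_mult;
      [apply partials_const|exact PC]]|..]; intros; cbv beta; ring. }
  apply vpartials_of.
  - eapply partials_eq; [apply partials_mult; [apply partials_mult; [apply partials_mult;
      [exact PA|exact Pp]|exact itau_partials]|apply partials_const]|..]; intros; cbv beta; ring.
  - eapply partials_eq; [apply partials_mult; [apply partials_mult; [apply partials_const|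
      exact PS]|exact itau_partials]|..]; intros; cbv beta; ring.
  - eapply partials_eq; [apply partials_mult; [exact PA|apply partials_const]|..];
    intros; cbv beta; ring.
Qed.

Let x3_partials : vpartials D x3 d3 d3.
Proof.
  destruct Hpend as (_ & PC & PS & Pp & _).
  assert (PA : partials D A3 (fun u v => - lam * (S u v * p u v)) (fun u v => - lam * (S u v * p u v))).
  { eapply partials_eq; [apply partials_plus; [apply partials_mult;
      [apply partials_const|exact PC]|apply partials_const]|..]; intros; cbv beta; ring. }
  apply vpartials_of.
  - eapply partials_eq; [apply partials_mult; [apply partials_mult; [apply partials_mult;
      [exact PA|exact Pp]|exact itau_partials]|apply partials_const]|..]; intros; cbv beta; ring.
  - eapply partials_eq; [apply partials_mult; [apply partials_mult; [apply partials_const|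
      exact PS]|exact itau_partials]|..]; intros; cbv beta; ring.
  - eapply partials_eq; [apply partials_mult; [exact PA|apply partials_const]|..];
    intros; cbv beta; ring.
Qed.

Let xn_partials : vpartials D xn dn dn.
Proof.
  destruct Hpend as (_ & PC & PS & Pp & _).
  apply vpartials_of.
  - eapply partials_eq; [apply partials_mult; [exact tau_partials|apply partials_const]|..];
    intros; cbv beta; ring.
  - apply partials_const.
  - eapply partials_eq; [apply partials_mult; [apply partials_const|exact Pp]|..];
    intros; cbv beta; ring.
Qed.

(** The angle of rotation about the axis will have derivatives q' + W / 2 in u and q' - W / 2 in v.
    Their difference is the angular speed W along d/du - d/dv; the common part q' is the function of
    u + v that the prescribed angular velocities then require. *)
Let q' u v := (lam * lam - mu * mu) * W / (2 * (tau u v * tau u v)).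

Let pair_dots u v : D u v -> dot (x1 u v) (x1 u v) = 1 /\ dot (x3 u v) (x3 u v) = 1 /\
  dot (x1 u v) (x3 u v) = C u v /\ cross (x1 u v) (x3 u v) = scal3 (S u v) (xn u v).
Proof.
  intros h. pose proof (tau_pos u v h). pose proof (tau_sqr u v h) as E1. pose proof (WW u v h) as E2.
  pose proof (SS u v h) as E3. unfold x1, x3, xn, A1, A3.
  assert (tau u v <> 0) by lra. assert (W <> 0) by lra.
  (* After clearing denominators these are polynomial identities modulo the relations for tau^2,
     W^2, S^2 and lam mu. *)
  repeat split; try apply R3_ext; vec_simpl; field_simplify_eq; auto;
  ring [E1 E2 E3 Hmu].
Qed.

(** The contribution of the changing cylindrical coordinates alone; the rotation about the axis
    supplies the rest of the angular velocities. *)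
Let pair_derivs u v : D u v ->
  dot (d1 u v) (x3 u v) = S u v * p u v * (- (W / 2) + q' u v) / W /\
  dot (d1 u v) (xn u v) = mu * S u v * (W / 2 + q' u v) / W /\
  dot (d3 u v) (xn u v) = lam * S u v * (W / 2 - q' u v) / W.
Proof.
  intros h. pose proof (tau_pos u v h). pose proof (tau_sqr u v h) as E1. pose proof (WW u v h) as E2.
  pose proof (SS u v h) as E3. unfold d1, d3, x3, xn, A1, A3, q'.
  assert (tau u v <> 0) by lra. assert (W <> 0) by lra.
  repeat split; vec_simpl; field_simplify_eq; auto;
  ring [E1 E2 E3 Hmu].
Qed.
Let smooth_scalars : smooth D tau /\ smooth D (fun u v => / tau u v).
Proof.
  destruct (proj1 Hpend) as (SC & _).
  assert (ST : smooth D T).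
  { apply smooth_plus; [exact HD|now apply smooth_const|].
    apply smooth_mult; [exact HD|now apply smooth_const|exact SC]. }
  assert (St : smooth D tau) by (apply smooth_sqrt; auto; intros; now apply T_pos).
  split; [exact St|]. apply smooth_inv; auto. intros u v h. pose proof (tau_pos u v h). lra.
Qed.

Let smooth_x : smooth3 D x1 /\ smooth3 D x3 /\ smooth3 D xn.
Proof.
  destruct (proj1 Hpend) as (SC & SS' & Sp). destruct smooth_scalars as [St Si].
  assert (K : forall a, smooth D (fun _ _ => a)) by (intros; now apply smooth_const).
  assert (SA1 : smooth D A1) by (apply smooth_plus; auto; apply smooth_mult; auto).
  assert (SA3 : smooth D A3) by (apply smooth_plus; auto; apply smooth_mult; auto).
  split; [|split]; apply smooth3_of; repeat (apply smooth_mult; auto); auto.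
Qed.

Lemma K_frame_exists : exists e, K_moving D lam C S p e /\
  forall q, smooth3 D (fun u v => fr (e u v) q).
Proof.
  destruct smooth_scalars as [St Si]. destruct smooth_x as (Sx1 & Sx3 & Sxn).
  assert (Sq' : smooth D q').
  { apply (smooth_ext D (fun u v => (lam * lam - mu * mu) * W / 2 * (/ tau u v * / tau u v)));
      [exact HD| |repeat apply smooth_mult; auto; now apply smooth_const].
    intros u v h. pose proof (tau_pos u v h). unfold q'. field. lra. }
  (* The derivatives of q' in u and v agree, so q' (du + dv) is exact. *)
  destruct (poincare D q' q' HD Hconv Sq' Sq') as (q & Sq & Hq).
  { intros u v h.
    assert (exists r, partials D q' r r) as [r Hr].
    { eexists. eapply (partials_ext D (fun u v => (lam * lam - mu * mu) * W / 2 * (/ tau u v * / tau u v)));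
        [exact HD| | | |apply partials_mult; [apply partials_const|
          apply partials_mult; exact itau_partials]]; [|reflexivity|reflexivity].
      intros x y h'. pose proof (tau_pos x y h'). unfold q'. field. lra. }
    now rewrite (partials_pu _ _ _ _ _ _ Hr h), (partials_pv _ _ _ _ _ _ Hr h). }
  pose (Phi := fun u v => (W / 2 * u + - (W / 2) * v) + q u v).
  assert (HPhi : partials D Phi (fun u v => W / 2 + q' u v) (fun u v => - (W / 2) + q' u v)).
  { apply partials_plus; [|exact Hq]. intros u v _. split; auto_derive; auto; ring. }
  assert (SPhi : smooth D Phi).
  { apply (smooth_of_partials D Phi _ _ HD HPhi); apply smooth_plus; auto; now apply smooth_const. }
  pose proof (moving_rotation D Phi _ _ HPhi) as Hm.
  match type of Hm with moving _ ?e _ _ => set (e0 := e) in Hm end.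
  assert (Se0 : forall r, smooth3 D (fun u v => fr (e0 u v) r)).
  { intros r. destruct (smooth_sin_cos D Phi HD SPhi) as [Ss Sc]. unfold fr, e0. cbn [fst snd].
    repeat apply smooth3_add; auto; apply smooth3_cscal; auto; apply smooth3_of; auto;
    try (now apply smooth_const). now apply smooth_opp. }
  pose proof (moving_vpartials D e0 _ _ x1 _ _ HD Hm x1_partials) as P1.
  pose proof (moving_vpartials D e0 _ _ x3 _ _ HD Hm x3_partials) as P3.
  pose proof (moving_vpartials D e0 _ _ xn _ _ HD Hm xn_partials) as Pn.
  assert (Ho : forall u v, D u v -> onf (e0 u v)) by apply Hm.
  pose proof (proj2 (proj2 (proj2 (proj2 Hpend)))) as HSC.
  destruct (moving_of_pair D _ _ _ _ _ _ _ _ _ C S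
    (fun u v => - p u v) (fun _ _ => 0) (fun _ _ => lam)
    (fun _ _ => 0) (fun u v => mu * S u v) (fun u v => - mu * C u v)
    HD P1 P3 Pn) as [M _].
  - intros u v h. destruct (pair_dots u v h) as (Q1 & Q2 & Q3 & Q4).
    rewrite !fr_dot, fr_cross, Q4, fr_scal by auto. destruct (HSC u v h). tauto.
  - intros u v h. destruct (pair_derivs u v h) as (Q1 & Q2 & Q3).
    rewrite !fr_dot, !dot_add_l, Q1, Q2, Q3 by auto.
    pose proof (tau_pos u v h). pose proof (tau_sqr u v h) as E1. pose proof (WW u v h) as E2.
    pose proof (SS u v h) as E3. assert (tau u v <> 0) by lra. assert (W <> 0) by lra.
    unfold x1, x3, xn, A1, A3, q'.
    repeat split; vec_simpl; field_simplify_eq; auto; ring [E1 E2 E3 Hmu].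
  - intros u v h. destruct (pair_derivs u v h) as (Q1 & Q2 & Q3).
    rewrite !fr_dot, !dot_add_l, Q1, Q2, Q3 by auto.
    pose proof (tau_pos u v h). pose proof (tau_sqr u v h) as E1. pose proof (WW u v h) as E2.
    pose proof (SS u v h) as E3. assert (tau u v <> 0) by lra. assert (W <> 0) by lra.
    unfold x1, x3, xn, A1, A3, q'.
    repeat split; vec_simpl; field_simplify_eq; auto; ring [E1 E2 E3 Hmu].
  - exists (fun u v => pair_triad (fr (e0 u v) (x1 u v)) (fr (e0 u v) (xn u v))). split.
    + destruct M as [M1 M2]. split; [exact M1|]. intros r.
      assert (Emu : mu = / lam) by (apply (Rmult_eq_reg_l lam); [rewrite Hmu; field; lra|lra]).
      eapply vpartials_eq; [apply (M2 r)|..]; intros u v h; cbv beta; f_equal; f_equal;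
      apply R3_ext; vec_simpl; try reflexivity; try ring; rewrite Emu; field; lra.
    + intros r.
      assert (S1' := smooth3_fr D e0 x1 HD Se0 Sx1). assert (Sn' := smooth3_fr D e0 xn HD Se0 Sxn).
      exact (smooth3_pair_triad D _ _ r HD S1' Sn').
Qed.
End Helicoidal_frame.

(** * Existence of the nets over the explicit frame *)

Lemma adapted_exists D lam C S p a b da db nu e : open_dom D -> convex_dom D -> lam <> 0 ->
  pendulum D C S p -> net_coeffs D C S p a b da db nu -> K_moving D lam C S p e ->
  (forall q, smooth3 D (fun u v => fr (e u v) q)) ->
  exists eta, smooth3 D eta /\ adapted D C S a b e eta.
Proof.
  intros HD Hc Hl Hp (Sa & Sb & Ha & Hb & _ & Hk) He Se.
  destruct (proj1 Hp) as (SC & SS & _).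
  pose proof (proj2 (proj2 (proj2 (proj2 Hp)))) as HSC.
  eapply (vpoincare D _ _ _ _ _ _ HD Hc).
  - apply smooth3_fr; auto. apply smooth3_of; try apply smooth_mult; auto. now apply smooth_const.
  - apply smooth3_fr; auto. apply smooth3_of; auto; now apply smooth_const.
  - exact (vpartials_E3_body D lam C S p e a _ _ HD Hl Hp He Ha).
  - exact (vpartials_E1_body D lam C S p e b _ _ HD Hl He Hb).
  - intros u v h. cbv beta. f_equal. destruct (Hk u v h) as (_ & K1 & K2).
    destruct (HSC u v h) as [S0 E].
    apply R3_ext; vec_simpl; [| |reflexivity]; apply (Rmult_eq_reg_l (S u v)); try lra.
    + transitivity (da u v * S u v * C u v - a u v * p u v * S u v ^ 2); [ring|].
      replace (da u v * S u v) with (- (a u v * p u v * C u v + b u v * p u v)) by lra.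
      replace (S u v ^ 2) with (1 - C u v ^ 2) by lra.
      replace (S u v * db u v) with (- (b u v * p u v * C u v + a u v * p u v)) by lra. ring.
    + transitivity (S u v * (da u v * S u v + a u v * p u v * C u v)); [ring|].
      replace (da u v * S u v + a u v * p u v * C u v) with (- (b u v * p u v)) by lra. ring.
Qed.

(** Keeps the frame and the coefficients, because a given net is later recognized by comparing
    frames. The positive and the negative net with the same t and k lie over one and the same
    frame. *)
Lemma existence_frame (t k : R) (Om : dom) (I : R -> Prop) s c p : 0 < k ->
  (forall u v, Om u v <-> I (u + v)) -> (forall x, I x -> locally x I) ->
  (forall x y r, I x -> I y -> 0 <= r <= 1 -> I ((1 - r) * x + r * y)) ->
  omega_param k I s c p ->
  exists e, K_moving Om (exp t) (Cos_of c) (Sin_of s c) (sum_of p) e /\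
    (exists eta, is_net Om eta /\ has_forms 1 Om eta (I_pos k) (II_pos t k) /\
       adapted Om (Cos_of c) (Sin_of s c)
         (fun u v => - (1) / s (u + v) ^ 2) (fun u v => - (1) / s (u + v) ^ 2) e eta) /\
    (exists eta, is_net Om eta /\ has_forms 1 Om eta (I_neg k) (II_neg t k) /\
       adapted Om (Cos_of c) (Sin_of s c)
         (fun u v => 1 / c (u + v) ^ 2) (fun u v => - (1) / c (u + v) ^ 2) e eta).
Proof.
  intros Hk HI Hopen HcI Hpar. pose proof (exp_pos t) as Ht.
  assert (HDI : forall u v, Om u v -> I (u + v)) by (intros u v h; now apply HI).
  pose proof (proj1 Hpar) as Hh.
  assert (HD : open_dom Om).
  { intros u v h. destruct (Hopen _ (HDI u v h)) as [d Hd].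
    exists (mkposreal (d / 2) (is_pos_div_2 d)). simpl. intros x y Hx Hy. apply HI, Hd.
    change (Rabs (x + y - (u + v)) < d).
    replace (x + y - (u + v)) with ((x - u) + (y - v)) by ring.
    eapply Rle_lt_trans; [apply Rabs_triang|]. lra. }
  assert (Hc : convex_dom Om).
  { intros u v u' v' r h h' Hr. apply HI.
    replace ((1 - r) * u + r * u' + ((1 - r) * v + r * v'))
      with ((1 - r) * (u + v) + r * (u' + v')) by ring.
    apply HcI; auto. }
  pose proof (pendulum_of_param Om I k s c p HD Hh HDI) as Hpend.
  assert (Hcp : forall u v, Om u v -> -1 < Cos_of c u v).
  { intros u v h. destruct (Hh _ (HDI u v h)) as (_ & _ & _ & _ & H2 & _).
    unfold Cos_of. pose proof (pow_lt _ 2 H2). lra. }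
  assert (Hpp : forall u v, Om u v -> sum_of p u v ^ 2 = 4 * k ^ 2 - 2 - 2 * Cos_of c u v).
  { intros u v h. destruct (Hh _ (HDI u v h)) as (_ & _ & _ & _ & _ & _ & H2).
    unfold Cos_of, sum_of. rewrite H2. ring. }
  assert (Hmu : exp t * / exp t = 1) by (field; lra).
  assert (Hl0 : exp t <> 0) by lra.
  destruct (K_frame_exists Om _ _ _ (exp t) (/ exp t) k HD Hc Hpend Ht Hmu Hk Hcp Hpp) as (e & He & Se).
  assert (H1s : is_sign 1) by now left.
  assert (L : forall x, scal3 1 x = x) by (intros; vec_ring).
  exists e. split; [exact He|]. split.
  - pose proof (net_coeffs_pos Om I k s c p 1 HD Hh HDI H1s) as Hco.
    destruct (adapted_exists _ _ _ _ _ _ _ _ _ _ e HD Hc Hl0 Hpend Hco He Se) as (eta & Seta & Hae).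
    destruct Hco as (Sa & Sb & Ha & Hb & Hnu & Hq).
    pose proof (fun u v h => proj1 (Hq u v h)) as Hab.
    exists eta. split; [|split; [|exact Hae]].
    + exact (adapted_net Om (exp t) _ _ _ _ _ e eta (-1) HD Hpend He Hnu Hab Hae Seta).
    + intros u v h. destruct (forms_pos I k s c p t 1 u v Hpar (HDI u v h) H1s) as [-> ->].
      rewrite !L. split.
      * exact (adapted_first_form Om (exp t) _ _ _ _ _ e eta Hpend He Hae u v h).
      * exact (adapted_second_form Om (exp t) _ _ _ _ _ _ _ _ _ e eta (-1) HD Hl0 Hpend He Ha Hb Hnu Hab Hae u v h).
  - pose proof (net_coeffs_neg Om I k s c p 1 HD Hh HDI H1s) as Hco.
    destruct (adapted_exists _ _ _ _ _ _ _ _ _ _ e HD Hc Hl0 Hpend Hco He Se) as (eta & Seta & Hae).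
    destruct Hco as (Sa & Sb & Ha & Hb & Hnu & Hq).
    pose proof (fun u v h => proj1 (Hq u v h)) as Hab.
    exists eta. split; [|split; [|exact Hae]].
    + exact (adapted_net Om (exp t) _ _ _ _ _ e eta 1 HD Hpend He Hnu Hab Hae Seta).
    + intros u v h. destruct (forms_neg I k s c p t 1 u v Hpar (HDI u v h) H1s) as [-> ->].
      rewrite !L. split.
      * exact (adapted_first_form Om (exp t) _ _ _ _ _ e eta Hpend He Hae u v h).
      * exact (adapted_second_form Om (exp t) _ _ _ _ _ _ _ _ _ e eta 1 HD Hl0 Hpend He Ha Hb Hnu Hab Hae u v h).
Qed.

Lemma existence (t k : R) (Om : dom) : is_Omega k Om ->
  (exists eta, is_net Om eta /\ has_forms 1 Om eta (I_pos k) (II_pos t k)) /\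
  (exists eta, is_net Om eta /\ has_forms 1 Om eta (I_neg k) (II_neg t k)).
Proof.
  intros HOm.
  destruct (is_Omega_param k Om HOm) as (Hk & I & s & c & p & HI & Hopen & HcI & Hpar).
  destruct (existence_frame t k Om I s c p Hk HI Hopen HcI Hpar)
    as (e & _ & (eta1 & N1 & F1 & _) & (eta2 & N2 & F2 & _)).
  split; eauto.
Qed.

(** * K-surfaces with a tangent screw field *)

Lemma is_vderive_dot X t d z : is_vderive X t d -> is_derive (fun s => dot z (X s)) t (dot z d).
Proof.
  intros (H1 & H2 & H3).
  assert (K : forall (f : R -> R) r l, is_derive f t l -> is_derive (fun s => r * f s) t (r * l)).
  { intros f r l H. eapply is_derive_eq;
    [exact (is_derive_Rmult (fun _ => r) f t 0 l (is_derive_Rconst r t) H)|cbv beta; ring]. }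
  exact (is_derive_Rplus _ _ t _ _ (is_derive_Rplus _ _ t _ _ (K _ _ _ H1) (K _ _ _ H2)) (K _ _ _ H3)).
Qed.

Lemma derive_0_bound f l eps : is_derive f 0 l -> f 0 = 0 -> 0 < eps ->
  exists d : posreal, forall s, Rabs s < d -> Rabs (f s - l * s) <= eps * Rabs s.
Proof.
  intros H H0 He. apply is_derive_Reals in H. destruct (H eps He) as [d Hd].
  exists d. intros s Hs. destruct (Req_dec s 0) as [->|Hs0].
  - rewrite H0, Rmult_0_r, Rminus_diag, Rabs_R0. lra.
  - specialize (Hd s Hs0 Hs). rewrite Rplus_0_l, H0, Rminus_0_r in Hd.
    replace (f s - l * s) with ((f s / s - l) * s) by (field; exact Hs0).
    rewrite Rabs_mult. apply Rmult_le_compat_r; [apply Rabs_pos|lra].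
Qed.

(* Any surface point reached by a short motion along the screw stays, to first
   order, in the tangent plane. *)
Lemma small_motion (phi U V : R -> R -> R) (a b a' b' q : R) (fs us vs : R -> R) u0 v0 :
  differentiable_pt_lim phi u0 v0 0 0 -> differentiable_pt_lim U u0 v0 1 0 ->
  differentiable_pt_lim V u0 v0 0 1 ->
  phi u0 v0 = 0 -> U u0 v0 = 0 -> V u0 v0 = 0 ->
  is_derive fs 0 q -> is_derive us 0 a -> is_derive vs 0 b ->
  fs 0 = 0 -> us 0 = 0 -> vs 0 = 0 ->
  (forall delta : posreal, exists eps : posreal, forall s, Rabs s < eps ->
     exists u v, Rabs (u - u0) < delta /\ Rabs (v - v0) < delta /\
       phi u v = fs s /\ U u v = us s /\ V u v = vs s) ->
  q = 0.
Proof.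
  intros Hphi HU HV P0 U0 V0 Hf Hu Hv F0 u0' v0' Hm.
  destruct (Req_dec q 0) as [E|Hq]; [exact E|exfalso].
  pose proof (Rabs_pos_lt q Hq) as Hq0.
  (* B bounds the speed of [us] and [vs] near 0, the summand 1 being the error allowed in their
     expansions. With e as below, M <= 2 B s yields |fs s| <= |q| s / 4, which contradicts |fs s - q
     s| <= |q| s / 4 unless q = 0. *)
  set (B := Rabs a + Rabs b + 1).
  assert (HB : 1 <= B) by (unfold B; pose proof (Rabs_pos a); pose proof (Rabs_pos b); lra).
  set (e := Rabs q / (8 * B)).
  assert (He : 0 < e) by (apply Rdiv_lt_0_compat; lra).
  assert (Hh : 0 < / 2) by lra.
  destruct (Hphi (mkposreal e He)) as [d1 D1].
  destruct (HU (mkposreal _ Hh)) as [d2 D2].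
  destruct (HV (mkposreal _ Hh)) as [d3 D3]. simpl in D1, D2, D3.
  assert (Hd : 0 < Rmin d1 (Rmin d2 d3)) by (repeat apply Rmin_glb_lt; apply cond_pos).
  destruct (Hm (mkposreal _ Hd)) as [ep Hep]. simpl in Hep.
  assert (Hq2 : 0 < Rabs q / 4) by lra.
  destruct (derive_0_bound fs q (Rabs q / 4) Hf F0 Hq2) as [df Df].
  destruct (derive_0_bound us a 1 Hu u0' Rlt_0_1) as [du Du].
  destruct (derive_0_bound vs b 1 Hv v0' Rlt_0_1) as [dv Dv].
  pose (m := Rmin (Rmin ep df) (Rmin du dv)).
  assert (Hm0 : 0 < m) by (repeat apply Rmin_glb_lt; apply cond_pos).
  pose proof (Rmin_l (Rmin ep df) (Rmin du dv)). pose proof (Rmin_r (Rmin ep df) (Rmin du dv)).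
  pose proof (Rmin_l ep df). pose proof (Rmin_r ep df).
  pose proof (Rmin_l du dv). pose proof (Rmin_r du dv). fold m in H, H0.
  pose (s := m / 2). assert (Hs : 0 < s) by (unfold s; lra).
  assert (Hsa : Rabs s = s) by (apply Rabs_right; lra).
  assert (Hsm : s < m) by (unfold s; lra).
  destruct (Hep s) as (u & v & Hu1 & Hv1 & E1 & E2 & E3); [lra|].
  specialize (Df s ltac:(lra)). specialize (Du s ltac:(lra)). specialize (Dv s ltac:(lra)).
  rewrite Hsa in Df, Du, Dv.
  pose proof (Rmin_l d1 (Rmin d2 d3)). pose proof (Rmin_r d1 (Rmin d2 d3)).
  pose proof (Rmin_l d2 d3). pose proof (Rmin_r d2 d3).
  specialize (D1 u v ltac:(lra) ltac:(lra)). specialize (D2 u v ltac:(lra) ltac:(lra)).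
  specialize (D3 u v ltac:(lra) ltac:(lra)).
  rewrite P0, E1 in D1. rewrite U0, E2 in D2. rewrite V0, E3 in D3.
  set (M := Rmax (Rabs (u - u0)) (Rabs (v - v0))) in *.
  assert (K2 : Rabs (u - u0) <= Rabs (us s) + / 2 * M).
  { replace (u - u0) with (us s + - (us s - 0 - (1 * (u - u0) + 0 * (v - v0)))) by ring.
    eapply Rle_trans; [apply Rabs_triang|]. rewrite Rabs_Ropp. lra. }
  assert (K3 : Rabs (v - v0) <= Rabs (vs s) + / 2 * M).
  { replace (v - v0) with (vs s + - (vs s - 0 - (0 * (u - u0) + 1 * (v - v0)))) by ring.
    eapply Rle_trans; [apply Rabs_triang|]. rewrite Rabs_Ropp. lra. }
  assert (L2 : Rabs (us s) <= B * s).
  { replace (us s) with ((us s - a * s) + a * s) by ring.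
    eapply Rle_trans; [apply Rabs_triang|]. rewrite Rabs_mult, Hsa.
    unfold B. pose proof (Rabs_pos b). assert (0 <= Rabs b * s) by (apply Rmult_le_pos; lra). lra. }
  assert (L3 : Rabs (vs s) <= B * s).
  { replace (vs s) with ((vs s - b * s) + b * s) by ring.
    eapply Rle_trans; [apply Rabs_triang|]. rewrite Rabs_mult, Hsa.
    unfold B. pose proof (Rabs_pos a). assert (0 <= Rabs a * s) by (apply Rmult_le_pos; lra). lra. }
  (* The functions U and V determine the displacement up to an error M / 2, which is absorbed on the
     left. *)
  assert (KM : M <= 2 * B * s).
  { unfold M at 1. apply Rmax_lub; [|]; assert (M <= B * s + / 2 * M)
      by (unfold M at 1; apply Rmax_lub; lra); lra. }
  assert (KF : Rabs (fs s) <= Rabs q / 4 * s).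
  { replace (fs s) with (fs s - 0 - (0 * (u - u0) + 0 * (v - v0))) by ring.
    eapply Rle_trans; [exact D1|]. apply Rle_trans with (e * (2 * B * s)).
    - apply Rmult_le_compat_l; lra.
    - unfold e. right. field. lra. }
  assert (Rabs (q * s) <= Rabs q / 4 * s + Rabs q / 4 * s).
  { replace (q * s) with (fs s + - (fs s - q * s)) by ring.
    eapply Rle_trans; [apply Rabs_triang|]. rewrite Rabs_Ropp. lra. }
  rewrite Rabs_mult, Hsa in H9. assert (0 < Rabs q * s) by now apply Rmult_lt_0_compat. lra.
Qed.

Definition screw_field (o w : R3) (h : R) (x : R3) : R3 := add3 (cross w (sub3 x o)) (scal3 h w).

(** The infinitesimal form of [helicoidal], through which the invariance enters the recognition of a
    given net. *)
Definition screw_tangent (D : dom) (psi : R -> R -> R3) : Prop :=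
  exists o w h, dot w w = 1 /\ forall u v, D u v ->
    dot (screw_field o w h (psi u v)) (cross (du psi u v) (dv psi u v)) = 0.

Lemma differentiable_dot D psi z u v : open_dom D -> smooth3 D psi -> D u v ->
  differentiable_pt_lim (fun a b => dot z (sub3 (psi a b) (psi u v))) u v
    (dot z (du psi u v)) (dot z (dv psi u v)).
Proof.
  intros HD Hs h.
  assert (HP : partials D (fun a b => dot z (sub3 (psi a b) (psi u v)))
    (fun a b => dot z (du psi a b)) (fun a b => dot z (dv psi a b))).
  { eapply partials_eq; [apply partials_dot; [apply vpartials_const|
     apply vpartials_add; [apply smooth3_vpartials, Hs|apply vpartials_const]]|..];
    intros a b _; unfold zero3; vec_simpl; ring. }
  apply (differentiable_of_partials D _ _ _ u v HD HP h).
  apply (smooth_continuity D); [|exact h].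
  apply smooth_dot; [exact HD|now apply smooth3_const|now apply smooth3_du].
Qed.

Lemma helicoidal_tangent D psi : is_net D psi -> helicoidal D psi -> screw_tangent D psi.
Proof.
  intros (HD & Hs & Hreg) (o & w & h & Hw & Hinv). exists o, w, h. split; [exact Hw|].
  intros u v Huv. set (x0 := psi u v). set (a := du psi u v). set (b := dv psi u v).
  set (N := cross a b). assert (HN : 0 < dot N N) by (apply dot_self_pos, (Hreg u v Huv)).
  (* The basis of the tangent plane dual to (psi_u, psi_v): products with it are functions whose
     derivatives at the point are (1, 0) and (0, 1). *)
  pose (as_ := scal3 (/ dot N N) (cross b N)). pose (bs := scal3 (/ dot N N) (cross N a)).
  assert (HN' : dot N N = dot a a * dot b b - dot a b * dot a b) by (unfold N; vec_simpl; ring).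
  assert (Ea : dot as_ a = 1 /\ dot as_ b = 0).
  { unfold as_. rewrite !dot_scal_l. split.
    - replace (dot (cross b N) a) with (dot N N) by (unfold N; vec_simpl; ring). field. lra.
    - replace (dot (cross b N) b) with 0 by (vec_simpl; ring). ring. }
  assert (Eb : dot bs a = 0 /\ dot bs b = 1).
  { unfold bs. rewrite !dot_scal_l. split.
    - replace (dot (cross N a) a) with 0 by (vec_simpl; ring). ring.
    - replace (dot (cross N a) b) with (dot N N) by (unfold N; vec_simpl; ring). field. lra. }
  assert (EN : dot N a = 0 /\ dot N b = 0) by (unfold N; split; vec_simpl; ring).
  assert (S0 : screw o w h 0 x0 = x0).
  { unfold screw. rewrite cos_0, sin_0, Rmult_0_r. vec_ring. }
  assert (Hder : forall z, is_derive (fun s => dot z (sub3 (screw o w h s x0) x0)) 0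
     (dot z (screw_field o w h x0))).
  { intros z. apply is_vderive_dot.
    destruct (screw_derive o w h x0 1 0 Hw) as (H1 & H2 & H3).
    assert (Hr : forall f : R3 -> R, forall l, (forall p q, f (sub3 p q) = f p - f q) ->
      is_derive (fun t => f (screw o w h (t * 1) x0)) 0 l ->
      is_derive (fun t => f (sub3 (screw o w h t x0) x0)) 0 l).
    { intros f l Hf Hd.
      apply (is_derive_ext (fun t => f (screw o w h (t * 1) x0) + - f x0)).
      - intros t. rewrite Hf, Rmult_1_r. reflexivity.
      - rewrite <- (Rplus_0_r l). apply is_derive_Rplus; [exact Hd|apply is_derive_Rconst]. }
    rewrite Rmult_0_l, S0 in H1, H2, H3.
    split; [|split]; apply Hr; try (intros; vec_simpl; ring);
    [eapply is_derive_eq; [exact H1|]|eapply is_derive_eq; [exact H2|]|eapply is_derive_eq; [exact H3|]];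
    unfold screw_field; vec_simpl; ring. }
  rewrite dot_comm.
  apply (small_motion (fun u' v' => dot N (sub3 (psi u' v') x0))
    (fun u' v' => dot as_ (sub3 (psi u' v') x0)) (fun u' v' => dot bs (sub3 (psi u' v') x0))
    (dot as_ (screw_field o w h x0)) (dot bs (screw_field o w h x0)) 0 0
    (dot N (screw_field o w h x0))
    (fun s => dot N (sub3 (screw o w h s x0) x0)) (fun s => dot as_ (sub3 (screw o w h s x0) x0))
    (fun s => dot bs (sub3 (screw o w h s x0) x0)) u v); auto.
  - pose proof (differentiable_dot D psi N u v HD Hs Huv) as K. fold a b x0 in K.
    now rewrite (proj1 EN), (proj2 EN) in K.
  - pose proof (differentiable_dot D psi as_ u v HD Hs Huv) as K. fold a b x0 in K.
    now rewrite (proj1 Ea), (proj2 Ea) in K.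
  - pose proof (differentiable_dot D psi bs u v HD Hs Huv) as K. fold a b x0 in K.
    now rewrite (proj1 Eb), (proj2 Eb) in K.
  - fold x0. vec_simpl; ring.
  - fold x0. vec_simpl; ring.
  - fold x0. vec_simpl; ring.
  - rewrite S0. vec_simpl; ring.
  - rewrite S0. vec_simpl; ring.
  - rewrite S0. vec_simpl; ring.
  - intros delta. destruct (Hinv u v Huv delta) as (d' & ep & He). exists ep. intros s Hse.
    destruct (He s u v Hse) as (u' & v' & _ & Hu' & Hv' & E);
      [rewrite Rminus_diag, Rabs_R0; apply cond_pos..|].
    exists u', v'. fold x0 in E. rewrite E. auto.
Qed.

Lemma fr_inj e p q : onf e -> fr e p = fr e q -> p = q.
Proof. intros H E. now rewrite <- (cof_fr e p H), E, cof_fr. Qed.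

(** Equality of the mixed derivatives of the triad, written in body coordinates. By the Jacobi
    identity it says that the difference of both sides is annihilated by the cross product with
    every q; two basis vectors q already determine it. *)
Lemma maurer_cartan D e ku kv kuu kuv kvu kvv : open_dom D -> moving D e ku kv ->
  vpartials D ku kuu kuv -> vpartials D kv kvu kvv ->
  (forall q, smooth3 D (fun u v => fr (e u v) q)) ->
  forall u v, D u v -> sub3 (kuv u v) (kvu u v) = cross (ku u v) (kv u v).
Proof.
  intros HD He Hku Hkv Se u v h.
  assert (K : forall q, add3 (cross (kuv u v) q) (cross (kv u v) (cross (ku u v) q))
     = add3 (cross (kvu u v) q) (cross (ku u v) (cross (kv u v) q))).
  { intros q. apply (fr_inj (e u v)); [now apply He|].
    assert (Pu : vpartials D (fun a b => cross (ku a b) q) (fun a b => cross (kuu a b) q)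
      (fun a b => cross (kuv a b) q)).
    { eapply vpartials_eq; [apply vpartials_cross; [exact Hku|apply vpartials_const]|..];
      intros; unfold zero3; vec_ring. }
    assert (Pv : vpartials D (fun a b => cross (kv a b) q) (fun a b => cross (kvu a b) q)
      (fun a b => cross (kvv a b) q)).
    { eapply vpartials_eq; [apply vpartials_cross; [exact Hkv|apply vpartials_const]|..];
      intros; unfold zero3; vec_ring. }
    exact (vpartials_comm D _ _ _ _ _ _ _ HD (Se q) (proj2 He q)
      (moving_vpartials D e _ _ _ _ _ HD He Pu) (moving_vpartials D e _ _ _ _ _ HD He Pv) u v h). }
  pose proof (K (1, 0, 0)) as K1. pose proof (K (0, 1, 0)) as K2.
  revert K1 K2. generalize (kuv u v) (kvu u v) (ku u v) (kv u v). intros a b c d K1 K2.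
  pose proof (f_equal c2 K1) as F1. pose proof (f_equal c3 K1) as F2. pose proof (f_equal c3 K2) as F3.
  revert F1 F2 F3. clear. destruct a as [[? ?] ?], b as [[? ?] ?], c as [[? ?] ?], d as [[? ?] ?].
  unfold sub3, add3, scal3, cross, c1, c2, c3. cbn [fst snd]. intros.
  f_equal; [f_equal|]; lra.
Qed.

Lemma smooth_sign_constant D f : open_dom D -> convex_dom D -> smooth D f ->
  (forall u v, D u v -> f u v * f u v = 1) ->
  exists s, is_sign s /\ forall u v, D u v -> f u v = s.
Proof.
  intros HD Hc Hf H.
  destruct (Classical_Prop.classic (exists u v, D u v)) as [(u0 & v0 & h0)|Hn].
  2:{ exists 1. split; [now left|]. intros u v h. destruct Hn. now exists u, v. }
  exists (f u0 v0). split.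
  - specialize (H u0 v0 h0). unfold is_sign.
    assert (E : (f u0 v0 - 1) * (f u0 v0 + 1) = 0) by lra.
    apply Rmult_integral in E. lra.
  - intros u v h. apply (constant_of_zero_partials D f HD Hc); auto.
    pose proof (smooth_partials D f Hf) as Pf.
    pose proof (partials_of_const D _ _ _ 1 HD (partials_mult D _ _ _ _ _ _ Pf Pf) H) as Z.
    eapply partials_eq; [exact Pf|..]; intros a b hab; destruct (Z a b hab) as [Z1 Z2];
    specialize (H a b hab).
    + replace (pu f a b) with (pu f a b * (f a b * f a b)) by (rewrite H; ring).
      replace (pu f a b * (f a b * f a b)) with (f a b * (pu f a b * f a b + f a b * pu f a b) / 2) by field.
      rewrite Z1. field.
    + replace (pv f a b) with (pv f a b * (f a b * f a b)) by (rewrite H; ring).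
      replace (pv f a b * (f a b * f a b)) with (f a b * (pv f a b * f a b + f a b * pv f a b) / 2) by field.
      rewrite Z2. field.
Qed.

(** The lines being asymptotic, psi_uu and psi_vv have no normal part, and curvature -1 fixes that
    of psi_uv up to a constant sign [sg]. This gives the tangential angular velocities.
    Integrability then shows that A1 depends on u only and A3 on v only (the asymptotic lines form a
    Chebyshev net), and that E1 does not turn about n along the v-lines. As x = - w_u, the last
    clause is the sine-Gordon equation w_uv = A1 A3 sin w. *)
Lemma asymptotic_frame D psi A1 A3 X Y n C S :
  open_dom D -> convex_dom D -> smooth3 D psi -> smooth D A1 -> smooth D A3 ->
  smooth3 D X -> smooth3 D Y -> smooth3 D n -> smooth D C -> smooth D S ->
  vpartials D psi (fun u v => scal3 (A1 u v) (X u v)) (fun u v => scal3 (A3 u v) (Y u v)) ->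
  (forall u v, D u v -> A1 u v <> 0 /\ A3 u v <> 0) ->
  (forall u v, D u v -> dot (X u v) (X u v) = 1 /\ dot (Y u v) (Y u v) = 1 /\
    dot (X u v) (Y u v) = C u v /\ cross (X u v) (Y u v) = scal3 (S u v) (n u v) /\
    0 < S u v /\ S u v ^ 2 + C u v ^ 2 = 1) ->
  (forall u v, D u v -> dot (du (du psi) u v) (n u v) = 0 /\ dot (dv (dv psi) u v) (n u v) = 0 /\
    dot (dv (du psi) u v) (n u v) ^ 2 = (A1 u v * A3 u v * S u v) ^ 2) ->
  exists sg x, is_sign sg /\ smooth D x /\
    moving D (fun u v => pair_triad (X u v) (n u v)) (fun u v => (sg * A1 u v, 0, x u v))
      (fun u v => (- (sg * A3 u v * C u v), - (sg * A3 u v * S u v), 0)) /\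
    (forall u v, D u v -> Y u v = fr (pair_triad (X u v) (n u v)) (C u v, S u v, 0)) /\
    partials D A1 (pu A1) (fun _ _ => 0) /\ partials D A3 (fun _ _ => 0) (pv A3) /\
    partials D C (fun u v => x u v * S u v) (pv C) /\
    partials D x (pu x) (fun u v => - (A1 u v * A3 u v * S u v)).
Proof.
  intros HD Hc Hpsi S1 S3 SX SY Sn SC SS Hp H0 Hpair Hsec.
  pose (m := fun u v => dot (dv (du psi) u v) (n u v)).
  assert (Sm : smooth D m) by (apply smooth_dot; auto; apply smooth3_dv; now apply smooth3_du).
  assert (Hden : forall u v, D u v -> A1 u v * A3 u v * S u v <> 0).
  { intros u v h. destruct (H0 u v h). destruct (Hpair u v h) as (_ & _ & _ & _ & P & _).
    repeat (apply Rmult_integral_contrapositive; split); auto; lra. }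
  destruct (smooth_sign_constant D (fun u v => m u v / (A1 u v * A3 u v * S u v)) HD Hc) as (sg & Hsg & Hsgm).
  { apply smooth_div; auto. repeat apply smooth_mult; auto. }
  { intros u v h. destruct (Hsec u v h) as (_ & _ & E). fold (m u v) in E. specialize (Hden u v h).
    replace (m u v / (A1 u v * A3 u v * S u v) * (m u v / (A1 u v * A3 u v * S u v)))
      with (m u v ^ 2 / (A1 u v * A3 u v * S u v) ^ 2) by (field; destruct (H0 u v h), (Hpair u v h) as (_&_&_&_&?&_); repeat split; auto; lra).
    rewrite E. field. destruct (H0 u v h), (Hpair u v h) as (_&_&_&_&?&_); repeat split; auto; lra. }
  assert (Em : forall u v, D u v -> m u v = sg * (A1 u v * A3 u v * S u v)).
  { intros u v h. rewrite <- (Hsgm u v h). field. 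
    destruct (H0 u v h), (Hpair u v h) as (_&_&_&_&?&_); repeat split; auto; lra. }
  assert (Hsg0 : sg <> 0) by (destruct Hsg; lra).
  pose proof (smooth_partials _ _ S1) as P1. pose proof (smooth_partials _ _ S3) as P3.
  pose proof (smooth3_vpartials _ _ SX) as PX. pose proof (smooth3_vpartials _ _ SY) as PY.
  pose proof (smooth_partials _ _ SC) as PC. pose proof (smooth_partials _ _ SS) as PS.
  pose proof (vpartials_scal D _ _ _ _ _ _ P1 PX) as Q1.
  pose proof (vpartials_scal D _ _ _ _ _ _ P3 PY) as Q3.
  pose proof (fun u v => vpartials_du D psi _ _ u v Hp) as Edu.
  pose proof (fun u v => vpartials_dv D psi _ _ u v Hp) as Edv.
  assert (Pdu := vpartials_ext D _ (du psi) _ _ _ _ HD Q1 (fun u v h => eq_sym (Edu u v h))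
    (fun _ _ _ => eq_refl) (fun _ _ _ => eq_refl)).
  assert (Pdv := vpartials_ext D _ (dv psi) _ _ _ _ HD Q3 (fun u v h => eq_sym (Edv u v h))
    (fun _ _ _ => eq_refl) (fun _ _ _ => eq_refl)).
  assert (Dn : forall u v, D u v -> dot (X u v) (n u v) = 0 /\ dot (Y u v) (n u v) = 0).
  { intros u v h. destruct (Hpair u v h) as (_ & _ & _ & E & Hs & _).
    split; (apply (Rmult_eq_reg_l (S u v)); [|lra]).
    - transitivity (dot (X u v) (scal3 (S u v) (n u v))); [rewrite dot_scal_r; ring|].
      rewrite <- E. vec_simpl; ring.
    - transitivity (dot (Y u v) (scal3 (S u v) (n u v))); [rewrite dot_scal_r; ring|].
      rewrite <- E. vec_simpl; ring. }
  pose (x := fun u v => dot (du X u v) (Y u v) / S u v).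
  pose (w := fun u v => dot (dv X u v) (Y u v) / S u v).
  assert (HS0 : forall u v, D u v -> S u v <> 0)
    by (intros u v h; destruct (Hpair u v h) as (_ & _ & _ & _ & Hs & _); lra).
  assert (Sx : smooth D x) by (apply smooth_div; auto; apply smooth_dot; auto; now apply smooth3_du).
  assert (Sw : smooth D w) by (apply smooth_div; auto; apply smooth_dot; auto; now apply smooth3_dv).
  destruct (moving_of_pair D X _ _ Y _ _ n _ _ C S x (fun _ _ => 0) (fun u v => sg * A1 u v)
    w (fun u v => sg * A3 u v * S u v) (fun u v => - (sg * A3 u v * C u v)) HD PX PY
    (smooth3_vpartials _ _ Sn) Hpair) as [M ME].
  { intros u v h. specialize (HS0 u v h). destruct (H0 u v h). destruct (Dn u v h) as [N1 N2].
    destruct (Hsec u v h) as (K1 & K2 & _). specialize (Em u v h). unfold m in Em.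
    rewrite (vpartials_comm D psi (du psi) (dv psi) _ _ _ _ HD Hpsi (smooth3_vpartials _ _ Hpsi)
      (smooth3_vpartials _ _ (smooth3_du _ _ Hpsi)) (smooth3_vpartials _ _ (smooth3_dv _ _ Hpsi)) u v h) in Em.
    rewrite (vpartials_du D _ _ _ u v Pdv h), dot_add_l, !dot_scal_l, N2 in Em.
    rewrite (vpartials_du D _ _ _ u v Pdu h), dot_add_l, !dot_scal_l, N1 in K1.
    split; [unfold x; field; auto|]. split.
    - apply (Rmult_eq_reg_l (A1 u v)); auto. lra.
    - apply (Rmult_eq_reg_l (A3 u v)); auto. lra. }
  { intros u v h. specialize (HS0 u v h). destruct (H0 u v h). destruct (Dn u v h) as [N1 N2].
    destruct (Hsec u v h) as (K1 & K2 & _). specialize (Em u v h). unfold m in Em.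
    rewrite (vpartials_dv D _ _ _ u v Pdu h), dot_add_l, !dot_scal_l, N1 in Em.
    rewrite (vpartials_dv D _ _ _ u v Pdv h), dot_add_l, !dot_scal_l, N2 in K2.
    split; [unfold w; field; auto|]. split.
    - apply (Rmult_eq_reg_l (A1 u v)); auto. lra.
    - apply (Rmult_eq_reg_l (A3 u v)); auto. lra. }
  pose (e := fun u v => pair_triad (X u v) (n u v)).
  assert (Se : forall q, smooth3 D (fun u v => fr (e u v) q))
    by (intros q; now apply (smooth3_pair_triad D X n q)).
  pose proof (smooth_partials _ _ Sx) as Px. pose proof (smooth_partials _ _ Sw) as Pw.
  assert (Pku := vpartials_of D _ _ _ _ _ _ _ _ _ (partials_mult D _ _ _ _ _ _ (partials_const D sg) P1)
    (partials_const D (- 0)) Px).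
  assert (Pkv := vpartials_of D _ _ _ _ _ _ _ _ _
    (partials_mult D _ _ _ _ _ _ (partials_const D (-1)) (partials_mult D _ _ _ _ _ _ (partials_mult D _ _ _ _ _ _ (partials_const D sg) P3) PC))
    (partials_mult D _ _ _ _ _ _ (partials_const D (-1)) (partials_mult D _ _ _ _ _ _ (partials_mult D _ _ _ _ _ _ (partials_const D sg) P3) PS)) Pw).
  assert (M' : moving D e (fun u v => (sg * A1 u v, - 0, x u v))
    (fun u v => (-1 * (sg * A3 u v * C u v), -1 * (sg * A3 u v * S u v), w u v))).
  { destruct M as [M1 M2]. split; [exact M1|]. intros q. eapply vpartials_eq; [apply (M2 q)|..];
    intros u v _; cbv beta; f_equal; vec_ring. }
  pose proof (maurer_cartan D e _ _ _ _ _ _ HD M' Pku Pkv Se) as MC.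
  assert (Ppu : vpartials D (fun u v => scal3 (A1 u v) (X u v)) (fun u v =>
     fr (e u v) (add3 (pu A1 u v, 0, 0) (cross (sg * A1 u v, - 0, x u v) (A1 u v, 0, 0))))
     (fun u v => fr (e u v) (add3 (pv A1 u v, 0, 0)
       (cross (-1 * (sg * A3 u v * C u v), -1 * (sg * A3 u v * S u v), w u v) (A1 u v, 0, 0))))).
  { eapply (vpartials_ext D); [exact HD|eapply (moving_vpartials D e _ _ (fun u v => (A1 u v, 0, 0)) _ _ HD M');
      apply vpartials_of; [exact P1|apply partials_const|apply partials_const]|..];
    try (intros; reflexivity).
    intros u v _. unfold e, fr, pair_triad. vec_ring. }
  assert (Ppv : vpartials D (fun u v => scal3 (A3 u v) (Y u v)) (fun u v =>
     fr (e u v) (add3 (pu A3 u v * C u v + A3 u v * pu C u v, pu A3 u v * S u v + A3 u v * pu S u v, 0)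
       (cross (sg * A1 u v, - 0, x u v) (A3 u v * C u v, A3 u v * S u v, 0))))
     (fun u v => fr (e u v) (add3 (pv A3 u v * C u v + A3 u v * pv C u v, pv A3 u v * S u v + A3 u v * pv S u v, 0)
       (cross (-1 * (sg * A3 u v * C u v), -1 * (sg * A3 u v * S u v), w u v)
          (A3 u v * C u v, A3 u v * S u v, 0))))).
  { eapply (vpartials_ext D); [exact HD|eapply (moving_vpartials D e _ _ (fun u v => (A3 u v * C u v, A3 u v * S u v, 0)) _ _ HD M');
      apply vpartials_of; [apply partials_mult; [exact P3|exact PC]|apply partials_mult; [exact P3|exact PS]|apply partials_const]|..];
    try (intros; reflexivity).
    intros u v h. rewrite (ME u v h). fold (e u v). rewrite fr_scal. f_equal. vec_ring. }
  assert (CL := vpartials_comm D psi _ _ _ _ _ _ HD Hpsi Hp Ppu Ppv).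
  assert (PSC := partials_of_const D _ _ _ 1 HD
    (partials_plus D _ _ _ _ _ _ (partials_mult D _ _ _ _ _ _ PS PS) (partials_mult D _ _ _ _ _ _ PC PC))
    (fun u v h => ltac:(destruct (Hpair u v h) as (_ & _ & _ & _ & _ & E); lra))).
  assert (Key : forall u v, D u v -> pv A1 u v = 0 /\ w u v = 0 /\ pu A3 u v = 0 /\
     pu C u v = x u v * S u v).
  { intros u v h. specialize (HS0 u v h). destruct (H0 u v h) as [A10 A30].
    destruct (Hpair u v h) as (_ & _ & _ & _ & Hs & HSC).
    pose proof (MC u v h) as MCh. pose proof (CL u v h) as CLh. cbv beta in CLh.
    apply (fr_inj (e u v)) in CLh; [|now apply M'].
    destruct (PSC u v h) as [SCu _].
    pose proof (f_equal c1 MCh) as m1. pose proof (f_equal c2 MCh) as m2.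
    pose proof (f_equal c1 CLh) as l1. pose proof (f_equal c2 CLh) as l2.
    revert m1 m2 l1 l2. unfold sub3, add3, scal3, cross, c1, c2, c3. cbn [fst snd].
    intros m1 m2 l1 l2. clear MCh CLh.
    (* The tangential Maurer-Cartan equations and the closedness of d psi equate A1_v, respectively
       A1 times the rotation [w], with the same expressions taken with opposite signs; hence all of
       them vanish. *)
    assert (B1 : sg * (pv A1 u v + (pu A3 u v * C u v + A3 u v * pu C u v) - x u v * A3 u v * S u v) = 0) by lra.
    apply Rmult_integral in B1. destruct B1 as [B1|B1]; [lra|].
    assert (B2 : sg * ((pu A3 u v * S u v + A3 u v * pu S u v) + x u v * A3 u v * C u v + A1 u v * w u v) = 0) by lra.
    apply Rmult_integral in B2. destruct B2 as [B2|B2]; [lra|].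
    assert (V1 : pv A1 u v = 0) by lra.
    assert (V2 : w u v * A1 u v = 0) by lra.
    apply Rmult_integral in V2. destruct V2 as [V2|V2]; [|lra].
    (* C times the first equation plus S times the second eliminates x, and S^2 + C^2 = 1 leaves
       A3_u = 0. *)
    assert (V3 : pu A3 u v = 0).
    { assert (T1 : C u v * (pu A3 u v * C u v + A3 u v * pu C u v) = C u v * (x u v * A3 u v * S u v)) by (f_equal; lra).
      assert (T2 : S u v * (pu A3 u v * S u v + A3 u v * pu S u v) = S u v * (- (x u v * A3 u v * C u v))).
      { f_equal. rewrite V2 in B2. lra. }
      assert (T3 : pu A3 u v * (S u v ^ 2 + C u v ^ 2) + A3 u v * ((pu S u v * S u v + S u v * pu S u v + (pu C u v * C u v + C u v * pu C u v)) / 2) = 0) by lra.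
      rewrite HSC, SCu in T3. lra. }
    repeat split; auto.
    apply (Rmult_eq_reg_l (A3 u v)); auto. rewrite V1, V3 in B1. lra. }
  exists sg, x. split; [exact Hsg|]. split; [exact Sx|]. split; [|split; [exact ME|split; [|split; [|split]]]].
  - destruct M' as [M1 M2]. split; [exact M1|]. intros q. eapply vpartials_eq; [apply (M2 q)|..];
    intros u v h; unfold e; cbv beta; f_equal; f_equal; apply R3_ext; vec_simpl; try ring.
    apply Key, h.
  - eapply partials_eq; [exact P1|reflexivity|]. intros u v h. apply Key, h.
  - eapply partials_eq; [exact P3| |reflexivity]. intros u v h. apply Key, h.
  - eapply partials_eq; [exact PC| |reflexivity]. intros u v h. apply Key, h.
  - eapply partials_eq; [exact Px|reflexivity|]. intros u v h.
    pose proof (MC u v h) as MCh. apply (f_equal c3) in MCh.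
    assert (W0 := partials_of_const D _ _ _ 0 HD Pw (fun a b hab => proj1 (proj2 (Key a b hab))) u v h).
    revert MCh. unfold sub3, add3, scal3, cross, c1, c2, c3. cbn [fst snd]. rewrite (proj1 W0).
    intros MCh. assert (sg * sg = 1) by (destruct Hsg as [-> | ->]; ring).
    replace (A1 u v * A3 u v * S u v) with ((sg * sg) * (A1 u v * A3 u v * S u v)) by (rewrite H; ring). lra.
Qed.

Lemma moving_cof_field D e ku kv Z Zu Zv : open_dom D -> moving D e ku kv ->
  vpartials D Z Zu Zv ->
  vpartials D (fun u v => cof (e u v) (Z u v))
    (fun u v => add3 (scal3 (-1) (cross (ku u v) (cof (e u v) (Z u v)))) (cof (e u v) (Zu u v)))
    (fun u v => add3 (scal3 (-1) (cross (kv u v) (cof (e u v) (Z u v)))) (cof (e u v) (Zv u v))).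
Proof.
  intros HD [Ho H] HZ.
  assert (K : forall q, partials D (fun u v => dot (fr (e u v) q) (Z u v))
    (fun u v => dot (cross (ku u v) q) (cof (e u v) (Z u v)) + dot q (cof (e u v) (Zu u v)))
    (fun u v => dot (cross (kv u v) q) (cof (e u v) (Z u v)) + dot q (cof (e u v) (Zv u v)))).
  { intros q. eapply partials_eq; [apply partials_dot; [apply H|exact HZ]|..];
    intros u v Huv; cbv beta; now rewrite !cof_dot by auto. }
  split; [|split];
  [apply (partials_ext D _ _ _ _ _ _ HD) with (4 := K (1, 0, 0))
  |apply (partials_ext D _ _ _ _ _ _ HD) with (4 := K (0, 1, 0))
  |apply (partials_ext D _ _ _ _ _ _ HD) with (4 := K (0, 0, 1))];
  intros u v _; unfold fr, cof; vec_simpl; ring.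
Qed.

(** [K1], [K2], [K3] are the body coordinates of the screw field along psi and [W1], [W2], [g] those
    of its rotation vector. Differentiating K3 = 0 expresses W1 and W2 by K1 and K2. Differentiating
    these expressions gives A1 g = x al and A3 g S = - be C_v, which are precisely what makes the
    derivatives of al and be vanish. *)
Lemma screw_constants D psi A1 A3 C S x sg e :
  open_dom D -> convex_dom D -> (exists u v, D u v) -> smooth3 D psi ->
  smooth D C -> smooth D S -> is_sign sg ->
  (forall u v, D u v -> A1 u v <> 0 /\ A3 u v <> 0) ->
  (forall u v, D u v -> 0 < S u v /\ S u v ^ 2 + C u v ^ 2 = 1) ->
  (forall q, smooth3 D (fun u v => fr (e u v) q)) ->
  vpartials D psi (fun u v => fr (e u v) (A1 u v, 0, 0))
    (fun u v => fr (e u v) (A3 u v * C u v, A3 u v * S u v, 0)) ->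
  moving D e (fun u v => (sg * A1 u v, 0, x u v))
      (fun u v => (- (sg * A3 u v * C u v), - (sg * A3 u v * S u v), 0)) ->
  partials D C (fun u v => x u v * S u v) (pv C) ->
  screw_tangent D psi ->
  exists al be g, al <> 0 /\ be <> 0 /\ smooth D g /\
    partials D g (fun u v => A1 u v * be * S u v) (fun u v => - (A3 u v * al * S u v)) /\
    forall u v, D u v -> A1 u v * g u v = x u v * al /\ A3 u v * g u v * S u v = - (be * pv C u v).
Proof.
  intros HD Hc (u0 & v0 & h0) Spsi SC SS Hsg H0 HSC Se Hp He PC (o & w & hh & Hw & Htan).
  pose (kap := fun u v => screw_field o w hh (psi u v)).
  assert (Pk : vpartials D kap (fun u v => cross w (fr (e u v) (A1 u v, 0, 0)))
    (fun u v => cross w (fr (e u v) (A3 u v * C u v, A3 u v * S u v, 0)))).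
  { eapply vpartials_eq; [apply vpartials_add; [apply vpartials_cross; [apply vpartials_const|
      apply vpartials_add; [exact Hp|apply vpartials_const]]|apply vpartials_const]|..];
    intros u v _; cbv beta; unfold zero3; vec_ring. }
  assert (Ho : forall u v, D u v -> onf (e u v)) by apply He.
  assert (PK := moving_cof_field D e _ _ _ _ _ HD He Pk).
  assert (PW := moving_cof_field D e _ _ _ _ _ HD He (vpartials_const D w)).
  pose (W1 := fun u v => c1 (cof (e u v) w)). pose (W2 := fun u v => c2 (cof (e u v) w)).
  pose (g := fun u v => c3 (cof (e u v) w)).
  pose (K1 := fun u v => c1 (cof (e u v) (kap u v))). pose (K2 := fun u v => c2 (cof (e u v) (kap u v))).
  pose (K3 := fun u v => c3 (cof (e u v) (kap u v))).
  assert (HK3 : forall u v, D u v -> K3 u v = 0).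
  { intros u v h. pose proof (Htan u v h) as E.
    rewrite (vpartials_du D _ _ _ u v Hp h), (vpartials_dv D _ _ _ u v Hp h), fr_cross in E by auto.
    fold (kap u v) in E. rewrite dot_comm, cof_dot in E by auto.
    destruct (H0 u v h). destruct (HSC u v h).
    apply (Rmult_eq_reg_l (A1 u v * A3 u v * S u v)).
    2:{ repeat (apply Rmult_integral_contrapositive; split); auto; lra. }
    rewrite Rmult_0_r, <- E. unfold K3. vec_simpl. ring. }
  assert (Ecx : forall u v q, D u v -> cof (e u v) (cross w (fr (e u v) q)) = cross (cof (e u v) w) q).
  { intros u v q h. rewrite <- (fr_cof (e u v) w) at 1 by auto.
    rewrite fr_cross, cof_fr by auto. reflexivity. }
  destruct PW as (PW1 & PW2 & PW3). destruct PK as (PK1 & PK2 & PK3). 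
  assert (QW1 : partials D W1 (fun u v => x u v * W2 u v) (fun u v => sg * A3 u v * S u v * g u v)).
  { eapply partials_eq; [exact PW1|..]; intros u v h; unfold W2, g; unfold cof; unfold zero3; vec_simpl; ring. }
  assert (QW2 : partials D W2 (fun u v => - x u v * W1 u v + sg * A1 u v * g u v)
    (fun u v => - (sg * A3 u v * C u v * g u v))).
  { eapply partials_eq; [exact PW2|..]; intros u v h; unfold W1, g; unfold cof; unfold zero3; vec_simpl; ring. }
  assert (QW3 : partials D g (fun u v => - (sg * A1 u v * W2 u v))
    (fun u v => sg * A3 u v * (C u v * W2 u v - S u v * W1 u v))).
  { eapply partials_eq; [exact PW3|..]; intros u v h; unfold W1, W2; unfold cof; unfold zero3; vec_simpl; ring. }
  assert (QK1 : partials D K1 (fun u v => x u v * K2 u v) (fun u v => sg * A3 u v * S u v * K3 u v - g u v * A3 u v * S u v)).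
  { eapply partials_eq; [exact PK1|..]; intros u v h; cbv beta; rewrite Ecx by exact h;
    unfold K2, K3, g; generalize (cof (e u v) w) (cof (e u v) (kap u v)); intros; vec_simpl; ring. }
  assert (QK2 : partials D K2 (fun u v => - x u v * K1 u v + sg * A1 u v * K3 u v + g u v * A1 u v)
    (fun u v => - (sg * A3 u v * C u v * K3 u v) + g u v * A3 u v * C u v)).
  { eapply partials_eq; [exact PK2|..]; intros u v h; cbv beta; rewrite Ecx by exact h;
    unfold K1, K3, g; generalize (cof (e u v) w) (cof (e u v) (kap u v)); intros; vec_simpl; ring. }
  assert (QK3 : partials D K3 (fun u v => - (sg * A1 u v * K2 u v) - W2 u v * A1 u v)
    (fun u v => sg * A3 u v * (C u v * K2 u v - S u v * K1 u v)
       + (W1 u v * S u v - W2 u v * C u v) * A3 u v)).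
  { eapply partials_eq; [exact PK3|..]; intros u v h; cbv beta; rewrite Ecx by exact h;
    unfold K1, K2, W1, W2; generalize (cof (e u v) w) (cof (e u v) (kap u v)); intros; vec_simpl; ring. }
  assert (Hsg2 : sg * sg = 1) by (destruct Hsg as [-> | ->]; ring).
  pose proof (partials_of_const D _ _ _ 0 HD QK3 HK3) as Z3.
  assert (EW2 : forall u v, D u v -> W2 u v = - sg * K2 u v).
  { intros u v h. destruct (H0 u v h). destruct (Z3 u v h) as [Z _].
    apply (Rmult_eq_reg_l (A1 u v)); auto. lra. }
  assert (EW1 : forall u v, D u v -> W1 u v * S u v = sg * (S u v * K1 u v - 2 * C u v * K2 u v)).
  { intros u v h. destruct (H0 u v h). destruct (Z3 u v h) as [_ Z]. rewrite EW2 in Z by exact h.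
    apply (Rmult_eq_reg_l (A3 u v)); auto. lra. }
  assert (HS0 : forall u v, D u v -> S u v <> 0) by (intros u v h; destruct (HSC u v h); lra).
  (* The components of the screw field on E1 and E3, from K1 = al + be C and K2 = be S. *)
  pose (be := fun u v => K2 u v / S u v). pose (al := fun u v => K1 u v - C u v * be u v).
  assert (EK2 : forall u v, D u v -> K2 u v = be u v * S u v)
    by (intros u v h; unfold be; field; auto).
  assert (EK1 : forall u v, K1 u v = al u v + be u v * C u v) by (intros; unfold al; ring).
  assert (EW1' : forall u v, D u v -> W1 u v = sg * (al u v - be u v * C u v)).
  { intros u v h. apply (Rmult_eq_reg_l (S u v)); auto. rewrite Rmult_comm, EW1, EK1, EK2 by exact h. ring. }
  pose proof (smooth_partials _ _ SS) as PS.
  assert (PSC := partials_of_const D _ _ _ 1 HD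
    (partials_plus D _ _ _ _ _ _ (partials_mult D _ _ _ _ _ _ PS PS) (partials_mult D _ _ _ _ _ _ PC PC))
    (fun u v h => ltac:(destruct (HSC u v h) as (_ & E); lra))).
  assert (ESu : forall u v, D u v -> pu S u v = - (x u v * C u v)).
  { intros u v h. destruct (PSC u v h) as [E _]. apply (Rmult_eq_reg_l (S u v)); auto. lra. }
  assert (ESv : forall u v, D u v -> S u v * pv S u v = - (C u v * pv C u v)).
  { intros u v h. destruct (PSC u v h) as [_ E]. lra. }
  assert (R1 : forall u v, D u v -> A1 u v * g u v = x u v * al u v).
  { intros u v h. 
    pose proof (partials_unique D _ _ _ _ _ _ HD QW2 (partials_mult D _ _ _ _ _ _ (partials_const D (- sg)) QK2) EW2 u v h) as [E _].
    cbv beta in E. rewrite HK3, EW1', EK1 in E by exact h.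
    assert (E2 : sg * (A1 u v * g u v - x u v * al u v) = 0) by lra.
    apply Rmult_integral in E2. destruct E2 as [E2|E2]; [destruct Hsg; lra|lra]. }
  assert (R2 : forall u v, D u v -> A3 u v * g u v * S u v = - (be u v * pv C u v)).
  { intros u v h.
    pose proof (partials_unique D _ _ _ _ _ _ HD (partials_mult D _ _ _ _ _ _ QW1 PS)
      (partials_mult D _ _ _ _ _ _ (partials_const D sg) (partials_minus D _ _ _ _ _ _
        (partials_mult D _ _ _ _ _ _ PS QK1)
        (partials_mult D _ _ _ _ _ _ (partials_mult D _ _ _ _ _ _ (partials_const D 2) PC) QK2)))
      EW1 u v h) as [_ E].
    cbv beta in E. rewrite HK3, EW1', EK1, EK2 in E by exact h.
    assert (E2 : sg * (A3 u v * g u v * (S u v ^ 2 + C u v ^ 2) - be u v * C u v * pv S u v + pv C u v * be u v * S u v) = 0) by lra.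
    apply Rmult_integral in E2. destruct E2 as [E2|E2]; [destruct Hsg; lra|].
    destruct (HSC u v h) as [_ E1]. rewrite E1 in E2.
    assert (E3 : S u v * (A3 u v * g u v * 1 - be u v * C u v * pv S u v + pv C u v * be u v * S u v) = 0) by (rewrite E2; ring).
    replace (S u v * (A3 u v * g u v * 1 - be u v * C u v * pv S u v + pv C u v * be u v * S u v))
      with (A3 u v * g u v * S u v - be u v * C u v * (S u v * pv S u v) + pv C u v * be u v * S u v ^ 2) in E3 by ring.
    rewrite (ESv u v h) in E3. replace (S u v ^ 2) with (1 - C u v ^ 2) in E3 by lra. lra. }
  assert (PiS := partials_inv D S _ _ PS HS0).
  assert (Pbe : partials D be (fun _ _ => 0) (fun _ _ => 0)).
  { eapply partials_eq; [exact (partials_mult D _ _ _ _ _ _ QK2 PiS)|..]; intros u v h; cbv beta;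
    rewrite HK3, ?EK1, EK2 by exact h; specialize (HS0 u v h).
    - rewrite ESu by exact h. replace (g u v * A1 u v) with (x u v * al u v) by (rewrite <- R1 by exact h; ring).
      field. exact HS0.
    - apply (Rmult_eq_reg_l (S u v ^ 2)); [|now apply pow_nonzero].
      transitivity (C u v * (A3 u v * g u v * S u v) - be u v * (S u v * pv S u v)); [field; exact HS0|].
      rewrite R2, ESv by exact h. ring. }
  assert (Pal : partials D al (fun _ _ => 0) (fun _ _ => 0)).
  { eapply partials_eq; [exact (partials_minus D _ _ _ _ _ _ QK1 (partials_mult D _ _ _ _ _ _ PC Pbe))|..];
    intros u v h; cbv beta; rewrite ?HK3, ?EK2 by exact h.
    - ring.
    - replace (g u v * A3 u v * S u v) with (- (be u v * pv C u v)) by (rewrite <- R2 by exact h; ring). ring. }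
  assert (Cbe : forall u v, D u v -> be u v = be u0 v0)
    by (intros u v h; apply (constant_of_zero_partials D be HD Hc Pbe); assumption).
  assert (Cal : forall u v, D u v -> al u v = al u0 v0)
    by (intros u v h; apply (constant_of_zero_partials D al HD Hc Pal); assumption).
  assert (Pg : partials D g (fun u v => A1 u v * be u0 v0 * S u v) (fun u v => - (A3 u v * al u0 v0 * S u v))).
  { eapply partials_eq; [exact QW3|..]; intros u v h; cbv beta; rewrite EW2, ?EW1', EK2, Cbe, ?Cal by exact h.
    - transitivity ((sg * sg) * (A1 u v * be u0 v0 * S u v)); [ring|rewrite Hsg2; ring].
    - transitivity (- ((sg * sg) * (A3 u v * al u0 v0 * S u v))); [ring|rewrite Hsg2; ring]. }
  assert (Hnz : ~ (al u0 v0 = 0 /\ be u0 v0 = 0)).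
  { intros [Ea Eb]. assert (Eg : g u0 v0 = 0).
    { destruct (H0 u0 v0 h0). apply (Rmult_eq_reg_l (A1 u0 v0)); auto. rewrite R1, Ea by exact h0. ring. }
    assert (E1 : W1 u0 v0 = 0) by (rewrite EW1', Ea, Eb by exact h0; ring).
    assert (E2 : W2 u0 v0 = 0) by (rewrite EW2, EK2, Eb by exact h0; ring).
    assert (E : dot w w = 0).
    { rewrite <- (fr_cof (e u0 v0) w) by auto. rewrite fr_dot by auto.
      unfold dot. fold (W1 u0 v0) (W2 u0 v0) (g u0 v0). rewrite E1, E2, Eg. ring. }
    lra. }
  exists (al u0 v0), (be u0 v0), g. split; [|split; [|split; [|split]]].
  (* If al = 0 then g vanishes identically, so its u-derivative A1 be S does, and be = 0 as well;
     but al = be = 0 makes the rotation vector zero at the base point. The argument for be is the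
     same with the v-derivative. *)
  - intros Ea. assert (Eg : forall u v, D u v -> g u v = 0).
    { intros u v h. destruct (H0 u v h). apply (Rmult_eq_reg_l (A1 u v)); auto.
      rewrite R1, Cal, Ea by exact h. ring. }
    destruct (partials_of_const D _ _ _ 0 HD Pg Eg u0 v0 h0) as [E _].
    apply Hnz. split; [exact Ea|]. destruct (H0 u0 v0 h0). specialize (HS0 u0 v0 h0).
    apply Rmult_integral in E. destruct E as [E|E]; [|contradiction].
    apply Rmult_integral in E. destruct E as [E|E]; [contradiction|exact E].
  - intros Eb. assert (Eg : forall u v, D u v -> g u v = 0).
    { intros u v h. destruct (H0 u v h). specialize (HS0 u v h).
      apply (Rmult_eq_reg_l (A3 u v * S u v)); [|now apply Rmult_integral_contrapositive].
      transitivity (A3 u v * g u v * S u v); [ring|]. rewrite R2, Cbe, Eb by exact h. ring. }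
    destruct (partials_of_const D _ _ _ 0 HD Pg Eg u0 v0 h0) as [_ E].
    apply Hnz. split; [|exact Eb]. destruct (H0 u0 v0 h0). specialize (HS0 u0 v0 h0).
    assert (E' : A3 u0 v0 * al u0 v0 * S u0 v0 = 0) by lra.
    apply Rmult_integral in E'. destruct E' as [E'|E']; [|contradiction].
    apply Rmult_integral in E'. destruct E' as [E'|E']; [contradiction|exact E'].
  - apply (smooth_ext D (fun u v => dot (fr (e u v) (0, 0, 1)) w)); [exact HD| |].
    + intros u v _. unfold g, cof, fr. vec_simpl. ring.
    + apply smooth_dot; auto. now apply smooth3_const.
  - exact Pg.
  - intros u v h. rewrite R1, R2, Cal, Cbe by exact h. auto.
Qed.

Set Implicit Arguments.

(* psi_u = A1 E1 and psi_v = A3 E3 with E3 = C E1 + S (n x E1);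
   eta_u = mu E3 and eta_v = nu E1. The screw field along psi is al E1 + be E3,
   and g is the normal component of its rotation vector. *)
Record local_structure (D : dom) (eta : R -> R -> R3) (F : K_data)
    (A1 A3 C S x g mu nu : R -> R -> R) (e : R -> R -> triad) (sg al be : R) : Prop := {
  ls_smooth1 : smooth D A1;
  ls_smooth3 : smooth D A3;
  ls_smoothC : smooth D C;
  ls_smoothS : smooth D S;
  ls_smoothg : smooth D g;
  ls_smoothmu : smooth D mu;
  ls_smoothnu : smooth D nu;
  ls_sign : is_sign sg;
  ls_nonzero : forall u v, D u v -> A1 u v <> 0 /\ A3 u v <> 0;
  ls_SC : forall u v, D u v -> 0 < S u v /\ S u v ^ 2 + C u v ^ 2 = 1;
  ls_moving : moving D e (fun u v => (sg * A1 u v, 0, x u v))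
      (fun u v => (- (sg * A3 u v * C u v), - (sg * A3 u v * S u v), 0));
  ls_A1 : partials D A1 (pu A1) (fun _ _ => 0);
  ls_A3 : partials D A3 (fun _ _ => 0) (pv A3);
  ls_C : partials D C (fun u v => x u v * S u v) (pv C);
  ls_al : al <> 0;
  ls_be : be <> 0;
  ls_g : partials D g (fun u v => A1 u v * be * S u v) (fun u v => - (A3 u v * al * S u v));
  ls_rel : forall u v, D u v ->
    A1 u v * g u v = x u v * al /\ A3 u v * g u v * S u v = - (be * pv C u v);
  ls_eta : vpartials D eta (fun u v => fr (e u v) (mu u v * C u v, mu u v * S u v, 0))
      (fun u v => fr (e u v) (nu u v, 0, 0));
  ls_munu : forall u v, D u v -> mu u v <> 0 /\ nu u v <> 0;
  ls_ext : forall u v, D u v -> ext_d (theta1_bar F) u v = - pv mu u v /\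
      ext_d (theta3_bar F) u v = pu nu u v;
  ls_angle : forall u v, D u v -> frame_angle F u v = acos (C u v) /\
      KE1 F u v = (/ A1 u v, 0) /\ KE3 F u v = (0, / A3 u v)
}.

Unset Implicit Arguments.

Lemma unit_normal_sign psi u v n r : r <> 0 -> dot n n = 1 ->
  cross (du psi u v) (dv psi u v) = scal3 r n ->
  exists th, th * th = 1 /\ unit_normal psi u v = scal3 th n.
Proof.
  intros Hr Hn E. destruct (Rlt_dec 0 r) as [h|h].
  - exists 1. split; [ring|]. rewrite (unit_normal_eq psi u v n r h Hn E). vec_ring.
  - exists (-1). split; [ring|]. apply (unit_normal_eq psi u v _ (- r)); [lra| |].
    + rewrite dot_scal_l, dot_scal_r, Hn. ring.
    + rewrite E. vec_ring.
Qed.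

(** A1 and A3 may be negative, since E1 and E3 may point against the coordinate directions. The
    normal n is the direction of E1 x E3, which makes S positive; [sg] is the sign of psi_uv . n
    relative to A1 A3. *)
Lemma local_structure_exists D eta F : convex_dom D -> (exists u v, D u v) ->
  smooth3 D eta -> reciprocal_parallel D eta F -> screw_tangent D (Kpsi F) ->
  exists A1 A3 C S x g mu nu e sg al be,
    local_structure D eta F A1 A3 C S x g mu nu e sg al be.
Proof.
  intros Hc Hex Seta (((HD & Spsi & Hreg) & HK) & _ & (SE1 & SE3 & U1 & U3 & As1 & As3 & Hdet) & Sb & Sc & Hrec) Htan.
  set (psi := Kpsi F) in *.
  pose (e1 := fun u v => fst (KE1 F u v)). pose (e3 := fun u v => snd (KE3 F u v)).
  assert (HE1 : forall u v, D u v -> KE1 F u v = (e1 u v, 0)).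
  { intros u v h. destruct (Hrec u v h) as (E & _). unfold e1. rewrite <- E. now destruct (KE1 F u v). }
  assert (HE3 : forall u v, D u v -> KE3 F u v = (0, e3 u v)).
  { intros u v h. destruct (Hrec u v h) as (_ & E & _). unfold e3. rewrite <- E. now destruct (KE3 F u v). }
  assert (Hdet' : forall u v, D u v -> det2 (KE1 F u v) (KE3 F u v) = e1 u v * e3 u v).
  { intros u v h. rewrite HE1, HE3 by exact h. unfold det2. cbn [fst snd]. ring. }
  assert (He0 : forall u v, D u v -> e1 u v <> 0 /\ e3 u v <> 0).
  { intros u v h. pose proof (Hdet u v h) as K. rewrite Hdet' in K by exact h.
    split; intros E; apply K; rewrite E; ring. }
  assert (Se1 : smooth D e1) by apply SE1. assert (Se3 : smooth D e3) by apply SE3.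
  pose (A1 := fun u v => / e1 u v). pose (A3 := fun u v => / e3 u v).
  assert (S1 : smooth D A1) by (apply smooth_inv; auto; intros; now apply He0).
  assert (S3 : smooth D A3) by (apply smooth_inv; auto; intros; now apply He0).
  assert (HA0 : forall u v, D u v -> A1 u v <> 0 /\ A3 u v <> 0).
  { intros u v h. destruct (He0 u v h). split; now apply Rinv_neq_0_compat. }
  pose (X := fun u v => scal3 (e1 u v) (du psi u v)). pose (Y := fun u v => scal3 (e3 u v) (dv psi u v)).
  assert (SX : smooth3 D X) by (apply smooth3_scal; auto; now apply smooth3_du).
  assert (SY : smooth3 D Y) by (apply smooth3_scal; auto; now apply smooth3_dv).
  assert (PushX : forall u v, D u v -> push psi u v (KE1 F u v) = X u v).
  { intros u v h. rewrite HE1 by exact h. unfold push, X. cbn [fst snd]. vec_ring. }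
  assert (PushY : forall u v, D u v -> push psi u v (KE3 F u v) = Y u v).
  { intros u v h. rewrite HE3 by exact h. unfold push, Y. cbn [fst snd]. vec_ring. }
  assert (UX : forall u v, D u v -> dot (X u v) (X u v) = 1).
  { intros u v h. pose proof (U1 u v h) as K. rewrite PushX in K by exact h. unfold norm3 in K.
    rewrite <- (sqrt_sqrt (dot (X u v) (X u v))), K; [ring|]. unfold dot; nra. }
  assert (UY : forall u v, D u v -> dot (Y u v) (Y u v) = 1).
  { intros u v h. pose proof (U3 u v h) as K. rewrite PushY in K by exact h. unfold norm3 in K.
    rewrite <- (sqrt_sqrt (dot (Y u v) (Y u v))), K; [ring|]. unfold dot; nra. }
  pose (C := fun u v => dot (X u v) (Y u v)).
  assert (SC : smooth D C) by now apply smooth_dot.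
  assert (HC : forall u v, D u v -> 0 < 1 - C u v * C u v).
  { intros u v h. destruct (He0 u v h).
    replace (1 - C u v * C u v) with (dot (cross (X u v) (Y u v)) (cross (X u v) (Y u v))).
    - apply dot_self_pos. intros E. apply (Hreg u v h).
      transitivity (scal3 (A1 u v * A3 u v) (cross (X u v) (Y u v))).
      + unfold A1, A3, X, Y. apply R3_ext; vec_simpl; field; auto.
      + rewrite E. unfold zero3. vec_ring.
    - transitivity (dot (X u v) (X u v) * dot (Y u v) (Y u v) - C u v * C u v);
      [unfold C; vec_simpl; ring|]. rewrite UX, UY by exact h. ring. }
  pose (S := fun u v => sqrt (1 - C u v * C u v)).
  assert (SS : smooth D S).
  { apply smooth_sqrt; auto. apply smooth_minus; auto; [now apply smooth_const|now apply smooth_mult]. }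
  assert (HSC : forall u v, D u v -> 0 < S u v /\ S u v ^ 2 + C u v ^ 2 = 1).
  { intros u v h. specialize (HC u v h). split; [now apply sqrt_lt_R0|].
    replace (S u v ^ 2) with (S u v * S u v) by ring. unfold S. rewrite sqrt_sqrt by lra. ring. }
  assert (HS0 : forall u v, D u v -> S u v <> 0) by (intros u v h; destruct (HSC u v h); lra).
  pose (n := fun u v => scal3 (/ S u v) (cross (X u v) (Y u v))).
  assert (Sn : smooth3 D n).
  { apply smooth3_scal; auto; [now apply smooth_inv|now apply smooth3_cross]. }
  assert (Hpair : forall u v, D u v -> dot (X u v) (X u v) = 1 /\ dot (Y u v) (Y u v) = 1 /\
    dot (X u v) (Y u v) = C u v /\ cross (X u v) (Y u v) = scal3 (S u v) (n u v) /\
    0 < S u v /\ S u v ^ 2 + C u v ^ 2 = 1).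
  { intros u v h. destruct (HSC u v h). repeat split; auto.
    unfold n. apply R3_ext; vec_simpl; field; auto. }
  assert (Hnn : forall u v, D u v -> dot (n u v) (n u v) = 1).
  { intros u v h. destruct (Hpair u v h) as (P1 & P2 & P3 & P4 & P5 & P6).
    apply (Rmult_eq_reg_l (S u v ^ 2)); [|apply pow_nonzero; auto].
    transitivity (dot (scal3 (S u v) (n u v)) (scal3 (S u v) (n u v)));
      [rewrite dot_scal_l, dot_scal_r; ring|]. rewrite <- P4.
    transitivity (dot (X u v) (X u v) * dot (Y u v) (Y u v) - dot (X u v) (Y u v) ^ 2);
    [vec_simpl; ring|]. rewrite P1, P2, P3. lra. }
  assert (Edu : forall u v, D u v -> du psi u v = scal3 (A1 u v) (X u v)).
  { intros u v h. destruct (He0 u v h). unfold A1, X. apply R3_ext; vec_simpl; field; auto. }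
  assert (Edv : forall u v, D u v -> dv psi u v = scal3 (A3 u v) (Y u v)).
  { intros u v h. destruct (He0 u v h). unfold A3, Y. apply R3_ext; vec_simpl; field; auto. }
  assert (Hp : vpartials D psi (fun u v => scal3 (A1 u v) (X u v)) (fun u v => scal3 (A3 u v) (Y u v))).
  { eapply vpartials_eq; [apply (smooth3_vpartials _ _ Spsi)|exact Edu|exact Edv]. }
  assert (Hcr : forall u v, D u v -> cross (du psi u v) (dv psi u v) = scal3 (A1 u v * A3 u v * S u v) (n u v)).
  { intros u v h. rewrite Edu, Edv by exact h. destruct (Hpair u v h) as (_ & _ & _ & E & _).
    transitivity (scal3 (A1 u v * A3 u v) (cross (X u v) (Y u v))); [vec_ring|]. rewrite E. vec_ring. }
  assert (Hr0 : forall u v, D u v -> A1 u v * A3 u v * S u v <> 0).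
  { intros u v h. destruct (HA0 u v h). repeat (apply Rmult_integral_contrapositive; split); auto. }
  assert (Hsec : forall u v, D u v -> dot (du (du psi) u v) (n u v) = 0 /\
    dot (dv (dv psi) u v) (n u v) = 0 /\
    dot (dv (du psi) u v) (n u v) ^ 2 = (A1 u v * A3 u v * S u v) ^ 2).
  { intros u v h. destruct (He0 u v h) as [E10 E30].
    (* The normal entering the second form is n or - n. The sign [th] drops out, because the two
       asymptotic conditions are homogeneous and the curvature involves only its square. *)
    destruct (unit_normal_sign psi u v _ _ (Hr0 u v h) (Hnn u v h) (Hcr u v h)) as (th & Hth & Hun).
    assert (th <> 0) by (intros E; rewrite E in Hth; lra).
    pose proof (As1 u v h) as L. pose proof (As3 u v h) as N. pose proof (HK u v h) as G.
    rewrite HE1 in L by exact h. rewrite HE3 in N by exact h.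
    unfold qeval, second_form in L, N. unfold gauss_curvature, second_form, first_form in G.
    rewrite Hun in L, N, G. rewrite !dot_scal_r in L, N, G. cbn [fst snd] in L, N.
    assert (L0 : dot (du (du psi) u v) (n u v) = 0).
    { apply (Rmult_eq_reg_l (th * (e1 u v * e1 u v))); [lra|].
      repeat (apply Rmult_integral_contrapositive; split); auto. }
    assert (N0 : dot (dv (dv psi) u v) (n u v) = 0).
    { apply (Rmult_eq_reg_l (th * (e3 u v * e3 u v))); [lra|].
      repeat (apply Rmult_integral_contrapositive; split); auto. }
    split; [exact L0|]. split; [exact N0|].
    rewrite L0, N0 in G.
    assert (EG : dot (du psi u v) (du psi u v) * dot (dv psi u v) (dv psi u v) - dot (du psi u v) (dv psi u v) ^ 2
      = (A1 u v * A3 u v * S u v) ^ 2).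
    { transitivity (dot (cross (du psi u v) (dv psi u v)) (cross (du psi u v) (dv psi u v)));
      [vec_simpl; ring|]. rewrite Hcr, dot_scal_l, dot_scal_r, Hnn by exact h. ring. }
    rewrite EG in G. pose proof (pow_nonzero _ 2 (Hr0 u v h)) as Q.
    assert (G' : (th * 0 * (th * 0) - (th * dot (dv (du psi) u v) (n u v)) ^ 2)
       = - (A1 u v * A3 u v * S u v) ^ 2).
    { rewrite <- (Rmult_1_l (- _)). 
      replace (1 * - (A1 u v * A3 u v * S u v) ^ 2) with (-1 * (A1 u v * A3 u v * S u v) ^ 2) by ring.
      rewrite <- G. field. repeat split; try (now apply HA0); auto. }
    replace (dot (dv (du psi) u v) (n u v) ^ 2) with ((th * th) * dot (dv (du psi) u v) (n u v) ^ 2)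
      by (rewrite Hth; ring). lra. }
  destruct (asymptotic_frame D psi A1 A3 X Y n C S HD Hc Spsi S1 S3 SX SY Sn SC SS Hp HA0 Hpair Hsec)
    as (sg & x & Hsg & Sx & He & HY & P1 & P3 & PC & Px).
  set (e := fun u v => pair_triad (X u v) (n u v)) in *.
  assert (HX : forall u v, D u v -> X u v = fr (e u v) (1, 0, 0))
    by (intros; unfold e, fr, pair_triad; vec_ring).
  assert (Se : forall q, smooth3 D (fun u v => fr (e u v) q))
    by (intros q; now apply (smooth3_pair_triad D X n q)).
  destruct (screw_constants D psi A1 A3 C S x sg e HD Hc Hex Spsi SC SS Hsg HA0 HSC Se) as
    (al & be & g & Hal & Hbe & Sg & Pg & Hrel).
  { eapply vpartials_eq; [exact Hp|..]; intros u v h; cbv beta.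
    - rewrite HX, fr_scal by exact h. f_equal. vec_ring.
    - rewrite HY by exact h. fold (e u v). rewrite fr_scal. f_equal. vec_ring. }
  { exact He. }
  { exact PC. }
  { exact Htan. }
  pose (mu := fun u v => Kc F u v * A1 u v). pose (nu := fun u v => Kb F u v * A3 u v).
  assert (Smu : smooth D mu) by now apply smooth_mult.
  assert (Snu : smooth D nu) by now apply smooth_mult.
  exists A1, A3, C, S, x, g, mu, nu, e, sg, al, be.
  constructor; auto.
  - eapply vpartials_eq; [apply (smooth3_vpartials _ _ Seta)|..]; intros u v h;
    destruct (Hrec u v h) as (_ & _ & _ & _ & E); destruct (He0 u v h).
    + specialize (E (1, 0)). fold psi in E. rewrite PushX, PushY in E by exact h.
      transitivity (push eta u v (1, 0)); [unfold push; cbn [fst snd]; vec_ring|].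
      rewrite E. transitivity (scal3 (mu u v) (Y u v)).
      * unfold pair2, theta1, theta3. cbv zeta. rewrite Hdet', HE1, HE3 by exact h. cbn [fst snd].
        unfold mu, A1. apply R3_ext; vec_simpl; field; auto.
      * rewrite HY by exact h. fold (e u v). rewrite fr_scal. f_equal. vec_ring.
    + specialize (E (0, 1)). fold psi in E. rewrite PushX, PushY in E by exact h.
      transitivity (push eta u v (0, 1)); [unfold push; cbn [fst snd]; vec_ring|].
      rewrite E. transitivity (scal3 (nu u v) (X u v)).
      * unfold pair2, theta1, theta3. cbv zeta. rewrite Hdet', HE1, HE3 by exact h. cbn [fst snd].
        unfold nu, A3. apply R3_ext; vec_simpl; field; auto.
      * rewrite HX, fr_scal by exact h. f_equal. vec_ring.
  - intros u v h. destruct (HA0 u v h). destruct (Hrec u v h) as (_ & _ & B1 & B2 & _).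
    split; now apply Rmult_integral_contrapositive.
  - intros u v h.
    assert (Z : partials D (fun _ _ => 0) (fun _ _ => 0) (fun _ _ => 0)) by apply partials_const.
    split.
    + unfold ext_d. rewrite (partials_pu D _ (fun _ _ => 0) (fun _ _ => 0)), (partials_pv D _ (pu mu) (pv mu)); try exact h.
      * ring.
      * apply (partials_ext D mu _ (pu mu) (pv mu)); auto; [|now apply smooth_partials].
        intros a b hab. destruct (He0 a b hab). unfold theta1_bar, scale_form, theta1. cbv zeta.
        rewrite Hdet', HE3 by exact hab. cbn [fst snd]. unfold mu, A1. field; auto.
      * apply (partials_ext D (fun _ _ => 0) _ (fun _ _ => 0) (fun _ _ => 0)); auto.
        intros a b hab. destruct (He0 a b hab). unfold theta1_bar, scale_form, theta1. cbv zeta.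
        rewrite Hdet', HE3 by exact hab. cbn [fst snd]. field; auto.
    + unfold ext_d. rewrite (partials_pv D _ (fun _ _ => 0) (fun _ _ => 0)), (partials_pu D _ (pu nu) (pv nu)); try exact h.
      * ring.
      * apply (partials_ext D nu _ (pu nu) (pv nu)); auto; [|now apply smooth_partials].
        intros a b hab. destruct (He0 a b hab). unfold theta3_bar, scale_form, theta3. cbv zeta.
        rewrite Hdet', HE1 by exact hab. cbn [fst snd]. unfold nu, A3. field; auto.
      * apply (partials_ext D (fun _ _ => 0) _ (fun _ _ => 0) (fun _ _ => 0)); auto.
        intros a b hab. destruct (He0 a b hab). unfold theta3_bar, scale_form, theta3. cbv zeta.
        rewrite Hdet', HE1 by exact hab. cbn [fst snd]. field; auto.
  - intros u v h. destruct (He0 u v h).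
    split; [|unfold A1, A3; rewrite !Rinv_inv, HE1, HE3 by exact h; auto].
    unfold frame_angle. fold psi. rewrite PushX, PushY by exact h. reflexivity.
Qed.

(** * Recognizing the families *)

(* As [pendulum], in coordinates (u, v) with u + v replaced by a function Z
   with Z_u = f1 and Z_v = g1. *)
Definition pendulum_along (D : dom) (C S P f1 g1 : R -> R -> R) : Prop :=
  partials D C (fun u v => - (S u v * P u v * f1 u v)) (fun u v => - (S u v * P u v * g1 u v)) /\
  partials D P (fun u v => S u v * f1 u v) (fun u v => S u v * g1 u v) /\
  forall u v, D u v -> 0 < S u v /\ S u v ^ 2 + C u v ^ 2 = 1.

(** The energy P^2 + 2 C is constant, and it exceeds -2 because S > 0 keeps C above -1; so the
    modulus k is positive. *)
Lemma pendulum_energy D C S P f1 g1 : open_dom D -> convex_dom D ->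
  pendulum_along D C S P f1 g1 -> (exists u v, D u v) ->
  exists k, 0 < k /\ forall u v, D u v -> P u v ^ 2 = 4 * k ^ 2 - 2 - 2 * C u v.
Proof.
  intros HD Hc (PC & PP & HSC) (u0 & v0 & h0).
  pose (En := fun u v => P u v * P u v + 2 * C u v).
  assert (PE : partials D En (fun _ _ => 0) (fun _ _ => 0)).
  { eapply partials_eq; [apply partials_plus; [apply partials_mult; exact PP|
      apply partials_mult; [apply partials_const|exact PC]]|..]; intros; cbv beta; ring. }
  assert (HE : 0 < (En u0 v0 + 2) / 4).
  { destruct (HSC u0 v0 h0) as [Hs HS]. unfold En. nra. }
  exists (sqrt ((En u0 v0 + 2) / 4)). split; [now apply sqrt_lt_R0|].
  intros u v h. replace (sqrt ((En u0 v0 + 2) / 4) ^ 2) with ((En u0 v0 + 2) / 4).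
  - rewrite (constant_of_zero_partials D En HD Hc PE u0 v0 u v h0 h). unfold En. field.
  - simpl. rewrite Rmult_1_r, sqrt_sqrt by lra. reflexivity.
Qed.

Lemma half_cos_sin D C S P f1 g1 : pendulum_along D C S P f1 g1 ->
  exists s c, partials D s (fun u v => c u v * P u v * f1 u v / 2) (fun u v => c u v * P u v * g1 u v / 2) /\
    partials D c (fun u v => - (s u v * P u v * f1 u v) / 2) (fun u v => - (s u v * P u v * g1 u v) / 2) /\
    forall u v, D u v -> 0 < s u v /\ 0 < c u v /\ s u v ^ 2 + c u v ^ 2 = 1 /\
      C u v = 2 * c u v ^ 2 - 1 /\ S u v = 2 * s u v * c u v.
Proof.
  intros (PC & PP & HSC).
  assert (Hin : forall u v, D u v -> -1 < C u v < 1).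
  { intros u v h. destruct (HSC u v h) as [H1 H2]. assert (0 < S u v ^ 2) by now apply pow_lt. nra. }
  pose (c := fun u v => sqrt ((1 + C u v) / 2)). pose (s := fun u v => sqrt ((1 - C u v) / 2)).
  assert (K : forall u v, D u v -> 0 < s u v /\ 0 < c u v /\ s u v ^ 2 + c u v ^ 2 = 1 /\
      C u v = 2 * c u v ^ 2 - 1 /\ S u v = 2 * s u v * c u v).
  { intros u v h. destruct (Hin u v h). destruct (HSC u v h) as [H1 H2].
    assert (E1 : s u v * s u v = (1 - C u v) / 2) by (apply sqrt_sqrt; lra).
    assert (E2 : c u v * c u v = (1 + C u v) / 2) by (apply sqrt_sqrt; lra).
    assert (0 < s u v) by (apply sqrt_lt_R0; lra). assert (0 < c u v) by (apply sqrt_lt_R0; lra).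
    repeat split; auto; try (simpl; lra).
    apply Rsqr_inj; [lra| |unfold Rsqr].
    - apply Rmult_le_pos; lra.
    - transitivity (4 * (s u v * s u v) * (c u v * c u v)); [rewrite E1, E2; field_simplify; simpl in *; lra|ring]. }
  exists s, c. split; [|split; [|exact K]].
  - assert (Hd : forall x, x < 1 ->
      is_derive (fun x => sqrt ((1 - x) / 2)) x (- / (4 * sqrt ((1 - x) / 2)))).
    { intros x Hx. eapply is_derive_eq; [apply (is_derive_sqrt (fun z => (1 - z) / 2) x (- / 2))|].
      - auto_derive; [exact I|field].
      - lra.
      - field. assert (0 < sqrt ((1 - x) / 2)) by (apply sqrt_lt_R0; lra). lra. }
    eapply partials_eq; [exact (partials_comp D (fun x => x < 1) _ _ C _ _ Hd
      (fun u v h => proj2 (Hin u v h)) PC)|..];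
    intros u v h; cbv beta; fold (s u v); destruct (K u v h) as (K1 & K2 & _ & _ & ->); field; lra.
  - assert (Hd : forall x, -1 < x ->
      is_derive (fun x => sqrt ((1 + x) / 2)) x (/ (4 * sqrt ((1 + x) / 2)))).
    { intros x Hx. eapply is_derive_eq; [apply (is_derive_sqrt (fun z => (1 + z) / 2) x (/ 2))|].
      - auto_derive; [exact I|field].
      - lra.
      - field. assert (0 < sqrt ((1 + x) / 2)) by (apply sqrt_lt_R0; lra). lra. }
    eapply partials_eq; [exact (partials_comp D (fun x => -1 < x) _ _ C _ _ Hd
      (fun u v h => proj1 (Hin u v h)) PC)|..];
    intros u v h; cbv beta; fold (c u v); destruct (K u v h) as (K1 & K2 & _ & _ & ->); field; lra.
Qed.

(** For k >= 1 the pendulum never comes to rest: P^2 = 4 k^2 - 2 - 2 C is positive since C < 1. The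
    sign of P at one point therefore holds on the whole domain. *)
Lemma pendulum_negative D C S P f1 g1 k : open_dom D -> convex_dom D -> smooth D P ->
  pendulum_along D C S P f1 g1 -> 1 <= k ->
  (forall u v, D u v -> P u v ^ 2 = 4 * k ^ 2 - 2 - 2 * C u v) ->
  (exists u v, D u v /\ P u v <= 0) -> forall u v, D u v -> P u v < 0.
Proof.
  intros HD Hc SP (PC & PP & HSC) Hk HE (u0 & v0 & h0 & Hp0).
  assert (H0 : forall u v, D u v -> 0 < P u v ^ 2).
  { intros u v h. rewrite HE by exact h. destruct (HSC u v h) as [H1 H2].
    assert (0 < S u v ^ 2) by now apply pow_lt. assert (1 <= k ^ 2) by nra.
    assert (C u v < 1) by nra. lra. }
  assert (Hs : forall u v, D u v -> sqrt (P u v ^ 2) <> 0).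
  { intros u v h. pose proof (sqrt_lt_R0 _ (H0 u v h)). lra. }
  destruct (smooth_sign_constant D (fun u v => P u v / sqrt (P u v ^ 2)) HD Hc) as (sg & Hsg & E).
  { apply smooth_div; auto. apply smooth_sqrt; auto.
    apply (smooth_ext D (fun u v => P u v * P u v)); [exact HD|intros; ring|now apply smooth_mult]. }
  { intros u v h. specialize (Hs u v h).
    replace (P u v / sqrt (P u v ^ 2) * (P u v / sqrt (P u v ^ 2)))
      with (P u v ^ 2 / (sqrt (P u v ^ 2) * sqrt (P u v ^ 2))) by (field; exact Hs).
    rewrite sqrt_sqrt by (apply Rlt_le; auto). field. intros E. specialize (H0 u v h). rewrite E in H0. lra. }
  assert (E' : forall u v, D u v -> P u v = sg * sqrt (P u v ^ 2)).
  { intros u v h. rewrite <- (E u v h). field. auto. }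
  assert (sg = -1) as ->.
  { destruct Hsg as [-> | ->]; [|reflexivity]. exfalso. pose proof (E' u0 v0 h0).
    pose proof (sqrt_lt_R0 _ (H0 u0 v0 h0)). lra. }
  intros u v h. rewrite (E' u v h). pose proof (sqrt_lt_R0 _ (H0 u v h)). lra.
Qed.

(** Inverts the parametrizations of the model. The angle is recovered from cos phi = - P / (2 k) for
    k < 1 and from cos chi = s for k > 1, and Z is its elliptic integral, divided by k in the second
    case; for k = 1, sinh Z = c / s. The domains with m = 0, and x > 0 for k = 1, are sufficient. *)
Lemma pendulum_match D C S P f1 g1 : open_dom D -> convex_dom D -> smooth D P ->
  pendulum_along D C S P f1 g1 -> (exists u v, D u v /\ P u v <= 0) ->
  exists k Om Z, is_Omega k Om /\ partials D Z f1 g1 /\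
    forall u v, D u v -> k ^ 2 * jacobi_sn (Z u v) k ^ 2 = (1 + C u v) / 2 /\
      forall a b, a + b = Z u v -> Om a b.
Proof.
  intros HD Hc SP Hpen Hex.
  assert (Hex' : exists u v, D u v) by (destruct Hex as (u & v & h & _); eauto).
  destruct (pendulum_energy D C S P f1 g1 HD Hc Hpen Hex') as (k & Hk & HE).
  destruct (half_cos_sin D C S P f1 g1 Hpen) as (s & c & Ps & Pc & Hsc).
  pose proof (proj1 (proj2 Hpen)) as PP.
  assert (HE' : forall u v, D u v -> P u v ^ 2 = 4 * (k ^ 2 - c u v ^ 2)).
  { intros u v h. rewrite HE by exact h. destruct (Hsc u v h) as (_ & _ & _ & -> & _). ring. }
  destruct (Rlt_le_dec k 1) as [Hk1|Hk1].
  - assert (Hkk : 0 < k < 1) by lra.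
    pose (phi := fun u v => acos (- P u v / (2 * k))).
    assert (HP1 : forall u v, D u v -> 1 - (- P u v / (2 * k)) ^ 2 = (c u v / k) ^ 2).
    { intros u v h. replace ((- P u v / (2 * k)) ^ 2) with (P u v ^ 2 / (4 * k ^ 2)) by (field; lra).
      rewrite HE' by exact h. field. lra. }
    assert (Hin : forall u v, D u v -> -1 < - P u v / (2 * k) < 1).
    { intros u v h. destruct (Hsc u v h) as (_ & Hc0 & _).
      assert (0 < (c u v / k) ^ 2) by (apply pow_lt, Rdiv_lt_0_compat; lra).
      rewrite <- HP1 in H by exact h. nra. }
    assert (Hsin : forall u v, D u v -> sin (phi u v) = c u v / k).
    { intros u v h. destruct (Hsc u v h) as (_ & Hc0 & _). unfold phi. rewrite sin_acos by (specialize (Hin u v h); lra).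
      unfold Rsqr. replace (1 - - P u v / (2 * k) * (- P u v / (2 * k))) with (1 - (- P u v / (2 * k)) ^ 2) by ring.
      rewrite HP1 by exact h. apply sqrt_pow2. apply Rlt_le, Rdiv_lt_0_compat; lra. }
    assert (HDl : forall u v, D u v -> ell_D k (phi u v) = s u v).
    { intros u v h. destruct (Hsc u v h) as (Hs0 & Hc0 & E & _). unfold ell_D. rewrite Hsin by exact h.
      replace (1 - k ^ 2 * (c u v / k) ^ 2) with (s u v ^ 2); [apply sqrt_pow2; lra|].
      transitivity (1 - c u v ^ 2); [lra|field; lra]. }
    assert (Pq : partials D (fun u v => - P u v / (2 * k)) (fun u v => - S u v * f1 u v / (2 * k))
      (fun u v => - S u v * g1 u v / (2 * k))).
    { eapply (partials_ext D (fun u v => (- / (2 * k)) * P u v)); [exact HD| | | |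
        apply partials_mult; [apply partials_const|exact PP]]; intros; cbv beta; field; lra. }
    assert (Pphi : partials D phi (fun u v => s u v * f1 u v) (fun u v => s u v * g1 u v)).
    { eapply partials_eq; [exact (partials_comp D (fun x => -1 < x < 1) acos _ _ _ _ is_derive_acos Hin Pq)|..];
      intros u v h; cbv beta; rewrite HP1 by exact h; destruct (Hsc u v h) as (Hs0 & Hc0 & _ & _ & ES);
      rewrite sqrt_pow2 by (apply Rlt_le, Rdiv_lt_0_compat; lra); rewrite ES; field; lra. }
    assert (Hphi : forall u v, D u v -> 0 < phi u v < PI).
    { intros u v h. pose proof (acos_bound (- P u v / (2 * k))) as B. fold (phi u v) in B.
      assert (Hs : 0 < sin (phi u v)).
      { rewrite Hsin by exact h. destruct (Hsc u v h) as (_ & Hc0 & _). apply Rdiv_lt_0_compat; lra. }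
      destruct (Req_dec (phi u v) 0) as [E|E]; [rewrite E, sin_0 in Hs; lra|].
      destruct (Req_dec (phi u v) PI) as [E'|E']; [rewrite E', sin_PI in Hs; lra|]. lra. }
    exists k, (fun a b => 2 * IZR 0 * ellK k < a + b < 2 * (IZR 0 + 1) * ellK k), (fun u v => ell_F k (phi u v)).
    split; [left; split; [exact Hkk|]; exists 0%Z; intros; tauto|]. split.
    + eapply partials_eq; [exact (partials_comp D (fun _ => True) (ell_F k) _ phi _ _
        (fun x _ => is_derive_ell_F k x Hkk) (fun _ _ _ => I) Pphi)|..];
      intros u v h; cbv beta; rewrite HDl by exact h; destruct (Hsc u v h); field; lra.
    + intros u v h. destruct (Hphi u v h) as [B1 B2]. split.
      * rewrite jacobi_sn_le, amplitude_ell_F, Hsin by (auto; lra).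
        destruct (Hsc u v h) as (_ & _ & _ & -> & _). field. lra.
      * intros a b ->. pose proof (ell_F_lt k 0 _ Hkk B1) as L1. pose proof (ell_F_lt k _ PI Hkk B2) as L2.
        rewrite ell_F_0 in L1. rewrite ell_F_PI in L2 by exact Hkk. lra.
  - pose proof (pendulum_negative D C S P f1 g1 k HD Hc SP Hpen Hk1 HE Hex) as Hneg.
    destruct (Req_dec k 1) as [-> | Hk2].
    + assert (EP : forall u v, D u v -> P u v = - 2 * s u v).
      { intros u v h. specialize (Hneg u v h). specialize (HE' u v h).
        destruct (Hsc u v h) as (Hs0 & _ & E & _). nra. }
      pose (y := fun u v => c u v * / s u v).
      assert (Hs0 : forall u v, D u v -> s u v <> 0) by (intros u v h; destruct (Hsc u v h); lra).
      assert (Py : partials D y (fun u v => f1 u v * / s u v) (fun u v => g1 u v * / s u v)).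
      { eapply partials_eq; [exact (partials_mult D _ _ _ _ _ _ Pc (partials_inv D _ _ _ Ps Hs0))|..];
        intros u v h; cbv beta; rewrite EP by exact h; destruct (Hsc u v h) as (H1 & H2 & E & _).
        - apply (Rmult_eq_reg_l (s u v)); [|lra].
          transitivity (f1 u v * (s u v ^ 2 + c u v ^ 2)); [field; lra|]. rewrite E. field. lra.
        - apply (Rmult_eq_reg_l (s u v)); [|lra].
          transitivity (g1 u v * (s u v ^ 2 + c u v ^ 2)); [field; lra|]. rewrite E. field. lra. }
      assert (Hy : forall u v, D u v -> y u v ^ 2 + 1 = (/ s u v) ^ 2).
      { intros u v h. destruct (Hsc u v h) as (H1 & H2 & E & _). unfold y.
        transitivity ((s u v ^ 2 + c u v ^ 2) / s u v ^ 2); [field; lra|]. rewrite E. field. lra. }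
      exists 1, (fun a b => 0 < a + b), (fun u v => arcsinh (y u v)).
      split; [right; left; split; [reflexivity|left; intros; tauto]|]. split.
      * eapply partials_eq; [exact (partials_comp D (fun _ => True) arcsinh (fun x => / sqrt (x ^ 2 + 1)) y _ _
          (fun x _ => proj2 (is_derive_Reals _ _ _) (derivable_pt_lim_arcsinh x)) (fun _ _ _ => I) Py)|..];
        intros u v h; cbv beta; rewrite Hy by exact h; destruct (Hsc u v h) as (H1 & _);
        rewrite sqrt_pow2 by (apply Rlt_le, Rinv_0_lt_compat, H1); field; lra.
      * intros u v h. destruct (Hsc u v h) as (H1 & H2 & E & EC & _). split.
        -- rewrite jacobi_sn_1. pose proof (cosh_sq (arcsinh (y u v))) as Q. rewrite sinh_arcsinh in Q.
           rewrite sinh_arcsinh. pose proof (cosh_pos (arcsinh (y u v))).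
           replace ((y u v / cosh (arcsinh (y u v))) ^ 2) with (y u v ^ 2 / cosh (arcsinh (y u v)) ^ 2)
             by (field; lra).
           rewrite Q, EC. replace (1 + y u v ^ 2) with ((/ s u v) ^ 2) by (rewrite <- Hy by exact h; ring).
           unfold y. field. lra.
        -- intros a b ->. rewrite <- arcsinh_0. apply arcsinh_lt. unfold y.
           apply Rmult_lt_0_compat; [exact H2|apply Rinv_0_lt_compat, H1].
    + assert (Hk3 : 1 < k) by lra. set (h' := / k).
      assert (Hh : 0 < h' < 1).
      { unfold h'. split; [apply Rinv_0_lt_compat; lra|]. rewrite <- Rinv_1.
        apply Rinv_lt_contravar; lra. }
      pose (chi := fun u v => acos (s u v)).
      assert (Hsin : forall u v, D u v -> sin (chi u v) = c u v).
      { intros u v h. destruct (Hsc u v h) as (H1 & H2 & E & _). unfold chi. rewrite sin_acos by nra.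
        unfold Rsqr. replace (1 - s u v * s u v) with (c u v ^ 2) by lra. apply sqrt_pow2. lra. }
      assert (Hdl : forall u v, D u v -> ell_D h' (chi u v) = - P u v / (2 * k)).
      { intros u v h. unfold ell_D. rewrite Hsin by exact h.
        replace (1 - h' ^ 2 * c u v ^ 2) with ((- P u v / (2 * k)) ^ 2).
        - apply sqrt_pow2. apply Rlt_le, Rdiv_lt_0_compat; [specialize (Hneg u v h)|]; lra.
        - replace ((- P u v / (2 * k)) ^ 2) with (P u v ^ 2 / (4 * k ^ 2)) by (field; lra).
          rewrite HE' by exact h. unfold h'. field. lra. }
      assert (Pchi : partials D chi (fun u v => - P u v * f1 u v / 2) (fun u v => - P u v * g1 u v / 2)).
      { eapply partials_eq; [exact (partials_comp D (fun x => -1 < x < 1) acos _ s _ _ is_derive_acos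
          (fun u v h => ltac:(destruct (Hsc u v h) as (H1 & H2 & E & _); nra)) Ps)|..];
        intros u v h; cbv beta; destruct (Hsc u v h) as (H1 & H2 & E & _);
        replace (1 - s u v ^ 2) with (c u v ^ 2) by lra; rewrite sqrt_pow2 by lra; field; lra. }
      assert (Hchi : forall u v, D u v -> 0 < chi u v < PI / 2).
      { intros u v h. destruct (Hsc u v h) as (H1 & H2 & E & _).
        pose proof (acos_bound (s u v)) as B. fold (chi u v) in B.
        assert (cos (chi u v) = s u v) by (apply cos_acos; nra).
        split.
        - destruct (Req_dec (chi u v) 0) as [E0|]; [|lra]. pose proof (Hsin u v h) as K. rewrite E0, sin_0 in K. lra.
        - destruct (Rlt_dec (chi u v) (PI / 2)) as [|Hge]; [assumption|].
          assert (cos (chi u v) <= 0) by (apply cos_le_0; lra). lra. }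
      exists k, (fun a b => 2 * IZR 0 * (/ k * ellK (/ k)) < a + b < (2 * IZR 0 + 1) * (/ k * ellK (/ k))),
        (fun u v => h' * ell_F h' (chi u v)).
      split; [right; right; split; [exact Hk3|]; exists 0%Z; intros; tauto|]. split.
      * eapply partials_eq; [apply partials_mult; [apply partials_const|
          exact (partials_comp D (fun _ => True) (ell_F h') _ chi _ _
           (fun x _ => is_derive_ell_F h' x Hh) (fun _ _ _ => I) Pchi)]|..];
        intros u v h; cbv beta; rewrite Hdl by exact h; specialize (Hneg u v h); unfold h'; field; lra.
      * intros u v h. destruct (Hchi u v h) as [B1 B2]. split.
        -- rewrite jacobi_sn_gt by exact Hk3. fold h'.
           replace (k * (h' * ell_F h' (chi u v))) with (ell_F h' (chi u v)) by (unfold h'; field; lra).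
           rewrite amplitude_ell_F, Hsin by assumption. destruct (Hsc u v h) as (_ & _ & _ & -> & _).
           unfold h'. field. lra.
        -- intros a b ->. fold h'. pose proof (ell_F_lt h' 0 _ Hh B1) as L1.
           pose proof (ell_F_lt h' _ (PI / 2) Hh B2) as L2. rewrite ell_F_0 in L1.
           change (ell_F h' (PI / 2)) with (ellK h') in L2.
           assert (0 < h' * ell_F h' (chi u v)) by (apply Rmult_lt_0_compat; lra).
           assert (h' * ell_F h' (chi u v) < h' * ellK h') by (apply Rmult_lt_compat_l; lra). lra.
Qed.

(** * Box reparametrizations *)

Lemma partials_box_comp (D Om : dom) h hu hv (f g : R -> R) f1 g1 :
  partials Om h hu hv -> (forall u v, D u v -> Om (f u) (g v)) ->
  (forall u v, D u v -> is_derive f u (f1 u v) /\ is_derive g v (g1 u v)) ->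
  partials D (fun u v => h (f u) (g v)) (fun u v => f1 u v * hu (f u) (g v))
    (fun u v => g1 u v * hv (f u) (g v)).
Proof.
  intros H Hin Hfg u v Huv. destruct (H _ _ (Hin u v Huv)) as [H1 H2].
  destruct (Hfg u v Huv) as [F G]. split.
  - rewrite Rmult_comm. exact (is_derive_Rcomp (fun z => h z (g v)) f u _ _ H1 F).
  - rewrite Rmult_comm. exact (is_derive_Rcomp (fun z => h (f u) z) g v _ _ H2 G).
Qed.

Lemma vpartials_box_comp (D Om : dom) X Xu Xv (f g : R -> R) f1 g1 :
  vpartials Om X Xu Xv -> (forall u v, D u v -> Om (f u) (g v)) ->
  (forall u v, D u v -> is_derive f u (f1 u v) /\ is_derive g v (g1 u v)) ->
  vpartials D (fun u v => X (f u) (g v)) (fun u v => scal3 (f1 u v) (Xu (f u) (g v)))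
    (fun u v => scal3 (g1 u v) (Xv (f u) (g v))).
Proof.
  intros (H1 & H2 & H3) Hin Hfg.
  split; [|split];
  [exact (partials_box_comp D Om _ _ _ f g f1 g1 H1 Hin Hfg)
  |exact (partials_box_comp D Om _ _ _ f g f1 g1 H2 Hin Hfg)
  |exact (partials_box_comp D Om _ _ _ f g f1 g1 H3 Hin Hfg)].
Qed.

Lemma moving_box_comp (D Om : dom) e ku kv (f g : R -> R) f1 g1 :
  moving Om e ku kv -> (forall u v, D u v -> Om (f u) (g v)) ->
  (forall u v, D u v -> is_derive f u (f1 u v) /\ is_derive g v (g1 u v)) ->
  moving D (fun u v => e (f u) (g v)) (fun u v => scal3 (f1 u v) (ku (f u) (g v)))
    (fun u v => scal3 (g1 u v) (kv (f u) (g v))).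
Proof.
  intros [H1 H2] Hin Hfg. split; [intros u v h; apply H1, Hin, h|]. intros q.
  eapply vpartials_eq; [exact (vpartials_box_comp D Om _ _ _ f g f1 g1 (H2 q) Hin Hfg)|..];
  intros u v _; cbv beta; rewrite fr_scal; f_equal; vec_ring.
Qed.

Lemma smooth_ex_derive_n_u D Z : open_dom D -> smooth D Z ->
  forall n u v, D u v -> ex_derive_n (fun z => Z z v) n u.
Proof.
  intros HD HZ.
  assert (S_ : forall n, smooth D (Nat.iter n pu Z)).
  { induction n as [|n IH]; [exact HZ|]. simpl. now apply smooth_pu. }
  assert (K : forall n u v, D u v -> Derive_n (fun z => Z z v) n u = Nat.iter n pu Z u v).
  { induction n as [|n IH]; intros u v h; [reflexivity|]. simpl. unfold pu at 1.
    apply Derive_ext_loc. generalize (open_dom_locally_u D u v HD h). apply filter_imp.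
    intros z Hz. now apply IH. }
  intros [|n] u v h; [exact I|]. simpl.
  apply (ex_derive_ext_loc (fun z => Nat.iter n pu Z z v)).
  - generalize (open_dom_locally_u D u v HD h). apply filter_imp.
    intros z Hz. symmetry. now apply K.
  - eexists. apply (smooth_partials D _ (S_ n) u v h).
Qed.

Lemma smooth_ex_derive_n_v D Z : open_dom D -> smooth D Z ->
  forall n u v, D u v -> ex_derive_n (fun z => Z u z) n v.
Proof.
  intros HD HZ.
  assert (S_ : forall n, smooth D (Nat.iter n pv Z)).
  { induction n as [|n IH]; [exact HZ|]. simpl. now apply smooth_pv. }
  assert (K : forall n u v, D u v -> Derive_n (fun z => Z u z) n v = Nat.iter n pv Z u v).
  { induction n as [|n IH]; intros u v h; [reflexivity|]. simpl. unfold pv at 1.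
    apply Derive_ext_loc. generalize (open_dom_locally_v D u v HD h). apply filter_imp.
    intros z Hz. now apply IH. }
  intros [|n] u v h; [exact I|]. simpl.
  apply (ex_derive_ext_loc (fun z => Nat.iter n pv Z u z)).
  - generalize (open_dom_locally_v D u v HD h). apply filter_imp.
    intros z Hz. symmetry. now apply K.
  - eexists. apply (smooth_partials D _ (S_ n) u v h).
Qed.

Definition box (u0 v0 r : R) : dom := fun u v => Rabs (u - u0) < r /\ Rabs (v - v0) < r.

Lemma box_open u0 v0 r : open_dom (box u0 v0 r).
Proof.
  intros u v [Hu Hv].
  assert (Hd : 0 < Rmin (r - Rabs (u - u0)) (r - Rabs (v - v0))) by (apply Rmin_glb_lt; lra).
  exists (mkposreal _ Hd). simpl. intros a b Ha Hb.
  pose proof (Rmin_l (r - Rabs (u - u0)) (r - Rabs (v - v0))).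
  pose proof (Rmin_r (r - Rabs (u - u0)) (r - Rabs (v - v0))).
  split.
  - replace (a - u0) with ((a - u) + (u - u0)) by ring. eapply Rle_lt_trans; [apply Rabs_triang|]. lra.
  - replace (b - v0) with ((b - v) + (v - v0)) by ring. eapply Rle_lt_trans; [apply Rabs_triang|]. lra.
Qed.

Lemma box_convex u0 v0 r : convex_dom (box u0 v0 r).
Proof.
  assert (K : forall x y x0 s, Rabs (x - x0) < r -> Rabs (y - x0) < r -> 0 <= s <= 1 ->
    Rabs ((1 - s) * x + s * y - x0) < r).
  { intros x y x0 s Hx Hy Hs. apply Rabs_def2 in Hx. apply Rabs_def2 in Hy.
    replace ((1 - s) * x + s * y - x0) with ((1 - s) * (x - x0) + s * (y - x0)) by ring.
    apply Rabs_def1; [now apply convex_comb_lt|now apply convex_comb_gt]. }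
  intros u v u' v' s [H1 H2] [H3 H4] Hs. split; apply K; assumption.
Qed.

Lemma box_center u0 v0 r : 0 < r -> box u0 v0 r u0 v0.
Proof. intros H. split; rewrite Rminus_diag, Rabs_R0; exact H. Qed.

Lemma box_u u0 v0 r u v : box u0 v0 r u v -> box u0 v0 r u v0.
Proof.
  intros [H1 H2]. split; [exact H1|]. rewrite Rminus_diag, Rabs_R0.
  eapply Rle_lt_trans; [apply Rabs_pos|exact H1].
Qed.

Lemma box_v u0 v0 r u v : box u0 v0 r u v -> box u0 v0 r u0 v.
Proof.
  intros [H1 H2]. split; [|exact H2]. rewrite Rminus_diag, Rabs_R0.
  eapply Rle_lt_trans; [apply Rabs_pos|exact H1].
Qed.

(** Z_u depends on u only and Z_v on v only, so Z is the sum of its restrictions to the two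
    coordinate lines through the centre, up to the constant Z (u0, v0). *)
Lemma box_split u0 v0 r Z f1 g1 df dg : 0 < r ->
  partials (box u0 v0 r) Z f1 g1 -> partials (box u0 v0 r) f1 df (fun _ _ => 0) ->
  partials (box u0 v0 r) g1 (fun _ _ => 0) dg ->
  smooth (box u0 v0 r) f1 -> smooth (box u0 v0 r) g1 ->
  exists f g, (forall u v, box u0 v0 r u v -> f u + g v = Z u v) /\
    (forall u v, box u0 v0 r u v -> is_derive f u (f1 u v) /\ is_derive g v (g1 u v)) /\
    (forall u v n, box u0 v0 r u v -> ex_derive_n f n u /\ ex_derive_n g n v).
Proof.
  intros Hr HZ Hf Hg Sf Sg. set (D := box u0 v0 r) in *.
  pose proof (box_open u0 v0 r) as HD. pose proof (box_convex u0 v0 r) as Hc. fold D in HD, Hc.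
  pose proof (box_center u0 v0 r Hr) as h0. fold D in h0.
  assert (SZ : smooth D Z) by (apply (smooth_of_partials D Z f1 g1); auto).
  assert (Ef : forall u v, D u v -> f1 u v = f1 u v0).
  { intros u v h. destruct (Req_dec v v0) as [->|Hne]; [reflexivity|].
    assert (K : forall s, 0 <= s <= 1 -> D u ((1 - s) * v0 + s * v)).
    { intros s Hs. replace u with ((1 - s) * u + s * u) by ring. apply Hc; auto. now apply (box_u u0 v0 r u v). }
    pose proof (eq_is_derive (V:=R_NormedModule) (fun s => f1 u ((1 - s) * v0 + s * v)) 0 1) as E.
    cbv beta in E. replace ((1 - 0) * v0 + 0 * v) with v0 in E by ring.
    replace ((1 - 1) * v0 + 1 * v) with v in E by ring. symmetry. apply E; [|lra].
    intros t Ht. eapply is_derive_eq.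
    - apply (is_derive_Rcomp (fun z => f1 u z) (fun s => (1 - s) * v0 + s * v)).
      + exact (proj2 (Hf _ _ (K t Ht))).
      + apply is_derive_affine.
    - change zero with 0. ring. }
  assert (Eg : forall u v, D u v -> g1 u v = g1 u0 v).
  { intros u v h. 
    assert (K : forall s, 0 <= s <= 1 -> D ((1 - s) * u0 + s * u) v).
    { intros s Hs. replace v with ((1 - s) * v + s * v) by ring. apply Hc; auto. now apply (box_v u0 v0 r u v). }
    pose proof (eq_is_derive (V:=R_NormedModule) (fun s => g1 ((1 - s) * u0 + s * u) v) 0 1) as E.
    cbv beta in E. replace ((1 - 0) * u0 + 0 * u) with u0 in E by ring.
    replace ((1 - 1) * u0 + 1 * u) with u in E by ring. symmetry. apply E; [|lra].
    intros t Ht. eapply is_derive_eq.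
    - apply (is_derive_Rcomp (fun z => g1 z v) (fun s => (1 - s) * u0 + s * u)).
      + exact (proj1 (Hg _ _ (K t Ht))).
      + apply is_derive_affine.
    - change zero with 0. ring. }
  pose (f := fun u => Z u v0). pose (g := fun v => Z u0 v + - Z u0 v0).
  assert (Hfg : forall u v, D u v -> is_derive f u (f1 u v) /\ is_derive g v (g1 u v)).
  { intros u v h. split.
    - rewrite Ef by exact h. exact (proj1 (HZ u v0 (box_u u0 v0 r u v h))).
    - rewrite Eg by exact h. rewrite <- (Rplus_0_r (g1 u0 v)).
      apply is_derive_Rplus; [exact (proj2 (HZ u0 v (box_v u0 v0 r u v h)))|apply is_derive_Rconst]. }
  exists f, g. split; [|split; [exact Hfg|]].
  - intros u v h.
    assert (PT : partials D (fun u v => (f u + g v) - Z u v) (fun _ _ => 0) (fun _ _ => 0)).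
    { eapply partials_eq; [apply partials_minus; [|exact HZ]; intros a b hab;
        destruct (Hfg a b hab) as [F G]; split|..].
      - apply is_derive_Rplus; [exact F|apply is_derive_Rconst].
      - apply (is_derive_Rplus (fun _ => f a)); [apply is_derive_Rconst|exact G].
      - intros; cbv beta; ring.
      - intros; cbv beta; ring. }
    pose proof (constant_of_zero_partials D _ HD Hc PT u v u0 v0 h h0) as E. cbv beta in E.
    unfold f, g in *. lra.
  - intros u v n h. split.
    + apply (smooth_ex_derive_n_u D Z HD SZ n u v0), (box_u u0 v0 r u v h).
    + assert (SZ' : smooth D (fun a b => Z a b + - Z u0 v0))
        by (apply smooth_plus; auto; now apply smooth_const).
      apply (smooth_ex_derive_n_v D _ HD SZ' n u0 v), (box_v u0 v0 r u v h).
Qed.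

(** * Rigid motions and the coefficients of an aligned net *)

Lemma vpartials_rigid D X Xu Xv r t0 d : vpartials D X Xu Xv ->
  vpartials D (fun u v => add3 t0 (scal3 d (fr r (X u v))))
    (fun u v => scal3 d (fr r (Xu u v))) (fun u v => scal3 d (fr r (Xv u v))).
Proof.
  intros (H1 & H2 & H3).
  eapply vpartials_eq; [apply vpartials_add; [apply vpartials_const|apply vpartials_cscal;
    unfold fr; apply vpartials_add; [apply vpartials_add|];
    (apply vpartials_scal; [|apply vpartials_const]); [exact H1|exact H2|exact H3]]|..];
  intros u v _; cbv beta; [generalize (Xu u v)|generalize (Xv u v)]; intros z; unfold fr, zero3; vec_ring.
Qed.

(** For eps = -1 the unit normal, being quadratic in the first derivatives, is only rotated, whereas
    the second derivatives also change sign. So the second form changes sign, as [has_forms eps]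
    accounts for. *)
Lemma rigid_net D eta I II r t0 eps : onf r -> is_sign eps -> is_net D eta ->
  has_forms 1 D eta I II ->
  is_net D (fun u v => add3 t0 (scal3 eps (fr r (eta u v)))) /\
  has_forms eps D (fun u v => add3 t0 (scal3 eps (fr r (eta u v)))) I II.
Proof.
  intros Hr Heps (HD & Hs & Hreg) Hf. set (eta' := fun u v => add3 t0 (scal3 eps (fr r (eta u v)))).
  assert (E2 : eps * eps = 1) by (destruct Heps as [-> | ->]; ring).
  pose proof (smooth3_vpartials _ _ Hs) as P.
  pose proof (smooth3_vpartials _ _ (smooth3_du _ _ Hs)) as Pu.
  pose proof (smooth3_vpartials _ _ (smooth3_dv _ _ Hs)) as Pv.
  pose proof (vpartials_rigid D _ _ _ r t0 eps P) as Q.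
  assert (Du : forall u v, D u v -> du eta' u v = scal3 eps (fr r (du eta u v)))
    by (intros u v h; exact (vpartials_du D eta' _ _ u v Q h)).
  assert (Dv : forall u v, D u v -> dv eta' u v = scal3 eps (fr r (dv eta u v)))
    by (intros u v h; exact (vpartials_dv D eta' _ _ u v Q h)).
  assert (Qu := vpartials_ext D _ (du eta') _ _ _ _ HD (vpartials_rigid D _ _ _ r zero3 eps Pu)
    (fun u v h => ltac:(rewrite Du by exact h; unfold zero3; vec_ring)) (fun _ _ _ => eq_refl) (fun _ _ _ => eq_refl)).
  assert (Qv := vpartials_ext D _ (dv eta') _ _ _ _ HD (vpartials_rigid D _ _ _ r zero3 eps Pv)
    (fun u v h => ltac:(rewrite Dv by exact h; unfold zero3; vec_ring)) (fun _ _ _ => eq_refl) (fun _ _ _ => eq_refl)).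
  assert (Hcr : forall u v, D u v -> cross (du eta' u v) (dv eta' u v) = fr r (cross (du eta u v) (dv eta u v))).
  { intros u v h. rewrite Du, Dv, <- fr_cross by auto.
    transitivity (scal3 (eps * eps) (cross (fr r (du eta u v)) (fr r (dv eta u v)))); [vec_ring|].
    rewrite E2. vec_ring. }
  assert (Hun : forall u v, D u v -> unit_normal eta' u v = fr r (unit_normal eta u v)).
  { intros u v h. unfold unit_normal. rewrite Hcr, <- fr_scal by exact h. unfold norm3.
    rewrite fr_dot by exact Hr. reflexivity. }
  split.
  - split; [exact HD|]. split.
    + apply smooth3_add; [exact HD|now apply smooth3_const|]. apply smooth3_cscal; [exact HD|].
      apply (smooth3_fr D (fun _ _ => r)); auto. intros q. now apply smooth3_const.
    + intros u v h E. rewrite Hcr in E by exact h. apply (fr_ext_zero r) in E; auto.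
      now apply (Hreg u v h).
  - intros u v h. destruct (Hf u v h) as [F1 F2]. rewrite <- F1, <- F2. split.
    + unfold first_form. rewrite Du, Dv, !dot_scal_l, !dot_scal_r, !fr_dot, <- !Rmult_assoc, E2 by auto.
      now rewrite !Rmult_1_l.
    + unfold second_form. rewrite Hun by exact h.
      rewrite (vpartials_du D _ _ _ u v Qu h), (vpartials_dv D _ _ _ u v Qu h), (vpartials_dv D _ _ _ u v Qv h).
      rewrite !dot_scal_l, !fr_dot by auto.
      apply R3_ext; vec_simpl; rewrite <- Rmult_assoc, E2; reflexivity.
Qed.

(* With [tau = 1] (resp. [-1]) the hypothesis [pu n = tau * pv m] is positive
   (resp. negative) alignability. *)
Lemma aligned_coeffs D C S P f1 g1 m n tau : open_dom D -> convex_dom D ->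
  (exists u v, D u v) -> smooth D m -> smooth D n -> pendulum_along D C S P f1 g1 ->
  partials D f1 (pu f1) (fun _ _ => 0) -> partials D g1 (fun _ _ => 0) (pv g1) ->
  (forall u v, D u v -> f1 u v <> 0 /\ g1 u v <> 0) -> is_sign tau ->
  (forall u v, D u v -> pv m u v * C u v - m u v * S u v * P u v * g1 u v = pu n u v /\
     pv m u v * S u v + m u v * C u v * P u v * g1 u v = - (f1 u v * P u v * n u v)) ->
  (forall u v, D u v -> pu n u v = tau * pv m u v) ->
  exists ka, forall u v, D u v -> m u v = ka * f1 u v / (1 - tau * C u v) /\
    n u v = tau * ka * g1 u v / (1 - tau * C u v).
Proof.
  intros HD Hc (u0 & v0 & h0) Sm Sn (PC & PP & HSC) Pf Pg Hfg Htau Heq Hal.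
  assert (T2 : tau * tau = 1) by (destruct Htau as [-> | ->]; ring).
  assert (HC : forall u v, D u v -> 1 - tau * C u v <> 0).
  { intros u v h. destruct (HSC u v h) as [H1 H2]. assert (0 < S u v ^ 2) by now apply pow_lt.
    destruct Htau as [-> | ->]; nra. }
  assert (K1 : forall u v, D u v -> pv m u v * (1 - tau * C u v) = - tau * (m u v * S u v * P u v * g1 u v)).
  { intros u v h. destruct (Heq u v h) as [E1 _]. rewrite Hal in E1 by exact h.
    replace (m u v * S u v * P u v * g1 u v) with (pv m u v * C u v - tau * pv m u v) by lra.
    ring [T2]. }
  (* Eliminating m_v from the two integrability equations leaves a relation with the factor P, which
     says nothing where P vanishes. *)
  assert (K2 : forall u v, D u v -> P u v * (tau * m u v * g1 u v - f1 u v * n u v) = 0).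
  { intros u v h. destruct (Heq u v h) as [_ E2]. specialize (K1 u v h). specialize (HC u v h).
    destruct (HSC u v h) as [_ HS]. apply (Rmult_eq_reg_l (1 - tau * C u v)); auto.
    assert (E3 : (pv m u v * (1 - tau * C u v)) * S u v + m u v * C u v * P u v * g1 u v * (1 - tau * C u v)
      = - (f1 u v * P u v * n u v) * (1 - tau * C u v)) by (rewrite <- E2; ring).
    rewrite K1 in E3.
    replace (- tau * (m u v * S u v * P u v * g1 u v) * S u v)
      with (- tau * m u v * P u v * g1 u v * S u v ^ 2) in E3 by ring.
    replace (S u v ^ 2) with (1 - C u v ^ 2) in E3 by lra.
    assert (E4 : - tau * m u v * P u v * g1 u v * (1 - C u v ^ 2) + m u v * C u v * P u v * g1 u v * (1 - tau * C u v)
      = (1 - tau * C u v) * - (tau * m u v * P u v * g1 u v)) by ring [T2].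
    rewrite E4 in E3. lra. }
  (* The value of the constant [ka] as computed from m and from n. The two are shown to coincide,
     and then to have zero derivatives. *)
  pose (N1 := fun u v => m u v * (1 + - tau * C u v) * / f1 u v).
  pose (N3 := fun u v => tau * (n u v * (1 + - tau * C u v) * / g1 u v)).
  assert (PT : partials D (fun u v => 1 + - tau * C u v) (fun u v => tau * (S u v * P u v * f1 u v))
    (fun u v => tau * (S u v * P u v * g1 u v))).
  { eapply partials_eq; [apply partials_plus; [apply partials_const|apply partials_mult;
      [apply partials_const|exact PC]]|..]; intros; cbv beta; ring. }
  assert (Pif := partials_inv D _ _ _ Pf (fun u v h => proj1 (Hfg u v h))).
  assert (Pig := partials_inv D _ _ _ Pg (fun u v h => proj2 (Hfg u v h))).
  assert (P1 := partials_mult D _ _ _ _ _ _ (partials_mult D _ _ _ _ _ _ (smooth_partials _ _ Sm) PT) Pif).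
  assert (P3 := partials_mult D _ _ _ _ _ _ (partials_const D tau)
    (partials_mult D _ _ _ _ _ _ (partials_mult D _ _ _ _ _ _ (smooth_partials _ _ Sn) PT) Pig)).
  fold N1 in P1. fold N3 in P3.
  assert (Z1 : forall u v, D u v -> N1 u v - N3 u v =
     tau * (1 - tau * C u v) * (tau * m u v * g1 u v - f1 u v * n u v) / (f1 u v * g1 u v)).
  { intros u v h. destruct (Hfg u v h). unfold N1, N3.
    transitivity ((1 - tau * C u v) * ((tau * tau) * m u v * g1 u v - tau * f1 u v * n u v) / (f1 u v * g1 u v));
    [rewrite T2; field; auto|field; auto]. }
  assert (Z2 : forall u v, D u v -> P u v * (N1 u v - N3 u v) = 0).
  { intros u v h. rewrite Z1 by exact h. destruct (Hfg u v h).
    transitivity (tau * (1 - tau * C u v) * (P u v * (tau * m u v * g1 u v - f1 u v * n u v)) / (f1 u v * g1 u v));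
    [field; auto|]. rewrite K2 by exact h. field; auto. }
  (* Where P = 0, the u-derivative of the identity P (N1 - N3) = 0 reduces to S f1 (N1 - N3) = 0,
     and S f1 is nonzero. *)
  assert (Z3 : forall u v, D u v -> N1 u v - N3 u v = 0).
  { intros u v h. destruct (Req_dec (P u v) 0) as [E|E].
    - pose proof (partials_of_const D _ _ _ 0 HD (partials_mult D _ _ _ _ _ _ PP
        (partials_minus D _ _ _ _ _ _ P1 P3)) Z2 u v h) as [Q _].
      cbv beta in Q. rewrite E, Rmult_0_l, Rplus_0_r in Q. destruct (Hfg u v h). destruct (HSC u v h).
      apply (Rmult_eq_reg_l (S u v * f1 u v)); [rewrite Rmult_0_r; exact Q|].
      apply Rmult_integral_contrapositive. split; [lra|assumption].
    - apply (Rmult_eq_reg_l (P u v)); auto. rewrite Z2 by exact h. ring. }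
  assert (PN : partials D N1 (fun _ _ => 0) (fun _ _ => 0)).
  { intros u v h.
    assert (Hv : pv m u v * (1 + - tau * C u v) + m u v * (tau * (S u v * P u v * g1 u v)) = 0).
    { pose proof (K1 u v h). lra. }
    destruct (P1 u v h) as [Q1 Q2]. cbv beta in Q1, Q2. destruct (Hfg u v h). split.
    - pose proof (partials_unique D _ _ _ _ _ _ HD P1 P3
        (fun a b hab => Rminus_diag_uniq _ _ (Z3 a b hab)) u v h) as [U _].
      cbv beta in U. rewrite U in Q1. eapply is_derive_eq; [exact Q1|].
      rewrite Hal by exact h.
      transitivity ((tau * tau) * (pv m u v * (1 + - tau * C u v)) / g1 u v + (tau * tau) * S u v * (P u v * (f1 u v * n u v)) / g1 u v);
      [field; auto|]. rewrite T2.
      replace (pv m u v * (1 + - tau * C u v)) with (- (m u v * (tau * (S u v * P u v * g1 u v)))) by lra.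
      transitivity (- S u v * (P u v * (tau * m u v * g1 u v - f1 u v * n u v)) / g1 u v); [field; auto|].
      rewrite K2 by exact h. field; auto.
    - eapply is_derive_eq; [exact Q2|].
      transitivity ((pv m u v * (1 + - tau * C u v) + m u v * (tau * (S u v * P u v * g1 u v))) / f1 u v);
      [field; auto|]. rewrite Hv. field; auto. }
  exists (N1 u0 v0). intros u v h. destruct (Hfg u v h). specialize (HC u v h).
  assert (EN : N1 u v = N1 u0 v0) by (apply (constant_of_zero_partials D N1 HD Hc PN); assumption).
  split.
  - rewrite <- EN. unfold N1. field; auto.
  - rewrite <- EN. replace (N1 u v) with (N3 u v) by (specialize (Z3 u v h); lra). unfold N3.
    transitivity ((tau * tau) * n u v); [rewrite T2; ring|field; auto].
Qed.

(** * Reduction of a given net to the model *)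

Definition flip (d : R) (e : triad) : triad :=
  (scal3 d (fst (fst e)), scal3 d (snd (fst e)), snd e).

Lemma fr_flip d e q : fr (flip d e) q = fr e (d * c1 q, d * c2 q, c3 q).
Proof. unfold fr, flip. vec_ring. Qed.

(** For d = -1, [flip] is the half turn about n: it keeps the orientation of the triad and reverses
    E1 and E3 together. *)
Lemma moving_flip D e ku kv d : open_dom D -> is_sign d -> moving D e ku kv ->
  moving D (fun u v => flip d (e u v))
    (fun u v => (d * c1 (ku u v), d * c2 (ku u v), c3 (ku u v)))
    (fun u v => (d * c1 (kv u v), d * c2 (kv u v), c3 (kv u v))).
Proof.
  intros HD Hd [Ho H]. assert (d2 : d * d = 1) by (destruct Hd as [-> | ->]; ring).
  split.
  - intros u v h. specialize (Ho u v h). destruct (e u v) as [[a b] c].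
    destruct Ho as (H1 & H2 & H3 & ->). unfold flip, onf. cbn [fst snd].
    rewrite !dot_scal_l, !dot_scal_r, H1, H2, H3. repeat split; try lra.
    transitivity (scal3 (d * d) (cross a b)); [rewrite d2; vec_ring|vec_ring].
  - intros q.
    apply (vpartials_ext D _ _ _ _ _ _ HD (H (d * c1 q, d * c2 q, c3 q)));
    intros u v _; rewrite fr_flip; f_equal; apply R3_ext; vec_simpl; try ring; ring [d2].
Qed.

(** In coordinates with derivatives f1 = vs rho A1 and g1 = (vs / rho) A3, the screw field al E1 +
    be E3 becomes vs al rho times d/du - d/dv exactly when rho^2 = - be / al. Then lam = 1 / rho.
    The half turn with sign sg vs absorbs the remaining signs of the angular velocities. *)
Lemma local_reparametrization D eta F A1 A3 C S x g mu nu e sg al be u0 v0 :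
  open_dom D -> D u0 v0 ->
  local_structure D eta F A1 A3 C S x g mu nu e sg al be -> 0 < - be / al ->
  exists lam f1 g1 P e' d, 0 < lam /\ is_sign d /\ pendulum_along D C S P f1 g1 /\
    (smooth D P /\ smooth D f1 /\ smooth D g1) /\
    partials D f1 (pu f1) (fun _ _ => 0) /\ partials D g1 (fun _ _ => 0) (pv g1) /\
    (forall u v, D u v -> f1 u v <> 0 /\ g1 u v <> 0) /\ P u0 v0 <= 0 /\
    moving D e' (fun u v => (f1 u v * lam, 0, - (f1 u v * P u v)))
      (fun u v => (- (g1 u v * C u v / lam), - (g1 u v * S u v / lam), 0)) /\
    vpartials D eta (fun u v => fr (e' u v) (d * mu u v * C u v, d * mu u v * S u v, 0))
      (fun u v => fr (e' u v) (d * nu u v, 0, 0)).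
Proof.
  intros HD h0 L Hr. pose (rho := sqrt (- be / al)).
  assert (Hrho : 0 < rho) by now apply sqrt_lt_R0.
  assert (Hrho2 : rho * rho = - be / al) by (apply sqrt_sqrt; lra).
  pose proof (ls_al L) as Hal.
  pose proof (ls_be L) as Hbe.
  (* The sign [vs] reverses both coordinates, and P with them, to obtain P <= 0 at the base
     point. *)
  assert (exists vs, is_sign vs /\ - vs * g u0 v0 / (al * rho) <= 0) as (vs & Hvs & Hvs0).
  { destruct (Rle_dec (- 1 * g u0 v0 / (al * rho)) 0) as [h|h].
    - exists 1. split; [now left|]. lra.
    - exists (-1). split; [now right|].
      replace (- -1 * g u0 v0 / (al * rho)) with (- (- 1 * g u0 v0 / (al * rho))) by (unfold Rdiv; ring). lra. }
  assert (V2 : vs * vs = 1) by (destruct Hvs as [-> | ->]; ring).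
  assert (Hvs1 : vs <> 0) by (destruct Hvs; lra).
  assert (Hsg : is_sign sg) by apply L.
  pose (f1 := fun u v => vs * rho * A1 u v). pose (g1 := fun u v => vs / rho * A3 u v).
  pose (P := fun u v => - vs / (al * rho) * g u v).
  assert (Hd : is_sign (sg * vs)).
  { destruct Hsg as [-> | ->], Hvs as [-> | ->]; unfold is_sign; lra. }
  assert (Hbe' : be = - al * (rho * rho)) by (rewrite Hrho2; field; exact Hal).
  assert (Hx : forall u v, D u v -> x u v = - (f1 u v * P u v)).
  { intros u v h. destruct (ls_rel L u v h) as [R _].
    unfold f1, P. apply (Rmult_eq_reg_r al); auto. rewrite <- R.
    transitivity ((vs * vs) * (A1 u v * g u v)); [rewrite V2; ring|field; repeat split; first [assumption|lra]]. }
  assert (Sf : smooth D f1) by (apply smooth_mult; auto; [now apply smooth_const|apply L]).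
  assert (Sg : smooth D g1) by (apply smooth_mult; auto; [now apply smooth_const|apply L]).
  assert (SP : smooth D P) by (apply smooth_mult; auto; [now apply smooth_const|apply L]).
  assert (Pf : partials D f1 (pu f1) (fun _ _ => 0)).
  { eapply partials_eq; [exact (partials_mult D _ _ _ _ _ _ (partials_const D (vs * rho)) (ls_A1 L))|..];
    intros u v h; cbv beta; [|ring]. symmetry.
    exact (partials_pu D _ _ _ u v (partials_mult D _ _ _ _ _ _ (partials_const D (vs * rho)) (ls_A1 L)) h). }
  assert (Pg : partials D g1 (fun _ _ => 0) (pv g1)).
  { eapply partials_eq; [exact (partials_mult D _ _ _ _ _ _ (partials_const D (vs / rho)) (ls_A3 L))|..];
    intros u v h; cbv beta; [ring|]. symmetry.
    exact (partials_pv D _ _ _ u v (partials_mult D _ _ _ _ _ _ (partials_const D (vs / rho)) (ls_A3 L)) h). }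
  exists (/ rho), f1, g1, P, (fun u v => flip (sg * vs) (e u v)), (sg * vs).
  split; [now apply Rinv_0_lt_compat|]. split; [exact Hd|]. split; [split; [|split]|].
  - eapply partials_eq; [exact (ls_C L)|..]; intros u v h; cbv beta.
    + rewrite Hx by exact h. ring.
    + destruct (ls_rel L u v h) as [_ R].
      apply (Rmult_eq_reg_l be); auto. transitivity (- (A3 u v * g u v * S u v)); [lra|].
      rewrite Hbe'. unfold P, g1.
      transitivity (- (vs * vs) * (A3 u v * g u v * S u v)); [rewrite V2; ring|field; repeat split; first [assumption|lra]].
  - eapply partials_eq; [exact (partials_mult D _ _ _ _ _ _ (partials_const D (- vs / (al * rho))) (ls_g L))|..];
    intros u v h; cbv beta; rewrite ?Hbe'; unfold f1, g1; field; repeat split; first [assumption|lra].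
  - apply L.
  - split; [auto|]. split; [exact Pf|]. split; [exact Pg|]. split; [|split; [|split]].
    + intros u v h. destruct (ls_nonzero L u v h).
      assert (vs / rho <> 0) by (apply Rmult_integral_contrapositive; split; [auto|apply Rinv_neq_0_compat; lra]).
      assert (vs * rho <> 0) by (apply Rmult_integral_contrapositive; split; [auto|lra]).
      unfold f1, g1. split; apply Rmult_integral_contrapositive; split; assumption.
    + unfold P. replace (- vs / (al * rho) * g u0 v0) with (- vs * g u0 v0 / (al * rho)) by (unfold Rdiv; ring).
      exact Hvs0.
    + pose proof (moving_flip D e _ _ (sg * vs) HD Hd (ls_moving L)) as [M1 M2].
      assert (S2 : sg * sg = 1) by (destruct Hsg as [-> | ->]; ring).
      split; [exact M1|]. intros q. eapply vpartials_eq; [apply (M2 q)|..]; intros u v h; cbv beta;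
      f_equal; f_equal; unfold c1, c2, c3; cbn [fst snd]; [rewrite (Hx u v h)|]; unfold f1, g1;
      apply R3_ext; unfold c1, c2, c3; cbn [fst snd]; first [ring|field_simplify_eq; [ring [S2]|lra]].
    + assert (d2 : sg * vs * (sg * vs) = 1) by (destruct Hd as [-> | ->]; ring).
      eapply vpartials_eq; [exact (ls_eta L)|..]; intros u v h;
      cbv beta; rewrite fr_flip; f_equal; unfold c1, c2, c3; cbn [fst snd];
      apply R3_ext; unfold c1, c2, c3; cbn [fst snd]; first [ring|ring [d2]].
Qed.

(** Once cos w is matched with the model, positivity matches S, and P follows by comparing the
    u-derivatives of C, because S f1 is nonzero. *)
Lemma model_frame u0 v0 r C S P f1 g1 : 0 < r ->
  let D := box u0 v0 r in
  pendulum_along D C S P f1 g1 -> smooth D P -> smooth D f1 -> smooth D g1 ->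
  partials D f1 (pu f1) (fun _ _ => 0) -> partials D g1 (fun _ _ => 0) (pv g1) ->
  (forall u v, D u v -> f1 u v <> 0 /\ g1 u v <> 0) -> P u0 v0 <= 0 ->
  exists k Om I s c p f g,
    is_Omega k Om /\ 0 < k /\ (forall a b, Om a b <-> I (a + b)) /\ (forall y, I y -> locally y I) /\
    (forall y z q, I y -> I z -> 0 <= q <= 1 -> I ((1 - q) * y + q * z)) /\
    omega_param k I s c p /\
    (forall u v, D u v -> Om (f u) (g v)) /\
    (forall u v, D u v -> is_derive f u (f1 u v) /\ is_derive g v (g1 u v)) /\
    (forall u v n, D u v -> ex_derive_n f n u /\ ex_derive_n g n v) /\
    (forall u v, D u v -> Cos_of c (f u) (g v) = C u v /\ Sin_of s c (f u) (g v) = S u v /\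
       sum_of p (f u) (g v) = P u v).
Proof.
  intros Hr D Hpen SP Sf Sg Pf Pg Hfg Hneg.
  pose proof (box_open u0 v0 r) as HD. pose proof (box_convex u0 v0 r) as Hc.
  pose proof (box_center u0 v0 r Hr) as h0. fold D in HD, Hc, h0.
  destruct (pendulum_match D C S P f1 g1 HD Hc SP Hpen (ex_intro _ u0 (ex_intro _ v0 (conj h0 Hneg))))
    as (k & Om & Z & HOm & PZ & HZ).
  destruct (is_Omega_param k Om HOm) as (Hk & I & s & c & p & HI & Hopen & HcI & Hpar).
  destruct (box_split u0 v0 r Z f1 g1 _ _ Hr PZ Pf Pg Sf Sg) as (f & g & Efg & Dfg & Nfg).
  fold D in Efg, Dfg, Nfg.
  assert (Hin : forall u v, D u v -> Om (f u) (g v)) by (intros u v h; exact (proj2 (HZ u v h) _ _ (Efg u v h))).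
  assert (HI' : forall u v, D u v -> I (f u + g v)) by (intros u v h; now apply HI, Hin).
  pose proof Hpar as [Hh Hsn].
  assert (HCS : forall u v, D u v -> Cos_of c (f u) (g v) = C u v /\ Sin_of s c (f u) (g v) = S u v).
  { intros u v h. destruct (HZ u v h) as [E _]. rewrite <- Efg in E by exact h.
    rewrite Hsn in E by now apply HI'. destruct (Hh _ (HI' u v h)) as (_ & _ & _ & H1 & H2 & H3 & _).
    destruct (proj2 (proj2 Hpen) u v h) as [HS1 HS2].
    assert (EC : Cos_of c (f u) (g v) = C u v) by (unfold Cos_of; rewrite E; field).
    split; [exact EC|]. unfold Sin_of. apply Rsqr_inj; [|lra|].
    - apply Rmult_le_pos; lra.
    - unfold Rsqr. unfold Cos_of in EC. rewrite <- EC in HS2.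
      transitivity (4 * (s (f u + g v) ^ 2) * c (f u + g v) ^ 2); [ring|].
      replace (s (f u + g v) ^ 2) with (1 - c (f u + g v) ^ 2) by lra. simpl in *. lra. }
  exists k, Om, I, s, c, p, f, g. do 9 (split; [assumption|]).
  intros u v h. destruct (HCS u v h) as [EC ES]. split; [exact EC|]. split; [exact ES|].
  assert (HDO : forall a b, Om a b -> I (a + b)) by (intros a b; apply HI).
  assert (PCo : partials Om (Cos_of c) (fun u v => - (Sin_of s c u v * sum_of p u v))
    (fun u v => - (Sin_of s c u v * sum_of p u v))).
  { destruct (half_angle_partials Om I k s c p Hh HDO) as (_ & Pc & _). unfold Cos_of, Sin_of, sum_of.
    intros a b hab.
    pose proof (partials_plus Om _ _ _ _ _ _ (partials_mult Om _ _ _ _ _ _ (partials_const Om 2)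
      (partials_mult Om _ _ _ _ _ _ Pc Pc)) (partials_const Om (-1)) a b hab) as [Q1 Q2].
    split.
    - eapply is_derive_ext; [|eapply is_derive_eq; [exact Q1|]]; [intros z; simpl; ring|cbv beta; field].
    - eapply is_derive_ext; [|eapply is_derive_eq; [exact Q2|]]; [intros z; simpl; ring|cbv beta; field]. }
  pose proof (partials_box_comp D Om _ _ _ f g f1 g1 PCo Hin Dfg) as Q.
  destruct (partials_unique D _ _ _ _ _ _ HD Q (proj1 Hpen) (fun a b hab => proj1 (HCS a b hab)) u v h) as [U _].
  cbv beta in U. rewrite ES in U. destruct (Hfg u v h). destruct (proj2 (proj2 Hpen) u v h) as [HS1 _].
  apply (Rmult_eq_reg_l (- (f1 u v * S u v))).
  - lra.
  - apply Ropp_neq_0_compat, Rmult_integral_contrapositive. split; lra.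
Qed.

Lemma abs_sign d : d <> 0 -> exists eps, is_sign eps /\ d = Rabs d * eps /\ 0 < Rabs d.
Proof.
  intros H. pose proof (Rabs_pos_lt d H). destruct (Rlt_dec 0 d).
  - exists 1. rewrite Rabs_right in * by lra. unfold is_sign. lra.
  - exists (-1). rewrite Rabs_left in * by lra. unfold is_sign. lra.
Qed.

(** The absolute value of d is the constant scaling, while its sign becomes part of the isometry and
    hence the [eps] of the second form. Since the scaling acts last, the translation is divided by
    it. *)
Lemma locally_in_family_of_rigid (I : R -> R -> R -> qform) (II : R -> R -> R -> R -> qform)
    (eta eta0 : R -> R -> R3) u0 v0 r t k Om f g f1 g1 q t0 d :
  0 < r -> is_Omega k Om -> is_net Om eta0 -> has_forms 1 Om eta0 (I k) (II t k) ->
  (forall u v, box u0 v0 r u v -> Om (f u) (g v)) ->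
  (forall u v, box u0 v0 r u v -> is_derive f u (f1 u v) /\ is_derive g v (g1 u v)) ->
  (forall u v, box u0 v0 r u v -> f1 u v <> 0 /\ g1 u v <> 0) ->
  (forall u v n, box u0 v0 r u v -> ex_derive_n f n u /\ ex_derive_n g n v) ->
  onf q -> d <> 0 ->
  (forall u v, box u0 v0 r u v -> eta u v = add3 t0 (scal3 d (fr q (eta0 (f u) (g v))))) ->
  locally_in_family I II eta u0 v0.
Proof.
  intros Hr HOm Hn Hf Hin Dfg Hfg Nfg Hq Hd He.
  destruct (abs_sign d Hd) as (eps & Heps & Ed & Hs). set (s := Rabs d) in *.
  destruct (rigid_net Om eta0 (I k) (II t k) q (scal3 (/ s) t0) eps Hq Heps Hn Hf) as [N' F'].
  assert (Hu : forall y, Rabs (y - u0) < r -> box u0 v0 r y v0).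
  { intros y Hy. split; [exact Hy|]. rewrite Rminus_diag, Rabs_R0. exact Hr. }
  assert (Hv : forall y, Rabs (y - v0) < r -> box u0 v0 r u0 y).
  { intros y Hy. split; [|exact Hy]. rewrite Rminus_diag, Rabs_R0. exact Hr. }
  exists t, k, Om, eps, (fun u v => add3 (scal3 (/ s) t0) (scal3 eps (fr q (eta0 u v)))), f, g, s,
    (mkposreal r Hr).
  split; [exact HOm|]. split; [exact N'|]. split; [exact Heps|]. split; [exact F'|].
  split; [exact Hs|]. split; [|split].
  - intros y Hy. simpl in Hy. specialize (Hu y Hy). split; [intros n; exact (proj1 (Nfg _ _ n Hu))|].
    rewrite (is_derive_unique _ _ _ (proj1 (Dfg _ _ Hu))). apply (Hfg _ _ Hu).
  - intros y Hy. simpl in Hy. specialize (Hv y Hy). split; [intros n; exact (proj2 (Nfg _ _ n Hv))|].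
    rewrite (is_derive_unique _ _ _ (proj2 (Dfg _ _ Hv))). apply (Hfg _ _ Hv).
  - intros u v H1 H2. simpl in H1, H2. assert (h : box u0 v0 r u v) by now split.
    split; [now apply Hin|]. rewrite He by exact h. rewrite Ed at 1. apply R3_ext; vec_simpl; field; lra.
Qed.

(** The frame of the given net and the pulled-back frame of the model with t = ln lam have the same
    angular velocities. Alignability fixes the coefficients up to one constant, so the net is a
    rotated, translated and scaled copy of the model net. *)
Lemma aligned_in_family u0 v0 r eta F A1 A3 C S x g mu nu e sg al be : 0 < r ->
  let D := box u0 v0 r in smooth3 D eta ->
  local_structure D eta F A1 A3 C S x g mu nu e sg al be -> 0 < - be / al ->
  ((forall u v, D u v -> pu nu u v = 1 * pv mu u v) -> locally_in_family I_pos II_pos eta u0 v0) /\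
  ((forall u v, D u v -> pu nu u v = -1 * pv mu u v) -> locally_in_family I_neg II_neg eta u0 v0).
Proof.
  intros Hr D Seta L Hab.
  pose proof (box_open u0 v0 r) as HD. pose proof (box_convex u0 v0 r) as Hc.
  pose proof (box_center u0 v0 r Hr) as h0. fold D in HD, Hc, h0.
  assert (Hex : exists u v, D u v) by (now exists u0, v0).
  destruct (local_reparametrization D eta F A1 A3 C S x g mu nu e sg al be u0 v0 HD h0 L Hab)
    as (lam & f1 & g1 & P & e' & d & Hlam & Hd & Hpen & (SP & Sf & Sg) & Pf & Pg & Hfg & Hneg & He' & Heta).
  destruct (model_frame u0 v0 r C S P f1 g1 Hr Hpen SP Sf Sg Pf Pg Hfg Hneg)
    as (k & Om & I & s & c & p & f & gg & HOm & Hk & HI & Hopen & HcI & Hpar & Hin & Dfg & Nfg & HCS).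
  fold D in Hin, Dfg, Nfg, HCS.
  destruct (existence_frame (ln lam) k Om I s c p Hk HI Hopen HcI Hpar)
    as (e0 & He0 & (ep & Np & Fp & Ap) & (en & Nn & Fn & An)).
  assert (Elam : exp (ln lam) = lam) by now apply exp_ln.
  assert (He0' : moving D (fun u v => e0 (f u) (gg v))
     (fun u v => (f1 u v * lam, 0, - (f1 u v * P u v)))
      (fun u v => (- (g1 u v * C u v / lam), - (g1 u v * S u v / lam), 0))).
  { destruct (moving_box_comp D Om e0 _ _ f gg f1 g1 He0 Hin Dfg) as [M1 M2].
    split; [exact M1|]. intros q. eapply vpartials_eq; [apply (M2 q)|..]; intros u v h; cbv beta;
    destruct (HCS u v h) as (E1 & E2 & E3); rewrite ?E1, ?E2, ?E3, Elam; f_equal; f_equal;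
    apply R3_ext; vec_simpl; field; lra. }
  assert (Smu : smooth D (fun u v => d * mu u v)) by (apply smooth_mult; auto; [now apply smooth_const|apply L]).
  assert (Snu : smooth D (fun u v => d * nu u v)) by (apply smooth_mult; auto; [now apply smooth_const|apply L]).
  set (m := fun u v => d * mu u v) in *. set (n := fun u v => d * nu u v) in *.
  assert (Hd0 : d <> 0) by (destruct Hd; lra).
  assert (Hm0 : m u0 v0 <> 0).
  { apply Rmult_integral_contrapositive. split; [exact Hd0|].
    apply (ls_munu L u0 v0 h0). }
  pose proof (smooth_partials _ _ Smu) as Pm. pose proof (smooth_partials _ _ Snu) as Pn.
  assert (Em : forall u v, D u v -> pv m u v = d * pv mu u v).
  { intros u v h. etransitivity; [exact (partials_pv D _ _ _ u v (partials_mult D _ _ _ _ _ _ (partials_const D d)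
      (smooth_partials _ _ (ls_smoothmu L))) h)|]. cbv beta; ring. }
  assert (En : forall u v, D u v -> pu n u v = d * pu nu u v).
  { intros u v h. etransitivity; [exact (partials_pu D _ _ _ u v (partials_mult D _ _ _ _ _ _ (partials_const D d)
      (smooth_partials _ _ (ls_smoothnu L))) h)|]. cbv beta; ring. }
  pose proof (proj1 Hpen) as PC.
  assert (PS : partials D S (pu S) (fun u v => C u v * P u v * g1 u v)).
  { pose proof (smooth_partials _ _ (ls_smoothS L)) as PS.
    eapply partials_eq; [exact PS|reflexivity|]. intros u v h.
    pose proof (partials_of_const D _ _ _ 1 HD (partials_plus D _ _ _ _ _ _
      (partials_mult D _ _ _ _ _ _ PS PS) (partials_mult D _ _ _ _ _ _ PC PC))
      (fun a b hab => ltac:(destruct (proj2 (proj2 Hpen) a b hab) as [_ E]; lra)) u v h) as [_ Q].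
    cbv beta in Q. destruct (proj2 (proj2 Hpen) u v h). apply (Rmult_eq_reg_l (S u v)); lra. }
  (* The tangential components of the mixed derivative of eta, computed in both orders. *)
  assert (Heq : forall u v, D u v -> pv m u v * C u v - m u v * S u v * P u v * g1 u v = pu n u v /\
     pv m u v * S u v + m u v * C u v * P u v * g1 u v = - (f1 u v * P u v * n u v)).
  { intros u v h.
    pose proof (vpartials_comm D eta _ _ _ _ _ _ HD Seta Heta
      (moving_vpartials D e' _ _ _ _ _ HD He' (vpartials_of D _ _ _ _ _ _ _ _ _
        (partials_mult D _ _ _ _ _ _ Pm PC) (partials_mult D _ _ _ _ _ _ Pm PS) (partials_const D 0)))
      (moving_vpartials D e' _ _ _ _ _ HD He' (vpartials_of D _ _ _ _ _ _ _ _ _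
        Pn (partials_const D 0) (partials_const D 0))) u v h) as E.
    cbv beta in E. apply (fr_inj (e' u v)) in E; [|now apply He'].
    pose proof (f_equal c1 E) as E1. pose proof (f_equal c2 E) as E2. revert E1 E2.
    vec_simpl. intros E1 E2. split; [rewrite <- (Rplus_0_r (pu n u v))|]; lra. }
  assert (Hpos : forall u v, D u v -> 1 - C u v = 2 * s (f u + gg v) ^ 2 /\ 1 + C u v = 2 * c (f u + gg v) ^ 2 /\
     0 < s (f u + gg v) /\ 0 < c (f u + gg v)).
  { intros u v h. destruct (HCS u v h) as (<- & _). unfold Cos_of.
    assert (hI : I (f u + gg v)) by (apply HI, Hin, h).
    destruct (proj1 Hpar _ hI) as (_ & _ & _ & H1 & H2 & H3 & _). repeat split; lra. }
  split; intros Hal.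
  - destruct (aligned_coeffs D C S P f1 g1 m n 1 HD Hc Hex Smu Snu Hpen Pf Pg Hfg (or_introl eq_refl) Heq)
      as [ka Hka]; [intros u v h; rewrite Em, En, Hal by exact h; ring|].
    pose proof (vpartials_box_comp D Om ep _ _ f gg f1 g1 Ap Hin Dfg) as Bp.
    (* The factor comes from 1 - C = 2 s^2 and the model coefficient - 1 / s^2. In the negative case
       1 + C = 2 c^2 and the coefficient 1 / c^2 give ka / 2. *)
    assert (Hk0 : - (ka / 2) <> 0).
    { intros E. apply Hm0. destruct (Hka u0 v0 h0) as [-> _]. replace ka with 0 by lra.
      unfold Rdiv; ring. }
    destruct (rigid_of_moving D (fun u v => e0 (f u) (gg v)) e' _ _
      (fun u v => scal3 (f1 u v) (E3_body (Cos_of c) (Sin_of s c) (fun u v => - (1) / s (u + v) ^ 2) (f u) (gg v)))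
      (fun u v => scal3 (g1 u v) (E1_body (fun u v => - (1) / s (u + v) ^ 2) (f u) (gg v)))
      (fun u v => ep (f u) (gg v)) eta (- (ka / 2)) HD Hc Hex He0' He') as (q & t0 & Hq & Hre).
    + eapply vpartials_eq; [exact Bp|..]; intros; cbv beta; apply fr_scal.
    + eapply vpartials_eq; [exact Heta|..]; intros u v h; cbv beta; f_equal;
      destruct (Hka u v h) as [K1 K2]; destruct (Hpos u v h) as (Q1 & Q2 & Q3 & Q4);
      destruct (HCS u v h) as (E1 & E2 & _); unfold E3_body, E1_body; rewrite ?E1, ?E2;
      fold (m u v) (n u v); rewrite ?K1, ?K2;
      replace (1 - 1 * C u v) with (2 * s (f u + gg v) ^ 2) by lra; apply R3_ext; vec_simpl; field; lra.
    + exact (locally_in_family_of_rigid I_pos II_pos eta ep u0 v0 r (ln lam) k Om f gg f1 g1 q t0 _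
        Hr HOm Np Fp Hin Dfg Hfg Nfg Hq Hk0 Hre).
  - destruct (aligned_coeffs D C S P f1 g1 m n (-1) HD Hc Hex Smu Snu Hpen Pf Pg Hfg (or_intror eq_refl) Heq)
      as [ka Hka]; [intros u v h; rewrite Em, En, Hal by exact h; ring|].
    pose proof (vpartials_box_comp D Om en _ _ f gg f1 g1 An Hin Dfg) as Bp.
    assert (Hk0 : ka / 2 <> 0).
    { intros E. apply Hm0. destruct (Hka u0 v0 h0) as [-> _]. replace ka with 0 by lra.
      unfold Rdiv; ring. }
    destruct (rigid_of_moving D (fun u v => e0 (f u) (gg v)) e' _ _
      (fun u v => scal3 (f1 u v) (E3_body (Cos_of c) (Sin_of s c) (fun u v => 1 / c (u + v) ^ 2) (f u) (gg v)))
      (fun u v => scal3 (g1 u v) (E1_body (fun u v => - (1) / c (u + v) ^ 2) (f u) (gg v)))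
      (fun u v => en (f u) (gg v)) eta (ka / 2) HD Hc Hex He0' He') as (q & t0 & Hq & Hre).
    + eapply vpartials_eq; [exact Bp|..]; intros; cbv beta; apply fr_scal.
    + eapply vpartials_eq; [exact Heta|..]; intros u v h; cbv beta; f_equal;
      destruct (Hka u v h) as [K1 K2]; destruct (Hpos u v h) as (Q1 & Q2 & Q3 & Q4);
      destruct (HCS u v h) as (E1 & E2 & _); unfold E3_body, E1_body; rewrite ?E1, ?E2;
      fold (m u v) (n u v); rewrite ?K1, ?K2;
      replace (1 - -1 * C u v) with (2 * c (f u + gg v) ^ 2) by lra;
      apply R3_ext; vec_simpl; field; lra.
    + exact (locally_in_family_of_rigid I_neg II_neg eta en u0 v0 r (ln lam) k Om f gg f1 g1 q t0 _
        Hr HOm Nn Fn Hin Dfg Hfg Nfg Hq Hk0 Hre).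
Qed.

(** * Reversal of E1 and the choice of the family *)

Lemma reciprocal_parallel_sub D D' eta F : open_dom D' -> sub_dom D' D ->
  reciprocal_parallel D eta F -> reciprocal_parallel D' eta F.
Proof.
  intros HD K (((_ & Spsi & Hreg) & HK) & (xi & Sxi & Hxi) & (SE1 & SE3 & U1 & U3 & As1 & As3 & Hdet) & Sb & Sc & Hrec).
  split; [|split; [|split; [|split; [|split]]]].
  - split; [split; [exact HD|split]|]; [eapply smooth3_sub; eauto|intros; apply Hreg; auto|intros; apply HK; auto].
  - exists xi. split; [eapply smooth3_sub; eauto|intros; apply Hxi; auto].
  - split; [split; eapply smooth_sub; eauto; apply SE1|].
    split; [split; eapply smooth_sub; eauto; apply SE3|].
    split; [intros u v h; exact (U1 u v (K u v h))|]. split; [intros u v h; exact (U3 u v (K u v h))|].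
    split; [intros u v h; exact (As1 u v (K u v h))|]. split; [intros u v h; exact (As3 u v (K u v h))|].
    intros u v h; exact (Hdet u v (K u v h)).
  - eapply smooth_sub; eauto.
  - eapply smooth_sub; eauto.
  - intros u v h; exact (Hrec u v (K u v h)).
Qed.

Definition reverse_E1 (F : K_data) : K_data :=
  mkK (Kpsi F) (fun u v => (- fst (KE1 F u v), - snd (KE1 F u v))) (KE3 F)
    (fun u v => - Kb F u v) (fun u v => - Kc F u v).

Lemma push_reverse F u v :
  push (Kpsi F) u v (KE1 (reverse_E1 F) u v) = scal3 (-1) (push (Kpsi F) u v (KE1 F u v)).
Proof. unfold push, reverse_E1. cbn [KE1 fst snd]. vec_ring. Qed.

Lemma det2_reverse F u v :
  det2 (KE1 (reverse_E1 F) u v) (KE3 F u v) = - det2 (KE1 F u v) (KE3 F u v).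
Proof. unfold det2, reverse_E1. cbn [KE1 fst snd]. ring. Qed.

Lemma theta1_reverse F u v : theta1 (KE1 (reverse_E1 F)) (KE3 F) u v =
  (- fst (theta1 (KE1 F) (KE3 F) u v), - snd (theta1 (KE1 F) (KE3 F) u v)).
Proof.
  unfold theta1. rewrite det2_reverse. cbn [fst snd]. unfold Rdiv. rewrite Rinv_opp. f_equal; ring.
Qed.

Lemma theta3_reverse F u v :
  theta3 (KE1 (reverse_E1 F)) (KE3 F) u v = theta3 (KE1 F) (KE3 F) u v.
Proof.
  unfold theta3. rewrite det2_reverse. unfold reverse_E1. cbn [KE1 fst snd]. unfold Rdiv.
  rewrite Rinv_opp. f_equal; ring.
Qed.

Lemma reciprocal_parallel_reverse D eta F :
  reciprocal_parallel D eta F -> reciprocal_parallel D eta (reverse_E1 F).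
Proof.
  intros (HK & Hrot & (SE1 & SE3 & U1 & U3 & As1 & As3 & Hdet) & Sb & Sc & Hrec).
  pose proof HK as [[HD _] _].
  split; [exact HK|]. split; [exact Hrot|]. split; [|split; [|split]].
  - split; [split; apply smooth_opp; auto; apply SE1|]. split; [exact SE3|].
    split; [|split; [exact U3|split; [|split; [exact As3|]]]].
    + intros u v h. pose proof (U1 u v h) as E. change (Kpsi (reverse_E1 F)) with (Kpsi F).
      rewrite push_reverse.
      unfold norm3 in *. rewrite dot_scal_l, dot_scal_r.
      replace (-1 * (-1 * dot (push (Kpsi F) u v (KE1 F u v)) (push (Kpsi F) u v (KE1 F u v))))
        with (dot (push (Kpsi F) u v (KE1 F u v)) (push (Kpsi F) u v (KE1 F u v))) by ring. exact E.
    + intros u v h. rewrite <- (As1 u v h). unfold reverse_E1, qeval. cbn [KE1 Kpsi].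
      destruct (second_form (Kpsi F) u v) as [[? ?] ?]. cbn [fst snd]. ring.
    + intros u v h. change (KE3 (reverse_E1 F)) with (KE3 F). rewrite det2_reverse.
      pose proof (Hdet u v h). lra.
  - apply smooth_opp; auto.
  - apply smooth_opp; auto.
  - intros u v h. destruct (Hrec u v h) as (E1 & E3 & Hb & Hc & HX).
    split; [cbn; rewrite E1; ring|]. split; [exact E3|].
    split; [cbn; lra|]. split; [cbn; lra|].
    intros X. rewrite HX. change (KE3 (reverse_E1 F)) with (KE3 F).
    change (Kpsi (reverse_E1 F)) with (Kpsi F).
    unfold pair2. rewrite theta1_reverse, theta3_reverse, push_reverse.
    change (Kb (reverse_E1 F) u v) with (- Kb F u v). change (Kc (reverse_E1 F) u v) with (- Kc F u v).
    cbn [fst snd]. apply R3_ext; vec_simpl; ring.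
Qed.

(** Both theta1 and c change sign, whereas theta3 stays and b changes sign. This exchanges the two
    alignability conditions. *)
Lemma ext_d_bar_reverse F u v :
  ext_d (theta1_bar (reverse_E1 F)) u v = ext_d (theta1_bar F) u v /\
  ext_d (theta3_bar (reverse_E1 F)) u v = - ext_d (theta3_bar F) u v.
Proof.
  assert (T1 : forall a b, theta1_bar (reverse_E1 F) a b = theta1_bar F a b).
  { intros a b. unfold theta1_bar, scale_form. change (KE3 (reverse_E1 F)) with (KE3 F).
    rewrite theta1_reverse. cbn [Kc reverse_E1 fst snd]. f_equal; ring. }
  assert (T3 : forall a b, theta3_bar (reverse_E1 F) a b = (- fst (theta3_bar F a b), - snd (theta3_bar F a b))).
  { intros a b. unfold theta3_bar, scale_form. change (KE3 (reverse_E1 F)) with (KE3 F).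
    rewrite theta3_reverse. cbn [Kb reverse_E1 fst snd]. f_equal; ring. }
  unfold ext_d, pu, pv. split.
  - apply (f_equal2 Rminus); apply Derive_ext; intros z; now rewrite T1.
  - transitivity (Derive (fun z => - snd (theta3_bar F z v)) u - Derive (fun z => - fst (theta3_bar F u z)) v).
    + apply (f_equal2 Rminus); apply Derive_ext; intros z; now rewrite T3.
    + rewrite !Derive_opp. ring.
Qed.

Section Frame_angle.

Context (D : dom) (eta : R -> R -> R3) (F : K_data) (A1 A3 C S x g mu nu : R -> R -> R)
  (e : R -> R -> triad) (sg al be : R) (HD : open_dom D)
  (L : local_structure D eta F A1 A3 C S x g mu nu e sg al be).

Lemma frame_angle_partials :
  partials D (frame_angle F) (fun u v => - x u v) (fun u v => - (pv C u v / S u v)).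
Proof.
  assert (HSC := ls_SC L).
  assert (Hin : forall u v, D u v -> -1 < C u v < 1).
  { intros u v h. destruct (HSC u v h). assert (0 < S u v ^ 2) by now apply pow_lt. nra. }
  apply (partials_ext D (fun u v => acos (C u v)) _ (fun u v => - x u v) (fun u v => - (pv C u v / S u v)));
    auto; [intros u v h; symmetry; exact (proj1 (ls_angle L u v h))|].
  eapply partials_eq; [apply (partials_comp D (fun x => -1 < x < 1) acos _ C _ _
    is_derive_acos Hin (ls_C L))|..];
  intros u v h; cbv beta; destruct (HSC u v h) as [H1 H2];
  (replace (1 - C u v ^ 2) with (S u v ^ 2) by lra); rewrite sqrt_pow2 by lra; field; lra.
Qed.

(** The derivatives of the frame angle along E1 and E3 are - g / al and g / be, so coherence is a
    matter of the sign of al be. Reversing E1 replaces the angle by its supplement and changes the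
    sign of the product. *)
Lemma frame_angle_dir u v : D u v ->
  dir (KE1 F) (frame_angle F) u v * dir (KE3 F) (frame_angle F) u v = - g u v ^ 2 / (al * be) /\
  dir (KE1 (reverse_E1 F)) (frame_angle (reverse_E1 F)) u v *
    dir (KE3 (reverse_E1 F)) (frame_angle (reverse_E1 F)) u v = g u v ^ 2 / (al * be).
Proof.
  intros h. pose proof frame_angle_partials as P.
  assert (P' : partials D (frame_angle (reverse_E1 F)) (fun u v => x u v) (fun u v => pv C u v / S u v)).
  { apply (partials_ext D (fun u v => PI + -1 * frame_angle F u v) _ (fun u v => 0 + (0 * frame_angle F u v + -1 * - x u v))
      (fun u v => 0 + (0 * frame_angle F u v + -1 * - (pv C u v / S u v)))); auto; try (intros; ring).
    - intros a b _. unfold frame_angle. change (KE3 (reverse_E1 F)) with (KE3 F).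
      change (Kpsi (reverse_E1 F)) with (Kpsi F). rewrite push_reverse, dot_scal_l.
      replace (-1 * dot (push (Kpsi F) a b (KE1 F a b)) (push (Kpsi F) a b (KE3 F a b)))
        with (- dot (push (Kpsi F) a b (KE1 F a b)) (push (Kpsi F) a b (KE3 F a b))) by ring.
      rewrite acos_opp. ring.
    - exact (partials_plus D _ _ _ _ _ _ (partials_const D PI) (partials_mult D _ _ _ _ _ _ (partials_const D (-1)) P)). }
  destruct (ls_angle L u v h) as (_ & E1 & E3).
  destruct (ls_nonzero L u v h) as [N1 N3].
  destruct (ls_SC L u v h) as [S0 _].
  pose proof (ls_al L) as Hal.
  pose proof (ls_be L) as Hbe.
  destruct (ls_rel L u v h) as [R1 R3].
  assert (Ex : x u v = A1 u v * g u v / al) by (rewrite R1; field; auto).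
  assert (Ec : pv C u v = - (A3 u v * g u v * S u v) / be) by (rewrite R3; field; auto).
  change (KE3 (reverse_E1 F)) with (KE3 F).
  unfold dir, reverse_E1 at 1 3. cbn [KE1].
  rewrite (partials_pu D _ _ _ u v P h), (partials_pv D _ _ _ u v P h),
    (partials_pu D _ _ _ u v P' h), (partials_pv D _ _ _ u v P' h), E1, E3, Ex, Ec.
  cbn [fst snd]. split; field; repeat split; auto; lra.
Qed.

(** If al be were positive, coherence would force g = 0 everywhere, contradicting its u-derivative
    A1 be S, which is nonzero. *)
Lemma coherent_ratio : (exists u v, D u v) -> coherent_frame D F -> 0 < - be / al.
Proof.
  intros (u & v & h) Hco.
  pose proof (ls_al L) as Hal.
  pose proof (ls_be L) as Hbe.
  assert (Hm : al * be <> 0) by (now apply Rmult_integral_contrapositive).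
  destruct (Rlt_dec (al * be) 0) as [N|N].
  - replace (- be / al) with (- (al * be) * / al ^ 2) by (field; auto).
    apply Rmult_lt_0_compat; [lra|]. apply Rinv_0_lt_compat. apply pow2_gt_0, Hal.
  - exfalso. assert (Hi : 0 < / (al * be)) by (apply Rinv_0_lt_compat; lra).
    assert (Z : forall a b, D a b -> g a b = 0).
    { intros a b hab. pose proof (Hco a b hab) as K. rewrite (proj1 (frame_angle_dir a b hab)) in K.
      unfold Rdiv in K. apply Rsqr_0_uniq. unfold Rsqr. pose proof (pow2_ge_0 (g a b)). nra. }
    destruct (partials_of_const D _ _ _ 0 HD (ls_g L) Z u v h) as [E _].
    destruct (ls_nonzero L u v h) as [N1 N3].
    destruct (ls_SC L u v h) as [S0 _].
    revert E. cbv beta. apply Rmult_integral_contrapositive. split; [|lra].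
    now apply Rmult_integral_contrapositive.
Qed.

Lemma coherent_reverse : 0 < al * be -> coherent_frame D (reverse_E1 F).
Proof.
  intros H u v h. rewrite (proj2 (frame_angle_dir u v h)).
  apply Rmult_le_pos; [apply pow2_ge_0|]. left. now apply Rinv_0_lt_compat.
Qed.

End Frame_angle.

Lemma family_of_coherent u0 v0 r eta F : 0 < r -> let D := box u0 v0 r in
  smooth3 D eta -> reciprocal_parallel D eta F -> screw_tangent D (Kpsi F) ->
  coherent_frame D F ->
  (positive_alignable D F -> locally_in_family I_pos II_pos eta u0 v0) /\
  (negative_alignable D F -> locally_in_family I_neg II_neg eta u0 v0).
Proof.
  intros Hr D Seta Hrec Htan Hco. pose proof (box_center u0 v0 r Hr) as h0. fold D in h0.
  assert (Hex : exists u v, D u v) by (now exists u0, v0).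
  destruct (local_structure_exists D eta F (box_convex u0 v0 r) Hex Seta Hrec Htan)
    as (A1 & A3 & C & S & x & g & mu & nu & e & sg & al & be & L).
  pose proof (coherent_ratio D eta F A1 A3 C S x g mu nu e sg al be (box_open u0 v0 r) L Hex Hco) as Hab.
  destruct (aligned_in_family u0 v0 r eta F A1 A3 C S x g mu nu e sg al be Hr Seta L Hab) as [Kp Kn].
  split; intros Ha; [apply Kp|apply Kn]; intros u v h; pose proof (Ha u v h) as E;
  destruct (ls_ext L u v h) as [X1 X3]; rewrite X1, X3 in E; lra.
Qed.

(** For an arbitrary frame the kind of alignability does not tell the family: when al be > 0, the
    coherent frame has E1 reversed and satisfies the other condition. *)
Lemma family_of_alignable u0 v0 r eta F : 0 < r -> let D := box u0 v0 r in
  smooth3 D eta -> reciprocal_parallel D eta F -> screw_tangent D (Kpsi F) ->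
  positive_alignable D F \/ negative_alignable D F ->
  locally_in_family I_pos II_pos eta u0 v0 \/ locally_in_family I_neg II_neg eta u0 v0.
Proof.
  intros Hr D Seta Hrec Htan Ha. pose proof (box_center u0 v0 r Hr) as h0. fold D in h0.
  assert (Hex : exists u v, D u v) by (now exists u0, v0).
  destruct (local_structure_exists D eta F (box_convex u0 v0 r) Hex Seta Hrec Htan)
    as (A1 & A3 & C & S & x & g & mu & nu & e & sg & al & be & L).
  pose proof (ls_al L) as Hal.
  pose proof (ls_be L) as Hbe.
  destruct (Rlt_dec 0 (al * be)) as [N|N].
  - pose proof (coherent_reverse D eta F A1 A3 C S x g mu nu e sg al be (box_open u0 v0 r) L N) as Hco.
    destruct (family_of_coherent u0 v0 r eta (reverse_E1 F) Hr Seta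
      (reciprocal_parallel_reverse D eta F Hrec) Htan Hco) as [Kp Kn].
    destruct Ha as [Ha|Ha]; [right; apply Kn|left; apply Kp]; intros u v h;
    destruct (ext_d_bar_reverse F u v) as [X1 X3]; rewrite X1, X3; pose proof (Ha u v h); lra.
  - assert (Hm : al * be <> 0) by (now apply Rmult_integral_contrapositive).
    assert (Hco : coherent_frame D F).
    { intros u v h. rewrite (proj1 (frame_angle_dir D eta F A1 A3 C S x g mu nu e sg al be (box_open u0 v0 r) L u v h)).
      replace (- g u v ^ 2 / (al * be)) with (g u v ^ 2 * / (- (al * be))) by (field; auto).
      apply Rmult_le_pos; [apply pow2_ge_0|]. left. apply Rinv_0_lt_compat. lra. }
    destruct (family_of_coherent u0 v0 r eta F Hr Seta Hrec Htan Hco) as [Kp Kn].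
    destruct Ha as [Ha|Ha]; [left; exact (Kp Ha)|right; exact (Kn Ha)].
Qed.

(** Openness provides a box around the point, which is convex as the reconstruction requires. The
    invariance is first turned into tangency of the screw field, a pointwise condition that passes
    to the box at once. *)
Lemma alignable_in_family D eta F u0 v0 :
  V_net D eta -> reciprocal_parallel D eta F -> helicoidal D (Kpsi F) -> D u0 v0 ->
  (positive_alignable D F \/ negative_alignable D F ->
     locally_in_family I_pos II_pos eta u0 v0 \/ locally_in_family I_neg II_neg eta u0 v0) /\
  (coherent_frame D F -> positive_alignable D F -> locally_in_family I_pos II_pos eta u0 v0) /\
  (coherent_frame D F -> negative_alignable D F -> locally_in_family I_neg II_neg eta u0 v0).
Proof.
  intros ((HD & Seta & _) & _) Hrec Hhel h0.
  destruct (HD u0 v0 h0) as [[r Hr] Hbox]. simpl in Hbox.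
  assert (K : sub_dom (box u0 v0 r) D) by (intros u v [H1 H2]; now apply Hbox).
  pose proof (smooth3_sub D _ eta K Seta) as Seta'.
  pose proof (reciprocal_parallel_sub D _ eta F (box_open u0 v0 r) K Hrec) as Hrec'.
  assert (Htan : screw_tangent (box u0 v0 r) (Kpsi F)).
  { destruct (helicoidal_tangent D (Kpsi F) (proj1 (proj1 Hrec)) Hhel) as (o & w & h & Hw & Ht).
    exists o, w, h. split; [exact Hw|]. intros u v huv. exact (Ht u v (K u v huv)). }
  assert (Kp : positive_alignable D F -> positive_alignable (box u0 v0 r) F)
    by (intros H u v h; exact (H u v (K u v h))).
  assert (Kn : negative_alignable D F -> negative_alignable (box u0 v0 r) F)
    by (intros H u v h; exact (H u v (K u v h))).
  assert (Kc : coherent_frame D F -> coherent_frame (box u0 v0 r) F)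
    by (intros H u v h; exact (H u v (K u v h))).
  split; [|split].
  - intros Ha. apply (family_of_alignable u0 v0 r eta F Hr Seta' Hrec' Htan). tauto.
  - intros Hc Ha. exact (proj1 (family_of_coherent u0 v0 r eta F Hr Seta' Hrec' Htan (Kc Hc)) (Kp Ha)).
  - intros Hc Ha. exact (proj2 (family_of_coherent u0 v0 r eta F Hr Seta' Hrec' Htan (Kc Hc)) (Kn Ha)).
Qed.

Theorem theorem5p8 :
  (* the two families exist on each domain Omega_k *)
  (forall (t k : R) (Om : dom), is_Omega k Om ->
     (exists eta, is_net Om eta /\ has_forms 1 Om eta (I_pos k) (II_pos t k)) /\
     (exists eta, is_net Om eta /\ has_forms 1 Om eta (I_neg k) (II_neg t k)))
  /\
  (* the forms determine the net up to isometries; it is an alignable V-net of the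
     first kind, with the stated curvatures (on Omega_k and its convex subdomains) *)
  (forall (t k : R) (Om D : dom) (eta : R -> R -> R3) (eps : R),
     is_Omega k Om -> sub_dom D Om -> convex_dom D -> is_net D eta -> is_sign eps ->
     (has_forms eps D eta (I_pos k) (II_pos t k) ->
        V_net D eta /\
        (exists F, reciprocal_parallel D eta F /\ helicoidal D (Kpsi F) /\
                   coherent_frame D F /\ positive_alignable D F) /\
        (forall u v, D u v ->
           gauss_curvature eta u v = K_pos k u v /\
           eps * mean_curvature eta u v = H_pos t k u v) /\
        (forall eta' eps', is_net D eta' -> is_sign eps' ->
           has_forms eps' D eta' (I_pos k) (II_pos t k) -> congruent D eta eta')) /\
     (has_forms eps D eta (I_neg k) (II_neg t k) ->
        V_net D eta /\
        (exists F, reciprocal_parallel D eta F /\ helicoidal D (Kpsi F) /\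
                   coherent_frame D F /\ negative_alignable D F) /\
        (forall u v, D u v ->
           gauss_curvature eta u v = K_neg k u v /\
           eps * mean_curvature eta u v = H_neg t k u v) /\
        (forall eta' eps', is_net D eta' -> is_sign eps' ->
           has_forms eps' D eta' (I_neg k) (II_neg t k) -> congruent D eta eta')))
  /\
  (* every alignable V-net of the first kind arises in this way *)
  (forall (D : dom) (eta : R -> R -> R3) (F : K_data),
     V_net D eta -> reciprocal_parallel D eta F -> helicoidal D (Kpsi F) ->
     forall u0 v0, D u0 v0 ->
       (positive_alignable D F \/ negative_alignable D F ->
          locally_in_family I_pos II_pos eta u0 v0 \/
          locally_in_family I_neg II_neg eta u0 v0) /\
       (coherent_frame D F -> positive_alignable D F ->
          locally_in_family I_pos II_pos eta u0 v0) /\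
       (coherent_frame D F -> negative_alignable D F ->
          locally_in_family I_neg II_neg eta u0 v0)).
Proof.
  split; [exact existence|split; [exact characterization|]].
  intros D eta F Hnet Hrec Hhel u0 v0 h0.
  exact (alignable_in_family D eta F u0 v0 Hnet Hrec Hhel h0).
Qed.
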